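(* Let $S_1, S_2$ be del Pezzo surfaces of the same degree $d \le 7$ over a field $k$ such that $S_1(k) \neq \emptyset$ and $S_2(k) \neq \emptyset$. Let $W(S_1), W(S_2) \subseteq W(R_d)$ be the corresponding subgroups describing the Galois actions on the geometric Picard groups. Suppose that $W(S_1) \subseteq g W(S_2) g^{-1}$ for some $g \in W(R_d)$, and that $\operatorname{rk} \operatorname{Pic}(S_1) = \operatorname{rk} \operatorname{Pic}(S_2)$. Then $\alpha(S_1) = \alpha(S_2)$.
   Context: A del Pezzo surface $S$ over a field $k$ is a smooth projective surface over $k$ whose anticanonical class $-K_S$ is ample; its degree is $d = (-K_S,-K_S)$. Let $\overline{k}$ be an algebraic closure of $k$ and $S_{\overline{k}}$ the base change. A $(-1)$-curve is a curve $E$ on $S_{\overline{k}}$ with $(-K_S,[E])=1$ and $([E],[E])=-1$; a $(-2)$-class is an $L \in \operatorname{Pic}(S_{\overline{k}})$ with $(-K_S,L)=0$ and $(L,L)=-2$. For $d \le 7$, the lattice $\operatorname{Pic}(S_{\overline{k}})$ (free of rank $10-d$) together with its intersection form, its anticanonical class, its $(-2)$-classes and its classes of $(-1)$-curves depends, up to isomorphism, only on $d$. The $(-2)$-classes form a root system $R_d$, and $W(R_d)$ denotes its Weyl group, which is the group of automorphisms of $\operatorname{Pic}(S_{\overline{k}})$ preserving the intersection form and the anticanonical class. The natural action of $\operatorname{Gal}(\overline{k}/k)$ on $\operatorname{Pic}(S_{\overline{k}})$ factors through a subgroup $W(S) \subseteq W(R_d)$ (the image of the Galois group), well defined up to conjugacy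 in $W(R_d)$ after identifying $\operatorname{Pic}(S_{\overline k})$ with the fixed lattice attached to $d$. Definition of $\alpha(S)$: Let $\varrho(S)=\operatorname{rk}\operatorname{Pic}(S)$ and $\operatorname{Pic}(S)_{\mathbb{R}} = \operatorname{Pic}(S)\otimes_{\mathbb{Z}}\mathbb{R}$. Let $\Lambda_{\rm eff}(S) \subset \operatorname{Pic}(S)_{\mathbb{R}}$ be the effective cone of $S$ (the cone generated by classes of effective divisors), and let $\Lambda_{\rm eff}^\vee(S) \subset \operatorname{Pic}(S)_{\mathbb{R}}$ be its dual cone with respect to the intersection form $\langle\cdot,\cdot\rangle$. Then $$\alpha(S) = \varrho(S)\cdot \operatorname{vol}\{x \in \Lambda_{\rm eff}^\vee(S) \mid \langle x, -K_S\rangle \le 1\},$$ where the volume is normalized such that the lattice $\{x \in \operatorname{Pic}(S)_{\mathbb{R}} \mid \langle x,y\rangle \in \mathbb{Z} \text{ for all } y \in \operatorname{Pic}(S)\}$ dual to $\operatorname{Pic}(S)$ has covolume $1$. *)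

(* Defs.v *)
From HB Require Import structures.
From mathcomp Require Import all_boot all_order all_algebra.
From mathcomp Require Import all_classical all_reals all_analysis.
From mathcomp Require mpoly.
Import -(notations) mpoly.

Set Implicit Arguments.
Unset Strict Implicit.
Unset Printing Implicit Defensive.

Import Order.TTheory GRing.Theory Num.Theory.

Local Open Scope classical_set_scope.
Local Open Scope ring_scope.

(* The notations of mpoly clash with those of mathcomp-analysis. *)
Notation mpol R n := (mpoly.mpoly n R).
Definition homogeneous (R : nzRingType) (n e : nat) (F : mpol R n) : Prop :=
  F \is mpoly.ishomog1 e mpoly.mdeg.

Definition alg_independent (F E : fieldType) (j : {rmorphism F -> E}) (r : nat)
    (t : 'I_r -> E) : Prop :=
  forall Q : mpol F r, mpoly.mmap j t Q = 0 -> Q = 0.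

Definition derivation_over (F E : fieldType) (j : {rmorphism F -> E})
    (delta : E -> E) : Prop :=
  [/\ forall a b, delta (a + b) = delta a + delta b,
      forall a b, delta (a * b) = delta a * b + a * delta b
    & forall c, delta (j c) = 0].

(* An integral closed subscheme of projective space is the closure of its
   generic point.  Accordingly a geometrically integral projective variety S
   over k is given by the function field K of its base change to kbar, and by
   homogeneous coordinates x, with values in K, of the generic point.
   The homogeneous ideal of S consists of the polynomials over k that vanish
   at x. *)
Section Model.
Variables (k kbar K : fieldType).
Variables (iota : {rmorphism k -> kbar}) (emb : {rmorphism kbar -> K}).
Variables (n : nat) (x : 'I_n.+1 -> K).

Definition gen_eval (F : mpol kbar n.+1) : K := mpoly.mmap emb x F.
Definition gen_eval_k (F : mpol k n.+1) : K := mpoly.mmap (emb \o iota) x F.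
Definition pt_eval (p : 'rV[kbar]_n.+1) (F : mpol kbar n.+1) : kbar :=
  mpoly.meval (fun i => p 0 i) F.

(* Closed points of the base change; the first nonzero homogeneous coordinate
   is normalized to 1, so that a point has a unique representative. *)
Definition closed_point (p : 'rV[kbar]_n.+1) : Prop :=
  (exists2 i, p 0 i = 1 & forall i' : 'I_n.+1, (i' < i)%N -> p 0 i' = 0) /\
  (forall e (F : mpol kbar n.+1),
     homogeneous e F -> gen_eval F = 0 -> pt_eval p F = 0).

Definition local_ring (p : 'rV[kbar]_n.+1) : set K :=
  [set z | exists e (F G : mpol kbar n.+1),
     [/\ homogeneous e F, homogeneous e G, pt_eval p G != 0
       & z = gen_eval F / gen_eval G]].

Definition local_unit (p : 'rV[kbar]_n.+1) : set K :=
  [set z | [/\ z != 0, local_ring p z & local_ring p z^-1]].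

Definition local_max (p : 'rV[kbar]_n.+1) : set K :=
  local_ring p `\` local_unit p.

Definition local_ideal2 (p : 'rV[kbar]_n.+1) (f g : K) : set K :=
  [set z | exists a b, [/\ local_ring p a, local_ring p b & z = a * f + b * g]].

Definition regular_params (p : 'rV[kbar]_n.+1) (u v : K) : Prop :=
  local_max p = local_ideal2 p u v.

Definition function_field_k : set K :=
  [set z | exists e (F G : mpol k n.+1),
     [/\ homogeneous e F, homogeneous e G, gen_eval_k G != 0
       & z = gen_eval_k F / gen_eval_k G]].

End Model.

Record smooth_projective_surface (k kbar : fieldType)
    (iota : {rmorphism k -> kbar}) := SmoothProjectiveSurface {
  dim_amb : nat;
  fun_field : fieldType;
  fun_emb : {rmorphism kbar -> fun_field};
  gen_pt : 'I_dim_amb.+1 -> fun_field;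
  gen_pt_neq0 : exists i, gen_pt i != 0;
  fun_field_gen : forall z, exists e (F G : mpol kbar dim_amb.+1),
    [/\ homogeneous e F, homogeneous e G, gen_eval fun_emb gen_pt G != 0
      & z = gen_eval fun_emb gen_pt F / gen_eval fun_emb gen_pt G];
  (* The closure of the generic point over kbar is the base change of its
     closure over k: the ideal over kbar is spanned by the ideal over k. *)
  geom_integral : forall e (F : mpol kbar dim_amb.+1),
    homogeneous e F -> gen_eval fun_emb gen_pt F = 0 ->
    exists m (c : 'I_m -> kbar) (G : 'I_m -> mpol k dim_amb.+1),
      [/\ forall i, homogeneous e (G i),
          forall i, gen_eval_k iota fun_emb gen_pt (G i) = 0
        & F = \sum_(i < m) c i *: mpoly.map_mpoly iota (G i)];
  dim_eq2 :
    (exists t : 'I_2 -> fun_field, alg_independent fun_emb t) /\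
    (forall t : 'I_3 -> fun_field, ~ alg_independent fun_emb t);
  (* The closed points of the base change have two-dimensional local rings,
     hence are regular iff two elements generate the maximal ideal. *)
  geom_regular : forall p, closed_point fun_emb gen_pt p ->
    exists u v, regular_params fun_emb gen_pt p u v }.

Arguments gen_pt {k kbar iota} s _.
Arguments fun_emb {k kbar iota} s.

Section Surface.
Variables (k kbar : fieldType) (iota : {rmorphism k -> kbar}).
Variable S : smooth_projective_surface iota.

Notation K := (fun_field S).
Notation N := (dim_amb S).
Notation pt := 'rV[kbar]_N.+1.

Definition onS (p : pt) : Prop := closed_point (fun_emb S) (gen_pt S) p.
Definition OS (p : pt) : set K := local_ring (fun_emb S) (gen_pt S) p.
Definition OSunit (p : pt) : set K := local_unit (fun_emb S) (gen_pt S) p.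
Definition kS : set K := function_field_k iota (fun_emb S) (gen_pt S).

Definition has_rational_point : Prop :=
  exists p : 'rV[k]_N.+1, onS (map_mx iota p).

(* Cartier divisors on the base change: D p is a local equation at p. The
   values of D outside of S are irrelevant. *)
Definition divisor : Type := pt -> K.

Definition cartier (D : divisor) : Prop :=
  forall p, onS p -> D p != 0 /\
    exists e (g : mpol kbar N.+1),
      [/\ homogeneous e g, pt_eval p g != 0
        & forall q, onS q -> pt_eval q g != 0 -> OSunit q (D p / D q)].

Definition div_add (D E : divisor) : divisor := fun p => D p * E p.
Definition div_opp (D : divisor) : divisor := fun p => (D p)^-1.
Definition div_muln (m : nat) (D : divisor) : divisor := fun p => D p ^+ m.
Definition div_comb r (b : 'I_r -> divisor) (a : 'rV[int]_r) : divisor :=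
  fun p => \prod_(i < r) b i p ^ a 0 i.

Definition div_eq (D E : divisor) : Prop :=
  forall p, onS p -> OSunit p (D p / E p).
Definition div_zero (D : divisor) : Prop := forall p, onS p -> OSunit p (D p).
Definition effective (D : divisor) : Prop := forall p, onS p -> OS p (D p).

Definition lin_equiv (D E : divisor) : Prop :=
  exists2 f, f != 0 & div_eq D (fun p => f * E p).

(* Irreducible (and reduced) curves on the base change. *)
Definition prime_divisor (C : divisor) : Prop :=
  [/\ cartier C, effective C, ~ div_zero C
    & forall D E, cartier D -> effective D -> cartier E -> effective E ->
        div_eq C (div_add D E) -> div_zero D \/ div_zero E].

(* The local ring at p modulo (f, g) has dimension m over kbar. *)
Definition local_mult (p : pt) (f g : K) (m : nat) : Prop :=
  exists2 e : 'I_m -> K, (forall i, OS p (e i)) &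
    forall z, OS p z -> exists! c : 'rV[kbar]_m,
      local_ideal2 (fun_emb S) (gen_pt S) p f g
        (z - \sum_(i < m) fun_emb S (c 0 i) * e i).

(* The intersection form on the Picard group of the base change is the unique
   symmetric bilinear form that is given by local multiplicities for distinct
   irreducible curves. It is written here on divisors. *)
Definition intersection_form (B : divisor -> divisor -> int) : Prop :=
  [/\ forall D E, cartier D -> cartier E -> B D E = B E D,
      forall D D' E, cartier D -> cartier D' -> cartier E ->
        B (div_add D D') E = B D E + B D' E,
      forall D D' E, cartier D -> cartier D' -> cartier E ->
        lin_equiv D D' -> B D E = B D' E
    & forall C C', prime_divisor C -> prime_divisor C' -> ~ div_eq C C' ->
        exists2 m : pt -> nat,
          (forall p, onS p -> local_mult p (C p) (C' p) (m p)) &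
          B C C' = \sum_(p \in [set p | onS p]) (m p)%:Z].

(* Divisor of the rational 2-form omega with omega (delta1, delta2) = 1: if u, v
   are regular parameters at p, then du /\ dv generates the 2-forms at p and
   du /\ dv = (delta1 u * delta2 v - delta1 v * delta2 u) omega. *)
Definition canonical_divisor (D : divisor) : Prop :=
  cartier D /\
  exists delta1 delta2 : K -> K,
    [/\ derivation_over (fun_emb S) delta1,
        derivation_over (fun_emb S) delta2,
        forall a b, (forall z, a * delta1 z + b * delta2 z = 0) ->
          a = 0 /\ b = 0
      & forall p u v, onS p ->
          regular_params (fun_emb S) (gen_pt S) p u v ->
          OSunit p (D p * (delta1 u * delta2 v - delta1 v * delta2 u))].

(* The sections y_0, ..., y_m of O(D) have no common zero, and the morphism to
   projective m-space that they define is a closed immersion.  As S is proper,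
   the latter means that the local rings of projective space surject onto
   those of S (injectivity on points follows, since different points of S have
   different local rings in K). *)
Definition very_ample (D : divisor) : Prop :=
  exists m (y : 'I_m.+1 -> K), forall p, onS p ->
    [/\ forall i, OS p (y i * D p),
        exists i, OSunit p (y i * D p)
      & forall f, OS p f -> exists e (F G : mpol kbar m.+1),
          [/\ homogeneous e F, homogeneous e G,
              OSunit p (gen_eval (fun_emb S) y G * D p ^+ e)
            & f = gen_eval (fun_emb S) y F / gen_eval (fun_emb S) y G]].

Definition ample (D : divisor) : Prop :=
  exists2 m, (0 < m)%N & very_ample (div_muln m D).

Definition del_pezzo (B : divisor -> divisor -> int) (d : nat) : Prop :=
  exists Kc, [/\ canonical_divisor Kc, ample (div_opp Kc)
               & B (div_opp Kc) (div_opp Kc) = d%:Z].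

Definition minus_one_curve (B : divisor -> divisor -> int) (C : divisor) :
    Prop :=
  [/\ prime_divisor C,
      forall Kc, canonical_divisor Kc -> B (div_opp Kc) C = 1
    & B C C = - 1].

(* Cartier divisors on S itself, as divisors on the base change: they have
   local equations in k(S) on an open covering of S defined over k. *)
Definition divisor_over_k (D : divisor) : Prop :=
  cartier D /\
  forall p, onS p -> exists f e (g : mpol k N.+1),
    [/\ kS f /\ f != 0, homogeneous e g,
        pt_eval p (mpoly.map_mpoly iota g) != 0
      & forall q, onS q -> pt_eval q (mpoly.map_mpoly iota g) != 0 ->
          OSunit q (f / D q)].

Definition lin_equiv_k (D E : divisor) : Prop :=
  exists f, [/\ kS f, f != 0 & div_eq D (fun p => f * E p)].

(* The classes of the b i form a basis of Pic(S). *)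
Definition pic_basis r (b : 'I_r -> divisor) : Prop :=
  (forall i, divisor_over_k (b i)) /\
  (forall D, divisor_over_k D ->
     exists! a : 'rV[int]_r, lin_equiv_k D (div_comb b a)).

Definition picard_rank : nat :=
  xget 0%N [set r | exists b : 'I_r -> divisor, pic_basis b].

(* tau is the extension of sigma to K = Frac (kbar (x) k(S)) that fixes k(S);
   sigma' is the inverse of sigma. *)
Definition galois_element (sigma sigma' : {rmorphism kbar -> kbar})
    (tau : {rmorphism K -> K}) : Prop :=
  [/\ cancel sigma sigma', cancel sigma' sigma,
      forall c, sigma (iota c) = iota c,
      forall c, tau (fun_emb S c) = fun_emb S (sigma c)
    & forall z, kS z -> tau z = z].

Definition galois_act (sigma' : {rmorphism kbar -> kbar})
    (tau : {rmorphism K -> K}) (D : divisor) : divisor :=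
  fun p => tau (D (map_mx sigma' p)).

End Surface.

(* The lattice attached to the degree d <= 7: the Picard lattice of the blow-up
   of the plane in 9 - d points, with basis the class of a line followed by the
   classes of the exceptional curves. *)
Definition lattice (d : nat) := 'rV[int]_(9 - d).+1.

Definition lat_form d (v w : lattice d) : int :=
  v 0 ord0 * w 0 ord0 - \sum_(i | i != ord0) v 0 i * w 0 i.

Definition lat_anticanonical d : lattice d :=
  \row_i (if i == ord0 then 3 else - 1).

Definition lat_root d (a : lattice d) : Prop :=
  lat_form (lat_anticanonical d) a = 0 /\ lat_form a a = - 2.

Definition lat_exceptional d (v : lattice d) : Prop :=
  lat_form (lat_anticanonical d) v = 1 /\ lat_form v v = - 1.

Definition lat_reflection d (a v : lattice d) : lattice d :=
  v + lat_form v a *: a.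

Inductive weyl_group d : set (lattice d -> lattice d) :=
| weyl_id : weyl_group id
| weyl_reflection a w :
    lat_root a -> weyl_group w -> weyl_group (lat_reflection a \o w).

(* phi induces an isomorphism from the Picard group of the base change to the
   lattice that respects the intersection forms, the anticanonical classes and
   the classes of (-1)-curves. *)
Definition marking (k kbar : fieldType) (iota : {rmorphism k -> kbar})
    (S : smooth_projective_surface iota) (B : divisor S -> divisor S -> int)
    (d : nat) (phi : divisor S -> lattice d) : Prop :=
  [/\ forall D E, cartier D -> cartier E ->
        phi (div_add D E) = phi D + phi E,
      forall D E, cartier D -> cartier E ->
        (phi D = phi E <-> lin_equiv D E),
      forall v, exists2 D, cartier D & phi D = v,
      forall D E, cartier D -> cartier E -> lat_form (phi D) (phi E) = B D E
    & (forall Kc, canonical_divisor Kc ->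
         phi (div_opp Kc) = lat_anticanonical d) /\
      (forall v, lat_exceptional v <->
         exists2 C, minus_one_curve B C & phi C = v)].

(* The group W(S). *)
Definition galois_image (k kbar : fieldType) (iota : {rmorphism k -> kbar})
    (S : smooth_projective_surface iota) (d : nat)
    (phi : divisor S -> lattice d) : set (lattice d -> lattice d) :=
  [set w | exists sigma sigma' tau, galois_element sigma sigma' tau /\
     forall D, cartier D -> phi (galois_act sigma' tau D) = w (phi D)].

(* g W g^-1 for a bijection g. *)
Definition conjugate d (g : lattice d -> lattice d)
    (W : set (lattice d -> lattice d)) : set (lattice d -> lattice d) :=
  [set w : lattice d -> lattice d |
     exists2 w', W w' & forall v, w (g v) = g (w' v)].

(* Lebesgue measure of a Borel set of R^n, by iterated integration. *)
Fixpoint volume (R : realType) (n : nat) : set 'rV[R]_n -> \bar R :=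
  match n with
  | 0 => fun A => (\1_A (0 : 'rV[R]_0))%:E
  | m.+1 => fun A =>
      (\int[@lebesgue_measure R]_t
         volume [set y : 'rV[R]_m | A (row_mx (t%:M : 'rV[R]_1) y)])%E
  end.

Section Alpha.
Variables (R : realType) (k kbar : fieldType) (iota : {rmorphism k -> kbar}).
Variables (S : smooth_projective_surface iota).
Variable B : divisor S -> divisor S -> int.

(* Elements of Pic(S)_R are given by their coordinates in the basis b. *)
Section Basis.
Variables (r : nat) (b : 'I_r -> divisor S).

Definition gram : 'M[R]_r := \matrix_(i, j) (B (b i) (b j))%:~R.

Definition pairing (x y : 'rV[R]_r) : R := (x *m gram *m y^T) 0 0.

Definition effective_class (a : 'rV[int]_r) : Prop :=
  exists D, [/\ divisor_over_k D, effective D & lin_equiv_k D (div_comb b a)].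

Definition effective_cone : set 'rV[R]_r :=
  [set y | exists m (c : 'I_m -> R) (a : 'I_m -> 'rV[int]_r),
     [/\ forall i, 0 <= c i, forall i, effective_class (a i)
       & y = \sum_(i < m) c i *: map_mx (fun z : int => z%:~R) (a i)]].

Definition dual_effective_cone : set 'rV[R]_r :=
  [set x | forall y, effective_cone y -> 0 <= pairing x y].

Definition alpha_polytope : set 'rV[R]_r :=
  [set x | dual_effective_cone x /\
     forall Kc, canonical_divisor Kc ->
       \sum_(i < r) x 0 i * (B (b i) (div_opp Kc))%:~R <= 1].

(* The dual lattice consists of the x with x *m gram integral, and so has
   covolume 1 / `|\det gram| in the coordinates x. *)
Definition alpha_in_basis : \bar R :=
  ((r%:R)%:E * ((`|\det gram|)%:E * volume alpha_polytope))%E.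

End Basis.

(* The value does not depend on the basis of Pic(S). *)
Definition alpha : \bar R :=
  xget 0%E [set a | exists r (b : 'I_r -> divisor S),
                      pic_basis b /\ a = alpha_in_basis b].

End Alpha.

(* Main.v *)
(* Both values of alpha are computed inside the lattice Pic(S_kbar). A class is
   represented by a divisor over k iff it is fixed by the Galois image (this uses
   the rational point), and a real class x of Pic(S) is dual to the effective cone
   of S iff x.E >= 0 for every (-1)-class E: an effective divisor is a sum of
   (-1)-curves and nef curves, two classes that are nonnegative on all (-1)-classes
   have nonnegative product, and conversely the sum of the Galois conjugates of a
   (-1)-curve is defined over k. Hence alpha(S) depends only on the sublattice of
   fixed classes. If W(S_1) is contained in g W(S_2) g^-1, then g maps the classes
   fixed by W(S_2) into those fixed by W(S_1); both sublattices are saturated and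
   have the same rank, so g maps one onto the other. As g preserves the form, the
   anticanonical class and the (-1)-classes, alpha(S_1) = alpha(S_2).

   A (-1)-curve E is defined over a separable extension of k: otherwise it is
   minimally defined over a field with a derivation delta, some equation A of E
   over that field has delta A nonzero on E, and comparing the residual divisors
   of A and delta A along E contradicts E.E = -1. *)

Require Import Defs.
From HB Require Import structures.
From mathcomp Require Import all_boot all_order all_algebra all_field.
From mathcomp Require Import all_classical all_reals all_analysis.
From mathcomp Require Import zify ring lra.
From mathcomp Require mpoly.
Import -(notations) mpoly.

Set Implicit Arguments.
Unset Strict Implicit.
Unset Printing Implicit Defensive.

Import Order.TTheory GRing.Theory Num.Theory.

Local Open Scope classical_set_scope.
Local Open Scope ring_scope.

(** * Ideals of polynomial rings *)

(** The intersection form enters only through bilinearity, invariance under linear equivalence and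
    the local multiplicities of distinct curves. Self-intersections are therefore reached by moving
    a divisor off a curve, and multiplicities have to be shown additive, which rests on a
    Cohen-Macaulay property of the regular local rings. The bound d <= 7 makes the (-1)-classes span
    the lattice. The bound d >= 1, on which the index theorem and the pairing of nef classes depend,
    has to be extracted from ampleness: if K^2 were 0, the embedding would contract a curve. As k
    may be imperfect, automorphisms of kbar detect only its perfect closure; derivations take over
    the inseparable part of the descent. The rational point provides a normalization: the functions
    relating the conjugates of a divisor are determined only up to constants, and prescribing the
    value 1 at that point turns them into a genuine cocycle. Fields of definition are treated by
    linear algebra: vanishing along a divisor is a finite system of linear equations over the field
    of definition, so its solutions are spanned by solutions over that field. *)

Definition ideal_set (R : comNzRingType) (I : set R) : Prop :=
  [/\ I 0, forall a b, I a -> I b -> I (a + b) & forall a b, I b -> I (a * b)].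

(** Beyond every bound there is an index at which the tail attains its minimum; along such indices
    the sequence is nondecreasing. *)
Lemma nondecreasing_subseq (u : nat -> nat) :
  exists phi : nat -> nat, (forall i, phi i < phi i.+1)%N /\
    (forall i, u (phi i) <= u (phi i.+1))%N.
Proof.
have H N : exists i, (N <= i)%N /\ forall j, (i <= j)%N -> (u i <= u j)%N.
  have E : exists v, `[< exists2 i, (N <= i)%N & u i = v >].
    by exists (u N); apply/asboolP; exists N.
  case: (ex_minnP E) => v /asboolP[i Ni <-] vmin; exists i; split=> // j ij.
  by apply: vmin; apply/asboolP; exists j => //; apply: leq_trans ij.
have [h hP] := choice H.
exists (fix phi i := if i is i'.+1 then h (phi i').+1 else h 0).
split=> i; first exact: (hP _).1.
case: i => [|i]; apply: (hP _).2; apply: ltnW; exact: (hP _).1.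
Qed.

Lemma nondecreasing_subseqs (m : nat -> nat -> nat) k :
  exists phi : nat -> nat, (forall i, phi i < phi i.+1)%N /\
    forall t, (t < k)%N -> forall i, (m (phi i) t <= m (phi i.+1) t)%N.
Proof.
elim: k => [|k [phi [phi1 phi2]]]; first by exists id.
have [psi [psi1 psi2]] := nondecreasing_subseq (fun i => m (phi i) k).
have mono (w : nat -> nat) : (forall i, w i <= w i.+1)%N ->
    forall i j, (i <= j)%N -> (w i <= w j)%N.
  move=> w1 i j; apply: (@homo_leq nat w (fun a b => a <= b)%N) => //.
  by move=> a b c; apply: leq_trans.
have smono i j : (i < j)%N -> (phi i < phi j)%N.
  by apply: (@homo_ltn nat phi (fun a b => a < b)%N) => // a b c; apply: ltn_trans.
exists (phi \o psi); split=> [i|t tk i]; first exact: smono.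
move: tk; rewrite ltnS leq_eqVlt => /orP[/eqP ->|/phi2 {}phi2]; first exact: psi2.
by apply: (mono (fun i => m (phi i) t)) => //; apply: ltnW.
Qed.

(** Thinning the sequence once per coordinate makes all exponents nondecreasing, so the first two
    members left are already comparable. *)
Lemma dickson n (m : nat -> multinom n) :
  exists i j, (i < j)%N /\ forall t, (m i t <= m j t)%N.
Proof.
have [phi [phi1 phi2]] :=
  nondecreasing_subseqs (fun i t => if insub t is Some t' then m i t' else 0) n.
exists (phi 0), (phi 1); split=> // t.
by have := phi2 t (ltn_ord t) 0; rewrite valK.
Qed.

(** Hilbert's basis theorem by leading monomials: take in each [I i.+1] outside [I i] an element
    with minimal leading monomial. When one of these monomials divides a later one, cancelling the
    leading term produces an element that contradicts minimality. *)
Lemma mpoly_acc (F : fieldType) n (I : nat -> set (mpol F n)) :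
  (forall i, ideal_set (I i)) -> (forall i, I i `<=` I i.+1) ->
  exists i, I i.+1 `<=` I i.
Proof.
move=> Iid Iinc; apply: contrapT => /forallNP H.
have {}H i : exists x, [/\ I i.+1 x, ~ I i x &
    forall y, I i.+1 y -> ~ I i y -> ~ (mlead y < mlead x)%O].
  have [x [Ix nIx]] : exists x, I i.+1 x /\ ~ I i x.
    apply: contrapT => N; apply: (H i) => x Ix; apply: contrapT => nx.
    by apply: N; exists x.
  move: {1}(mlead x) (erefl (mlead x)) => m; move: m x Ix nIx.
  apply: (well_founded_ind (@ltom_wf n)) => m IH x Ix nIx mx.
  have [[y [Iy nIy yx]]|N] :=
      pselect (exists y, [/\ I i.+1 y, ~ I i y & (mlead y < mlead x)%O]).
    by apply: (IH (mlead y)) (erefl _) => //; rewrite mx.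
  by exists x; split=> // y Iy nIy yx; apply: N; exists y.
have [f fP] := choice H.
have [i [j [ij le_ij]]] := dickson (fun i => mlead (f i)).
have Iij k x : I i.+1 x -> (i < k)%N -> I k x.
  move=> Ix; elim: k => // k IH; rewrite ltnS leq_eqVlt => /orP[/eqP <-//|/IH].
  exact: Iinc.
have [Ifi nIfi _] := fP i; have [Ifj nIfj minj] := fP j.
have fi0 : f i != 0 by apply/eqP => E; apply: nIfi; rewrite E; case: (Iid i).
have fj0 : f j != 0 by apply/eqP => E; apply: nIfj; rewrite E; case: (Iid j).
pose d := mnm_sub (mlead (f j)) (mlead (f i)).
pose c := mleadc (f j) / mleadc (f i).
have ci0 : mleadc (f i) != 0 by rewrite mleadc_eq0.
have cj0 : mleadc (f j) != 0 by rewrite mleadc_eq0.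
have c0 : c != 0 by rewrite mulf_neq0 ?invr_eq0.
pose q := (c *: mpolyX F d) * f i.
have X0 : mpolyX F d != 0 by rewrite -mleadc_eq0 mleadXm mcoeffX eqxx oner_eq0.
have lq : mlead q = mlead (f j).
  rewrite mleadM ?scaler_eq0 ?negb_or ?c0 ?X0 // mleadZ // mleadXm submK //.
  exact/mnm_lepP.
have cq : mleadc q = mleadc (f j).
  have E : mlead q = mnm_add (mlead (c *: mpolyX F d)) (mlead (f i)).
    by rewrite /q mleadM ?scaler_eq0 ?negb_or ?c0 ?X0.
  by rewrite E /q mleadcM mleadZ // mleadXm mcoeffZ mcoeffX eqxx mulr1 /c divfK.
have Iq : I j q.
  by apply: Iij ij; case: (Iid i.+1) => _ _; apply.
have Iy : I j.+1 (f j - q).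
  case: (Iid j.+1) => _ aD aM; apply: aD => //.
  by rewrite -mulN1r; apply: aM; apply: Iinc.
have nIy : ~ I j (f j - q).
  by move=> h; apply: nIfj; rewrite -(subrK q (f j)); case: (Iid j) => _ + _; apply.
apply: (minj _ Iy nIy).
have y0 : f j - q != 0 by apply/eqP => E; apply: nIy; rewrite E; case: (Iid j).
rewrite lt_def.
have := mleadB_le (f j) q; rewrite lq joinxx => ->; rewrite andbT.
apply/eqP => E; move: y0; rewrite -mleadc_eq0 -E mcoeffB -{2}lq cq subrr.
by rewrite eqxx.
Qed.
(** * Extension of ring morphisms and the Nullstellensatz *)

Lemma poly_infinite_nonroot (F : closedFieldType) (p : {poly F}) :
  p != 0 -> exists c, ~~ root p c.
Proof.
by move/closed_nonrootP.
Qed.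

(** A morphism with kernel may kill leading coefficients. Cutting off what lies above the degree of
    the image gives a representative of the same degree as its image, as pseudo-division
    requires. *)
Lemma map_poly_trunc (R L : nzRingType) (f : {rmorphism R -> L}) (Q : {poly R}) :
  let T := take_poly (size (map_poly f Q)) Q in
  map_poly f T = map_poly f Q /\ size T = size (map_poly f Q).
Proof.
set s := size _ => T.
have E : map_poly f T = map_poly f Q.
  apply/polyP => i; rewrite !coef_map coef_take_poly.
  case: ltnP => //= si; rewrite rmorph0; apply/esym.
  by rewrite -coef_map nth_default.
split=> //; apply/eqP; rewrite eqn_leq size_take_poly /=.
by rewrite -/s /s -E size_poly.
Qed.

Section Extend.
Import Pdiv.CommonRing.
Variables (R : comNzRingType) (L : fieldType) (f : {rmorphism R -> L}) (y : L).

Local Notation ev Q := (map_poly f Q).[y].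

Lemma evM (P Q : {poly R}) : ev (P * Q) = ev P * ev Q.
Proof. by rewrite rmorphM hornerM. Qed.

Lemma evC (a : R) : ev a%:P = f a.
Proof. by rewrite map_polyC hornerC. Qed.

(** A minimal polynomial of [y] over the domain [f R], lifted to [R]. *)
Lemma exists_min_annihilator :
  (exists Q, ev Q = 0 /\ map_poly f Q != 0) ->
  exists Q, [/\ ev Q = 0, f (lead_coef Q) != 0, (1 < size Q)%N &
    forall Z, ev Z = 0 -> map_poly f Z != 0 -> (size Q <= size (map_poly f Z))%N].
Proof.
move=> [Q0 [Q0y Q00]].
have E : exists v, `[< exists Q, [/\ ev Q = 0, map_poly f Q != 0
    & size (map_poly f Q) = v] >].
  by exists (size (map_poly f Q0)); apply/asboolP; exists Q0.
case: (ex_minnP E) => v /asboolP[Q [Qy Qn0 <-]] vmin.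
have [Tf Ts] := map_poly_trunc f Q; set T := take_poly _ _ in Tf Ts.
exists T; split; first by rewrite Tf.
- have : lead_coef (map_poly f Q) != 0 by rewrite lead_coef_eq0.
  by rewrite /lead_coef -Ts -Tf coef_map.
- rewrite Ts ltnNge; apply/negP => /size1_polyC E1.
  by move: Qy Qn0; rewrite E1 hornerC => ->; rewrite eqxx.
- by move=> Z Zy Zn0; rewrite Ts; apply: vmin; apply/asboolP; exists Z.
Qed.

(** An element algebraic over the domain [f R] divides a nonzero element of it. Among the
    polynomials whose value is a multiple of [ev b], take [T] of least degree: were it nonconstant,
    pseudo-division of [b] by [T] (if [T] vanishes at [y]) or of [Q] by [T] (otherwise) would give a
    contradiction. *)
Lemma ev_mult (Q b : {poly R}) : ev b != 0 -> ev Q = 0 ->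
  f (lead_coef Q) != 0 -> (1 < size Q)%N ->
  (forall Z, ev Z = 0 -> map_poly f Z != 0 -> (size Q <= size (map_poly f Z))%N) ->
  exists a V, f a != 0 /\ f a = ev V * ev b.
Proof.
move=> b0 Qy lQ sQ Qmin.
have map0 (T : {poly R}) : f (lead_coef T) != 0 -> map_poly f T != 0.
  by move=> l; apply/eqP => /(congr1 (fun p : {poly L} => p`_(size T).-1));
    rewrite coef_map coef0 => /eqP; rewrite (negPf l).
have E : exists v, `[< exists T, [/\ exists V, ev T = ev V * ev b,
    map_poly f T != 0 & size (map_poly f T) = v] >].
  exists (size (map_poly f Q)); apply/asboolP; exists Q; split=> //.
    by exists 0; rewrite Qy rmorph0 horner0 mul0r.
  exact: map0.
case: (ex_minnP E) => v /asboolP[T0 [[V TV] T0n0 <-]] vmin.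
have [Tf Ts] := map_poly_trunc f T0; set T := take_poly _ _ in Tf Ts.
have {TV} Ty : ev T = ev V * ev b by rewrite Tf.
have lT : f (lead_coef T) != 0.
  have : lead_coef (map_poly f T0) != 0 by rewrite lead_coef_eq0.
  by rewrite /lead_coef -Ts -Tf coef_map.
have Tmin Z : (exists W, ev Z = ev W * ev b) -> map_poly f Z != 0 ->
    (size T <= size (map_poly f Z))%N.
  by move=> ZW Zn0; rewrite Ts; apply: vmin; apply/asboolP; exists Z.
have Tn0 : T != 0 by rewrite -lead_coef_eq0; apply: contraNneq lT => ->; rewrite rmorph0.
have small (r : {poly R}) : (size r < size T)%N ->
    (exists W, ev r = ev W * ev b) -> map_poly f r = 0.
  move=> sr rW; apply: contrapT => /eqP /(Tmin _ rW).
  by rewrite leqNgt (leq_ltn_trans (size_poly _ _) sr).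
have divT (P : {poly R}) : ev P * f (lead_coef T) ^+ rscalp P T =
    ev (rdivp P T) * ev T + ev (rmodp P T).
  rewrite -evM -hornerD -rmorphD -Pdiv.ComRing.rdivp_eq -mul_polyC evM evC.
  by rewrite rmorphXn mulrC.
have sm (P : {poly R}) : (size (rmodp P T) < size T)%N by rewrite ltn_rmodp.
have [T1|T1] := leqP (size T) 1.
  have := size1_polyC T1 => ET.
  exists T`_0, V; rewrite -[f _]evC -ET; split=> //.
  move: lT; rewrite /lead_coef; have -> : (size T).-1 = 0%N by case: (size T) T1 => [|[]].
  by rewrite [in X in _ -> X]ET evC.
have ev0 (Z : {poly R}) : map_poly f Z = 0 -> ev Z = 0.
  by move=> ->; rewrite horner0.
have [Ty0|Ty0] := eqVneq (ev T) 0.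
  have rE := divT b; rewrite Ty0 mulr0 add0r in rE.
  have /ev0 r0 : map_poly f (rmodp b T) = 0.
    apply: small => //; exists ((lead_coef T) ^+ rscalp b T)%:P.
    by rewrite evC rmorphXn -rE mulrC.
  by move/eqP: rE; rewrite r0 mulf_eq0 (negPf b0) expf_eq0 (negPf lT) andbF.
have rE := divT Q; rewrite Qy mul0r in rE.
have r0 : map_poly f (rmodp Q T) = 0.
  apply: small => //; exists (- (rdivp Q T) * V).
  rewrite evM rmorphN hornerN -mulrA -Ty mulNr.
  by apply/eqP; rewrite -addr_eq0 addrC -rE.
move/eqP: rE; rewrite (ev0 _ r0) addr0 eq_sym mulf_eq0 (negPf Ty0) orbF => /eqP S0.
have E2 : (f (lead_coef T) ^+ rscalp Q T)%:P * map_poly f Q =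
    map_poly f (rdivp Q T) * map_poly f T.
  rewrite -rmorphXn -map_polyC -!rmorphM mul_polyC Pdiv.ComRing.rdivp_eq.
  by rewrite rmorphD /= r0 addr0.
have Sn0 : map_poly f (rdivp Q T) != 0.
  apply: contraTneq (map0 _ lQ) => S00; move/eqP: E2; rewrite S00 mul0r mulf_eq0.
  by rewrite polyC_eq0 expf_eq0 (negPf lT) andbF /= => ->.
have := Qmin _ S0 Sn0.
have sQ' : size (map_poly f Q) = size Q by rewrite size_map_poly_id0.
have sT' : size (map_poly f T) = size T by rewrite size_map_poly_id0.
have -> : size Q = (size (map_poly f (rdivp Q T)) + size T).-1.
  have l0 : f (lead_coef T) ^+ rscalp Q T != 0 by rewrite expf_neq0.
  rewrite -[in LHS]sQ' -[X in (_ + X)%N]sT'.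
  have <- := size_Cmul (map_poly f Q) l0; rewrite E2.
  by apply: size_mul => //; apply: map0.
by case: (size T) T1 => [|[|t]] // _; rewrite !addnS /= leqNgt ltnS leq_addr.
Qed.

(** Extension of a specialization from [R] to [R[y]]: away from the zeros of one element [a], every
    point of [R] lifts to a point of [R[y]] at which [b] survives. For transcendental [y] any
    nonroot of [b] will do; for algebraic [y] a root of the minimal polynomial is taken, and [b]
    survives because it divides a constant that does. *)
Lemma extend_morphism (b : {poly R}) : ev b != 0 ->
  exists2 a, f a != 0 & forall (F : closedFieldType) (g : {rmorphism R -> F}),
    (forall r, f r = 0 -> g r = 0) -> g a != 0 ->
    exists2 c, (map_poly g b).[c] != 0 &
      forall Q, ev Q = 0 -> (map_poly g Q).[c] = 0.
Proof.
move=> b0.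
have [/exists_min_annihilator [Q [Qy lQ sQ Qmin]]|N] :=
    pselect (exists Q, ev Q = 0 /\ map_poly f Q != 0); last first.
  have bn0 : map_poly f b != 0.
    by apply: contraNneq b0 => ->; rewrite horner0.
  pose i := (size (map_poly f b)).-1.
  have bi : (map_poly f b)`_i != 0 by rewrite -/(lead_coef _) lead_coef_eq0.
  exists b`_i => [|F g gf ga]; first by rewrite -coef_map.
  have /poly_infinite_nonroot [c] : map_poly g b != 0.
    by apply: contraNneq ga => /polyP/(_ i); rewrite coef_map coef0 => ->.
  exists c => // Q Qy; have Q0 : map_poly f Q = 0.
    by apply: contrapT => /eqP Q0; apply: N; exists Q.
  suff -> : map_poly g Q = 0 by rewrite horner0.
  apply/polyP => j; rewrite coef_map coef0; apply: gf.
  by rewrite -coef_map Q0 coef0.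
have [a [V [fa fab]]] := ev_mult b0 Qy lQ sQ Qmin.
exists (a * lead_coef Q) => [|F g gf]; first by rewrite rmorphM mulf_neq0.
rewrite rmorphM mulf_eq0 negb_or => /andP[ga gq].
have sg : size (map_poly g Q) = size Q by rewrite size_map_poly_id0.
have [c /rootP Qc] : exists c, root (map_poly g Q) c.
  by apply/closed_rootP; rewrite sg neq_ltn sQ orbT.
have H Z : ev Z = 0 -> (map_poly g Z).[c] = 0.
  move=> Zy.
  have Q0 : Q != 0 by rewrite -size_poly_gt0 (leq_trans _ sQ).
  have E := Pdiv.ComRing.rdivp_eq Q Z; rewrite -mul_polyC in E.
  have r0 : map_poly f (rmodp Z Q) = 0.
    apply: contrapT => /eqP r0.
    have ry : ev (rmodp Z Q) = 0.
      have := congr1 (fun p => ev p) E; rewrite evM Zy mulr0 rmorphD hornerD.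
      by rewrite -/(ev _) evM Qy mulr0 add0r => <-.
    have := Qmin _ ry r0; rewrite leqNgt (leq_ltn_trans (size_poly _ _)) //.
    by rewrite ltn_rmodp.
  have gr0 : map_poly g (rmodp Z Q) = 0.
    by apply/polyP => i; rewrite coef_map coef0; apply: gf; rewrite -coef_map r0 coef0.
  have := congr1 (fun p => (map_poly g p).[c]) E.
  rewrite rmorphM hornerM rmorphD /= gr0 addr0 rmorphM hornerM /= Qc mulr0 => /eqP.
  rewrite mulf_eq0 map_polyC hornerC /= rmorphXn expf_eq0 (negPf gq) andbF /=.
  by move/eqP.
exists c; last exact: H.
have := H (a%:P - V * b).
rewrite rmorphB hornerD hornerN evM evC fab subrr => /(_ erefl) /eqP.
rewrite rmorphB hornerD hornerN subr_eq0 /= map_polyC hornerC rmorphM hornerM => /eqP E.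
by apply: contraNneq ga; rewrite E => ->; rewrite mulr0.
Qed.

End Extend.

(** * Points of polynomial rings with values in a field, and their specialization *)

Notation mX i := (mpolyX _ (mnm1 i)).

Lemma mpoly_morphP n (R : nzRingType) (S : nzRingType)
    (h1 h2 : {rmorphism mpol R n -> S}) :
  (forall c, h1 (mpolyC n c) = h2 (mpolyC n c)) ->
  (forall i, h1 (mX i) = h2 (mX i)) -> h1 =1 h2.
Proof.
move=> hC hX p; rewrite (mpolyE p) !rmorph_sum; apply: eq_bigr => m _.
rewrite -mul_mpolyC !rmorphM hC; congr (_ * _).
rewrite mpolyXE_id !rmorph_prod; apply: eq_bigr => i _.
by rewrite !rmorphXn hX.
Qed.

Section LastVariable.
Variables (F : fieldType) (n : nat).

Definition split_last : mpol F n.+1 -> {poly mpol F n} :=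
  mmap (polyC \o @mpolyC n F)
    (fun i => if unlift ord_max i is Some j then (mX j)%:P else 'X).
HB.instance Definition _ := GRing.RMorphism.on split_last.

Definition widen_vars : mpol F n -> mpol F n.+1 :=
  mmap (@mpolyC n.+1 F) (fun j => mX (lift ord_max j)).
HB.instance Definition _ := GRing.RMorphism.on widen_vars.

Lemma split_lastE (S : comNzRingType) (f : {rmorphism mpol F n.+1 -> S}) Q :
  f Q = (map_poly (f \o widen_vars) (split_last Q)).[f (mX ord_max)].
Proof.
apply: (@mpoly_morphP _ _ _ f
  (horner_eval (f (mX ord_max)) \o map_poly (f \o widen_vars) \o split_last)) => [c|i] /=.
  rewrite /split_last mmapC /= map_polyC /horner_eval hornerC /=.
  by rewrite /widen_vars mmapC.
rewrite /split_last mmapX mmap1U; case: unliftP => [j ->|->].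
  by rewrite map_polyC /horner_eval hornerC /= /widen_vars mmapX mmap1U.
by rewrite map_polyX /horner_eval hornerX.
Qed.

End LastVariable.

(** The field [L] may be transcendental over [kb]. Its point is specialized one variable at a time:
    the element [a] produced for the last variable is the open condition imposed on the others. *)
Lemma field_point (kb : closedFieldType) n (L : fieldType)
    (f : {rmorphism mpol kb n -> L}) (b : mpol kb n) : f b != 0 ->
  exists2 c, meval c b != 0 & forall Q, f Q = 0 -> meval c Q = 0.
Proof.
elim: n f b => [|n IH] f b fb.
  have E (Q : mpol kb 0) : Q = mpolyC 0 (meval (fun=> 0) Q).
    apply: (@mpoly_morphP _ _ _ idfun (@mpolyC 0 kb \o meval (fun=> 0))) => [c|[]//].
    by rewrite /= mevalC.
  have H (Q : mpol kb 0) : (meval (fun=> 0) Q == 0) = (f Q == 0).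
    by rewrite {2}(E Q) (fmorph_eq0 (f \o @mpolyC 0 kb)).
  exists (fun=> 0); first by rewrite H.
  by move=> Q /eqP; rewrite -H => /eqP.
rewrite split_lastE in fb.
have [a fa ext] := extend_morphism fb.
have [c ca cQ] := IH (f \o @widen_vars kb n) a fa.
have [e eb eQ] := ext kb (meval c) cQ ca.
pose c' i := if unlift ord_max i is Some j then c j else e.
have E Q : meval c' Q = (map_poly (meval c) (split_last Q)).[e].
  rewrite split_lastE /= mevalXU {2}/c' unlift_none; congr (_.[_]).
  apply: eq_map_poly => P; apply: (@mpoly_morphP _ _ _
    (meval c' \o @widen_vars kb n) (meval c)) => [x|i] /=.
    by rewrite /widen_vars mmapC !mevalC.
  by rewrite /widen_vars mmapX mmap1U !mevalXU /c' liftK.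
by exists c' => [|Q]; rewrite E // split_lastE => /eQ.
Qed.

(** * The field of fractions of the quotient by a prime ideal *)

Section PrimeQuotient.
Variable R : comNzRingType.

Definition prime_set (P : set R) : Prop :=
  [/\ ideal_set P, ~ P 1 & forall a b, P (a * b) -> P a \/ P b].

Section Quot.
Variables (P : set R) (PP : prime_set P).

Lemma prime_set_closed : idealr_closed (fun x : R => `[< P x >]).
Proof.
case: PP => [[P0 PD PM] P1 _]; split; first exact/asboolP.
  by apply/negP => /asboolP.
by move=> a x y /asboolP xP /asboolP yP; apply/asboolP/PD => //; apply: PM.
Qed.

Definition prime_idealr : idealr R :=
  HB.pack_for (idealr R) (fun x : R => `[< P x >]) (isIdealr.Build R _ prime_set_closed).

Definition prime_quot := Quotient.quot prime_idealr.
HB.instance Definition _ := GRing.ComNzRing.on prime_quot.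

(** Units and inverses are chosen classically, to give the quotient the structure over which a
    fraction field is formed. *)
Definition quot_unit : pred prime_quot := fun x => `[< exists y, y * x = 1 >].
Definition quot_inv (x : prime_quot) : prime_quot :=
  if pselect (exists y, y * x = 1) is left h then projT1 (cid h) else x.

Lemma quot_mulVx : {in quot_unit, left_inverse 1 quot_inv *%R}.
Proof.
move=> x /asboolP h; rewrite /quot_inv; case: pselect => // h'.
by case: (cid h').
Qed.

Lemma quot_unitP (x y : prime_quot) : y * x = 1 -> quot_unit x.
Proof. by move=> h; apply/asboolP; exists y. Qed.

Lemma quot_inv_out : {in [predC quot_unit], quot_inv =1 id}.
Proof. by move=> x /asboolP h; rewrite /quot_inv; case: pselect. Qed.

HB.instance Definition _ := GRing.ComNzRing_hasMulInverse.Build prime_quot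
  quot_mulVx quot_unitP quot_inv_out.

Definition to_quot : R -> prime_quot := \pi_(Quotient.quot prime_idealr)%qT.
HB.instance Definition _ := GRing.RMorphism.on to_quot.

Lemma to_quot_eq0 x : to_quot x = 0 <-> P x.
Proof.
rewrite /to_quot -(rmorph0 to_quot) /to_quot; split.
  by move/eqP; rewrite -Quotient.idealrBE subr0 => /asboolP.
by move=> Px; apply/eqP; rewrite -Quotient.idealrBE subr0; apply/asboolP.
Qed.

Lemma quot_domain (x y : prime_quot) : x * y = 0 -> (x == 0) || (y == 0).
Proof.
rewrite -[x]reprK -[y]reprK -/(to_quot _) -/(to_quot _) -rmorphM => /to_quot_eq0.
by case: PP => _ _ Pp /Pp [] /to_quot_eq0 ->; rewrite eqxx ?orbT.
Qed.

HB.instance Definition _ := GRing.ComUnitRing_isIntegral.Build prime_quot quot_domain.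

End Quot.

Lemma prime_quot_field (P : set R) : prime_set P ->
  exists (L : fieldType) (f : {rmorphism R -> L}), forall x, f x = 0 <-> P x.
Proof.
move=> PP; exists {fraction prime_quot PP}.
exists (@tofrac _ \o to_quot PP) => x /=; rewrite -(to_quot_eq0 PP).
by split=> [/eqP|->]; rewrite ?tofrac_eq0 ?tofrac0 // => /eqP.
Qed.

End PrimeQuotient.

Lemma ideal_set_gen (R : comNzRingType) (I : set R) (x : R) : ideal_set I ->
  ideal_set [set y | exists a b, I b /\ y = a * x + b].
Proof.
case=> I0 ID IM; split.
- by exists 0, 0; rewrite mul0r addr0.
- move=> _ _ [a [b [Ib ->]]] [a' [b' [Ib' ->]]]; exists (a + a'), (b + b').
  by split; [exact: ID | rewrite mulrDl addrACA].
- move=> c _ [a [b [Ib ->]]]; exists (c * a), (c * b).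
  by split; [exact: IM | rewrite mulrDr mulrA].
Qed.

(** An ideal maximal among those that contain [I] and no power of [G] is prime. The generic point of
    its quotient specializes to a zero of [I] at which [G] does not vanish. *)
Theorem nullstellensatz (kb : closedFieldType) n (I : set (mpol kb n)) (G : mpol kb n) :
  ideal_set I ->
  (forall c, (forall F, I F -> meval c F = 0) -> meval c G = 0) ->
  exists k, I (G ^+ k).
Proof.
move=> Iid IG; apply: contrapT => /forallNP NG.
pose good (M : set (mpol kb n)) := [/\ ideal_set M, I `<=` M & forall k, ~ M (G ^+ k)].
(* Without a maximal such ideal, iterated enlargement would contradict the ascending chain
   condition. *)
have [M [[Mid IM MG] Mmax]] : exists M, good M /\ forall M', good M' -> M `<=` M' -> M' `<=` M.
  apply: contrapT => N.
  have H (M : {M | good M}) : exists M' : {M | good M}, sval M `<=` sval M' /\ ~ (sval M' `<=` sval M).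
    case: M => M gM /=; apply: contrapT => N2; apply: N; exists M; split=> // M' gM' MM'.
    by apply: contrapT => N3; apply: N2; exists (exist _ M' gM').
  have [h hP] := choice H.
  have gI : good I by split.
  have [i] := @mpoly_acc kb n (fun i => sval (iter i h (exist _ I gI)))
    (fun i => let: And3 a _ _ := svalP (iter i h (exist _ I gI)) in a)
    (fun i => (hP _).1).
  exact: (hP _).2.
have step x : ~ M x -> exists k a b, M b /\ G ^+ k = a * x + b.
  move=> Mx; apply: contrapT => N.
  pose M' := [set y | exists a b, M b /\ y = a * x + b].
  have Mx' : M' x by exists 1, 0; rewrite mul1r addr0; case: Mid.
  apply: Mx; apply: (Mmax M') Mx'; last first.
    by move=> y My; exists 0, y; rewrite mul0r add0r.
  split; first exact: ideal_set_gen.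
    by move=> y /IM My; exists 0, y; rewrite mul0r add0r.
  by move=> k [a [b ab]]; apply: N; exists k, a, b.
case: (Mid) => M0 MD MM.
have Mp : prime_set M.
  split=> // [M1|x y Mxy]; first by apply: (MG 0); rewrite expr0.
  apply: contrapT => /not_orP[/step[k [a [b [Mb E]]]] /step[l [c [d [Md E']]]]].
  apply: (MG (k + l)); rewrite exprD E E' mulrDl.
  have -> : a * x * (c * y + d) + b * (c * y + d) =
     (a * c) * (x * y) + (a * x) * d + (c * y + d) * b by ring.
  by apply: (MD); [apply: (MD)|]; apply: (MM).
have [L [f fP]] := prime_quot_field Mp.
have fG : f G != 0 by apply/eqP => /fP MG1; apply: (MG 1).
have [c cG cM] := field_point fG.
by move/eqP: cG; apply; apply: IG => F /IM /fP /cM.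
Qed.
(** * Automorphisms of the algebraic closure *)

Lemma mk_rmorphism (R S : nzRingType) (f : R -> S) :
  (forall x y, f (x - y) = f x - f y) -> (forall x y, f (x * y) = f x * f y) ->
  f 1 = 1 -> exists g : {rmorphism R -> S}, g =1 f.
Proof.
move=> fB fM f1.
pose g : {rmorphism R -> S} := HB.pack_for {rmorphism R -> S} f
  (GRing.isZmodMorphism.Build R S f fB)
  (GRing.isMonoidMorphism.Build R S f (conj f1 fM)).
by exists g.
Qed.

Section SubringGraph.
Variables (T : comNzRingType) (G : set T).

Definition subring_set : Prop :=
  [/\ G 1, forall x y, G x -> G y -> G (x - y) & forall x y, G x -> G y -> G (x * y)].

Hypothesis GG : subring_set.

Lemma subring_set_closed : subring_closed (fun x => `[< G x >]).
Proof.
case: GG => G1 GB GM; split; first exact/asboolP.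
  by move=> x y /asboolP ? /asboolP ?; apply/asboolP/GB.
by move=> x y /asboolP ? /asboolP ?; apply/asboolP/GM.
Qed.

Definition subring_closed_pack : subringClosed T :=
  HB.pack_for (subringClosed T) (fun x : T => `[< G x >])
    (GRing.isSubringClosed.Build T _ subring_set_closed).

(** A subset closed under the operations becomes a ring type, so that the graph of a partial
    morphism can be the base ring of [extend_morphism]. *)
Record subring_of := SubringOf { subring_val : T; _ : subring_val \in subring_closed_pack }.
HB.instance Definition _ := [isSub for subring_val].
HB.instance Definition _ := [Choice of subring_of by <:].
HB.instance Definition _ := [SubChoice_isSubComNzRing of subring_of by <:].

Lemma subring_valP (x : subring_of) : G (subring_val x).
Proof. exact: (@elimT (G (subring_val x)) _ (asboolP _) (valP x)). Qed.

Lemma subring_val_onto (x : T) : G x -> exists y : subring_of, subring_val y = x.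
Proof.
move=> /asboolP Gx; have h : x \in subring_closed_pack by [].
by exists (SubringOf h).
Qed.

End SubringGraph.

Section Automorphisms.
Variables (k : fieldType) (kb : closedFieldType) (iota : {rmorphism k -> kb}).
Hypothesis alg : forall z : kb, algebraicOver iota z.

Local Notation pk P := (map_poly iota P).

(** The graph of a morphism over k from a subring of [kb] to [kb]; by additivity, single-valuedness
    only has to be stated at 0. *)
Definition partial_hom (G : set (kb * kb)%type) : Prop :=
  [/\ subring_set G, forall c, G (iota c, iota c) & forall y, G (0, y) -> y = 0].

Lemma partial_hom_poly G P x y : partial_hom G -> G (x, y) -> G ((pk P).[x], (pk P).[y]).
Proof.
case=> [[G1 GB GM] Gc _] Gxy.
have G0 : G (0, 0) by have := Gc 0; rewrite rmorph0.
have GD u v : G u -> G v -> G (u + v).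
  by move=> Gu Gv; rewrite -[v]opprK; apply: (GB) => //; rewrite -sub0r; exact: GB.
elim/poly_ind: P => [|P c IH]; first by rewrite rmorph0 !horner0.
rewrite rmorphD rmorphM /= map_polyX map_polyC !hornerMXaddC /=.
exact: (GD (_, _) (_, _) (GM (_, _) (_, _) IH Gxy) (Gc c)).
Qed.

Lemma nonzero_constant_annihilator (x : kb) : x != 0 ->
  exists2 P, (pk P).[x] = 0 & P`_0 != 0.
Proof.
move=> x0; have [P0 P00 /rootP P0x] := alg x.
have [m [P Pn0 E]] := multiplicity_XsubC P0 0; rewrite P00 /= in Pn0.
exists P; last by move: Pn0; rewrite /root horner_coef0.
move: P0x; rewrite E polyC0 subr0 rmorphM rmorphXn /= map_polyX hornerM hornerXn => /eqP.
by rewrite mulf_eq0 expf_eq0 (negPf x0) andbF orbF => /eqP.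
Qed.

(** A nonzero algebraic element satisfies an equation over k with nonzero constant term, which 0
    does not satisfy. *)
Lemma partial_hom_inj G x y : partial_hom G -> G (x, y) -> x != 0 -> y != 0.
Proof.
move=> GG Gxy /nonzero_constant_annihilator [P Px P0].
have := partial_hom_poly P GG Gxy; rewrite Px => H.
case: GG => _ _ /(_ _ H) Py; apply: contraNneq P0 => y0.
by move: Py; rewrite y0 horner_coef0 coef_map => /eqP; rewrite fmorph_eq0.
Qed.

(** The graph is the base ring, with its first projection as [f] and its second as [g]. By
    [partial_hom_inj], [g] does not kill the element [a] of [extend_morphism]. *)
Lemma partial_hom_extend G w : partial_hom G -> exists G', [/\ partial_hom G', G `<=` G' &
  exists c, G' (w, c)].
Proof.
move=> GG; case: (GG) => GS Gc Gv.
pose R : comNzRingType := subring_of GS.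
pose f : {rmorphism R -> kb} := (@fst kb kb) \o (\val : subring_of GS -> (kb * kb)%type).
pose g : {rmorphism R -> kb} := (@snd kb kb) \o (\val : subring_of GS -> (kb * kb)%type).
have fg (r : R) : G (f r, g r) by rewrite /f /g /= -surjective_pairing; exact: subring_valP.
have f0 r : f r = 0 -> g r = 0 by move=> fr; apply: Gv; rewrite -fr.
have one0 : (map_poly f 1).[w] != 0 by rewrite rmorph1 hornerC oner_eq0.
have [a fa ext] := extend_morphism one0.
have [c _ cQ] := ext kb g f0 (partial_hom_inj GG (fg a) fa).
exists [set u | exists Q : {poly R}, u = ((map_poly f Q).[w], (map_poly g Q).[c])]; split.
- split.
  + split; first by exists 1; rewrite !rmorph1 !hornerC.
      move=> _ _ [P ->] [Q ->]; exists (P - Q).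
      by rewrite !rmorphB !hornerD !hornerN.
    move=> _ _ [P ->] [Q ->]; exists (P * Q).
    by rewrite !rmorphM !hornerM.
  + move=> e; have [r rE] := subring_val_onto GS (Gc e).
    by exists r%:P; rewrite !map_polyC !hornerC /f /g /= rE.
  + by move=> y [Q [/esym/cQ -> ->]].
- move=> u /(subring_val_onto GS) [r rE]; exists r%:P.
  by rewrite !map_polyC !hornerC /f /g /= rE -surjective_pairing.
- by exists c, 'X; rewrite !map_polyX !hornerX.
Qed.

(** The hypothesis makes the substitution of [z'] for [z] a partial morphism. A maximal extension is
    defined on all of [kb]; it is onto because it permutes the finitely many roots of each
    polynomial over k. *)
Theorem extend_automorphism (z z' : kb) :
  (forall P, root (pk P) z -> root (pk P) z') ->
  exists s s' : {rmorphism kb -> kb}, [/\ cancel s s', cancel s' s,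
    forall c, s (iota c) = iota c & s z = z'].
Proof.
move=> zz'.
pose G0 := [set u : (kb * kb)%type | exists P, u = ((pk P).[z], (pk P).[z'])].
have G0G : partial_hom G0.
  split.
  - split; first by exists 1; rewrite rmorph1 !hornerC.
      by move=> _ _ [P ->] [Q ->]; exists (P - Q); rewrite !rmorphB !hornerD !hornerN.
    by move=> _ _ [P ->] [Q ->]; exists (P * Q); rewrite !rmorphM !hornerM.
  - by move=> c; exists c%:P; rewrite map_polyC !hornerC.
  - by move=> y [P [/esym/rootP/zz'/rootP -> ->]].
pose good G := G = set0 \/ (partial_hom G /\ G0 `<=` G).
have [G [Ggood Gmax]] : exists G, good G /\ forall H, G `<` H -> ~ good H.
  apply: Zorn_bigcup => F Fgood Ftot.
  have [[H [FH [h Hh]]]|N] := pselect (exists H, F H /\ H !=set0); last first.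
    left; apply/seteqP; split=> // u [H FH Hu]; apply: N; exists H; split=> //.
    by exists u.
  have Fph H' u : F H' -> H' u -> partial_hom H' /\ G0 `<=` H'.
    by move=> /Fgood [->|].
  have two u v : (\bigcup_(X in F) X) u -> (\bigcup_(X in F) X) v ->
      exists H', [/\ F H', H' u & H' v].
    move=> [A FA Au] [B FB Bv]; have [AB|BA] := Ftot _ _ FA FB.
      by exists B; split=> //; apply: AB.
    by exists A; split=> //; apply: BA.
  right; have [Hph HG] := Fph _ _ FH Hh; split; last by move=> u /HG Hu; exists H.
  split.
  - split; first by exists H => //; case: Hph => -[].
      move=> u v Uu Uv; have [H' [FH' Hu Hv]] := two _ _ Uu Uv.
      by exists H' => //; have [[[_ HB _] _ _] _] := Fph _ _ FH' Hu; apply: HB.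
    move=> u v Uu Uv; have [H' [FH' Hu Hv]] := two _ _ Uu Uv.
    by exists H' => //; have [[[_ _ HM] _ _] _] := Fph _ _ FH' Hu; apply: HM.
  - by move=> c; exists H => //; case: Hph.
  - move=> y [H' FH' Hy]; have [[_ _ Hv] _] := Fph _ _ FH' Hy; exact: Hv.
have {Ggood} [GG G0G'] : partial_hom G /\ G0 `<=` G.
  case: Ggood => // E; exfalso; apply: (Gmax G0); last by right; split.
  split; first by rewrite E.
  by move=> h; have [[h1 _ _] _ _] := G0G; have := h _ h1; rewrite E.
have tot w : exists c, G (w, c).
  have [G' [GG' GG'' [c cw]]] := partial_hom_extend w GG.
  exists c; apply: contrapT => N; apply: (Gmax G'); last by right; split => // u /G0G' /GG''.
  by split=> // h; apply: N; apply: h.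
have [s0 s0P] := choice tot.
case: (GG) => -[G1 GB GM] Gc Gv.
have s0E w c : G (w, c) -> s0 w = c.
  move=> Gw; apply/eqP; rewrite -subr_eq0; apply/eqP; apply: Gv.
  have : G (w - w, s0 w - c) := GB _ _ (s0P w) Gw.
  by rewrite subrr.
have [s sE] : exists s : {rmorphism kb -> kb}, s =1 s0.
  apply: mk_rmorphism => [x y|x y|]; apply: s0E.
  - exact: (GB _ _ (s0P x) (s0P y)).
  - exact: (GM _ _ (s0P x) (s0P y)).
  - exact: G1.
have sc c : s (iota c) = iota c by rewrite sE; apply: s0E; apply: Gc.
have sroot P w : root (pk P) w -> root (pk P) (s w).
  have E : pk P = map_poly s (pk P).
    by rewrite -map_poly_comp; apply: eq_map_poly => c /=; rewrite sc.
  by move=> /rootP r; apply/rootP; rewrite E horner_map r rmorph0.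
have sonto v : exists w, s w = v.
  have [P P0 Pv] := alg v.
  have [rs rsE] := closed_field_poly_normal (pk P).
  have l0 : lead_coef (pk P) != 0 by rewrite lead_coef_eq0 map_poly_eq0.
  have memr w : (w \in undup rs) = root (pk P) w.
    by rewrite mem_undup rsE rootZ // root_prod_XsubC.
  have sub : {subset map s (undup rs) <= undup rs}.
    by move=> _ /mapP[w wr ->]; rewrite memr; apply: sroot; rewrite -memr.
  have u : uniq (map s (undup rs)).
    by rewrite map_inj_uniq ?undup_uniq //; apply: fmorph_inj.
  have [_ E] := uniq_min_size u sub (eq_leq (esym (size_map _ _))).
  have : v \in map s (undup rs) by rewrite E memr.
  by case/mapP => w _ ->; exists w.
have [s1 s1P] := choice sonto.
have s1K : cancel s s1 by move=> w; apply: (fmorph_inj s); rewrite s1P.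
have [s' s'E] : exists s' : {rmorphism kb -> kb}, s' =1 s1.
  apply: mk_rmorphism => [x y|x y|]; apply: (fmorph_inj s); rewrite ?rmorphB ?rmorphM;
    by rewrite ?rmorph1 ?s1P.
exists s, s'; split=> //; first by move=> w; rewrite s'E.
  by move=> w; rewrite s'E.
by rewrite sE; apply: s0E; apply: G0G'; exists 'X; rewrite !map_polyX !hornerX.
Qed.

End Automorphisms.
(** * Fields of definition of polynomials *)

Definition subfield_set (F : fieldType) (Phi : set F) : Prop :=
  [/\ Phi 1, forall x y, Phi x -> Phi y -> Phi (x - y),
      forall x y, Phi x -> Phi y -> Phi (x * y) & forall x, Phi x -> Phi x^-1].

Definition poly_in (F : fieldType) (Phi : set F) n (P : mpol F n) : Prop :=
  forall m, Phi (mcoeff m P).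

Section Coefficientwise.
Variables (F : fieldType) (n : nat).
Implicit Types (h : F -> F) (P Q : mpol F n).

(** [h] need not be additive, only [h 0 = 0] is asked for: it may be a coordinate with respect to a
    basis, or a derivation that behaves well on a subfield only. *)
Definition mapc h P : mpol F n :=
  \sum_(m <- msupp P) h (mcoeff m P) *: mpolyX F m.

Lemma mcoeff_mapc h P m : h 0 = 0 -> mcoeff m (mapc h P) = h (mcoeff m P).
Proof.
move=> h0; rewrite /mapc raddf_sum /=.
under eq_bigr do rewrite mcoeffZ mcoeffX.
have [mP|mP] := boolP (m \in msupp P).
  rewrite (bigD1_seq m) ?msupp_uniq //= eqxx mulr1 big1 ?addr0 // => m' /negPf E.
  by rewrite E mulr0.
rewrite big_seq_cond big1 ?(memN_msupp_eq0 mP) // => m' /andP[m'P _].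
by case: eqP m'P mP => [->->//|]; rewrite mulr0.
Qed.

Lemma homogeneous_coeff e P :
  (forall m, mcoeff m P != 0 -> mdeg m = e) -> homogeneous e P.
Proof. by move=> H; apply/dhomogP => m; rewrite mcoeff_msupp => /H. Qed.

Lemma homogeneousP e P : homogeneous e P -> forall m, mcoeff m P != 0 -> mdeg m = e.
Proof. by move/dhomogP => H m; rewrite -mcoeff_msupp => /H. Qed.

Lemma homogeneous_subset e P Q : {subset msupp Q <= msupp P} -> homogeneous e P ->
  homogeneous e Q.
Proof. by move=> s /dhomogP He; apply/dhomogP => m /s /He. Qed.

Lemma homogeneous_mapc h e P : h 0 = 0 -> homogeneous e P -> homogeneous e (mapc h P).
Proof.
move=> h0 /homogeneousP He; apply: homogeneous_coeff => m.
rewrite mcoeff_mapc // => H; apply: He; apply: contraNneq H => ->; exact/eqP.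
Qed.

End Coefficientwise.

Section Subfield.
Variables (F : fieldType) (Phi : set F).
Hypothesis PhiF : subfield_set Phi.

Lemma sf1 : Phi 1. Proof. by case: PhiF. Qed.
Lemma sfB x y : Phi x -> Phi y -> Phi (x - y). Proof. by case: PhiF => _ + _ _; apply. Qed.
Lemma sfM x y : Phi x -> Phi y -> Phi (x * y). Proof. by case: PhiF => _ _ + _; apply. Qed.
Lemma sfV x : Phi x -> Phi x^-1. Proof. by case: PhiF => _ _ _; apply. Qed.
Lemma sf0 : Phi 0. Proof. by rewrite -(subrr 1); apply: sfB; apply: sf1. Qed.
Lemma sfN x : Phi x -> Phi (- x).
Proof. by rewrite -sub0r => ?; apply: sfB => //; apply: sf0. Qed.
Lemma sfD x y : Phi x -> Phi y -> Phi (x + y).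
Proof. by move=> ? ?; rewrite -[y]opprK; apply: sfB => //; apply: sfN. Qed.
Lemma sf_sum I (r : seq I) (p : pred I) (f : I -> F) :
  (forall i, p i -> Phi (f i)) -> Phi (\sum_(i <- r | p i) f i).
Proof. by move=> H; apply: big_ind => //; [apply: sf0 | apply: sfD]. Qed.

Lemma poly_in0 n : poly_in Phi (0 : mpol F n).
Proof. by move=> m; rewrite mcoeff0; apply: sf0. Qed.
Lemma poly_inD n (P Q : mpol F n) : poly_in Phi P -> poly_in Phi Q -> poly_in Phi (P + Q).
Proof. by move=> ? ? m; rewrite mcoeffD; apply: sfD. Qed.
Lemma poly_inN n (P : mpol F n) : poly_in Phi P -> poly_in Phi (- P).
Proof. by move=> ? m; rewrite mcoeffN; apply: sfN. Qed.
Lemma poly_inB n (P Q : mpol F n) : poly_in Phi P -> poly_in Phi Q -> poly_in Phi (P - Q).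
Proof. by move=> ? ?; apply: poly_inD => //; apply: poly_inN. Qed.
Lemma poly_inM n (P Q : mpol F n) : poly_in Phi P -> poly_in Phi Q -> poly_in Phi (P * Q).
Proof. by move=> PP PQ m; rewrite mcoeffM; apply: sf_sum => i _; apply: sfM. Qed.
Lemma poly_inZ n c (P : mpol F n) : Phi c -> poly_in Phi P -> poly_in Phi (c *: P).
Proof. by move=> ? ? m; rewrite mcoeffZ; apply: sfM. Qed.
Lemma poly_inX n m : poly_in Phi (mpolyX F m : mpol F n).
Proof.
by move=> m'; rewrite mcoeffX; case: eqP => _; [apply: sf1 | apply: sf0].
Qed.
Lemma poly_in1 n : poly_in Phi (1 : mpol F n).
Proof. by move=> m; rewrite mcoeff1; case: eqP => _; [apply: sf1 | apply: sf0]. Qed.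
Lemma poly_in_exp n (P : mpol F n) e : poly_in Phi P -> poly_in Phi (P ^+ e).
Proof.
move=> PP; elim: e => [|e IH]; first exact: poly_in1.
by rewrite exprS; apply: poly_inM.
Qed.
Lemma poly_in_sum n I (r : seq I) (p : pred I) (f : I -> mpol F n) :
  (forall i, p i -> poly_in Phi (f i)) -> poly_in Phi (\sum_(i <- r | p i) f i).
Proof. by move=> H; apply: big_ind => //; [apply: poly_in0 | apply: poly_inD]. Qed.
Lemma poly_in_prod n I (r : seq I) (p : pred I) (f : I -> mpol F n) :
  (forall i, p i -> poly_in Phi (f i)) -> poly_in Phi (\prod_(i <- r | p i) f i).
Proof. by move=> H; apply: big_ind => //; [apply: poly_in1 | apply: poly_inM]. Qed.

(** [Phi] is a mere subset of [F], so a basis of the span is built by hand, adjoining an element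
    whenever it is independent of the previous ones. *)
Lemma span_basis (s : seq F) : exists m (b : 'I_m -> F),
  (forall a : 'I_m -> F, (forall i, Phi (a i)) -> \sum_i a i * b i = 0 -> forall i, a i = 0) /\
  forall z, z \in s -> exists2 a : 'I_m -> F, (forall i, Phi (a i)) & z = \sum_i a i * b i.
Proof.
elim: s => [|z s [m [b [bi bs]]]]; first by exists 0, (fun=> 0); split=> // a _ _ [].
have [[a aP zE]|N] := pselect (exists2 a : 'I_m -> F, (forall i, Phi (a i)) &
    z = \sum_i a i * b i).
  exists m, b; split=> // y; rewrite inE => /orP[/eqP ->|]; [by exists a | exact: bs].
pose b' i := if unlift ord0 i is Some j then b j else z.
have E (a : 'I_m.+1 -> F) : \sum_i a i * b' i = a ord0 * z + \sum_i a (lift ord0 i) * b i.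
  rewrite big_ord_recl /b' unlift_none; congr (_ + _).
  by apply: eq_bigr => i _; rewrite liftK.
exists m.+1, b'; split=> [a aP|y].
  rewrite E => H; have a0 : a ord0 = 0.
    apply: contrapT => /eqP a0; apply: N; exists (fun i => - (a (lift ord0 i) / a ord0)).
      by move=> i; apply/sfN/sfM => //; apply: sfV.
    apply: (mulfI a0); rewrite mulr_sumr; move/eqP: H; rewrite addr_eq0 => /eqP ->.
    rewrite -sumrN; apply: eq_bigr => i _; field; exact: a0.
  rewrite a0 mul0r add0r in H; move=> i; case: (unliftP ord0 i) => [j|] -> //.
  exact: (bi (fun j => a (lift ord0 j))).
rewrite inE => /orP[/eqP ->|/bs[a aP yE]].
  exists (fun i => (i == ord0)%:R).
    by move=> i; case: (_ == _); [apply: sf1 | apply: sf0].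
  by rewrite E eqxx mul1r big1 ?addr0 // => i _; rewrite mul0r.
exists (fun i => if unlift ord0 i is Some j then a j else 0).
  by move=> i; case: unliftP => // _; apply: sf0.
rewrite E unlift_none mul0r add0r yE; apply: eq_bigr => i _; by rewrite liftK.
Qed.

(** Expand all coefficients in a [Phi]-basis and compare coordinates: a solution of linear equations
    over [Phi], modulo an ideal spanned over [Phi], becomes a combination of solutions over [Phi].
    Taking coordinates does not enlarge supports, so homogeneity is inherited. *)
Lemma descend_equations n (I : set (mpol F n)) T J
    (P : 'I_T -> 'I_J -> mpol F n) (Q : 'I_J -> mpol F n) :
  ideal_set I ->
  (forall G, I G -> exists2 s : seq (F * mpol F n),
     forall x, x \in s -> poly_in Phi x.2 /\ I x.2 & G = \sum_(x <- s) x.1 *: x.2) ->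
  (forall t j, poly_in Phi (P t j)) ->
  (forall t, I (\sum_j P t j * Q j)) ->
  exists m (b : 'I_m -> F) (R : 'I_m -> 'I_J -> mpol F n),
    [/\ forall l j, poly_in Phi (R l j), forall j, Q j = \sum_l b l *: R l j,
        forall l t, I (\sum_j P t j * R l j) &
        forall l j, {subset msupp (R l j) <= msupp (Q j)}].
Proof.
case=> I0 ID IM Isp PP IQ.
have [st stP] := choice (fun t => let: ex_intro2 s a b := Isp _ (IQ t) in
  ex_intro (fun s => (forall x, x \in s -> poly_in Phi x.2 /\ I x.2) /\
     \sum_j P t j * Q j = \sum_(x <- s) x.1 *: x.2) s (conj a b)).
(* The span must also contain the scalars in the expansions of the values in [I]: their coordinates
   witness that the new values are in [I]. *)
pose cs := [seq mcoeff m (Q j) | j <- enum 'I_J, m <- msupp (Q j)] ++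
  [seq x.1 | t <- enum 'I_T, x <- st t].
have [m [b [bi bs]]] := span_basis cs.
(* The coordinates of 0 are chosen to be 0, as [mapc] requires. *)
have /choice [la laP] : forall z, exists a : 'I_m -> F, (forall i, Phi (a i)) /\
    (z = 0 -> a = fun=> 0) /\ (z \in cs -> z = \sum_i a i * b i).
  move=> z; have [->|z0] := eqVneq z 0.
    exists (fun=> 0); split; first by move=> _; apply: sf0.
    by split=> // _; rewrite big1 // => i _; rewrite mul0r.
  have [zc|zc] := boolP (z \in cs).
    have [a aP zE] := bs z zc; exists a; split=> //; split=> // E.
    by rewrite E eqxx in z0.
  exists (fun=> 0); split; first by move=> _; apply: sf0.
  by split=> // zc'; rewrite zc' in zc.
have la0 l : la 0 l = 0 by have [_ [-> //]] := laP 0.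
have laE z : z = 0 \/ z \in cs -> z = \sum_i la z i * b i.
  case=> [->|]; first by rewrite big1 // => i _; rewrite la0 mul0r.
  by have [_ [_ h]] := laP z => /h.
exists m, b, (fun l j => mapc (fun z => la z l) (Q j)).
have R_in l j : poly_in Phi (mapc (fun z => la z l) (Q j)).
  by move=> mu; rewrite mcoeff_mapc //; have [] := laP (mcoeff mu (Q j)).
have QE j : Q j = \sum_l b l *: mapc (fun z => la z l) (Q j).
  apply/mpolyP => mu; rewrite raddf_sum /=.
  under eq_bigr do rewrite mcoeffZ mcoeff_mapc // mulrC.
  apply: laE; have [/memN_msupp_eq0|mQ] := boolP (mu \notin msupp (Q j)); first by left.
  right; rewrite mem_cat; apply/orP; left; apply/allpairsPdep.
  by exists j, mu; rewrite mem_enum; split=> //; rewrite negbK in mQ.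
split=> // [l t|l j mu]; last first.
  by rewrite !mcoeff_msupp mcoeff_mapc //; apply: contraNneq => ->; rewrite la0.
have [stI stE] := stP t.
have -> : \sum_j P t j * mapc (fun z => la z l) (Q j) =
    \sum_(x <- st t) la x.1 l *: x.2; last first.
  rewrite big_seq; apply: (big_ind I) => // x xs.
  by rewrite -mul_mpolyC; apply: IM; case: (stI x xs).
apply/mpolyP => mu; apply/eqP; rewrite -subr_eq0; apply/eqP.
(* The [u l] are in [Phi] and combine with [b] to a coefficient of the zero polynomial, so they
   vanish by independence. *)
pose u l := mcoeff mu (\sum_j P t j * mapc (fun z => la z l) (Q j)) -
   mcoeff mu (\sum_(x <- st t) la x.1 l *: x.2).
apply: (bi u) => [i|].
  apply: sfB; first by apply: poly_in_sum => // j _; apply: poly_inM.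
  rewrite big_seq; apply: poly_in_sum => x xs; apply: poly_inZ; last by case: (stI x xs).
  by have [] := laP x.1.
have lin (X : 'I_m -> mpol F n) :
    \sum_i mcoeff mu (X i) * b i = mcoeff mu (\sum_i b i *: X i).
  by rewrite raddf_sum; apply: eq_bigr => i _ /=; rewrite mcoeffZ mulrC.
rewrite /u; under eq_bigr do rewrite mulrBl.
rewrite sumrB !lin -raddfB.
have -> : \sum_i b i *: (\sum_j P t j * mapc (fun z => la z i) (Q j)) = \sum_j P t j * Q j.
  under eq_bigr do rewrite scaler_sumr.
  rewrite exchange_big; apply: eq_bigr => j _ /=.
  by rewrite {2}(QE j) mulr_sumr; apply: eq_bigr => i _; rewrite scalerAr.
rewrite stE; have -> : \sum_i b i *: (\sum_(x <- st t) la x.1 i *: x.2) =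
    \sum_(x <- st t) x.1 *: x.2; last by rewrite subrr raddf0.
under eq_bigr do rewrite scaler_sumr.
rewrite exchange_big /= big_seq [RHS]big_seq; apply: eq_bigr => x xs.
have {2}-> : x.1 = \sum_i la x.1 i * b i.
  apply: laE; right; rewrite mem_cat; apply/orP; right; apply/allpairsPdep.
  by exists t, x; rewrite mem_enum.
by rewrite scaler_suml; apply: eq_bigr => i _; rewrite scalerA mulrC.
Qed.

End Subfield.

(** * Descent along operators acting on coefficients *)

Section OperatorDescent.
Variables (F : fieldType) (Phi1 : set F) (TT : set (F -> F)) (n : nat).
Hypothesis Phi1F : subfield_set Phi1.
Hypothesis TT0 : forall t, TT t -> t 0 = 0.
Hypothesis TT1 : forall t, TT t -> t 1 = 0.
Hypothesis TTin : forall t z, TT t -> Phi1 z -> Phi1 (t z).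

(** The field of constants when the operator is a derivation; the fixed field when the operators are
    [s - 1] for automorphisms [s]. *)
Definition operator_kernel : set F := [set z | Phi1 z /\ forall t, TT t -> t z = 0].

Variable W : set (mpol F n).
Hypothesis W0 : W 0.
Hypothesis WD : forall a b, W a -> W b -> W (a + b).
Hypothesis WZ : forall c a, Phi1 c -> W a -> W (c *: a).
Hypothesis WT : forall t a, TT t -> poly_in Phi1 a -> W a -> W (mapc t a).

(* A vector of minimal support with a coefficient 1 is killed by the operators;
   the induction is on the size of the support. *)
Lemma operator_descent (w : mpol F n) : W w -> poly_in Phi1 w ->
  exists2 s : seq (F * mpol F n), forall x, x \in s ->
     [/\ Phi1 x.1, W x.2, poly_in operator_kernel x.2 & {subset msupp x.2 <= msupp w}]
   & w = \sum_(x <- s) x.1 *: x.2.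
Proof.
have [N] := ubnP (size (msupp w)); elim: N w => // N IH w sN Ww Pw.
have smaller (v : mpol F n) m : {subset msupp v <= msupp w} -> m \in msupp w ->
    m \notin msupp v -> (size (msupp v) < N)%N.
  move=> vw mw mv; rewrite -ltnS; apply: leq_trans sN; rewrite !ltnS.
  have : uniq (m :: msupp v) by rewrite /= mv msupp_uniq.
  by move/uniq_leq_size; apply=> m'; rewrite inE => /orP[/eqP ->|/vw].
have [->|w0] := eqVneq w 0; first by exists [::]; rewrite ?big_nil.
pose m := mlead w; have mw : m \in msupp w by apply: mlead_supp.
have c0 : mcoeff m w != 0 by rewrite -mcoeff_msupp.
pose v := (mcoeff m w)^-1 *: w.
have Pc : Phi1 (mcoeff m w) by apply: Pw.
have Wv : W v by apply: WZ => //; apply: sfV.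
have Pv : poly_in Phi1 v by apply: poly_inZ => //; apply: sfV.
have vm : mcoeff m v = 1 by rewrite mcoeffZ mulVf.
have wE : w = mcoeff m w *: v by rewrite scalerA mulfV // scale1r.
have sv m' : (m' \in msupp v) = (m' \in msupp w).
  by rewrite !mcoeff_msupp mcoeffZ mulf_eq0 invr_eq0 (negPf c0).
have [H|] := pselect (forall t, TT t -> mapc t v = 0).
  exists [:: (mcoeff m w, v)]; last by rewrite big_seq1.
  move=> x; rewrite inE => /eqP -> /=; split=> //; last by move=> m'; rewrite sv.
  move=> m'; split=> [|t tT]; first exact: Pv.
  by rewrite -mcoeff_mapc ?TT0 // H // mcoeff0.
move=> /existsNP [t /not_implyP [tT /eqP tv0]].
have Ptv : poly_in Phi1 (mapc t v).
  by move=> m'; rewrite mcoeff_mapc ?TT0 //; apply: TTin.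
have stv : {subset msupp (mapc t v) <= msupp w}.
  move=> m'; rewrite -sv !mcoeff_msupp mcoeff_mapc ?TT0 //.
  by apply: contraNneq => ->; rewrite TT0.
(* [t] kills the coefficient 1 at [m], so the support of [mapc t v] is strictly smaller. *)
have mtv : m \notin msupp (mapc t v) by rewrite -mcoeff_eq0 mcoeff_mapc ?TT0 // vm TT1.
have [s sP sE] := IH _ (smaller _ _ stv mw mtv) (WT tT Pv Wv) Ptv.
have [x xs x0] : exists2 x, x \in s & x.2 != 0.
  apply: contrapT => Nx; move/eqP: tv0; apply; rewrite sE big_seq big1 // => x xs.
  suff -> : x.2 = 0 by rewrite scaler0.
  by apply: contrapT => /eqP x0; apply: Nx; exists x.
have [_ Wx Kx sx] := sP x xs.
have Px : poly_in Phi1 x.2 by move=> m'; case: (Kx m').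
pose j := mlead x.2; have jx : j \in msupp x.2 by apply: mlead_supp.
have d0 : mcoeff j x.2 != 0 by rewrite -mcoeff_msupp.
(* A member over the kernel whose support lies in that of [w] serves to remove a monomial from
   [w]. *)
pose c := mcoeff j w / mcoeff j x.2.
have Pcc : Phi1 c by apply: sfM => //; apply: sfV.
have jw : j \in msupp w by apply/stv/sx.
have su : {subset msupp (w - c *: x.2) <= msupp w}.
  move=> m'; rewrite !mcoeff_msupp mcoeffB mcoeffZ; apply: contraNneq => E.
  have : m' \notin msupp x.2 by apply/negP => /sx /stv; rewrite mcoeff_msupp E eqxx.
  by rewrite -mcoeff_eq0 => /eqP ->; rewrite E mulr0 subrr.
have ju : j \notin msupp (w - c *: x.2).
  by rewrite -mcoeff_eq0 mcoeffB mcoeffZ divfK // subrr.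
have Wu : W (w - c *: x.2).
  by apply: WD => //; rewrite -scaleNr; apply: WZ => //; apply: sfN.
have Pu : poly_in Phi1 (w - c *: x.2) by apply: poly_inB => //; apply: poly_inZ.
have [s' s'P s'E] := IH _ (smaller _ _ su jw ju) Wu Pu.
exists ((c, x.2) :: s').
  move=> y; rewrite inE => /orP[/eqP -> /=|/s'P[? ? ? sy]].
    by split=> // m' /sx /stv.
  by split=> // m' /sy /su.
by rewrite big_cons -s'E /= addrC subrK.
Qed.

End OperatorDescent.

(** * Ideals spanned over a small field, seen from an intermediate one *)

Section SpannedIn.
Variables (F : fieldType) (Phi0 Phi : set F) (n : nat) (I : set (mpol F n)).
Hypotheses (Phi0F : subfield_set Phi0) (PhiF : subfield_set Phi) (Phi0Phi : Phi0 `<=` Phi).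
Hypothesis Iid : ideal_set I.
Hypothesis Isp : forall G, I G -> exists2 s : seq (F * mpol F n),
  forall x, x \in s -> poly_in Phi0 x.2 /\ I x.2 & G = \sum_(x <- s) x.1 *: x.2.

(* Subtract from G a multiple of a member of I over Phi0 whose support is contained
   in the support of G. *)
Lemma spanned_in G : I G -> poly_in Phi G -> exists2 s : seq (F * mpol F n),
  forall x, x \in s -> [/\ Phi x.1, poly_in Phi0 x.2 & I x.2] & G = \sum_(x <- s) x.1 *: x.2.
Proof.
have [I0 ID IM] := Iid.
have [N] := ubnP (size (msupp G)); elim: N G => // N IH G sN IG PG.
have [->|G0] := eqVneq G 0; first by exists [::]; rewrite ?big_nil.
have [||m [b [R [R0 GE IR Rsub]]]] := @descend_equations _ _ Phi0F n I 1 1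
  (fun _ _ => 1) (fun _ => G) Iid Isp.
- by move=> _ _; apply: poly_in1.
- by move=> _; rewrite big_ord1 mul1r.
have [l Rl] : exists l, R l ord0 != 0.
  apply: contrapT => N0; move/eqP: G0; apply; rewrite (GE ord0) big1 // => l _.
  by have [->|h] := eqVneq (R l ord0) 0; [rewrite scaler0 | case: N0; exists l].
have IRl : I (R l ord0) by have := IR l ord0; rewrite big_ord1 mul1r.
pose j := mlead (R l ord0); have jR : j \in msupp (R l ord0) by apply: mlead_supp.
have d0 : mcoeff j (R l ord0) != 0 by rewrite -mcoeff_msupp.
pose c := mcoeff j G / mcoeff j (R l ord0).
have Pc : Phi c by apply: (sfM PhiF (PG j)); apply: (sfV PhiF); apply: Phi0Phi; apply: R0.
have [|||s sP sE] := IH (G - c *: R l ord0).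
- rewrite -ltnS; apply: leq_trans sN; rewrite !ltnS.
  have : uniq (j :: msupp (G - c *: R l ord0)).
    by rewrite /= msupp_uniq andbT -mcoeff_eq0 mcoeffB mcoeffZ divfK // subrr.
  move/uniq_leq_size; apply=> m'; rewrite inE => /orP[/eqP ->|]; first exact: Rsub jR.
  rewrite !mcoeff_msupp mcoeffB mcoeffZ; apply: contraNneq => E.
  have : m' \notin msupp (R l ord0) by apply/negP => /Rsub; rewrite mcoeff_msupp E eqxx.
  by rewrite -mcoeff_eq0 => /eqP ->; rewrite E mulr0 subrr.
- by apply: ID => //; rewrite -scaleNr -mul_mpolyC; apply: IM.
- apply: (poly_inB PhiF PG); apply: (poly_inZ PhiF Pc) => m'; apply: Phi0Phi; exact: R0.
exists ((c, R l ord0) :: s).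
  move=> y; rewrite inE => /orP[/eqP -> /=|ys]; last exact: sP.
  by split=> //; apply: R0.
by rewrite big_cons -sE /= addrC subrK.
Qed.

End SpannedIn.
(** * Local rings of a surface *)

Section Homogeneous.
Variables (F : fieldType) (n : nat).

Lemma homogeneous0 e : homogeneous e (0 : mpol F n).
Proof. exact: dhomog0. Qed.
Lemma homogeneousC c : homogeneous 0 (mpolyC n c : mpol F n).
Proof.
apply: homogeneous_coeff => m; rewrite mcoeffC.
by have [->|] := eqVneq m; rewrite ?mdeg0 // mulr0 eqxx.
Qed.
Lemma homogeneous1 : homogeneous 0 (1 : mpol F n).
Proof. exact: (homogeneousC 1). Qed.
Lemma homogeneousD e (P Q : mpol F n) :
  homogeneous e P -> homogeneous e Q -> homogeneous e (P + Q).
Proof. exact: rpredD. Qed.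
Lemma homogeneousB e (P Q : mpol F n) :
  homogeneous e P -> homogeneous e Q -> homogeneous e (P - Q).
Proof. exact: rpredB. Qed.
Lemma homogeneousZ e c (P : mpol F n) : homogeneous e P -> homogeneous e (c *: P).
Proof. exact: rpredZ. Qed.
Lemma homogeneous_sum e I (r : seq I) (p : pred I) (f : I -> mpol F n) :
  (forall i, p i -> homogeneous e (f i)) -> homogeneous e (\sum_(i <- r | p i) f i).
Proof. exact: rpred_sum. Qed.
Lemma homogeneousM d e (P Q : mpol F n) :
  homogeneous d P -> homogeneous e Q -> homogeneous (d + e) (P * Q).
Proof. exact: dhomogM. Qed.
Lemma homogeneous_exp d (P : mpol F n) e : homogeneous d P -> homogeneous (d * e) (P ^+ e).
Proof. exact: dhomogMn. Qed.
Lemma homogeneousX i : homogeneous 1 (mX i : mpol F n).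
Proof. by rewrite /homogeneous dhomogX /= mdeg1. Qed.

Definition piece e (P : mpol F n) : mpol F n := pihomog mdeg e P.
Lemma piece_homogeneous e P : homogeneous e (piece e P). Proof. exact: pihomogP. Qed.
Lemma piece_sum P : exists D, P = \sum_(d < D) piece d P.
Proof. by exists (mmeasure mdeg P); apply: pihomog_partitionE. Qed.

Lemma meval_homogeneous e (P : mpol F n) c (v : 'I_n -> F) : homogeneous e P ->
  meval (fun i => c * v i) P = c ^+ e * meval v P.
Proof.
move=> Pe; rewrite !mevalE mulr_sumr big_seq [RHS]big_seq; apply: eq_bigr => m mP.
have <- : mdeg m = e by apply: (homogeneousP Pe); rewrite -mcoeff_msupp.
rewrite mulrCA; congr (_ * _); rewrite mdegE -prodrXr -big_split /=.
by apply: eq_bigr => i _; rewrite exprMn.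
Qed.

Lemma meval0_homogeneous e (P : mpol F n) : homogeneous e P -> (0 < e)%N ->
  meval (fun=> 0) P = 0.
Proof.
move=> Pe e0; have := meval_homogeneous 0 (fun=> 0) Pe.
rewrite expr0n gtn_eqF //= [X in _ = X -> _]mul0r => E; rewrite -[RHS]E.
by apply: meval_eq => i /=; rewrite mul0r.
Qed.

End Homogeneous.
Arguments homogeneous0 {F n}.
Arguments homogeneous1 {F n}.
Arguments homogeneousX {F n}.

Section Surface.
Variables (k : fieldType) (kb : closedFieldType) (iota : {rmorphism k -> kb}).
Variable S : smooth_projective_surface iota.

Local Notation K := (fun_field S).
Local Notation N := (dim_amb S).
Local Notation form := (mpol kb N.+1).
Local Notation pt := 'rV[kb]_N.+1.
Local Notation emb := (fun_emb S).
Local Notation x := (gen_pt S).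
Local Notation gev := (gen_eval emb x).
Implicit Types (p q : pt) (F G H P : form).

HB.instance Definition _ := GRing.RMorphism.copy gev (mmap emb x).
HB.instance Definition _ p := GRing.RMorphism.copy (pt_eval p) (meval (fun i => p 0 i)).

Lemma gevC c : gev (mpolyC _ c) = emb c. Proof. exact: mmapC. Qed.
Lemma gevZ c F : gev (c *: F) = emb c * gev F. Proof. exact: mmapZ. Qed.
Lemma gevX i : gev (mX i) = x i. Proof. by rewrite /gen_eval mmapX mmap1U. Qed.
Lemma ptZ p c F : pt_eval p (c *: F) = c * pt_eval p F. Proof. exact: mevalZ. Qed.
Lemma ptX p i : pt_eval p (mX i) = p 0 i. Proof. exact: mevalXU. Qed.

(** A form of degree e goes to its value times ['X^e], so that the kernel is the homogeneous ideal
    of S and inhomogeneous polynomials need no splitting into pieces. *)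
Definition graded_eval : form -> {poly K} :=
  mmap (polyC \o emb) (fun i => x i *: 'X).
HB.instance Definition _ := GRing.RMorphism.on graded_eval.

Lemma graded_eval_homogeneous e F : homogeneous e F -> graded_eval F = gev F *: 'X^e.
Proof.
move=> Fe; rewrite /graded_eval /gen_eval /mmap scaler_suml big_seq [RHS]big_seq.
apply: eq_bigr => m mF; have <- : mdeg m = e.
  by apply: (homogeneousP Fe); rewrite -mcoeff_msupp.
rewrite /= mul_polyC -scalerA; congr (_ *: _).
rewrite /mmap1; under eq_bigr do rewrite exprZn.
by rewrite scaler_prod mdegE prodrXr.
Qed.

Lemma coef_graded_eval F e : (graded_eval F)`_e = gev (piece e F).
Proof.
have [D] := piece_sum F; set G := (X in _ = X) => FG.
have coefG d : (graded_eval (piece d F))`_e = if e == d then gev (piece e F) else 0.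
  rewrite (graded_eval_homogeneous (piece_homogeneous d F)) coefZ coefXn.
  by case: eqP => [->|]; rewrite ?mulr1 ?mulr0.
rewrite {1}FG rmorph_sum coef_sum; under eq_bigr do rewrite coefG.
have [eD|De] := ltnP e D.
  rewrite (bigD1 (Ordinal eD)) //= eqxx big1 ?addr0 // => i /negPf.
  by rewrite -val_eqE /= eq_sym => ->.
rewrite big1 => [|i _]; last by case: eqP => // E; have := ltn_ord i; rewrite -E ltnNge De.
have -> : piece e F = 0; last by rewrite raddf0.
rewrite {1}FG /piece raddf_sum big1 //= => i _.
apply: (@pihomog_ne0 _ _ mdeg i); last exact: pihomogP.
by apply: contraTneq (ltn_ord i) => ->; rewrite ltnNge De.
Qed.

Definition IS : set form := [set F | graded_eval F = 0].

Lemma IS_ideal : ideal_set IS.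
Proof.
split=> [|a b|a b]; rewrite /IS /= ?rmorph0 //.
  by rewrite rmorphD /= => -> ->; rewrite addr0.
by rewrite rmorphM /= => ->; rewrite mulr0.
Qed.

Lemma IS_homogeneous e F : homogeneous e F -> IS F <-> gev F = 0.
Proof.
move=> Fe; rewrite /IS /= (graded_eval_homogeneous Fe).
split=> [/eqP|->]; last by rewrite scale0r.
by rewrite scaler_eq0 -size_poly_eq0 size_polyXn orbF => /eqP.
Qed.

Lemma IS_piece F e : IS F -> gev (piece e F) = 0.
Proof. by rewrite /IS /= -coef_graded_eval => ->; rewrite coef0. Qed.

Lemma onS_gev e p F : onS p -> homogeneous e F -> gev F = 0 -> pt_eval p F = 0.
Proof. by case=> _; apply. Qed.

Lemma onS_neq0 e p F : onS p -> homogeneous e F -> pt_eval p F != 0 -> gev F != 0.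
Proof. by move=> pS Fe; apply: contraNneq => /(onS_gev pS Fe) ->. Qed.

Lemma onS_coord p : onS p -> exists2 i, p 0 i = 1 & x i != 0.
Proof.
move=> pS; have [[i pi _] _] := pS; exists i => //.
by rewrite -gevX; apply: (onS_neq0 pS (homogeneousX i)); rewrite ptX pi oner_eq0.
Qed.

Lemma IS_spanned G : IS G -> exists2 s : seq (kb * form),
  forall y, y \in s -> poly_in (range iota) y.2 /\ IS y.2 & G = \sum_(y <- s) y.1 *: y.2.
Proof.
move=> GI; have [D GE] := piece_sum G.
have H d : exists2 s : seq (kb * form),
    forall y, y \in s -> poly_in (range iota) y.2 /\ IS y.2 &
    piece d G = \sum_(y <- s) y.1 *: y.2.
  have [m [c [G' [G'h G'0 E]]]] :=
    geom_integral (piece_homogeneous d G) (IS_piece d GI).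
  exists [seq (c i, mpoly.map_mpoly iota (G' i)) | i <- enum 'I_m].
    move=> y /mapP[i _ ->] /=; split.
      by move=> mu; rewrite mcoeff_map_mpoly; exists (mcoeff mu (G' i)).
    have h : homogeneous d (mpoly.map_mpoly iota (G' i)).
      apply: homogeneous_coeff => mu; rewrite mcoeff_map_mpoly fmorph_eq0.
      exact: (homogeneousP (G'h i)).
    apply/(IS_homogeneous h); rewrite -(G'0 i) /gen_eval /gen_eval_k.
    apply: (@mpoly_morphP _ _ _ (mmap emb x \o mpoly.map_mpoly iota)
      (mmap (emb \o iota) x)) => [e|j] /=.
      by rewrite map_mpolyC !mmapC.
    by rewrite map_mpolyX !mmapX !mmap1U.
  by rewrite big_map big_enum.
have {H} [f fP] := choice (fun d => let: ex_intro2 s a b := H d in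
  ex_intro (fun s => (forall y, y \in s -> poly_in (range iota) y.2 /\ IS y.2) /\
     piece d G = \sum_(y <- s) y.1 *: y.2) s (conj a b)).
exists (flatten [seq f (d : 'I_D) | d <- enum 'I_D]).
  by move=> y /flattenP[_ /mapP[d _ ->] yf]; apply: (fP d).1.
rewrite GE big_flatten big_map big_enum; apply: eq_bigr => d _; exact: (fP d).2.
Qed.

(** Proportional coordinate vectors agree because the first nonzero coordinate of each is 1. *)
Lemma onS_point p q : onS p -> onS q ->
  (forall i j, p 0 i * q 0 j = p 0 j * q 0 i) -> p = q.
Proof.
move=> [[i pi pz] _] [[j qj qz] _] H.
have eij : i = j.
  apply/val_inj/eqP; rewrite eqn_leq; apply/andP; split; rewrite leqNgt; apply/negP => lt.
    by have := H i j; rewrite pi qj (pz _ lt) mul1r mul0r => /eqP; rewrite oner_eq0.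
  by have := H i j; rewrite pi qj (qz _ lt) mulr0 mulr1 => /eqP; rewrite oner_eq0.
apply/rowP => l; have := H i l; rewrite pi eij qj mul1r mulr1 => ->.
by [].
Qed.

Local Notation OSm p := (local_max emb x p).

Section Local.
Variable p : pt.
Hypothesis pS : onS p.

Lemma OS_frac e F G : homogeneous e F -> homogeneous e G -> pt_eval p G != 0 ->
  OS p (gev F / gev G).
Proof. by move=> Fe Ge G0; exists e, F, G. Qed.

Lemma OS_emb c : OS p (emb c).
Proof.
exists 0%N, (mpolyC _ c), 1; split; rewrite ?rmorph1 ?oner_eq0 ?gevC ?divr1 //.
  exact: homogeneousC.
exact: homogeneous1.
Qed.

Lemma OS0 : OS p 0. Proof. by rewrite -(rmorph0 emb); apply: OS_emb. Qed.
Lemma OS1 : OS p 1. Proof. by rewrite -(rmorph1 emb); apply: OS_emb. Qed.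

Lemma OSD a b : OS p a -> OS p b -> OS p (a + b).
Proof.
move=> [e [F [G [Fe Ge G0 ->]]]] [e' [F' [G' [Fe' Ge' G0' ->]]]].
exists (e + e')%N, (F * G' + F' * G), (G * G'); split.
- apply: homogeneousD; first exact: homogeneousM.
  by rewrite addnC; apply: homogeneousM.
- exact: homogeneousM.
- by rewrite rmorphM mulf_neq0.
- by rewrite rmorphD !rmorphM addf_div ?(onS_neq0 pS Ge) ?(onS_neq0 pS Ge').
Qed.

Lemma OSM a b : OS p a -> OS p b -> OS p (a * b).
Proof.
move=> [e [F [G [Fe Ge G0 ->]]]] [e' [F' [G' [Fe' Ge' G0' ->]]]].
exists (e + e')%N, (F * F'), (G * G'); split; try exact: homogeneousM.
  by rewrite rmorphM mulf_neq0.
by rewrite !rmorphM mulf_div.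
Qed.

Lemma OSN a : OS p a -> OS p (- a).
Proof.
by rewrite -mulN1r -(rmorph1 emb) -rmorphN => ?; apply: OSM => //; apply: OS_emb.
Qed.
Lemma OSB a b : OS p a -> OS p b -> OS p (a - b).
Proof. by move=> ? ?; apply: OSD => //; apply: OSN. Qed.
Lemma OSX a e : OS p a -> OS p (a ^+ e).
Proof. by move=> Oa; elim: e => [|e IH]; rewrite ?exprS; [apply: OS1 | apply: OSM]. Qed.
Lemma OS_sum I (r : seq I) (P : pred I) (f : I -> K) :
  (forall i, P i -> OS p (f i)) -> OS p (\sum_(i <- r | P i) f i).
Proof. by move=> H; apply: big_ind => //; [apply: OS0 | apply: OSD]. Qed.
Lemma OS_prod I (r : seq I) (P : pred I) (f : I -> K) :
  (forall i, P i -> OS p (f i)) -> OS p (\prod_(i <- r | P i) f i).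
Proof. by move=> H; apply: big_ind => //; [apply: OS1 | apply: OSM]. Qed.

Lemma OSunit_OS a : OSunit p a -> OS p a. Proof. by case. Qed.
Lemma OSunit_neq0 a : OSunit p a -> a != 0. Proof. by case. Qed.
Lemma OSunitV a : OSunit p a -> OSunit p a^-1.
Proof. by case=> a0 Oa Oa'; split; rewrite ?invr_eq0 ?invrK. Qed.
Lemma OSunitM a b : OSunit p a -> OSunit p b -> OSunit p (a * b).
Proof.
move=> [a0 Oa Oa'] [b0 Ob Ob']; split; first by rewrite mulf_neq0.
  exact: OSM.
by rewrite invfM; apply: OSM.
Qed.
Lemma OSunit_div a b : OSunit p a -> OSunit p b -> OSunit p (a / b).
Proof. by move=> ? ?; apply: OSunitM => //; apply: OSunitV. Qed.
Lemma OSunit1 : OSunit p 1.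
Proof. by split; rewrite ?invr1 ?oner_eq0 //; apply: OS1. Qed.
Lemma OSunitX a e : OSunit p a -> OSunit p (a ^+ e).
Proof. by move=> ua; elim: e => [|e IH]; rewrite ?exprS; [apply: OSunit1 | apply: OSunitM]. Qed.
Lemma OSunit_emb c : c != 0 -> OSunit p (emb c).
Proof. by split; rewrite ?fmorph_eq0 -?fmorphV //; apply: OS_emb. Qed.
Lemma OSunit_frac e F G : homogeneous e F -> homogeneous e G -> pt_eval p F != 0 ->
  pt_eval p G != 0 -> OSunit p (gev F / gev G).
Proof.
move=> Fe Ge F0 G0; split; last by rewrite invf_div; apply: (OS_frac Ge Fe).
  by rewrite mulf_neq0 ?invr_eq0 //; apply: (onS_neq0 pS); eassumption.
exact: (OS_frac Fe Ge).
Qed.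

(** Equality with another fraction, here one representing the inverse, is an equation between forms
    that holds on S and hence at [p]. *)
Lemma OSm_frac e F G : homogeneous e F -> homogeneous e G -> pt_eval p G != 0 ->
  OSm p (gev F / gev G) <-> pt_eval p F = 0.
Proof.
move=> Fe Ge G0; split=> [[_ nu]|F0].
  by apply/eqP/negPn/negP => F0; apply: nu; apply: (OSunit_frac Fe Ge).
split; first exact: (OS_frac Fe Ge).
move=> [z0 _ [e' [F' [G' [Fe' Ge' G0' E]]]]].
have gG : gev G != 0 := onS_neq0 pS Ge G0.
have gG' : gev G' != 0 := onS_neq0 pS Ge' G0'.
have gF : gev F != 0 by move: z0; rewrite mulf_eq0 negb_or => /andP[].
rewrite invf_div in E; move/eqP: E; rewrite eqr_div // -!rmorphM -subr_eq0 -rmorphB => /eqP E.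
have h : homogeneous (e + e') (G * G' - F' * F).
  by apply: homogeneousB; [|rewrite addnC]; apply: homogeneousM.
have := onS_gev pS h E; rewrite rmorphB !rmorphM /= F0 mulr0 subr0 => /eqP.
by rewrite mulf_eq0 (negPf G0) (negPf G0').
Qed.

Lemma OSm_OS a : OSm p a -> OS p a. Proof. by case. Qed.

Lemma OS_unit_or_max a : OS p a -> OSunit p a \/ OSm p a.
Proof. by move=> Oa; have [|n] := pselect (OSunit p a); [left | right]. Qed.

Lemma OSm_not_unit a : OSm p a -> ~ OSunit p a. Proof. by case. Qed.

Lemma OSm0 : OSm p 0.
Proof. by split; [apply: OS0 | case; rewrite eqxx]. Qed.

Lemma OSmD a b : OSm p a -> OSm p b -> OSm p (a + b).
Proof.
move=> [Oa na] [Ob nb].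
case: (Oa) na => e [F [G [Fe Ge G0 ->]]] na; case: (Ob) nb => e' [F' [G' [Fe' Ge' G0' ->]]] nb.
have /(OSm_frac Fe Ge G0) F0 : OSm p (gev F / gev G) by split=> //; apply: (OS_frac Fe Ge).
have /(OSm_frac Fe' Ge' G0') F0' : OSm p (gev F' / gev G').
  by split=> //; apply: (OS_frac Fe' Ge').
rewrite addf_div ?(onS_neq0 pS Ge) ?(onS_neq0 pS Ge') // -!rmorphM -rmorphD.
apply/(@OSm_frac (e + e')).
- by apply: homogeneousD; [|rewrite addnC]; apply: homogeneousM.
- exact: homogeneousM.
- by rewrite rmorphM mulf_neq0.
- by rewrite rmorphD !rmorphM /= F0 F0' !mul0r addr0.
Qed.

Lemma OSmM a b : OS p a -> OSm p b -> OSm p (a * b).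
Proof.
move=> Oa [Ob nb]; split; first exact: OSM.
move=> [ab0 _ Oab]; apply: nb; split=> //.
  by move: ab0; rewrite mulf_eq0 negb_or => /andP[].
have a0 : a != 0 by move: ab0; rewrite mulf_eq0 negb_or => /andP[].
have -> : b^-1 = a * (a * b)^-1 by rewrite invfM mulrA mulfV // mul1r.
exact: OSM.
Qed.

Lemma OSmN a : OSm p a -> OSm p (- a).
Proof.
by rewrite -mulN1r => h; apply: OSmM => //; apply: OSN; apply: OS1.
Qed.

Lemma OSmB a b : OSm p a -> OSm p b -> OSm p (a - b).
Proof. by move=> ? ?; apply: OSmD => //; apply: OSmN. Qed.

Lemma OSm_sum I (r : seq I) (P : pred I) (f : I -> K) :
  (forall i, P i -> OSm p (f i)) -> OSm p (\sum_(i <- r | P i) f i).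
Proof. by move=> H; apply: big_ind => //; [apply: OSm0 | apply: OSmD]. Qed.

Lemma OSunitD u a : OSunit p u -> OSm p a -> OSunit p (u + a).
Proof.
move=> uu ma; have /OS_unit_or_max [//|mua] := OSD (OSunit_OS uu) (OSm_OS ma).
case: (OSm_not_unit (OSmB mua ma)).
by rewrite addrK.
Qed.

(** The residue field is [kb]: the value is read off from a representing fraction. *)
Lemma OS_value a : OS p a -> exists c, OSm p (a - emb c).
Proof.
move=> [e [F [G [Fe Ge G0 ->]]]]; exists (pt_eval p F / pt_eval p G).
have gG : gev G != 0 := onS_neq0 pS Ge G0.
have -> : gev F / gev G - emb (pt_eval p F / pt_eval p G) =
    gev (F - (pt_eval p F / pt_eval p G) *: G) / gev G.
  by rewrite rmorphB /= gevZ mulrBl mulfK.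
apply/(OSm_frac _ Ge G0); first by apply: homogeneousB => //; apply: homogeneousZ.
by rewrite rmorphB /= ptZ divfK // subrr.
Qed.

Lemma OSm_emb c : OSm p (emb c) -> c = 0.
Proof.
by move=> m; apply/eqP/negPn/negP => c0; apply: (OSm_not_unit m); apply: OSunit_emb.
Qed.

Lemma OS_value_unit a c : OS p a -> OSm p (a - emb c) -> c != 0 -> OSunit p a.
Proof.
move=> Oa ma c0; rewrite -(subrK (emb c) a) addrC.
by apply: OSunitD => //; apply: OSunit_emb.
Qed.

End Local.
End Surface.

(** * Noetherianity, quasi-compactness and global functions *)

Section GlobalFunctions.
Variables (k : fieldType) (kb : closedFieldType) (iota : {rmorphism k -> kb}).
Variable S : smooth_projective_surface iota.

Local Notation K := (fun_field S).
Local Notation N := (dim_amb S).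
Local Notation form := (mpol kb N.+1).
Local Notation pt := 'rV[kb]_N.+1.
Local Notation emb := (fun_emb S).
Local Notation x := (gen_pt S).
Local Notation gev := (gen_eval emb x).
Local Notation OSm p := (local_max emb x p).
Local Notation Div := (divisor S).
Implicit Types (p q : pt) (F G H P : form) (f : K).

Definition dehom i : form -> K := mmap emb (fun j => x j / x i).
HB.instance Definition _ i := GRing.RMorphism.on (dehom i).

Lemma dehom_homogeneous i e F : homogeneous e F -> x i != 0 ->
  dehom i F = gev F / x i ^+ e.
Proof.
move=> Fe xi0; rewrite /dehom /gen_eval /mmap mulr_suml big_seq [RHS]big_seq.
apply: eq_bigr => m mF; have <- : mdeg m = e.
  by apply: (homogeneousP Fe); rewrite -mcoeff_msupp.
rewrite -mulrA; congr (_ * _); rewrite /mmap1 mdegE -prodrXr -prodf_div.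
by apply: eq_bigr => j _; rewrite expr_div_n.
Qed.

Lemma dehom_OS i p F : onS p -> p 0 i = 1 -> OS p (dehom i F).
Proof.
move=> pS pi; rewrite /dehom /mmap; apply: (OS_sum pS) => m _.
apply: OSM; first exact: OS_emb.
apply: OS_prod => j _; apply: OSX; rewrite -!gevX.
by apply: (@OS_frac _ _ _ _ _ 1); rewrite ?ptX ?pi ?oner_eq0 //; apply: homogeneousX.
Qed.

Definition OS_ideal p (J : set K) : Prop :=
  [/\ J 0, forall a b, J a -> J b -> J (a + b), forall a b, OS p a -> J b -> J (a * b)
    & J `<=` OS p].

(** Every element of the local ring is a unit times a dehomogenized form, so an ideal is determined
    by its inverse image in the polynomial ring. *)
Lemma OS_acc p (J : nat -> set K) : onS p -> (forall i, OS_ideal p (J i)) ->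
  (forall i, J i `<=` J i.+1) -> exists i, J i.+1 `<=` J i.
Proof.
move=> pS Jid Jinc; have [i pi xi] := onS_coord pS.
have [||l lE] := @mpoly_acc kb N.+1 (fun l => [set F | J l (dehom i F)]).
- move=> l; have [J0 JD JM _] := Jid l; split=> /= [|a b|a b].
  + by rewrite rmorph0.
  + by rewrite rmorphD; apply: JD.
  + by rewrite rmorphM => h; apply: JM => //; apply: dehom_OS.
- by move=> l F /Jinc.
exists l => z Jz; have [_ _ JM JO] := Jid l.+1.
have [e [F [G [Fe Ge G0 zE]]]] := JO _ Jz.
have gG : gev G != 0 := onS_neq0 pS Ge G0.
have pXi : pt_eval p (mX i ^+ e) != 0 by rewrite rmorphXn /= ptX pi expr1n oner_eq0.
have Xie : homogeneous e (mX i ^+ e : form).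
  by rewrite -{1}[e]mul1n; apply: homogeneous_exp; apply: homogeneousX.
have E : dehom i F = gev G / gev (mX i ^+ e) * z.
  rewrite (dehom_homogeneous Fe xi) zE rmorphXn /= gevX; field.
  by rewrite [X in X && _]gG expf_neq0.
have JF : J l.+1 (dehom i F) by rewrite E; apply: JM => //; apply: (OS_frac Ge Xie).
have -> : z = gev (mX i ^+ e) / gev G * dehom i F.
  rewrite E; field; rewrite gG rmorphXn /= gevX expf_neq0 //.
have [_ _ JM' _] := Jid l; apply: JM'; first exact: (OS_frac Xie Ge).
exact: lE.
Qed.

(** Adding points that are not yet covered, again and again, would give a strictly increasing chain
    of ideals: the polynomials vanishing on what is still uncovered. *)
Lemma finite_cover (g : pt -> form) : (forall p, onS p -> pt_eval p (g p) != 0) ->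
  exists2 s : seq pt, (forall p, p \in s -> onS p) &
    forall q, onS q -> exists2 p, p \in s & pt_eval q (g p) != 0.
Proof.
move=> gP; apply: contrapT => N0.
have H (s : {s : seq pt | forall p, p \in s -> onS p}) :
    exists q, onS q /\ forall p, p \in sval s -> pt_eval q (g p) = 0.
  case: s => s sP /=; apply: contrapT => N1; apply: N0; exists s => // q qS.
  apply: contrapT => N2; apply: N1; exists q; split=> // p ps.
  by apply/eqP/negPn/negP => h; apply: N2; exists p.
have [h hP] := choice H.
have nextP (s : {s : seq pt | forall p, p \in s -> onS p}) :
    forall p, p \in h s :: sval s -> onS p.
  by move=> p; rewrite inE => /orP[/eqP ->|/(svalP s)//]; case: (hP s).
pose next s := exist (fun s : seq pt => forall p, p \in s -> onS p) _ (nextP s).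
have nil0 : forall p : pt, p \in [::] -> onS p by [].
pose c n := iter n next (exist _ [::] nil0).
have [|n F|n nE] := @mpoly_acc kb N.+1 (fun n => [set F | forall q, onS q ->
    (forall p, p \in sval (c n) -> pt_eval q (g p) = 0) -> pt_eval q F = 0]).
- move=> n; split=> [q _ _|a b Ha Hb q qS Hq|a b Hb q qS Hq] /=; first by rewrite rmorph0.
    by rewrite rmorphD /= Ha // Hb // addr0.
  by rewrite rmorphM /= Hb // mulr0.
- move=> /= HF q qS Hq; apply: HF => // p ps; apply: Hq.
  by rewrite inE ps orbT.
have [qS qP] := hP (c n).
have /eqP := nE (g (h (c n))) (fun q _ Hq => Hq _ (mem_head _ _)) _ qS qP.
by rewrite (negPf (gP _ qS)).
Qed.

(* A common zero of an ideal containing the equations of the cone is either the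
   vertex or proportional to a point of the surface. *)
Lemma surface_nullstellensatz (I : set form) (G : form) g :
  ideal_set I -> @IS _ _ _ S `<=` I -> homogeneous g G -> (0 < g)%N ->
  (forall p, onS p -> pt_eval p G != 0 -> exists e F, [/\ I F, homogeneous e F & pt_eval p F != 0]) ->
  exists n, I (G ^+ n).
Proof.
move=> Iid ISI Gg g0 HI; apply: nullstellensatz => // c cI.
have [c0|] := pselect (forall i, c i = 0).
  by rewrite -(meval0_homogeneous Gg g0); apply: meval_eq.
move=> /existsNP [j0 cj0].
have [j [cj jmin]] : exists j : 'I_N.+1, c j != 0 /\ forall i : 'I_N.+1, (i < j)%N -> c i = 0.
  have E : exists n, [exists i : 'I_N.+1, (i == n :> nat) && (c i != 0)].
    by exists j0; apply/existsP; exists j0; rewrite eqxx; apply/eqP.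
  case: (ex_minnP E) => n /existsP[j /andP[/eqP <- cj]] nmin; exists j; split=> // i ij.
  apply/eqP/negPn/negP => ci; have : (j <= i)%N.
    by apply: nmin; apply/existsP; exists i; rewrite eqxx.
  by rewrite leqNgt ij.
pose p : pt := \row_i (c i / c j).
have pF e F : homogeneous e F -> pt_eval p F = (c j)^-1 ^+ e * meval c F.
  move=> Fe; rewrite -(meval_homogeneous _ _ Fe) /pt_eval; apply: meval_eq => i.
  by rewrite mxE mulrC.
have pS : onS p.
  split; first by exists j => [|i ij]; rewrite mxE ?mulfV // jmin // mul0r.
  move=> e F Fe F0; rewrite (pF e) // cI ?mulr0 //; apply: ISI.
  exact/(IS_homogeneous Fe).
apply/eqP/negPn/negP => cG.
have [|e [F [IF Fe]]] := HI p pS.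
  by rewrite (pF g) // mulf_neq0 // expf_neq0 // invr_eq0.
by rewrite (pF e) // cI // mulr0 eqxx.
Qed.

(** The denominators of [f] form an ideal whose zeros on S lie where [G] vanishes, so a power of [G]
    is among them. *)
Lemma regular_on_basic_open f g G : homogeneous g G -> (0 < g)%N ->
  (forall p, onS p -> pt_eval p G != 0 -> OS p f) ->
  exists n F, homogeneous (g * n) F /\ f * gev G ^+ n = gev F.
Proof.
move=> Gg g0 Gf.
pose I : set form := [set H | exists P, f%:P * graded_eval H = graded_eval P].
have Iid : ideal_set I.
  split=> /= [|a b [P aP] [Q bQ]|a b [P bP]].
  - by exists 0; rewrite !rmorph0 mulr0.
  - by exists (P + Q); rewrite !rmorphD mulrDr /= aP bQ.
  - by exists (a * P); rewrite !rmorphM mulrCA /= bP.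
have ISI : @IS _ _ _ S `<=` I by move=> H; rewrite /IS /= => HE; exists 0; rewrite HE rmorph0 mulr0.
have [|n [P nP]] := surface_nullstellensatz Iid ISI Gg g0.
  move=> p pS /(Gf p pS) [e [F [G' [Fe Ge G0 fE]]]]; exists e, G'; split=> //.
  exists F; rewrite (graded_eval_homogeneous Ge) (graded_eval_homogeneous Fe) mul_polyC.
  by rewrite scalerA fE divfK //; apply: (onS_neq0 pS Ge).
exists n, (piece (g * n) P); split; first exact: piece_homogeneous.
rewrite -coef_graded_eval -nP (graded_eval_homogeneous (homogeneous_exp n Gg)).
by rewrite coefCM coefZ coefXn eqxx mulr1 rmorphXn.
Qed.

(** [f] is an eigenvalue of a matrix over [kb], whose characteristic polynomial splits over [kb]. *)
Lemma scalar_of_finite_action (I : finType) (a : I -> I -> kb) (v : I -> K) f :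
  (exists i, v i != 0) -> (forall i, f * v i = \sum_j emb (a i j) * v j) ->
  exists c, f = emb c.
Proof.
move=> [i0 vi0] H; pose n := #|I|.
pose A : 'M[kb]_n := \matrix_(i, j) a (enum_val j) (enum_val i).
pose w : 'rV[K]_n := \row_i v (enum_val i).
have : eigenvalue (map_mx emb A) f.
  apply/eigenvalueP; exists w.
    apply/rowP => j; rewrite !mxE H (reindex _ (onW_bij _ (enum_val_bij I))) /=.
    by apply: eq_bigr => i _; rewrite !mxE mulrC.
  by apply/eqP => /rowP/(_ (enum_rank i0)); rewrite !mxE enum_rankK => /eqP; rewrite (negPf vi0).
rewrite eigenvalue_root_char -map_char_poly.
have [rs ->] := closed_field_poly_normal (char_poly A).
rewrite (monicP (char_poly_monic A)) scale1r rmorph_prod /=.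
under eq_bigr do rewrite rmorphB /= map_polyX map_polyC.
rewrite -(big_map emb predT (fun z => 'X - z%:P)) root_prod_XsubC => /mapP[c _ ->].
by exists c.
Qed.

Lemma mpoly_bounded_sum D F : homogeneous D F ->
  F = \sum_(m : bmultinom N.+1 D.+1) mcoeff m F *: mpolyX kb m.
Proof.
move=> FD; have [->|F0] := eqVneq F 0.
  by rewrite big1 // => m _; rewrite mcoeff0 scale0r.
apply: mpolywE; rewrite -mlead_deg //.
by rewrite (homogeneousP FD) // mleadc_eq0.
Qed.

Lemma homogeneous_mpolyX m : homogeneous (mdeg m) (mpolyX kb m : form).
Proof. by rewrite /homogeneous dhomogX. Qed.

Lemma coord_neq0 : exists i, x i != 0. Proof. exact: gen_pt_neq0. Qed.

(** Multiplication by [f] preserves the values of forms of one suitable degree, a nonzero space of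
    finite dimension over [kb]. *)
Theorem global_function_const f : (forall q, onS q -> OS q f) -> exists c, f = emb c.
Proof.
move=> fO.
have H i : exists n, exists F, homogeneous n F /\ f * x i ^+ n = gev F.
  have [n [F [Fn E]]] := regular_on_basic_open (homogeneousX i) (ltn0Sn 0)
     (fun p pS _ => fO p pS).
  by exists n, F; rewrite mul1n gevX in Fn E.
have [n /choice[F FP]] := choice H.
(* By pigeonhole a monomial of degree [D] contains some coordinate [i] to the power [n i], which
   absorbs the denominator of [f]. *)
pose D := (\sum_i n i)%N.
have mono (m : multinom N.+1) : mdeg m = D ->
    exists Q, homogeneous D Q /\ f * gev (mpolyX kb m) = gev Q.
  move=> mD; have [i ni] : exists i, (n i <= m i)%N.
    apply: contrapT => /forallNP h; have : (mdeg m < D)%N; last by rewrite mD ltnn.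
    rewrite mdegE /D (bigD1 ord0) // [X in (_ < X)%N](bigD1 ord0) //= -addSn leq_add //.
      by rewrite ltnNge; apply/negP.
    by apply: leq_sum => j _; apply: ltnW; rewrite ltnNge; apply/negP.
  have [Fh FE] := FP i.
  pose d := mnm_muln (mnm1 i) (n i).
  have dm : mnm_add (mnm_sub m d) d = m.
    apply: submK; apply/mnm_lepP => j; rewrite /d mulmnE mnm1E.
    by case: eqP => [<-|]; rewrite ?mul1n ?mul0n.
  exists (mpolyX kb (mnm_sub m d) * F i); split.
    have -> : D = (mdeg (mnm_sub m d) + n i)%N.
      by rewrite -mD -{1}dm mdegD /d mdegMn mdeg1 mul1n.
    by apply: homogeneousM => //; apply: homogeneous_mpolyX.
  rewrite -{1}dm mpolyXD !rmorphM /= -FE -mpolyXn rmorphXn /= gevX; ring.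
(* The index type contains all monomials of degree at most [D]; those of smaller degree are given
   the value 0. *)
pose Q (m : bmultinom N.+1 D.+1) : form :=
  if pselect (mdeg m = D) is left h then projT1 (cid (mono m h)) else 0.
pose v (m : bmultinom N.+1 D.+1) := if mdeg m == D then gev (mpolyX kb m) else 0.
apply: (@scalar_of_finite_action _ (fun i j : bmultinom N.+1 D.+1 => mcoeff j (Q i)) v).
  have [i xi] := coord_neq0.
  have dl : (mdeg (mnm_muln (mnm1 i) D) < D.+1)%N by rewrite mdegMn mdeg1 mul1n.
  exists (BMultinom dl); rewrite /v /= mdegMn mdeg1 mul1n eqxx -mpolyXn rmorphXn /= gevX.
  by rewrite expf_neq0.
move=> m; rewrite /v /Q; case: pselect => [mD|mD].
  case: (cid _) => P [PD PE] /=; rewrite mD eqxx PE {1}(mpoly_bounded_sum PD) rmorph_sum /=.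
  apply: eq_bigr => j _; rewrite gevZ; case: (eqVneq (mdeg j) D) => // jD.
  suff -> : mcoeff j P = 0 by rewrite rmorph0 !mul0r.
  by apply: contra_neq_eq jD => /(homogeneousP PD).
rewrite (introF eqP mD) mulr0 big1 // => j _.
by rewrite mcoeff0 rmorph0 mul0r.
Qed.

End GlobalFunctions.

(** * Effective divisors *)

Section Divisors.
Variables (k : fieldType) (kb : closedFieldType) (iota : {rmorphism k -> kb}).
Variable S : smooth_projective_surface iota.

Local Notation K := (fun_field S).
Local Notation N := (dim_amb S).
Local Notation form := (mpol kb N.+1).
Local Notation pt := 'rV[kb]_N.+1.
Local Notation emb := (fun_emb S).
Local Notation x := (gen_pt S).
Local Notation gev := (gen_eval emb x).
Local Notation OSm p := (local_max emb x p).
Local Notation Div := (divisor S).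
Implicit Types (p q : pt) (F G H A : form) (C D E : Div).

Lemma exists_unit_coord p : onS p -> exists i, p 0 i = 1 /\ x i != 0.
Proof. by case/onS_coord => i; exists i. Qed.

Lemma cartier_neq0 D p : cartier D -> onS p -> D p != 0.
Proof. by move=> DC pS; case: (DC p pS). Qed.

Lemma cartier_local D p : cartier D -> onS p -> exists e g,
  [/\ homogeneous e g, (0 < e)%N, pt_eval p g != 0 &
    forall q, onS q -> pt_eval q g != 0 -> OSunit q (D p / D q)].
Proof.
move=> DC pS; have [_ [e [g [ge gp gq]]]] := DC p pS.
have [i [pi _]] := exists_unit_coord pS.
exists (e + 1)%N, (g * mX i); split.
- by apply: homogeneousM => //; apply: homogeneousX.
- by rewrite addn1.
- by rewrite rmorphM /= ptX pi mulr1.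
- move=> q qS; rewrite rmorphM mulf_eq0 negb_or => /andP[gq0 _]; exact: gq.
Qed.

Lemma cartier_mul D E : cartier D -> cartier E -> cartier (div_add D E).
Proof.
move=> DC EC p pS; split; first by rewrite mulf_neq0 ?cartier_neq0.
have [e [g [ge _ gp gq]]] := cartier_local DC pS.
have [e' [g' [ge' _ gp' gq']]] := cartier_local EC pS.
exists (e + e')%N, (g * g'); split; first exact: homogeneousM.
  by rewrite rmorphM mulf_neq0.
move=> q qS; rewrite rmorphM mulf_eq0 negb_or => /andP[g0 g0'].
by rewrite /div_add -mulf_div; apply: OSunitM; [apply: gq | apply: gq'].
Qed.

Lemma cartier_inv D : cartier D -> cartier (div_opp D).
Proof.
move=> DC p pS; split; first by rewrite invr_eq0 cartier_neq0.
have [e [g [ge _ gp gq]]] := cartier_local DC pS.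
exists e, g; split=> // q qS gq0; rewrite /div_opp invrK mulrC -invf_div.
by apply: OSunitV; apply: gq.
Qed.

Lemma cartier_const (f : K) : f != 0 -> cartier (fun=> f : K).
Proof.
move=> f0 p pS; split=> //; exists 0%N, 1; split.
- exact: homogeneous1.
- by rewrite rmorph1 oner_eq0.
- by move=> q qS _; rewrite mulfV //; apply: OSunit1.
Qed.

Lemma cartier_scale f D : f != 0 -> cartier D -> cartier (fun p => f * D p).
Proof. by move=> f0 DC; apply: (cartier_mul (cartier_const f0) DC). Qed.

Lemma cartier_prod m (C : 'I_m -> Div) : (forall i, cartier (C i)) ->
  cartier (fun p => \prod_i C i p).
Proof.
elim: m C => [|m IH] C CC.
  have -> : (fun p => \prod_i C i p) = (fun=> 1 : K).
    by apply/funext => p; rewrite big_ord0.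
  exact/cartier_const/oner_neq0.
have -> : (fun p => \prod_i C i p) = div_add (C ord0) (fun p => \prod_i C (lift ord0 i) p).
  by apply/funext => p; rewrite big_ord_recl.
by apply: cartier_mul => //; apply: IH.
Qed.

Lemma cartier_muln m D : cartier D -> cartier (div_muln m D).
Proof.
move=> DC; have -> : div_muln m D = fun p => \prod_(i < m) D p.
  by apply/funext => p; rewrite prodr_const card_ord.
exact: cartier_prod.
Qed.

Lemma div_eq_refl D : cartier D -> div_eq D D.
Proof. by move=> DC p pS; rewrite mulfV ?cartier_neq0 //; apply: OSunit1. Qed.

Lemma div_eq_sym D E : div_eq D E -> div_eq E D.
Proof. by move=> DE p pS; rewrite -invf_div; apply/OSunitV/DE. Qed.

Lemma div_eq_trans D E C : cartier E -> div_eq D E -> div_eq E C -> div_eq D C.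
Proof.
move=> EC DE EC' p pS; have := OSunitM (DE p pS) (EC' p pS).
by rewrite mulrA divfK ?cartier_neq0.
Qed.

Lemma lin_equiv_div_eq D E : div_eq D E -> lin_equiv D E.
Proof. by move=> DE; exists 1; rewrite ?oner_eq0 // => p pS; rewrite mul1r; apply: DE. Qed.

(** Polynomials whose dehomogenizations are sections of the ideal sheaf O(-D). *)
Definition vanishing D : set form :=
  [set F | forall q i, onS q -> q 0 i = 1 -> OS q (dehom i F / D q)].

Lemma vanishing_ideal D : ideal_set (vanishing D).
Proof.
split=> [q i qS qi|a b Ha Hb q i qS qi|a b Hb q i qS qi] /=.
- by rewrite rmorph0 mul0r; apply: OS0.
- by rewrite rmorphD mulrDl; apply: (OSD qS); [apply: Ha | apply: Hb].
- by rewrite rmorphM -mulrA; apply: OSM; [apply: dehom_OS | apply: Hb].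
Qed.

Definition generates D p A : Prop :=
  forall i, p 0 i = 1 -> OSunit p (dehom i A / D p).

(** After a twist, the ideal sheaf of [D] is generated by forms. The local equation [a / b] at [p]
    may have poles relative to [D] elsewhere; a power of a form [gp] nonvanishing at [p] removes
    them, with one exponent for all members of a finite cover. *)
Lemma exists_generator D p : cartier D -> effective D -> onS p ->
  exists e A, [/\ homogeneous e A, vanishing D A & generates D p A].
Proof.
move=> DC DE pS.
have [e0 [a [b [ae be b0 DpE]]]] := DE p pS.
have /choice [gg ggP] : forall q, exists eg : nat * form, onS q ->
    [/\ homogeneous eg.1 eg.2, (0 < eg.1)%N, pt_eval q eg.2 != 0 &
      forall q', onS q' -> pt_eval q' eg.2 != 0 -> OSunit q' (D q / D q')].
  move=> q; have [qS|nq] := pselect (onS q); last by exists (0%N, 0).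
  by have [e [g [? ? ? ?]]] := cartier_local DC qS; exists (e, g).
have [s sS scov] := @finite_cover _ _ _ S (fun q => (gg q).2) (fun q qS => let: And4 _ _ h _ := ggP q qS in h).
pose gp := (gg p).2; pose dp := (gg p).1.
have [gph dp0 gpp gpD] := ggP p pS.
have /choice [nF nFP] : forall q, exists nF : nat * form, q \in s ->
    homogeneous (((gg q).1 + dp) * nF.1) nF.2 /\
    D p / D q * gev ((gg q).2 * gp) ^+ nF.1 = gev nF.2.
  move=> q; have [qs|] := boolP (q \in s); last by exists (0%N, 0).
  have [gqh dq0 gqq gqD] := ggP q (sS q qs).
  have := @regular_on_basic_open _ _ _ S (D p / D q) ((gg q).1 + dp) ((gg q).2 * gp).
  case=> [||q' q'S|n [F [Fn FE]]]; last by exists (n, F).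
  - exact: homogeneousM.
  - by rewrite addn_gt0 dq0.
  rewrite rmorphM mulf_eq0 negb_or => /andP[g1 g2]; apply: OSunit_OS.
  have := OSunit_div (gpD q' q'S g2) (gqD q' q'S g1).
  rewrite invf_div mulrA divfK ?cartier_neq0 //.
pose n := (\max_(q <- s) (nF q).1)%N.
pose A := gp ^+ n * a.
have Ah : homogeneous (dp * n + e0) A by apply: homogeneousM => //; apply: homogeneous_exp.
have gevb0 : gev b != 0 := onS_neq0 pS be b0.
have gevaE : gev a = D p * gev b by rewrite DpE divfK.
exists (dp * n + e0)%N, A; split=> //.
  move=> q' i q'S q'i.
  have xi : x i != 0 by rewrite -gevX; apply: (onS_neq0 q'S (homogeneousX i)); rewrite ptX q'i oner_eq0.
  have [q qs gqq'] := scov _ q'S; have qS := sS q qs.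
  have [gqh dq0 gqq gqD] := ggP q qS; have [Fh FE] := nFP q qs.
  have len : ((nF q).1 <= n)%N by apply: leq_bigmax_seq.
  rewrite (dehom_homogeneous Ah xi) -mulrA.
  set m := (nF q).1 in len FE Fh; set Fq := (nF q).2 in Fh FE.
  have Dq'0 : D q' != 0 by rewrite cartier_neq0.
  have Dq0 : D q != 0 by rewrite cartier_neq0.
  have gq0 : gev (gg q).2 != 0 := onS_neq0 q'S gqh gqq'.
  have gp0 : gev gp != 0 := onS_neq0 pS gph gpp.
  have -> : gev A * ((x i ^+ (dp * n + e0))^-1 / D q') =
     (gev (Fq * gp ^+ (n - m) * b) / gev ((gg q).2 ^+ m * mX i ^+ (dp * n + e0))) *
     (D q / D q').
    have Egp : gev gp ^+ n = gev gp ^+ (n - m) * gev gp ^+ m by rewrite -exprD subnK.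
    rewrite /A !rmorphM !rmorphXn /= gevX gevaE -FE rmorphM /= exprMn Egp.
    have : x i ^+ (dp * n + e0) != 0 by rewrite expf_neq0.
    have : gev (gg q).2 ^+ m != 0 by rewrite expf_neq0.
    move: (x i ^+ _) (gev (gg q).2 ^+ m) (gev gp ^+ m) (gev gp ^+ _) => X1 X2 X3 X4 X20 X10.
    by field; rewrite X10 X20 Dq'0 Dq0.
  apply: OSM; last exact/OSunit_OS/gqD.
  apply: (@OS_frac _ _ _ _ _ ((gg q).1 * m + (dp * n + e0))).
  - have -> : ((gg q).1 * m + (dp * n + e0) = ((gg q).1 + dp) * m + dp * (n - m) + e0)%N.
      have En : n = (n - m + m)%N by rewrite subnK.
      by rewrite {1}En mulnDr mulnDl -!addnA; congr (_ + _)%N; rewrite addnCA.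
    by do 2?[apply: homogeneousM => //]; apply: homogeneous_exp.
  - apply: homogeneousM; first exact: homogeneous_exp.
    by rewrite -[X in homogeneous X _]mul1n; apply: homogeneous_exp; apply: homogeneousX.
  - by rewrite rmorphM !rmorphXn /= ptX q'i expr1n mulr1 expf_neq0.
move=> i pi.
have xi : x i != 0 by rewrite -gevX; apply: (onS_neq0 pS (homogeneousX i)); rewrite ptX pi oner_eq0.
rewrite (dehom_homogeneous Ah xi).
have -> : gev A / x i ^+ (dp * n + e0) / D p = gev (gp ^+ n * b) / gev (mX i ^+ (dp * n + e0)).
  rewrite /A !rmorphM !rmorphXn /= gevX gevaE; field.
  by rewrite cartier_neq0 // expf_neq0.
apply: (@OSunit_frac _ _ _ _ _ pS (dp * n + e0)).
- by apply: homogeneousM => //; apply: homogeneous_exp.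
- by rewrite -[X in homogeneous X _]mul1n; apply: homogeneous_exp; apply: homogeneousX.
- by rewrite rmorphM rmorphXn mulf_neq0 ?expf_neq0.
- by rewrite rmorphXn /= ptX pi expr1n oner_neq0.
Qed.

(** The divisors decrease, so their ideals ascend. Once two consecutive ideals agree, the local
    generators of [D n.+1] vanish along [D n] as well. *)
Lemma divisor_acc (D : nat -> Div) : (forall n, cartier (D n)) -> (forall n, effective (D n)) ->
  (forall n p, onS p -> OS p (D n p / D n.+1 p)) -> exists n, div_eq (D n) (D n.+1).
Proof.
move=> DC DE Dle.
have [|n F HF|n nE] := @mpoly_acc kb N.+1 (fun n => vanishing (D n)).
- by move=> n; apply: vanishing_ideal.
- move=> q i qS qi; have := OSM (HF q i qS qi) (Dle n q qS).
  by rewrite mulrA divfK ?cartier_neq0.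
exists n => p pS.
have [e [A [Ae AD Ap]]] := exists_generator (DC n.+1) (DE n.+1) pS.
have [i [pi _]] := exists_unit_coord pS.
have := nE _ AD p i pS pi.
have D0 := cartier_neq0 (DC n) pS; have D1 := cartier_neq0 (DC n.+1) pS.
move=> H; split; first by rewrite mulf_neq0 ?invr_eq0.
  exact: Dle.
rewrite invf_div; have := OSM H (OSunit_OS (OSunitV (Ap i pi))).
have A0 : dehom i A != 0.
  by apply: contraNneq (OSunit_neq0 (Ap i pi)) => ->; rewrite mul0r.
by congr (OS _ _); field; rewrite A0 D0 D1.
Qed.

Definition prime_sum D m (C : 'I_m -> Div) : Prop :=
  (forall i, prime_divisor (C i)) /\ div_eq D (fun p => \prod_i C i p).

Lemma prime_sum_add D E m n (C : 'I_m -> Div) (C' : 'I_n -> Div) :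
  prime_sum D C -> prime_sum E C' -> exists C'' : 'I_(m + n) -> Div,
    prime_sum (div_add D E) C''.
Proof.
move=> [Cp DE] [C'p EE].
exists (fun i => match fintype.split i with inl a => C a | inr b => C' b end); split.
  by move=> i; case: (fintype.split i).
move=> p pS; rewrite big_split_ord /=.
under eq_bigr do rewrite (unsplitK (inl _)).
have -> : \prod_(i < n) (match fintype.split (rshift m i) with inl a => C a | inr b => C' b end) p =
    \prod_(i < n) C' i p by apply: eq_bigr => i _; rewrite (unsplitK (inr _)).
by rewrite /div_add -mulf_div; apply: OSunitM; [apply: DE | apply: EE].
Qed.

Lemma prime_cartier C : prime_divisor C -> cartier C. Proof. by case. Qed.
Lemma prime_effective C : prime_divisor C -> effective C. Proof. by case. Qed.

Lemma prime_sum_congr D E m (C : 'I_m -> Div) : cartier E -> div_eq D E -> prime_sum E C ->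
  prime_sum D C.
Proof.
move=> EC DE [Cp CE]; split=> //; apply: div_eq_trans CE => //.
Qed.

(** Noetherian induction: a divisor without a decomposition is a sum of two nonzero effective
    divisors, one of which has none either. Multiplicities appear as repetitions in the family. *)
Lemma effective_prime_sum D : cartier D -> effective D ->
  exists m (C : 'I_m -> Div), prime_sum D C.
Proof.
move=> DC DE; apply: contrapT => N0.
pose bad D := [/\ cartier D, effective D & ~ exists m (C : 'I_m -> Div), prime_sum D C].
have H (D0 : {D | bad D}) : exists D1 : {D | bad D},
    (forall p, onS p -> OS p (sval D0 p / sval D1 p)) /\ ~ div_eq (sval D0) (sval D1).
  case: D0 => {N0 DC DE}D [DC DE DN] /=.
  have Dnz : ~ div_zero D.
    move=> D0; apply: DN; exists 0, (fun=> D); split=> [[]//|p pS].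
    by rewrite big_ord0 divr1; apply: D0.
  have [[E [F [[EC EE] [FC FE] DEF [E0 F0]]]]|N2] := pselect (exists (E F : Div),
     [/\ cartier E /\ effective E, cartier F /\ effective F,
     div_eq D (div_add E F) & ~ div_zero E /\ ~ div_zero F]); last first.
    exfalso; apply: DN; exists 1, (fun=> D); split; last first.
      by move=> p pS; rewrite big_ord1; apply: div_eq_refl.
    move=> _; split=> // E F EC EE FC FE DEF; apply: contrapT => /not_orP h.
    by apply: N2; exists E, F.
  have sub (A B : Div) : cartier A -> cartier B -> effective B -> div_eq D (div_add A B) ->
      ~ div_zero B -> (forall p, onS p -> OS p (D p / A p)) /\ ~ div_eq D A.
    move=> AC BC BE DAB B0.
    have eq p : onS p -> D p / A p = D p / div_add A B p * B p.
      move=> pS; rewrite /div_add; field.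
      by rewrite (cartier_neq0 AC pS) (cartier_neq0 BC pS).
    split=> [p pS|DA].
      by rewrite eq //; apply: OSM; [apply/OSunit_OS/DAB | apply: BE].
    apply: B0 => p pS; have := OSunit_div (DA p pS) (DAB p pS).
    rewrite eq // mulrC mulKf //; exact: OSunit_neq0 (DAB p pS).
  have [badE|nbadE] := pselect (bad E).
    by exists (exist _ E badE); apply: (sub E F).
  have [badF|nbadF] := pselect (bad F).
    exists (exist _ F badF); apply: (sub F E) => //.
    by have -> : div_add F E = div_add E F by apply/funext => p; rewrite /div_add mulrC.
  exfalso; apply: DN.
  have [m [C CE]] : exists m (C : 'I_m -> Div), prime_sum E C.
    by apply: contrapT => h; apply: nbadE.
  have [n [C' C'F]] : exists m (C : 'I_m -> Div), prime_sum F C.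
    by apply: contrapT => h; apply: nbadF.
  have [C'' C''E] := prime_sum_add CE C'F.
  by exists (m + n)%N, C''; apply: prime_sum_congr C''E => //; apply: cartier_mul.
have [h hP] := choice H.
have badD : bad D by split.
pose c n := iter n h (exist _ D badD).
have [n||n p pS|n nE] := @divisor_acc (fun n => sval (c n)).
- by case: (svalP (c n)).
- by move=> n; case: (svalP (c n)).
- by apply: (hP (c n)).1.
- exact: (hP (c n)).2 nE.
Qed.

End Divisors.

(** * The Picard lattice *)

Section Lattice.
Variable n : nat.
Hypothesis n_ge2 : (2 <= n)%N.
Hypothesis n_le8 : (n <= 8)%N.

Definition lform (R : pzRingType) (v w : 'rV[R]_n.+1) : R :=
  v 0 ord0 * w 0 ord0 - \sum_(i | i != ord0) v 0 i * w 0 i.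

Lemma lformE (R : pzRingType) (v w : 'rV[R]_n.+1) :
  lform v w = v 0 ord0 * w 0 ord0 - \sum_(i < n) v 0 (lift ord0 i) * w 0 (lift ord0 i).
Proof. by rewrite /lform big_mkcond big_ord_recl /= add0r. Qed.

Section Form.
Variable R : comPzRingType.
Implicit Types u v w : 'rV[R]_n.+1.

Lemma lformC v w : lform v w = lform w v.
Proof. by rewrite !lformE mulrC; congr (_ - _); apply: eq_bigr => i _; rewrite mulrC. Qed.

Lemma lformDl u v w : lform (u + v) w = lform u w + lform v w.
Proof.
rewrite !lformE !mxE mulrDl addrACA -opprD -big_split; congr (_ - _).
by apply: eq_bigr => i _; rewrite !mxE mulrDl.
Qed.

Lemma lformZl c v w : lform (c *: v) w = c * lform v w.
Proof.
rewrite !lformE !mxE mulrBr mulr_sumr mulrA; congr (_ - _).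
by apply: eq_bigr => i _; rewrite !mxE mulrA.
Qed.

Lemma lformDr u v w : lform w (u + v) = lform w u + lform w v.
Proof. by rewrite lformC lformDl !(lformC w). Qed.
Lemma lformZr c v w : lform w (c *: v) = c * lform w v.
Proof. by rewrite lformC lformZl (lformC w). Qed.
Lemma lform0l w : lform 0 w = 0.
Proof. by rewrite -(scale0r 0) lformZl mul0r. Qed.
Lemma lform0r w : lform w 0 = 0. Proof. by rewrite lformC lform0l. Qed.
Lemma lformNl v w : lform (- v) w = - lform v w.
Proof. by rewrite -scaleN1r lformZl mulN1r. Qed.
Lemma lform_sumr I (r : seq I) (P : pred I) (f : I -> 'rV[R]_n.+1) w :
  lform w (\sum_(i <- r | P i) f i) = \sum_(i <- r | P i) lform w (f i).
Proof. by apply: (big_morph _ (fun u v => lformDr u v w) (lform0r w)). Qed.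
Lemma lform_suml I (r : seq I) (P : pred I) (f : I -> 'rV[R]_n.+1) w :
  lform (\sum_(i <- r | P i) f i) w = \sum_(i <- r | P i) lform (f i) w.
Proof. by rewrite lformC lform_sumr; apply: eq_bigr => i _; rewrite lformC. Qed.

Definition reflect_in (a v : 'rV[R]_n.+1) := v + lform v a *: a.

Lemma reflect_inK a : lform a a = - 2%:R -> involutive (reflect_in a).
Proof.
move=> aa v; rewrite /reflect_in lformDl lformZl aa -addrA -scalerDl.
have -> : lform v a + (lform v a + lform v a * - 2%:R) = 0 by ring.
by rewrite scale0r addr0.
Qed.

Lemma lform_reflect a v w : lform a a = - 2%:R ->
  lform (reflect_in a v) (reflect_in a w) = lform v w.
Proof.
move=> aa; rewrite /reflect_in !(lformDl, lformDr, lformZl, lformZr) aa (lformC a w).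
ring.
Qed.

End Form.

Definition anticanonical (R : pzRingType) : 'rV[R]_n.+1 :=
  \row_i (if i == ord0 then 3%:R else - 1).

Lemma lform_anticanonical (R : comPzRingType) (v : 'rV[R]_n.+1) :
  lform (anticanonical R) v = 3%:R * v 0 ord0 + \sum_(i < n) v 0 (lift ord0 i).
Proof.
rewrite lformE !mxE eqxx -sumrN; congr (_ + _).
by apply: eq_bigr => i _; rewrite mxE mulN1r opprK.
Qed.

Definition exceptional (v : 'rV[int]_n.+1) : Prop :=
  lform (anticanonical int) v = 1 /\ lform v v = - 1.

Definition root_vector (v : 'rV[int]_n.+1) : Prop :=
  lform (anticanonical int) v = 0 /\ lform v v = - 2%:R.

Lemma exceptional_reflect a v : root_vector a -> exceptional v -> exceptional (reflect_in a v).
Proof.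
move=> [Ka aa] [Kv vv]; split; last by rewrite lform_reflect.
by rewrite /reflect_in lformDr lformZr Ka mulr0 addr0.
Qed.

(* The class c h - sum_i m_i e_i. *)
Definition mkv (R : pzRingType) (c : R) (m : 'I_n -> R) : 'rV[R]_n.+1 :=
  \row_i (if unlift ord0 i is Some j then - m j else c).

Lemma mkv0 (R : pzRingType) (c : R) m : mkv c m 0 ord0 = c.
Proof. by rewrite mxE unlift_none. Qed.
Lemma mkvS (R : pzRingType) (c : R) m i : mkv c m 0 (lift ord0 i) = - m i.
Proof. by rewrite mxE liftK. Qed.

Lemma mkv_surj (R : pzRingType) (v : 'rV[R]_n.+1) :
  v = mkv (v 0 ord0) (fun i => - v 0 (lift ord0 i)).
Proof. by apply/rowP => i; rewrite mxE; case: unliftP => [j|] ->; rewrite ?opprK. Qed.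

Lemma lform_mkv (R : comPzRingType) (c c' : R) m m' :
  lform (mkv c m) (mkv c' m') = c * c' - \sum_i m i * m' i.
Proof.
rewrite lformE !mkv0; congr (_ - _).
by apply: eq_bigr => i _; rewrite !mkvS mulrNN.
Qed.

Lemma antican_mkv (R : comPzRingType) (c : R) m :
  lform (anticanonical R) (mkv c m) = 3%:R * c - \sum_i m i.
Proof.
rewrite lform_anticanonical mkv0 -sumrN; congr (_ + _).
by apply: eq_bigr => i _; rewrite mkvS.
Qed.

Lemma sum_indicator (R : comPzRingType) (T : {set 'I_n}) (f : 'I_n -> R) :
  \sum_i (i \in T)%:R * f i = \sum_(i in T) f i.
Proof.
rewrite [RHS]big_mkcond; apply: eq_bigr => i _.
by case: (i \in T); rewrite ?mul1r ?mul0r.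
Qed.

Lemma sum_indicator1 (R : comPzRingType) (T : {set 'I_n}) :
  \sum_i (i \in T)%:R = #|T|%:R :> R.
Proof.
under eq_bigr do rewrite -[_%:R]mulr1.
by rewrite sum_indicator sumr_const.
Qed.

Lemma sum_indicator2 (R : comPzRingType) (T : {set 'I_n}) :
  \sum_i (i \in T)%:R * (i \in T)%:R = #|T|%:R :> R.
Proof.
rewrite sum_indicator -sum_indicator1 [RHS]big_mkcond /= [LHS]big_mkcond /=.
by apply: eq_bigr => i _; case: (i \in T).
Qed.

Definition line_class (c : int) (T : {set 'I_n}) := mkv c (fun i => (i \in T)%:R).

Lemma line_class_numbers c T :
  lform (anticanonical int) (line_class c T) = 3%:R * c - #|T|%:R /\
  lform (line_class c T) (line_class c T) = c * c - #|T|%:R.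
Proof. by rewrite antican_mkv lform_mkv sum_indicator1 sum_indicator2. Qed.

(** The strict transform of the line through two of the blown-up points; the following lemmas treat
    the conic through five points, the curve over a point and a sextic. *)
Lemma exceptional_line i j : i != j -> exceptional (line_class 1 [set i; j]%SET).
Proof.
move=> ij; have [h1 h2] := line_class_numbers 1 [set i; j]%SET.
by rewrite /exceptional h1 h2 cards2 ij.
Qed.

Lemma exceptional_conic (T : {set 'I_n}) : #|T| = 5 -> exceptional (line_class 2%:R T).
Proof.
move=> T5; have [h1 h2] := line_class_numbers 2%:R T.
by rewrite /exceptional h1 h2 T5.
Qed.

Lemma exceptional_point i : exceptional (mkv 0 (fun j => - (j \in [set i]%SET)%:R)).
Proof.
have h1 : \sum_j - (j \in [set i]%SET)%:R = - 1 :> int by rewrite sumrN sum_indicator1 cards1.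
have h2 : \sum_j - (j \in [set i]%SET)%:R * - (j \in [set i]%SET)%:R = 1 :> int.
  by under eq_bigr do rewrite mulrNN; rewrite sum_indicator2 cards1.
by rewrite /exceptional antican_mkv lform_mkv h1 h2.
Qed.

(** A sextic with a triple point at one of eight points and double points at the other seven. *)
Lemma exceptional_sextic i : n = 8 ->
  exceptional (mkv 6%:R (fun j => 2%:R + (j \in [set i]%SET)%:R)).
Proof.
move=> n8; rewrite /exceptional antican_mkv lform_mkv.
have E : \sum_(j < n) (2%:R : int) = 16%:R by rewrite sumr_const card_ord n8.
have -> : \sum_j (2%:R + (j \in [set i]%SET)%:R) = 17%:R :> int.
  by rewrite big_split /= E sum_indicator1 cards1.
have -> : \sum_j (2%:R + (j \in [set i]%SET)%:R) * (2%:R + (j \in [set i]%SET)%:R) = 37%:R :> int.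
  under eq_bigr => j _.
    have -> : (2%:R + (j \in [set i]%SET)%:R) * (2%:R + (j \in [set i]%SET)%:R) =
      2%:R * 2%:R + 5%:R * (j \in [set i]%SET)%:R :> int by case: (j \in _).
    over.
  have E' : \sum_(j < n) (2%:R * 2%:R : int) = 32%:R by rewrite sumr_const card_ord n8.
  by rewrite big_split /= E' -mulr_sumr sum_indicator1 cards1.
by [].
Qed.

Lemma root_triple (T : {set 'I_n}) : #|T| = 3 -> root_vector (line_class 1 T).
Proof.
move=> T3; have [h1 h2] := line_class_numbers 1 T.
by rewrite /root_vector h1 h2 T3.
Qed.

Definition toR (R : nzRingType) (v : 'rV[int]_n.+1) : 'rV[R]_n.+1 := map_mx intr v.

Lemma lform_toR (R : comNzRingType) v w : lform (toR R v) (toR R w) = (lform v w)%:~R.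
Proof.
rewrite !lformE !mxE rmorphB rmorphM rmorph_sum; congr (_ - _).
by apply: eq_bigr => i _; rewrite !mxE rmorphM.
Qed.

Lemma reflect_toR (R : comNzRingType) a v : toR R (reflect_in a v) = reflect_in (toR R a) (toR R v).
Proof. by rewrite /reflect_in lform_toR; apply/rowP => i; rewrite !mxE rmorphD rmorphM. Qed.

Section Nef.
Variable R : realDomainType.
Implicit Types v : 'rV[R]_n.+1.

(** Only pairings with numerical (-1)-classes are tested; [prime_nef] and [nef_pairing] relate this
    to actual curves. *)
Definition nef v : Prop := forall e, exceptional e -> 0 <= lform v (toR R e).

Lemma nef_reflect a v : root_vector a -> nef v -> nef (reflect_in (toR R a) v).
Proof.
move=> ra Nv e /(exceptional_reflect ra)/Nv.
have aa : lform (toR R a) (toR R a) = - 2%:R by rewrite lform_toR ra.2 rmorphN /= rmorph_nat.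
by rewrite reflect_toR -(lform_reflect _ _ aa) reflect_inK.
Qed.

Lemma toR_mkv c m : toR R (mkv c m) = mkv c%:~R (fun i => (m i)%:~R).
Proof.
by apply/rowP => i; rewrite !mxE; case: (unlift _ _) => [j|]; rewrite ?rmorphN.
Qed.

Section Coordinates.
Variables (a : R) (b : 'I_n -> R).
Hypothesis N : nef (mkv a b).

Lemma nef_point i : 0 <= b i.
Proof.
have := N (exceptional_point i); rewrite toR_mkv lform_mkv rmorph0 mulr0 sub0r -sumrN.
rewrite (bigD1 i) //= big1 ?addr0 => [|j /negPf ji]; last first.
  by rewrite finset.in_set1 ji oppr0 rmorph0 mulr0 oppr0.
by rewrite finset.in_set1 eqxx rmorphN mulrN mulr1 opprK.
Qed.

Lemma lform_line c (T : {set 'I_n}) :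
  lform (mkv a b) (toR R (line_class c T)) = a * c%:~R - \sum_(i in T) b i.
Proof.
rewrite toR_mkv lform_mkv -sum_indicator; congr (_ - _); apply: eq_bigr => i _.
by rewrite mulrC; case: (i \in T).
Qed.

Lemma nef_line i j : i != j -> b i + b j <= a.
Proof.
move=> ij; have := N (exceptional_line ij); rewrite lform_line mulr1 subr_ge0.
by rewrite big_setU1 ?finset.in_set1 //= big_set1.
Qed.

Lemma nef_conic (T : {set 'I_n}) : #|T| = 5 -> \sum_(i in T) b i <= a * 2%:R.
Proof. by move=> T5; have := N (exceptional_conic T5); rewrite lform_line subr_ge0. Qed.

Lemma nef_sextic i : n = 8 -> \sum_j b j * 2%:R + b i <= a * 6%:R.
Proof.
move=> n8; have := N (exceptional_sextic i n8); rewrite toR_mkv lform_mkv subr_ge0.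
congr (_ <= _); under eq_bigr do rewrite rmorphD mulrDr /=.
rewrite big_split /=; congr (_ + _).
rewrite (bigD1 i) //= big1 ?addr0 => [|j /negPf ji]; last by rewrite finset.in_set1 ji mulr0.
by rewrite finset.in_set1 eqxx mulr1.
Qed.

Lemma nef_coord_le i : b i <= a.
Proof.
have [j ij] : exists j, i != j.
  apply: contrapT => /forallNP h.
  have : (#|'I_n| <= 1)%N.
    apply/fintype_le1P => y z.
    have E w : w = i by apply/eqP; rewrite eq_sym; apply/negPn/negP/h.
    by rewrite (E y) (E z).
  by rewrite card_ord leqNgt n_ge2.
by have := nef_line ij; have := nef_point j; lra.
Qed.

Lemma nef_ge0 : 0 <= a.
Proof.
have i : 'I_n by exists 0; apply: leq_trans n_ge2.
by have := nef_point i; have := nef_coord_le i; lra.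
Qed.

(** Nonnegativity against the anticanonical class, which up to a multiple is a sum of classes
    already treated: lines through cyclically consecutive points and copies of h for n <= 6, a line
    and the conic through the other five points for n = 7, a sextic and the curve over its triple
    point for n = 8. *)
Lemma nef_sum : \sum_i b i <= a * 3%:R.
Proof.
have a0 := nef_ge0.
have neS (i : 'I_n) : i != ordS i.
  rewrite -val_eqE /=; have := ltn_ord i; rewrite leq_eqVlt => /orP[/eqP E|lt].
    by rewrite E modnn -lt0n -ltnS E.
  by rewrite modn_small // neq_ltn ltnSn.
have i0 : 'I_n by exists 0; apply: leq_trans n_ge2.
have : (n <= 6)%N || (n == 7)%N || (n == 8)%N by move: n_le8; clear; lia.
case/orP => [/orP[n6|/eqP n7]|/eqP n8].
- have : \sum_i (b i + b (ordS i)) <= \sum_(i < n) a.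
    by apply: ler_sum => i _; apply: nef_line.
  rewrite big_split /= sumr_const card_ord.
  have -> : \sum_i b (ordS i) = \sum_i b i.
    by rewrite [RHS](reindex (@ordS n)) //; apply: onW_bij; apply: ordS_bij.
  have : a *+ n <= a *+ 6 by apply: ler_wpMn2l.
  rewrite -[a *+ 6]mulr_natr; lra.
- pose T : {set 'I_n} := ~: [set i0; ordS i0]%SET.
  have T5 : #|T| = 5.
    have := cardsC [set i0; ordS i0]%SET; rewrite cards2 neS card_ord -/T => E; have : (2 + #|T| = 7)%N by rewrite -[RHS]n7 -[RHS]E.
    by move=> [].

  have := nef_conic T5; have := nef_line (neS i0).
  have -> : \sum_i b i = b i0 + b (ordS i0) + \sum_(i in T) b i.
    rewrite (bigID (mem T)) /= addrC; congr (_ + _).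
    rewrite (eq_bigl (mem [set i0; ordS i0]%SET)).
      by rewrite big_setU1 ?finset.in_set1 ?neS //= big_set1.
    by move=> i; rewrite /= /T finset.in_setC negbK.
  lra.
- have := nef_sextic i0 n8; have := nef_point i0; rewrite -mulr_suml; lra.
Qed.

(** Let [mu] bound all coefficients of [m] but the two largest. Then [a * c - b t1 * m t1 - b t2 * m
    t2 - B' * mu] is the sum of the four nonnegative products [h1], [h2], [h3] and [h4]. *)
Lemma nef_pairing_reduced (c : R) (m : 'I_n -> R) : (forall i, 0 <= m i) ->
  (forall i j, i != j -> m i + m j <= c) ->
  (forall i j l, i != j -> l != i -> l != j -> m i + m j + m l <= c) ->
  0 <= a * c - \sum_i b i * m i.
Proof.
move=> m0 m2 m3.
have i0 : 'I_n by exists 0; apply: leq_trans n_ge2.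
have [t1 _ t1max] := Order.TotalTheory.arg_maxP m (erefl : xpredT i0).
have [i1 i1t] : exists i1, i1 != t1.
  apply: contrapT => /forallNP h.
  have : (#|'I_n| <= 1)%N.
    apply/fintype_le1P => y z.
    have E w : w = t1 by apply/eqP/negPn/negP/h.
    by rewrite (E y) (E z).
  by rewrite card_ord leqNgt n_ge2.
have [t2 t21 t2max] := Order.TotalTheory.arg_maxP m (i1t : (fun i => i != t1) i1).
have [mu [mu0 mu2 muc mumax]] : exists mu, [/\ 0 <= mu, mu <= m t2, m t1 + m t2 + mu <= c
    & forall l, l != t1 -> l != t2 -> m l <= mu].
  have [[l [l1 l2]]|Nl] := pselect (exists l, l != t1 /\ l != t2); last first.
    (* With two points there is no third coefficient, and 0 takes its place. *)
    exists 0; split=> //; first by rewrite addr0 m2 // eq_sym.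
    by move=> l l1 l2; case: Nl; exists l.
  have [t3 /andP[t31 t32] t3max] := Order.TotalTheory.arg_maxP m
    (introT andP (conj l1 l2) : (fun i => (i != t1) && (i != t2)) l).
  exists (m t3); split=> //; first exact: t2max.
    by apply: m3; rewrite // eq_sym.
  by move=> j j1 j2; apply: t3max; rewrite j1 j2.
have t1t2 : m t2 <= m t1 by apply: t1max.
have split3 (f : 'I_n -> R) : \sum_i f i = f t1 + f t2 + \sum_(i | (i != t1) && (i != t2)) f i.
  by rewrite (bigD1 t1) //= (bigD1 t2) //= addrA.
set B' := \sum_(i | (i != t1) && (i != t2)) b i.
have rest : \sum_(i | (i != t1) && (i != t2)) b i * m i <= B' * mu.
  rewrite mulr_suml; apply: ler_sum => i /andP[i1' i2'].
  by apply: ler_wpM2l; [apply: nef_point | apply: mumax].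
have sb := nef_sum; rewrite split3 -/B' in sb.
rewrite split3.
have a0 := nef_ge0; have b1 := nef_coord_le t1; have b2 := nef_coord_le t2.
have h1 : 0 <= (a - b t1) * (m t1 - mu) by apply: mulr_ge0; lra.
have h2 : 0 <= (a - b t2) * (m t2 - mu) by apply: mulr_ge0; lra.
have h3 : 0 <= mu * (a * 3%:R - (b t1 + b t2 + B')) by apply: mulr_ge0; lra.
have h4 : 0 <= a * (c - (m t1 + m t2 + mu)) by apply: mulr_ge0; lra.
nra.
Qed.

End Coordinates.

End Nef.

Lemma toR_int (v : 'rV[int]_n.+1) : toR int v = v.
Proof. by apply/rowP => i; rewrite mxE intz. Qed.

Lemma nef_int (v : 'rV[int]_n.+1) :
  nef v <-> forall e, exceptional e -> 0 <= lform v e.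
Proof. by split=> H e /H; rewrite toR_int. Qed.

(* Reflecting both vectors in roots h - e_i - e_j - e_l lowers the coefficient of
   h in the integral one, until [nef_pairing_reduced] applies. *)
Theorem nef_pairing (R : realDomainType) (v : 'rV[R]_n.+1) (w : 'rV[int]_n.+1) :
  nef v -> nef w -> 0 <= lform v (toR R w).
Proof.
have [s] := ubnP (absz (w 0 ord0)); elim: s v w => // s IH v w ws Nv Nw.
have Ev := mkv_surj v; have Ew := mkv_surj w.
set c := w 0 ord0 in Ew ws; set m := (fun i : 'I_n => _) in Ew.
have Nw' := Nw; rewrite Ew in Nw'; have Nv' := Nv; rewrite Ev in Nv'.
have [[i [j [l [ij li lj lt]]]]|Nt] := pselect (exists i j l,
    [/\ i != j, l != i, l != j & c < m i + m j + m l]); last first.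
  rewrite Ev Ew toR_mkv lform_mkv; apply: nef_pairing_reduced => //.
  - by move=> i; rewrite ler0z; apply: (nef_point Nw').
  - by move=> i j ij; rewrite -rmorphD ler_int; apply: (nef_line Nw').
  - move=> i j l ij li lj; rewrite -!rmorphD ler_int leNgt; apply/negP => lt.
    by apply: Nt; exists i, j, l.
pose T := [set l; i; j]%SET.
have lT : l \notin [set i; j]%SET by rewrite finset.in_set2 negb_or li.
have T3 : #|T| = 3 by rewrite /T -finset.setUA cardsU1 lT cards2 ij.
pose r := line_class 1 T; have rr : root_vector r := root_triple T3.
have aaR : lform (toR R r) (toR R r) = - 2%:R.
  by rewrite lform_toR rr.2 rmorphN /= rmorph_nat.
rewrite -(lform_reflect _ _ aaR) -reflect_toR.
have Nrw : nef (reflect_in r w) by have := nef_reflect rr Nw; rewrite toR_int.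
apply: IH => //; last exact: nef_reflect.
have E : (reflect_in r w) 0 ord0 = c + (c - (m i + m j + m l)).
  rewrite /reflect_in !mxE -/c unlift_none mulr1; congr (_ + _).
  rewrite Ew -[r]toR_int lform_line mulr1; congr (_ - _).
  rewrite /T -finset.setUA big_setU1 //= big_setU1 ?finset.in_set1 //= big_set1.
  by rewrite [LHS]addrC.
have ge0 : 0 <= (reflect_in r w) 0 ord0.
  by move: Nrw; rewrite (mkv_surj (reflect_in r w)) => /nef_ge0; rewrite mkv0.
have c0 : 0 <= c by apply: (nef_ge0 Nw').
by move: ws ge0; rewrite E; move: lt; clear -c0; lia.
Qed.

(** The index theorem. Cauchy-Schwarz gives 9 a^2 <= n sum b_i^2 with n <= 8, against sum b_i^2 <=
    a^2. *)
Lemma anticanonical_orthogonal (v : 'rV[int]_n.+1) :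
  lform (anticanonical int) v = 0 -> 0 <= lform v v -> v = 0.
Proof.
rewrite lform_anticanonical lformE; set a := v 0 ord0; set b := fun i : 'I_n => v 0 (lift ord0 i).
move=> K0 vv.
have CS : (\sum_i b i) ^+ 2 <= n%:R * \sum_i b i ^+ 2.
  have : 0 <= \sum_i \sum_j (b i - b j) ^+ 2.
    by apply: sumr_ge0 => i _; apply: sumr_ge0 => j _; apply: sqr_ge0.
  have -> : \sum_i \sum_j (b i - b j) ^+ 2 =
      (n%:R * \sum_i b i ^+ 2 - (\sum_i b i) ^+ 2) *+ 2.
    have inner i : \sum_j (b i - b j) ^+ 2 =
        n%:R * b i ^+ 2 - (2%:R * \sum_j b j) * b i + \sum_j b j ^+ 2.
      have -> : \sum_j (b i - b j) ^+ 2 = \sum_j (b i ^+ 2 - (2%:R * b i) * b j + b j ^+ 2).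
        by apply: eq_bigr => j _; ring.
      rewrite big_split sumrB sumr_const card_ord -mulr_sumr -[_ *+ n]mulr_natl /=.
      by congr (_ - _ + _); ring.
    rewrite (eq_bigr _ (fun i _ => inner i)) big_split sumrB -!mulr_sumr sumr_const card_ord.
    by rewrite -[_ *+ n]mulr_natl /= expr2; ring.
  by rewrite pmulrn_lge0 // subr_ge0.
have sq : \sum_i b i ^+ 2 = 0.
  have s0 : 0 <= \sum_i b i ^+ 2 by apply: sumr_ge0 => i _; apply: sqr_ge0.
  have vv' : 0 <= a ^+ 2 - \sum_i b i ^+ 2.
    by move: vv; rewrite expr2; under [X in _ - X]eq_bigr do rewrite -expr2.
  have n8 : n%:R <= 8%:R :> int by rewrite ler_nat.
  have E : \sum_i b i = - (3%:R * a) by apply/eqP; rewrite -addr_eq0 addrC K0.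
  rewrite E in CS; apply/eqP; rewrite eq_le s0 andbT.
  have := ler_wpM2r s0 n8.
  move: CS vv'; rewrite sqrrN exprMn; move: (_%:R * \sum_i _) => X.
  by move: (\sum_i _) => Y; move: (a ^+ 2) => Z; lia.
have b0 i : b i = 0.
  have /psumr_eq0P := sq => /(_ (fun i _ => sqr_ge0 (b i)) i erefl) /eqP.
  by rewrite sqrf_eq0 => /eqP.
have a0 : a = 0.
  move: K0; rewrite big1 => [|i _]; last exact: b0.
  by rewrite addr0 => /eqP; rewrite mulf_eq0 => /orP[//|/eqP].
apply/rowP => i; rewrite mxE; case: (unliftP ord0 i) => [j|] ->; [exact: b0 | exact: a0].
Qed.

(** The class of a line is (h - e_0 - e_1) + e_0 + e_1; this takes two points, that is d <= 7. *)
Lemma exceptional_span (v : 'rV[int]_n.+1) :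
  exists m (c : 'I_m -> int) (e : 'I_m -> 'rV[int]_n.+1),
    (forall i, exceptional (e i)) /\ v = \sum_i c i *: e i.
Proof.
pose P v := exists m (c : 'I_m -> int) (e : 'I_m -> 'rV[int]_n.+1),
    (forall i, exceptional (e i)) /\ v = \sum_i c i *: e i.
have P0 : P 0 by exists 0, (fun=> 0), (fun=> 0); split=> [[]//|]; rewrite big_ord0.
have PD u w : P u -> P w -> P (u + w).
  move=> [m1 [c1 [e1 [E1 ->]]]] [m2 [c2 [e2 [E2 ->]]]].
  exists (m1 + m2)%N, (fun i => match fintype.split i with inl j => c1 j | inr j => c2 j end),
    (fun i => match fintype.split i with inl j => e1 j | inr j => e2 j end).
  split=> [i|]; first by case: (fintype.split i).
  rewrite big_split_ord /=; congr (_ + _); apply: eq_bigr => i _.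
    by rewrite (unsplitK (inl _)).
  by rewrite (unsplitK (inr _)).
have PZ c u : P u -> P (c *: u).
  move=> [m1 [c1 [e1 [E1 ->]]]]; exists m1, (fun i => c * c1 i), e1; split=> //.
  by rewrite scaler_sumr; apply: eq_bigr => i _; rewrite scalerA.
have P1 e : exceptional e -> P e.
  by move=> ee; exists 1, (fun=> 1), (fun=> e); split=> //; rewrite big_ord1 scale1r.
pose ei i := mkv (0 : int) (fun j => - (j \in [set i]%SET)%:R).
have Pe i : P (ei i) by apply/P1/exceptional_point.
pose i0 := Ordinal (leq_trans (isT : (0 < 2)%N) n_ge2).
pose i1 := Ordinal n_ge2.
have i01 : i0 != i1 by [].
pose h := mkv (1 : int) (fun=> 0).
have Ph : P h.
  have -> : h = line_class 1 [set i0; i1]%SET + (ei i0 + ei i1).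
    apply/rowP => i; rewrite !mxE; case: (unlift _ _) => [j|]; last by rewrite !addr0.
    rewrite !opprK !finset.in_set1 finset.in_set2.
    by case: eqP => [->|_]; [rewrite (negPf i01) | case: eqP].
  by apply: (PD); [apply/P1/exceptional_line | apply: PD].
have -> : v = v 0 ord0 *: h + \sum_i v 0 (lift ord0 i) *: ei i.
  apply/rowP => j; rewrite !mxE summxE.
  case: (unliftP ord0 j) => [l|] ->.
    rewrite oppr0 mulr0 add0r (bigD1 l) //= big1 ?addr0 => [|i il].
      by rewrite !mxE liftK finset.in_set1 eqxx opprK mulr1.
    by rewrite !mxE liftK finset.in_set1 eq_sym (negPf il) opprK mulr0.
  by rewrite mulr1 big1 ?addr0 // => i _; rewrite !mxE unlift_none mulr0.
apply: (PD); first exact: PZ.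
by apply: (big_ind P) => // i _; apply: PZ.
Qed.

End Lattice.

(** * Local multiplicities *)

Section LocalMultiplicity.
Variables (k : fieldType) (kb : closedFieldType) (iota : {rmorphism k -> kb}).
Variable S : smooth_projective_surface iota.

Local Notation K := (fun_field S).
Local Notation N := (dim_amb S).
Local Notation form := (mpol kb N.+1).
Local Notation pt := 'rV[kb]_N.+1.
Local Notation emb := (fun_emb S).
Local Notation x := (gen_pt S).
Local Notation gev := (gen_eval emb x).
Local Notation OSm p := (local_max emb x p).
Local Notation Div := (divisor S).
Local Notation ideal2 p f g := (local_ideal2 emb x p f g).
Local Notation lmult p f g m := (@local_mult _ _ _ S p f g m).
Implicit Types (p q : pt) (f g h z : K).

Section AtPoint.
Variable p : pt.
Hypothesis pS : onS p.

Lemma ideal2_0 f g : ideal2 p f g 0.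
Proof. by exists 0, 0; split; rewrite ?mul0r ?addr0 //; apply: OS0. Qed.

Lemma ideal2D f g a b : ideal2 p f g a -> ideal2 p f g b -> ideal2 p f g (a + b).
Proof.
move=> [a1 [a2 [h1 h2 ->]]] [b1 [b2 [h3 h4 ->]]].
by exists (a1 + b1), (a2 + b2); split; [exact: OSD | exact: OSD | ring].
Qed.

Lemma ideal2M f g a b : OS p a -> ideal2 p f g b -> ideal2 p f g (a * b).
Proof.
move=> Oa [b1 [b2 [h3 h4 ->]]].
by exists (a * b1), (a * b2); split; [exact: OSM | exact: OSM | ring].
Qed.

Lemma ideal2N f g a : ideal2 p f g a -> ideal2 p f g (- a).
Proof. by rewrite -mulN1r => h; apply: ideal2M => //; apply: OSN; apply: OS1. Qed.

Lemma ideal2B f g a b : ideal2 p f g a -> ideal2 p f g b -> ideal2 p f g (a - b).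
Proof. by move=> h h'; apply: ideal2D => //; apply: ideal2N. Qed.

Lemma ideal2l f g a : OS p a -> ideal2 p f g (a * f).
Proof. by move=> Oa; exists a, 0; split; rewrite ?mul0r ?addr0 //; apply: OS0. Qed.

Lemma ideal2r f g a : OS p a -> ideal2 p f g (a * g).
Proof. by move=> Oa; exists 0, a; split; rewrite ?mul0r ?add0r //; apply: OS0. Qed.

Lemma ideal2_sum f g I (r : seq I) (P : pred I) (F : I -> K) :
  (forall i, P i -> ideal2 p f g (F i)) -> ideal2 p f g (\sum_(i <- r | P i) F i).
Proof. by move=> H; apply: (big_ind (ideal2 p f g)) => //; [exact: ideal2_0 | exact: ideal2D]. Qed.

Lemma ideal2_sub f g f' g' : ideal2 p f' g' f -> ideal2 p f' g' g ->
  ideal2 p f g `<=` ideal2 p f' g'.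
Proof. by move=> hf hg _ [a [b [Oa Ob ->]]]; apply: ideal2D; apply: ideal2M. Qed.

Lemma OS_ideal2 f g : OS p f -> OS p g -> OS_ideal p (ideal2 p f g).
Proof.
move=> Of Og; split; [exact: ideal2_0 | exact: ideal2D | exact: ideal2M |].
by move=> _ [a [b [Oa Ob ->]]]; apply: (OSD pS); apply: OSM.
Qed.

(** A dimension count in quotients of the local ring: with more elements than generators, the matrix
    of coordinates has a nonzero left kernel. *)
Lemma spanning_independent_le f g f' g' m m' (e : 'I_m -> K) (e' : 'I_m' -> K) :
  (forall j, exists c : 'I_m -> kb, ideal2 p f g (e' j - \sum_i emb (c i) * e i)) ->
  ideal2 p f g `<=` ideal2 p f' g' ->
  (forall c : 'I_m' -> kb, ideal2 p f' g' (\sum_j emb (c j) * e' j) -> forall j, c j = 0) ->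
  (m' <= m)%N.
Proof.
move=> /choice[c cP] sub ind; rewrite leqNgt; apply/negP => lt.
pose A := \matrix_(j < m', i < m) c j i.
have : kermx A != 0.
  by rewrite kermx_eq0 /row_free; apply: contraL lt => /eqP <-; rewrite -leqNgt rank_leq_col.
move=> /rowV0Pn [u /sub_kermxP uA u0].
apply/negP: u0; rewrite negbK; apply/eqP/rowP => j; rewrite mxE.
apply: (ind (fun j => u 0 j)); apply: sub.
have -> : \sum_j emb (u 0 j) * e' j =
    \sum_j emb (u 0 j) * (e' j - \sum_i emb (c j i) * e i).
  under [RHS]eq_bigr do rewrite mulrBr.
  rewrite sumrB; have -> : \sum_j emb (u 0 j) * (\sum_i emb (c j i) * e i) = 0; last by rewrite subr0.
  under eq_bigr do rewrite mulr_sumr.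
  rewrite exchange_big big1 //= => i _.
  under eq_bigr do rewrite mulrA -rmorphM.
  rewrite -mulr_suml -rmorph_sum /=.
  have -> : \sum_(l < m') u 0 l * c l i = (u *m A) 0 i.
    by rewrite mxE; apply: eq_bigr => l _; rewrite [A l i]mxE.
  by rewrite uA mxE rmorph0 mul0r.
by apply: ideal2_sum => l _; apply: ideal2M => //; apply: OS_emb.
Qed.

Lemma local_mult_span f g m : lmult p f g m -> exists e : 'I_m -> K,
  [/\ forall i, OS p (e i),
      forall z, OS p z -> exists c : 'I_m -> kb, ideal2 p f g (z - \sum_i emb (c i) * e i) &
      forall c : 'I_m -> kb, ideal2 p f g (\sum_i emb (c i) * e i) -> forall i, c i = 0].
Proof.
move=> [e Oe eP]; exists e; split=> // [z /eP [c [cP _]]|c cI i].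
  by exists (fun i => c 0 i).
have [c0 [c0P c0U]] := eP 0 (OS0 p).
have E1 : c0 = 0.
  apply: c0U; rewrite big1 ?subr0; first exact: ideal2_0.
  by move=> j _; rewrite mxE rmorph0 mul0r.
have E2 : c0 = \row_j c j.
  apply: c0U; rewrite sub0r; apply: ideal2N.
  by under eq_bigr do rewrite mxE.
by have := congr1 (fun B : 'rV_m => B 0 i) E1; rewrite E2 !mxE.
Qed.

Lemma local_mult_unit f g m : OSunit p f \/ OSunit p g -> lmult p f g m -> m = 0.
Proof.
move=> u /local_mult_span [e [Oe _ ind]].
have all z : OS p z -> ideal2 p f g z.
  case: u => u Oz; have u0 := OSunit_neq0 u.
    by rewrite -(divfK u0 z); apply: ideal2l; apply: OSM => //; apply/OSunit_OS/OSunitV.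
  by rewrite -(divfK u0 z); apply: ideal2r; apply: OSM => //; apply/OSunit_OS/OSunitV.
case: m e Oe ind => // m e Oe ind.
have /(_ (fun=> 1)) := ind; move=> /(_ _ ord0) H; exfalso.
have /eqP : (1 : kb) = 0.
  by apply: H; apply: all; apply: (OS_sum pS) => i _; apply: OSM; [apply: OS_emb|].
by rewrite oner_eq0.
Qed.

Lemma ideal2_max f g : OSm p f -> OSm p g -> ideal2 p f g `<=` OSm p.
Proof. by move=> mf mg _ [a [b [Oa Ob ->]]]; apply: (OSmD pS); apply: OSmM. Qed.

Lemma local_mult_gt0 f g m : OSm p f -> OSm p g -> lmult p f g m -> (0 < m)%N.
Proof.
move=> mf mg /local_mult_span [e [_ sp _]]; case: m e sp => // e sp.
have [c] := sp 1 (OS1 p); rewrite big_ord0 subr0 => /(ideal2_max mf mg) m1.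
by case: (OSm_not_unit m1); apply: OSunit1.
Qed.

(** In a quotient of dimension m the powers 1, z, ..., z^m are dependent; factoring out the lowest
    power that occurs leaves a unit. *)
Lemma local_mult_power f g m z : lmult p f g m -> OSm p z -> exists n, ideal2 p f g (z ^+ n).
Proof.
move=> /local_mult_span [e [Oe sp _]] mz; have Oz := OSm_OS mz.
have [c [cI /existsNP [j0 cj0]]] : exists c : 'I_m.+1 -> kb,
    ideal2 p f g (\sum_j emb (c j) * z ^+ j) /\ ~ forall j, c j = 0.
  apply: contrapT => N0; have : (m.+1 <= m)%N; last by rewrite ltnn.
  apply: (@spanning_independent_le f g f g _ _ e (fun j : 'I_m.+1 => z ^+ j)) => //.
    by move=> j; apply: sp; apply: OSX.
  by move=> c cI; apply: contrapT => h; apply: N0; exists c.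
have [j [cj jmin]] : exists j : 'I_m.+1, c j != 0 /\ forall i : 'I_m.+1, (i < j)%N -> c i = 0.
  have E : exists n, [exists i : 'I_m.+1, (i == n :> nat) && (c i != 0)].
    by exists j0; apply/existsP; exists j0; rewrite eqxx; apply/eqP.
  case: (ex_minnP E) => n /existsP[j /andP[/eqP <- cj]] nmin; exists j; split=> // i ij.
  apply/eqP/negPn/negP => ci; have : (j <= i)%N.
    by apply: nmin; apply/existsP; exists i; rewrite eqxx.
  by rewrite leqNgt ij.
exists j.
have split_sum : \sum_i emb (c i) * z ^+ i =
    z ^+ j * (emb (c j) + \sum_(i : 'I_m.+1 | (j < i)%N) emb (c i) * z ^+ (i - j)).
  rewrite mulrDr (bigD1 j) //= mulrC; congr (_ + _).
  rewrite mulr_sumr [LHS]big_mkcond [RHS]big_mkcond /=; apply: eq_bigr => i _.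
  case: (ltngtP i j) => ij.
  - by rewrite neq_ltn ij jmin // rmorph0 mul0r.
  - rewrite neq_ltn ij orbT mulrCA -exprD subnKC //; exact: ltnW.
  - by rewrite (val_inj ij) eqxx.
have u : OSunit p (emb (c j) + \sum_(i : 'I_m.+1 | (j < i)%N) emb (c i) * z ^+ (i - j)).
  apply: OSunitD => //; first exact: OSunit_emb.
  apply: (OSm_sum pS) => i ji; apply: OSmM; first exact: OS_emb.
  by rewrite -(subnSK ji) exprS mulrC; apply: OSmM => //; apply: OSX.
rewrite -(mulfK (OSunit_neq0 u) (z ^+ j)) -split_sum mulrC.
by apply: ideal2M => //; apply/OSunit_OS/OSunitV.
Qed.

End AtPoint.

Lemma exists_avoiding p : onS p -> exists L, homogeneous 1 L /\ pt_eval p L != 0.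
Proof.
case/exists_unit_coord => i [pi _]; exists (mX i); split; first exact: homogeneousX.
by rewrite ptX pi oner_eq0.
Qed.

(** The functions [x i / x l - p i] have powers in the ideal. Where the denominators in these
    relations do not vanish, a common zero of [f] and [g] has the coordinates of [p]. *)
Lemma isolated_zero p f g : onS p ->
  (forall z, OSm p z -> exists n, ideal2 p f g (z ^+ n)) ->
  exists e (G : form), [/\ homogeneous e G, pt_eval p G != 0 &
    forall q, onS q -> pt_eval q G != 0 -> OSm q f -> OSm q g -> q = p].
Proof.
move=> pS fg; have [l [pl xl]] := exists_unit_coord pS.
have key i : exists eG : nat * form, [/\ homogeneous eG.1 eG.2, pt_eval p eG.2 != 0 &
    forall q, onS q -> pt_eval q eG.2 != 0 -> q 0 l != 0 -> OSm q f -> OSm q g ->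
      q 0 i = p 0 i * q 0 l].
  pose H : form := mX i - p 0 i *: mX l.
  have H1 : homogeneous 1 H.
    by apply: homogeneousB; [|apply: homogeneousZ]; apply: homogeneousX.
  have Hp q : pt_eval q H = q 0 i - p 0 i * q 0 l.
    by rewrite rmorphB /= ptZ !ptX.
  have [|n [a [b [[e [a1 [a2 [a1e a2e a20 aE]]]] [e' [b1 [b2 [b1e b2e b20 bE]]]] nE]]]] :=
    fg (gev H / gev (mX l)).
    apply/(OSm_frac pS H1 (homogeneousX l)); first by rewrite ptX pl oner_eq0.
    by rewrite Hp pl mulr1 subrr.
  exists ((e + e')%N, a2 * b2); split.
  - exact: homogeneousM.
  - by rewrite rmorphM mulf_neq0.
  move=> q qS; rewrite rmorphM mulf_eq0 negb_or => /andP[q1 q2] ql mf mg.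
  have qX : pt_eval q (mX l) != 0 by rewrite ptX.
  have Oz : OS q (gev H / gev (mX l)) := OS_frac H1 (homogeneousX l) qX.
  have mz : OSm q ((gev H / gev (mX l)) ^+ n).
    rewrite nE; apply: (OSmD qS); apply: OSmM => //.
      by rewrite aE; apply: (OS_frac a1e a2e).
    by rewrite bE; apply: (OS_frac b1e b2e).
  have /(OSm_frac qS H1 (homogeneousX l) qX) : OSm q (gev H / gev (mX l)).
    have [u|//] := OS_unit_or_max Oz; by case: (OSm_not_unit mz); apply: OSunitX.
  by rewrite Hp => /eqP; rewrite subr_eq0 => /eqP.
have [eG eGP] := choice key.
have h : exists e, homogeneous e (\prod_i (eG i).2 * mX l : form).
  exists (\sum_i (eG i).1 + 1)%N; apply: homogeneousM; last exact: homogeneousX.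
  elim/big_rec2: _ => [|i e P _ Pe]; first exact: homogeneous1.
  by apply: homogeneousM => //; case: (eGP i).
have [e eh] := h; exists e, (\prod_i (eG i).2 * mX l); split=> //.
  rewrite rmorphM rmorph_prod /= ptX pl mulr1; apply/prodf_neq0 => i _.
  by case: (eGP i).
move=> q qS; rewrite rmorphM rmorph_prod mulf_eq0 negb_or /= ptX => /andP[/prodf_neq0 G0 ql] mf mg.
apply: (onS_point qS pS) => i j.
have E i' : q 0 i' = p 0 i' * q 0 l by have [_ _] := eGP i'; apply=> //; apply: G0.
by rewrite (E i) (E j); ring.
Qed.

(** Each point has a neighbourhood without other common zeros, and finitely many of these
    neighbourhoods cover S. *)
Lemma finite_intersection (C C' : Div) : cartier C -> cartier C' ->
  (forall p, onS p -> exists m, lmult p (C p) (C' p) m) ->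
  exists s : seq pt, forall q, onS q -> OSm q (C q) -> OSm q (C' q) -> q \in s.
Proof.
move=> CC CC' H.
have /choice [G GP] : forall p, exists G : form, onS p -> pt_eval p G != 0 /\
    forall q, onS q -> pt_eval q G != 0 -> OSm q (C q) -> OSm q (C' q) -> q = p.
  move=> p; have [pS|] := pselect (onS p); last by exists 0.
  have [m mE] := H p pS.
  have [e [G [Ge Gp Gq]]] := isolated_zero pS (fun z => local_mult_power pS mE).
  have [e1 [g1 [g1e _ g1p g1q]]] := cartier_local CC pS.
  have [e2 [g2 [g2e _ g2p g2q]]] := cartier_local CC' pS.
  exists (G * g1 * g2) => _; split; first by rewrite !rmorphM !mulf_neq0.
  move=> q qS; rewrite !rmorphM !mulf_eq0 !negb_or => /andP[/andP[q0 q1] q2] m1 m2.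
  apply: Gq => //.
    rewrite -(divfK (cartier_neq0 CC qS) (C p)); apply: OSmM => //; exact/OSunit_OS/g1q.
  rewrite -(divfK (cartier_neq0 CC' qS) (C' p)); apply: OSmM => //; exact/OSunit_OS/g2q.
have [s sS scov] := @finite_cover _ _ _ S G (fun p pS => (GP p pS).1).
exists s => q qS m1 m2; have [p ps pG] := scov q qS.
by rewrite ((GP p (sS p ps)).2 q qS pG m1 m2).
Qed.

End LocalMultiplicity.

(** * Intersection numbers *)

Section Intersections.
Variables (k : fieldType) (kb : closedFieldType) (iota : {rmorphism k -> kb}).
Variable S : smooth_projective_surface iota.

Local Notation K := (fun_field S).
Local Notation N := (dim_amb S).
Local Notation form := (mpol kb N.+1).
Local Notation pt := 'rV[kb]_N.+1.
Local Notation emb := (fun_emb S).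
Local Notation x := (gen_pt S).
Local Notation gev := (gen_eval emb x).
Local Notation OSm p := (local_max emb x p).
Local Notation Div := (divisor S).
Variables (B : Div -> Div -> int) (d : nat) (phi : Div -> lattice d).
Hypothesis BP : intersection_form B.
Hypothesis phiP : marking B phi.

Local Notation n := (9 - d)%N.
Local Notation lf := (@lform n int).
Local Notation antican := (anticanonical n int).
Local Notation exc := (@exceptional n).
Local Notation lmult p f g m := (@local_mult _ _ _ S p f g m).
Implicit Types (p q : pt) (C D E A : Div).

Lemma phi_add D E : cartier D -> cartier E -> phi (div_add D E) = phi D + phi E.
Proof. by case: phiP => h _ _ _ _; apply: h. Qed.

Lemma phi_lin_equiv D E : cartier D -> cartier E -> phi D = phi E <-> lin_equiv D E.
Proof. by case: phiP => _ h _ _ _; apply: h. Qed.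

Lemma phi_form D E : cartier D -> cartier E -> lf (phi D) (phi E) = B D E.
Proof. by case: phiP => _ _ _ h _; apply: h. Qed.

Lemma phi_onto v : exists2 D, cartier D & phi D = v.
Proof. by case: phiP. Qed.

Lemma phi_canonical Kc : canonical_divisor Kc -> phi (div_opp Kc) = antican.
Proof. by case: phiP => _ _ _ _ [h _]; apply: h. Qed.

Lemma phi_exceptional v : exc v <-> exists2 C, minus_one_curve B C & phi C = v.
Proof. by case: phiP => _ _ _ _ [_ h]; apply: h. Qed.

Lemma phi_div_eq D E : cartier D -> cartier E -> div_eq D E -> phi D = phi E.
Proof. by move=> DC EC DE; apply/phi_lin_equiv => //; apply: lin_equiv_div_eq. Qed.

Lemma phi_scale f D : f != 0 -> cartier D -> phi (fun p => f * D p) = phi D.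
Proof.
move=> f0 DC; apply/phi_lin_equiv => //; first exact: cartier_scale.
exists f => // p pS; apply: (div_eq_refl (cartier_scale f0 DC)) => //.
Qed.

Lemma phi_const f : f != 0 -> phi (fun=> f) = 0.
Proof.
move=> f0; have C1 : cartier (fun=> 1 : K) by apply: cartier_const; apply: oner_neq0.
have -> : phi (fun=> f) = phi (fun=> 1).
  by rewrite -(phi_scale f0 C1); congr phi; apply/funext => p; rewrite mulr1.
have /eqP : phi (fun=> 1) + phi (fun=> 1) = phi (fun=> 1).
  by rewrite -phi_add //; congr phi; apply/funext => p; rewrite /div_add mulr1.
by rewrite -subr_eq0 addrK => /eqP.
Qed.

Lemma phi_opp D : cartier D -> phi (div_opp D) = - phi D.
Proof.
move=> DC; have DC' := cartier_inv DC; apply/eqP; rewrite -addr_eq0 -phi_add //.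
rewrite -(phi_const (oner_neq0 K)); apply/eqP; apply: phi_div_eq.
- exact: cartier_mul.
- exact/cartier_const/oner_neq0.
- by move=> p pS; rewrite /div_add /div_opp mulVf ?cartier_neq0 // divr1; apply: OSunit1.
Qed.

Lemma phi_prod m (C : 'I_m -> Div) : (forall i, cartier (C i)) ->
  phi (fun p => \prod_i C i p) = \sum_i phi (C i).
Proof.
elim: m C => [|m IH] C CC.
  rewrite big_ord0 -(phi_const (oner_neq0 K)); congr phi.
  by apply/funext => p; rewrite big_ord0.
rewrite big_ord_recl -IH // -phi_add //; last exact: cartier_prod.
by congr phi; apply/funext => p; rewrite big_ord_recl.
Qed.

Lemma phi_muln m D : cartier D -> phi (div_muln m D) = phi D *+ m.
Proof.
move=> DC; have -> : div_muln m D = fun p => \prod_(i < m) D p.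
  by apply/funext => p; rewrite prodr_const card_ord.
by rewrite phi_prod // sumr_const card_ord.
Qed.

Lemma phi_prime_sum D m (C : 'I_m -> Div) : cartier D -> prime_sum D C ->
  phi D = \sum_i phi (C i).
Proof.
move=> DC [Cp DE]; have CC i := prime_cartier (Cp i).
by rewrite -phi_prod //; apply: phi_div_eq => //; apply: cartier_prod.
Qed.

(** The sum may run over any list containing a fixed finite set of points, so that several
    intersection numbers can be compared over one list. *)
Lemma prime_intersection C C' : prime_divisor C -> prime_divisor C' -> ~ div_eq C C' ->
  exists m : pt -> nat, (forall p, onS p -> lmult p (C p) (C' p) (m p)) /\
    exists s0 : seq pt, forall s, uniq s -> (forall q, q \in s -> onS q) ->
      {subset [seq q <- s0 | `[< onS q >]] <= s} ->
      lf (phi C) (phi C') = \sum_(q <- s) (m q)%:Z.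
Proof.
move=> Cp C'p CC'; have CC := prime_cartier Cp; have CC0 := prime_cartier C'p.
case: BP => _ _ _ /(_ C C' Cp C'p CC') [m mP BE]; exists m; split=> //.
have [s0 s0P] := finite_intersection CC CC0 (fun p pS => ex_intro _ _ (mP p pS)).
exists s0 => s us sS s0s; rewrite phi_form // BE (fsbigE s _ us) //.
- rewrite big_seq_cond [RHS]big_seq; apply: eq_bigl => q.
  by case: (boolP (q \in s)) => //= qs; apply/asboolP; apply: sS.
- move=> q qS qs.
  have [u|mC] := OS_unit_or_max (prime_effective Cp qS).
    by rewrite (local_mult_unit qS (or_introl u) (mP q qS)).
  have [u|mC'] := OS_unit_or_max (prime_effective C'p qS).
    by rewrite (local_mult_unit qS (or_intror u) (mP q qS)).
  case/negP: qs; apply: s0s; rewrite mem_filter s0P // andbT; exact/asboolP.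
Qed.

Lemma cover_seq (s0 : seq pt) : exists s, [/\ uniq s, forall q, q \in s -> onS q &
  {subset [seq q <- s0 | `[< onS (S := S) q >]] <= s}].
Proof.
exists (undup [seq q <- s0 | `[< onS q >]]); split; rewrite ?undup_uniq //.
  by move=> q; rewrite mem_undup mem_filter => /andP[/asboolP].
by move=> q; rewrite mem_undup.
Qed.

Lemma prime_intersection_ge0 C C' : prime_divisor C -> prime_divisor C' -> ~ div_eq C C' ->
  0 <= lf (phi C) (phi C').
Proof.
move=> Cp C'p CC'; have [m [_ [s0 sP]]] := prime_intersection Cp C'p CC'.
have [s [us sS ss]] := cover_seq s0.
by rewrite (sP s us sS ss); apply: sumr_ge0 => q _; rewrite lez_nat.
Qed.

Lemma prime_intersection_gt0 C C' q : prime_divisor C -> prime_divisor C' -> ~ div_eq C C' ->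
  onS q -> OSm q (C q) -> OSm q (C' q) -> 0 < lf (phi C) (phi C').
Proof.
move=> Cp C'p CC' qS mC mC'; have [m [mP [s0 sP]]] := prime_intersection Cp C'p CC'.
have [s [us sS ss]] := cover_seq (q :: s0).
have qs : q \in s.
  by apply: ss; rewrite mem_filter inE eqxx andbT; apply/asboolP.
have s0s : {subset [seq q <- s0 | `[< onS q >]] <= s}.
  move=> q'; rewrite mem_filter => /andP[q'S q's]; apply: ss.
  by rewrite mem_filter q'S inE q's orbT.
rewrite (sP s us sS s0s) (bigD1_seq q) //= ltr_wpDr //.
  by apply: sumr_ge0 => q' _; rewrite lez_nat.
by rewrite ltz_nat; apply: (local_mult_gt0 qS mC mC' (mP q qS)).
Qed.

Lemma prime_intersection_meet C C' : prime_divisor C -> prime_divisor C' -> ~ div_eq C C' ->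
  lf (phi C) (phi C') != 0 -> exists q, [/\ onS q, OSm q (C q) & OSm q (C' q)].
Proof.
move=> Cp C'p CC'; have [m [mP [s0 sP]]] := prime_intersection Cp C'p CC'.
have [s [us sS ss]] := cover_seq s0; rewrite (sP s us sS ss) => ne0.
apply: contrapT => N0; move/eqP: ne0; apply; rewrite big_seq big1 // => q /sS qS.
have [u|mC] := OS_unit_or_max (prime_effective Cp qS).
  by rewrite (local_mult_unit qS (or_introl u) (mP q qS)).
have [u|mC'] := OS_unit_or_max (prime_effective C'p qS).
  by rewrite (local_mult_unit qS (or_intror u) (mP q qS)).
by case: N0; exists q.
Qed.

Lemma prime_nonunit C : prime_divisor C -> exists q, onS q /\ OSm q (C q).
Proof.
move=> [CC CE C0 _]; apply: contrapT => N0; apply: C0 => p pS.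
by have [//|mC] := OS_unit_or_max (CE p pS); case: N0; exists p.
Qed.

Lemma div_eq_unit C D q : div_eq C D -> onS q -> OSunit q (C q) -> cartier C -> OSunit q (D q).
Proof.
move=> CD qS u CC; have C0 := cartier_neq0 CC qS.
have := OSunitM (OSunitV (CD q qS)) u; rewrite invf_div divfK //.
Qed.

Lemma prod_OSm m (f : 'I_m -> K) q : onS q -> (forall i, OS q (f i)) ->
  OSm q (\prod_i f i) -> exists i, OSm q (f i).
Proof.
move=> qS fO mf; apply: contrapT => N0; apply: (OSm_not_unit mf).
apply: (big_ind (OSunit q)) => [||i _]; [exact: OSunit1 | exact: OSunitM |].
by have [//|m'] := OS_unit_or_max (fO i); case: N0; exists i.
Qed.

Lemma OSunit_factor a b q : OSunit q (a * b) -> OS q a -> OS q b -> OSunit q a.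
Proof.
move=> [ab0 _ Oab] Oa Ob; split=> //.
  by move: ab0; rewrite mulf_eq0 negb_or => /andP[].
have b0 : b != 0 by move: ab0; rewrite mulf_eq0 negb_or => /andP[].
have -> : a^-1 = b * (a * b)^-1.
  by have a0 : a != 0 by [move: ab0; rewrite mulf_eq0 negb_or => /andP[]]; field; rewrite a0 b0.
exact: OSM.
Qed.

Lemma prime_sum_unit D m (C : 'I_m -> Div) q : onS q -> prime_sum D C ->
  cartier D -> OSunit q (D q) -> forall i, OSunit q (C i q).
Proof.
move=> qS [Cp DE] DC uD i.
have uC : OSunit q (\prod_i C i q) := div_eq_unit DE qS uD DC.
rewrite (bigD1 i) //= in uC; apply: (OSunit_factor uC).
  exact: prime_effective (Cp i) q qS.
by apply: OS_prod => j _; apply: prime_effective (Cp j) q qS.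
Qed.

(** [C] passes through [q] and no component of [D] does, so all components meet [C] properly. *)
Lemma effective_avoid_ge0 D C q : cartier D -> effective D -> prime_divisor C ->
  onS q -> OSunit q (D q) -> OSm q (C q) -> 0 <= lf (phi D) (phi C).
Proof.
move=> DC DE Cp qS uD mC; have [m [E EP]] := effective_prime_sum DC DE.
rewrite (phi_prime_sum DC EP) lform_suml; apply: sumr_ge0 => i _.
apply: prime_intersection_ge0 => //; first by case: EP.
move=> EC; have u := prime_sum_unit qS EP DC uD i.
apply: (OSm_not_unit mC); apply: (div_eq_unit EC qS u).
by apply: prime_cartier; case: EP.
Qed.

Lemma minus_one_prime E : minus_one_curve B E -> prime_divisor E. Proof. by case. Qed.

Lemma minus_one_exceptional E : minus_one_curve B E -> exc (phi E).
Proof. by move=> Em; apply/phi_exceptional; exists E. Qed.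

Lemma prime_nef C : prime_divisor C ->
  (exists2 E, minus_one_curve B E & div_eq C E) \/ nef (phi C).
Proof.
move=> Cp; have [h|N0] := pselect (exists2 E, minus_one_curve B E & div_eq C E).
  by left.
right; apply/nef_int => v /phi_exceptional [E Em <-].
apply: prime_intersection_ge0 => //; first exact: minus_one_prime.
by move=> CE; apply: N0; exists E.
Qed.

End Intersections.

(** * Consequences of ampleness *)

Section DelPezzo.
Variables (k : fieldType) (kb : closedFieldType) (iota : {rmorphism k -> kb}).
Variable S : smooth_projective_surface iota.

Local Notation K := (fun_field S).
Local Notation N := (dim_amb S).
Local Notation form := (mpol kb N.+1).
Local Notation pt := 'rV[kb]_N.+1.
Local Notation emb := (fun_emb S).
Local Notation x := (gen_pt S).
Local Notation gev := (gen_eval emb x).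
Local Notation OSm p := (local_max emb x p).
Local Notation Div := (divisor S).
Variables (B : Div -> Div -> int) (d : nat) (phi : Div -> lattice d).
Hypothesis BP : intersection_form B.
Hypothesis phiP : marking B phi.
Hypothesis dP : del_pezzo B d.
Hypothesis d_le7 : (d <= 7)%N.

Local Notation n := (9 - d)%N.
Local Notation lf := (@lform n int).
Local Notation antican := (anticanonical n int).
Local Notation exc := (@exceptional n).
Local Notation ideal2 p f g := (local_ideal2 emb x p f g).
Implicit Types (p q : pt) (C D E A : Div).

Lemma n_ge2 : (2 <= n)%N. Proof. by move: d_le7; clear; lia. Qed.

Lemma mmap_homogeneous M (z : 'I_M -> K) e (F : mpol kb M) c : homogeneous e F ->
  mmap emb (fun i => c * z i) F = c ^+ e * mmap emb z F.
Proof.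
move=> Fe; rewrite /mmap mulr_sumr big_seq [RHS]big_seq; apply: eq_bigr => mu muF.
have <- : mdeg mu = e by apply: (homogeneousP Fe); rewrite -mcoeff_msupp.
rewrite mulrCA; congr (_ * _); rewrite /mmap1 mdegE -prodrXr -big_split /=.
by apply: eq_bigr => i _; rewrite exprMn.
Qed.

Lemma polynomial_congruence q (J : set K) M (a : 'I_M -> K) (c : 'I_M -> kb) (P : mpol kb M) :
  onS q -> OS_ideal q J -> (forall i, OS q (a i)) -> (forall i, J (a i - emb (c i))) ->
  OS q (mmap emb a P) /\ J (mmap emb a P - emb (meval c P)).
Proof.
move=> qS [J0 JD JM JO] aO aJ.
pose good (z : K) (w : kb) := OS q z /\ J (z - emb w).
have gC w : good (emb w) w by split; [exact: OS_emb | rewrite subrr].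
have gD z w z' w' : good z w -> good z' w' -> good (z + z') (w + w').
  move=> [Oz Jz] [Oz' Jz']; split; first exact: OSD.
  by rewrite rmorphD opprD addrACA; apply: JD.
have gM z w z' w' : good z w -> good z' w' -> good (z * z') (w * w').
  move=> [Oz Jz] [Oz' Jz']; split; first exact: OSM.
  have -> : z * z' - emb (w * w') = z * (z' - emb w') + emb w' * (z - emb w).
    by rewrite rmorphM; ring.
  by apply: JD; apply: (JM) => //; apply: OS_emb.
suff : good (mmap emb a P) (meval c P) by [].
rewrite /meval /mmap; apply: (big_ind2 good).
- by rewrite -(rmorph0 emb); apply: gC.
- by move=> *; apply: gD.
move=> mu _; apply: (gM); first exact: gC.
rewrite /mmap1; apply: (big_ind2 good).
- by rewrite -(rmorph1 emb); apply: gC.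
- by move=> *; apply: gM.
move=> i _; elim: (mu i) => [|e IH]; first by rewrite !expr0 -(rmorph1 emb); apply: gC.
by rewrite !exprS; apply: gM.
Qed.

Lemma prime_sum_divides D m (C : 'I_m -> Div) C0 i q : onS q -> prime_sum D C -> cartier C0 ->
  div_eq (C i) C0 -> OS q (D q / C0 q).
Proof.
move=> qS [Cp DE] C0C CC0.
have Ci0 := cartier_neq0 (prime_cartier (Cp i)) qS.
have pr0 : \prod_(j | j != i) C j q != 0.
  by apply/prodf_neq0 => j _; apply: cartier_neq0 (prime_cartier (Cp j)) qS.
have -> : D q / C0 q = (D q / \prod_i C i q) * (C i q / C0 q) * \prod_(j | j != i) C j q.
  by rewrite (bigD1 i) //=; field; rewrite (cartier_neq0 C0C qS) Ci0 pr0.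
apply: OSM; first by apply: OSM; apply: OSunit_OS; [apply: DE | apply: CC0].
by apply: OS_prod => j _; apply: prime_effective (Cp j) q qS.
Qed.

Lemma exists_sections : exists m, (0 < m)%N /\ exists H : Div, [/\ cartier H, phi H = antican *+ m
  & very_ample H] .
Proof.
case: dP => Kc [KcC [m m0 VA] _]; exists m; split=> //; exists (div_muln m (div_opp Kc)).
have KC : cartier (div_opp Kc) by apply: cartier_inv; case: KcC.
split=> //; first exact: cartier_muln.
by rewrite (phi_muln phiP) // (phi_canonical phiP KcC).
Qed.

Lemma antican_square : lf antican antican = d%:Z.
Proof.
case: dP => Kc [KcC _ <-]; have KC : cartier (div_opp Kc) by apply: cartier_inv; case: KcC.
by rewrite -(phi_form phiP KC KC) (phi_canonical phiP KcC).
Qed.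

Section Sections.
Variables (m : nat) (H : Div).
Hypothesis m_gt0 : (0 < m)%N.
Hypothesis HC : cartier H.
Hypothesis phiH : phi H = antican *+ m.
Hypothesis HVA : very_ample H.

Lemma avoiding_section q : onS q -> exists A, [/\ cartier A, effective A, phi A = antican *+ m &
  OSunit q (A q)].
Proof.
move=> qS; case: HVA => M [y yP]; have [_ [i yi] _] := yP q qS.
have yi0 : y i != 0 by apply: contraNneq (OSunit_neq0 yi) => ->; rewrite mul0r.
exists (fun p => y i * H p); split=> //; first exact: cartier_scale.
  by move=> p pS; have [h _ _] := yP p pS.
by rewrite (phi_scale phiP).
Qed.

Lemma lf_section (C : Div) : lf (antican *+ m) (phi C) = m%:R * lf antican (phi C).
Proof. by rewrite -scaler_nat lformZl. Qed.

(** A multiple of the anticanonical class has an effective representative avoiding a chosen point of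
    [C]. *)
Lemma prime_degree_ge0 C : prime_divisor C -> 0 <= lf antican (phi C).
Proof.
move=> Cp; have [q [qS mq]] := prime_nonunit Cp.
have [A [AC AE Aphi uA]] := avoiding_section qS.
have := effective_avoid_ge0 BP phiP AC AE Cp qS uA mq.
by rewrite Aphi lf_section pmulr_rge0 // ltr0n.
Qed.

(** The divisor of a section has degree 0 on [C]. If it passed through a point of [C] without
    containing [C], this degree would be positive. *)
Lemma section_through C q s : prime_divisor C -> lf antican (phi C) = 0 -> onS q ->
  OSm q (C q) -> (forall p, onS p -> OS p (s * H p)) -> OSm q (s * H q) ->
  forall p, onS p -> OS p (s * H p / C p).
Proof.
move=> Cp C0 qS mC sO ms p pS.
have [->|s0] := eqVneq s 0; first by rewrite !mul0r; apply: OS0.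
pose A := (fun p => s * H p) : Div.
have AC : cartier A by apply: cartier_scale.
have [k0 [E EP]] := effective_prime_sum AC sO.
have [[i EC]|N0] := pselect (exists i, div_eq (E i) C).
  exact: (prime_sum_divides pS EP (prime_cartier Cp) EC).
exfalso; have Ep i : prime_divisor (E i) by case: EP.
have ge0 i : 0 <= lf (phi (E i)) (phi C).
  by apply: (prime_intersection_ge0 BP phiP) => // EC; apply: N0; exists i.
have : lf (phi A) (phi C) = 0 by rewrite (phi_scale phiP) // phiH lf_section C0 mulr0.
rewrite (phi_prime_sum phiP AC EP) lform_suml => /eqP; rewrite psumr_eq0 => [/allP all0|i _ //].
have mE : OSm q (\prod_i E i q).
  have [_ AE] := EP; have := div_eq_sym AE qS => u.
  rewrite -(divfK (cartier_neq0 AC qS) (\prod_i E i q)).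
  exact: OSmM (OSunit_OS u) ms.
have [i mi] := prod_OSm qS (fun i => prime_effective (Ep i) qS) mE.
have NC : ~ div_eq (E i) C by move=> h; apply: N0; exists i.
have := prime_intersection_gt0 BP phiP (Ep i) Cp NC qS mi mC.
by rewrite (eqP (all0 i (mem_index_enum i))) ltxx.
Qed.

(** If K^2 = 0, every component of a multiple of -K has degree 0, and one of them, [C], meets a
    (-1)-curve [E] without being equal to it. The embedding contracts [C], as sections through a
    point of [C] contain all of [C]. So every function vanishing at that point is divisible by [C],
    in particular the equation of [E], contradicting that [E] is prime. *)
Lemma degree_pos_of_zero : d = 0%N -> False.
Proof.
move=> d0; have n2 := n_ge2.
have i0 : 'I_n by exists 0; apply: leq_trans n2.
have [E Em phiE] := (phi_exceptional phiP _).1 (exceptional_point i0).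
have Ep := minus_one_prime Em.
have [KE _] := exceptional_point i0; rewrite -phiE in KE.
have [q0 [q0S mE0]] := prime_nonunit Ep.
(* Since [A] avoids the point [q0] of [E], no component of [A] is [E]. *)
have [A [AC AE Aphi uA]] := avoiding_section q0S.
have [k0 [Aj AP]] := effective_prime_sum AC AE.
have Ajp i : prime_divisor (Aj i) by case: AP.
have AjE i : ~ div_eq (Aj i) E.
  move=> h; apply: (OSm_not_unit mE0).
  exact: (div_eq_unit h q0S (prime_sum_unit q0S AP AC uA i) (prime_cartier (Ajp i))).
have AE_m : \sum_i lf (phi (Aj i)) (phi E) = m%:R.
  by rewrite -lform_suml -(phi_prime_sum phiP AC AP) Aphi lf_section KE mulr1.
have [j jE] : exists j, lf (phi (Aj j)) (phi E) != 0.
  apply: contrapT => N0; have : m%:R = 0 :> int.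
    rewrite -AE_m big1 // => i _; apply/eqP/negPn/negP => h; apply: N0; by exists i.
  by move/eqP; rewrite pnatr_eq0 gtn_eqF.
have [q [qS mC mE]] := prime_intersection_meet BP phiP (Ajp j) Ep (AjE j) jE.
set C := Aj j in mC; have Cp : prime_divisor C := Ajp j.
have C0 : lf antican (phi C) = 0.
  have : \sum_i lf antican (phi (Aj i)) = 0.
    rewrite -lform_sumr -(phi_prime_sum phiP AC AP) Aphi -scaler_nat lformZr antican_square d0.
    by rewrite mulr0.
  move/eqP; rewrite psumr_eq0 => [/allP all0|i _]; last exact: prime_degree_ge0.
  exact: (eqP (all0 j (mem_index_enum j))).
have through s := section_through Cp C0 qS mC (s := s).
case: HVA => M [y yP].
have [yO [i1 u1] yf] := yP q qS.
have y1 : y i1 != 0 by apply: contraNneq (OSunit_neq0 u1) => ->; rewrite mul0r.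
have Hq0 := cartier_neq0 HC qS.
pose a i := y i / y i1.
have aE i p : onS p -> a i = y i * H p / (y i1 * H p).
  by move=> pS; rewrite /a; have := cartier_neq0 HC pS => ?; field; apply/andP.
have aO i : OS q (a i).
  by rewrite (aE i q qS); apply: OSM => //; apply/OSunit_OS/OSunitV.
have [c cP] := choice (fun i => OS_value qS (aO i)).
(* The sections [s i] vanish at [q], hence along [C]; so the affine coordinates [a i] are constant
   modulo [C]. *)
pose s i := y i - emb (c i) * y i1.
have sO i p : onS p -> OS p (s i * H p).
  move=> pS; have [h _ _] := yP p pS.
  by rewrite /s mulrBl -mulrA; apply: (OSB pS) => //; apply: OSM => //; apply: OS_emb.
have smq i : OSm q (s i * H q).
  have -> : s i * H q = (y i1 * H q) * (a i - emb (c i)).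
    by rewrite /s /a; field.
  by apply: OSmM => //; apply: OSunit_OS.
have sC i p : onS p -> OS p (s i * H p / C p) := through (s i) (sO i) (smq i) p.
have homE e (F : mpol kb M.+1) : homogeneous e F ->
    gen_eval emb y F = y i1 ^+ e * mmap emb a F.
  move=> Fe; rewrite -(mmap_homogeneous _ _ Fe) /gen_eval; congr (mmap _ _ F).
  by apply/funext => i; rewrite /a mulrC divfK.
have cq p (J : set K) (F : mpol kb M.+1) : onS p -> OS_ideal p J ->
    (forall z, OS p z -> J (z * C p)) -> OSunit p (y i1 * H p) ->
    OS p (mmap emb a F) /\ J (mmap emb a F - emb (meval c F)).
  move=> pS JI JC up; apply: polynomial_congruence => // i.
    by rewrite (aE i p pS); apply: OSM; [case: (yP p pS) | apply/OSunit_OS/OSunitV].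
  have -> : a i - emb (c i) = ((y i1 * H p)^-1 * (s i * H p / C p)) * C p.
    have := cartier_neq0 HC pS; have := cartier_neq0 (prime_cartier Cp) pS => hC hH.
    by rewrite /a /s; field; rewrite y1 hC hH.
  by apply: JC; apply: OSM => //; [apply/OSunit_OS/OSunitV | apply: sC].
have idC p : onS p -> OS_ideal p [set z | OS p (z / C p)].
  move=> pS; split=> /=; first by rewrite mul0r; apply: OS0.
  - by move=> z w hz hw; rewrite mulrDl; apply: OSD.
  - by move=> z w Oz hw; rewrite -mulrA; apply: OSM.
  - move=> z hz; rewrite -(divfK (cartier_neq0 (prime_cartier Cp) pS) z).
    by apply: OSM => //; apply: prime_effective Cp p pS.
have JC p z : onS p -> OS p z -> OS p (z * C p / C p).
  by move=> pS Oz; rewrite mulfK // (cartier_neq0 (prime_cartier Cp)).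
(* The closed immersion writes [f] as a quotient of polynomials in the [a i]; as [f] vanishes at
   [q], the numerator vanishes at [c]. *)
have fq f : OSm q f -> exists F G : mpol kb M.+1,
    [/\ f = mmap emb a F / mmap emb a G, meval c G != 0 & meval c F = 0].
  move=> mf; have [e [F [G [Fe Ge uG fE]]]] := yf f (OSm_OS mf).
  have [OG JG] := cq q _ G qS (idC q qS) (fun z => JC q z qS) u1.
  have [OF JF] := cq q _ F qS (idC q qS) (fun z => JC q z qS) u1.
  have {}fE : f = mmap emb a F / mmap emb a G.
    rewrite fE (homE _ _ Fe) (homE _ _ Ge) -mulf_div mulfV ?mul1r // expf_neq0 //.
  have J2m z : OS q (z / C q) -> OSm q z.
    move=> h; rewrite -(divfK (cartier_neq0 (prime_cartier Cp) qS) z); exact: OSmM.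
  have uG' : OSunit q (mmap emb a G).
    have -> : mmap emb a G = gen_eval emb y G * H q ^+ e / (y i1 * H q) ^+ e.
      by rewrite (homE _ _ Ge) exprMn; field; rewrite !expf_neq0.
    by apply: OSunit_div => //; apply: OSunitX.
  have G0 : meval c G != 0.
    apply/eqP => h; apply: (OSm_not_unit _ uG').
    by have := J2m _ JG; rewrite h rmorph0 subr0.
  exists F, G; split=> //; apply: (OSm_emb (p := q)).
  have mF : OSm q (mmap emb a F).
    rewrite -(divfK (OSunit_neq0 uG') (mmap emb a F)) -fE mulrC; apply: OSmM => //.
  by have := OSmB qS mF (J2m _ JF); rewrite opprB addrC subrK.
(* [C] is concentrated at [q]: at another point of [C] the coordinates would take the same values
   [c], so a linear form through [q] and not through [q'] would vanish at [q']. *)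
have CU q' : onS q' -> q' != q -> OSunit q' (C q').
  move=> q'S q'q; have [//|mC'] := OS_unit_or_max (prime_effective Cp q'S); exfalso.
  have [i [j0 ij]] : exists i j, q' 0 i * q 0 j != q' 0 j * q 0 i.
    apply: contrapT => N0; move/eqP: q'q; apply; apply: (onS_point q'S qS) => i j0.
    by apply/eqP/negPn/negP => h; apply: N0; exists i, j0.
  pose l : mpol kb N.+1 := q 0 j0 *: mX i - q 0 i *: mX j0.
  have l1 : homogeneous 1 l.
    by apply: homogeneousB; apply: homogeneousZ; apply: homogeneousX.
  have [L [L1 Lq]] := exists_avoiding qS.
  have lq : pt_eval q l = 0 by rewrite rmorphB /= !ptZ !ptX; ring.
  have lq' : pt_eval q' l != 0.
    by rewrite rmorphB /= !ptZ !ptX subr_eq0 mulrC [X in _ != X]mulrC.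
  have [F [G [fE G0 F0]]] := fq _ ((OSm_frac qS l1 L1 Lq).2 lq).
  have u1' : OSunit q' (y i1 * H q').
    have [yO' [i2 u2] _] := yP q' q'S; have [//|m1] := OS_unit_or_max (yO' i1).
    exfalso; apply: (OSm_not_unit _ u2).
    have -> : y i2 * H q' = s i2 * H q' / C q' * C q' + emb (c i2) * (y i1 * H q').
      by rewrite divfK ?(cartier_neq0 (prime_cartier Cp)) // /s; ring.
    by apply: (OSmD q'S); apply: OSmM => //; [apply: sC | apply: OS_emb].
  have J2m z : OS q' (z / C q') -> OSm q' z.
    move=> h; rewrite -(divfK (cartier_neq0 (prime_cartier Cp) q'S) z); exact: OSmM.
  have [OG JG] := cq q' _ G q'S (idC q' q'S) (fun z => JC q' z q'S) u1'.
  have [OF JF] := cq q' _ F q'S (idC q' q'S) (fun z => JC q' z q'S) u1'.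
  have uG := OS_value_unit q'S OG (J2m _ JG) G0.
  have mF : OSm q' (mmap emb a F) by have := J2m _ JF; rewrite F0 rmorph0 subr0.
  have mf : OSm q' (gev l / gev L).
    by rewrite fE mulrC; apply: OSmM => //; apply/OSunit_OS/OSunitV.
  apply: (OSm_not_unit _ (OSunit1 q')).
  have -> : 1 = gev L / gev l * (gev l / gev L).
    by rewrite mulf_div [gev l * _]mulrC mulfV // mulf_neq0 ?(onS_neq0 q'S l1) ?(onS_neq0 qS L1).
  by apply: OSmM => //; apply: (OS_frac L1 l1).
(* At [q] the equation of [E] falls under [fq], so [C] divides it; elsewhere [C] is trivial. *)
have EC : effective (div_add E (div_opp C)).
  move=> p pS; rewrite /div_add /div_opp.
  have [->|pq] := eqVneq p q; last first.
    by apply: OSM; [apply: prime_effective Ep p pS | apply/OSunit_OS/OSunitV/CU].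
  have [F [G [fE G0 F0]]] := fq _ mE.
  have [OG JG] := cq q _ G qS (idC q qS) (fun z => JC q z qS) u1.
  have [_] := cq q _ F qS (idC q qS) (fun z => JC q z qS) u1.
  rewrite F0 rmorph0 subr0 /= => JF; rewrite fE mulrAC; apply: OSM => //.
  have J2m z : OS q (z / C q) -> OSm q z.
    move=> h; rewrite -(divfK (cartier_neq0 (prime_cartier Cp) qS) z); exact: OSmM.
  by apply/OSunit_OS/OSunitV; apply: (OS_value_unit qS OG (J2m _ JG) G0).
have CC := prime_cartier Cp; have ECar := prime_cartier Ep.
have ECC : cartier (div_add E (div_opp C)) by apply: cartier_mul => //; apply: cartier_inv.
have E_eq : div_eq E (div_add C (div_add E (div_opp C))).
  move=> p pS; have -> : div_add C (div_add E (div_opp C)) p = E p.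
    by rewrite /div_add /div_opp mulrCA mulfV ?mulr1 // cartier_neq0.
  by rewrite mulfV ?cartier_neq0 //; apply: OSunit1.
have [_ _ _ /(_ _ _ CC (prime_effective Cp) ECC EC E_eq)] := Ep.
case=> [Cz|ECz]; first by apply: (OSm_not_unit mC); apply: Cz.
apply: (AjE j); move=> p pS; have := OSunitV (ECz p pS).
by rewrite /div_add /div_opp invfM invrK mulrC.
Qed.

End Sections.

Lemma d_gt0 : (0 < d)%N.
Proof.
have [m [m0 [H [HC phiH HVA]]]] := exists_sections.
by rewrite lt0n; apply/eqP => /(degree_pos_of_zero m0 HC phiH HVA).
Qed.

Lemma n_le8 : (n <= 8)%N. Proof. by have := d_gt0; lia. Qed.

End DelPezzo.

(** * Regular sequences and additivity of local multiplicities *)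

Section RegularSequences.
Variables (k : fieldType) (kb : closedFieldType) (iota : {rmorphism k -> kb}).
Variable S : smooth_projective_surface iota.

Local Notation K := (fun_field S).
Local Notation N := (dim_amb S).
Local Notation form := (mpol kb N.+1).
Local Notation pt := 'rV[kb]_N.+1.
Local Notation emb := (fun_emb S).
Local Notation x := (gen_pt S).
Local Notation gev := (gen_eval emb x).
Local Notation OSm p := (local_max emb x p).
Local Notation Div := (divisor S).
Variables (B : Div -> Div -> int) (d : nat) (phi : Div -> lattice d).
Hypothesis BP : intersection_form B.
Hypothesis phiP : marking B phi.
Hypothesis dP : del_pezzo B d.
Hypothesis d_le7 : (d <= 7)%N.

Local Notation n := (9 - d)%N.
Local Notation lf := (@lform n int).
Local Notation antican := (anticanonical n int).
Local Notation exc := (@exceptional n).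
Local Notation ideal2 p f g := (local_ideal2 emb x p f g).
Local Notation lmult p f g m := (@local_mult _ _ _ S p f g m).
Implicit Types (p q : pt) (C D E A : Div).

Let n2 : (2 <= n)%N := n_ge2 d_le7.
Let n8 : (n <= 8)%N := n_le8 BP phiP dP d_le7.

(** A prime divisor of class 0 would be the divisor of a global function, which is constant. *)
Lemma prime_class_neq0 C : prime_divisor C -> phi C != 0.
Proof.
move=> Cp; apply/eqP => C0; have CC := prime_cartier Cp.
have C1 : cartier (fun=> 1 : K) by apply: cartier_const; apply: oner_neq0.
have /(phi_lin_equiv phiP CC C1) [f f0 fC] : phi C = phi (fun=> 1).
  by rewrite C0 (phi_const phiP) ?oner_eq0.
have [q qS|c cE] := @global_function_const _ _ _ S f.
  have := fC q qS; rewrite mulr1 => u; have Cq0 := cartier_neq0 CC qS.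
  have -> : f = C q * (C q / f)^-1 by field; rewrite f0.
  by apply: OSM; [apply: prime_effective Cp q qS | apply/OSunit_OS/OSunitV].
have [q [qS mq]] := prime_nonunit Cp; apply: (OSm_not_unit mq).
have := fC q qS; rewrite mulr1 => u; rewrite -(divfK f0 (C q)).
by apply: OSunitM => //; rewrite cE; apply: OSunit_emb; move: f0; rewrite cE fmorph_eq0.
Qed.

(** A curve of degree 0 is not a (-1)-curve, so it is nef and has nonnegative square; the index
    theorem then makes its class 0. *)
Lemma prime_degree_gt0 C : prime_divisor C -> 0 < lf antican (phi C).
Proof.
move=> Cp; have [m [m0 [H [HC phiH HVA]]]] := exists_sections phiP dP.
rewrite lt_def (prime_degree_ge0 BP phiP m0 HC phiH HVA Cp) andbT.
apply/eqP => C0; have := prime_class_neq0 Cp; apply/negP; rewrite negbK; apply/eqP.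
case: (prime_nef BP phiP Cp) => [[E Em CE]|Nef].
  have Ep := minus_one_prime Em; have [KE _] := minus_one_exceptional phiP Em.
  by move: C0; rewrite (phi_div_eq phiP (prime_cartier Cp) (prime_cartier Ep) CE) KE.
apply: (anticanonical_orthogonal n2 n8 C0).
by have := nef_pairing n2 n8 Nef Nef; rewrite toR_int.
Qed.

(** Otherwise K would equal [kb], and no local equation could vanish anywhere. *)
Lemma maximal_ideal_neq0 p : onS p -> exists2 z, OSm p z & z != 0.
Proof.
move=> pS; apply: contrapT => N0.
have m0 z : OSm p z -> z = 0.
  by move=> mz; apply/eqP/negPn/negP => z0; apply: N0; exists z.
have OSc z : OS p z -> exists c, z = emb c.
  by move=> /(OS_value pS) [c /m0 /eqP]; rewrite subr_eq0 => /eqP; exists c.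
have [L [L1 Lp]] := exists_avoiding pS.
have Kc z : exists c, z = emb c.
  have [e [F [G [Fe Ge G0 ->]]]] := fun_field_gen z.
  have h : homogeneous e (L ^+ e) by rewrite -{1}[e]mul1n; apply: homogeneous_exp.
  have Lep : pt_eval p (L ^+ e) != 0 by rewrite rmorphXn expf_neq0.
  have [a aE] := OSc _ (OS_frac Fe h Lep); have [b bE] := OSc _ (OS_frac Ge h Lep).
  have L0 := onS_neq0 pS h Lep.
  by exists (a / b); rewrite fmorph_div /= -aE -bE; field; rewrite L0 G0.
have [E Em _] := (phi_exceptional phiP _).1 (exceptional_point (Ordinal (leq_trans (isT : 0 < 2)%N n2))).
have Ep := minus_one_prime Em; have [q [qS mq]] := prime_nonunit Ep.
have [c cE] := Kc (E q); apply: (OSm_not_unit mq); rewrite cE; apply: OSunit_emb.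
by have := cartier_neq0 (prime_cartier Ep) qS; rewrite cE fmorph_eq0.
Qed.

(* Krull's intersection theorem for the principal maximal ideal of OS p / (u). *)
Lemma power_of_second_parameter p u v s t : onS p -> regular_params emb x p u v ->
  OS p s -> OS p t -> v * s = u * t -> ~ (exists2 s', OS p s' & s = u * s') ->
  exists e w, OS p w /\ v ^+ e = u * w.
Proof.
move=> pS uv Os Ot vs ns; apply: contrapT => N0.
have Ou : OSm p u.
  by rewrite uv; exists 1, 0; rewrite mul1r mul0r addr0; split; [apply: OS1 | apply: OS0 |].
have Ov : OSm p v.
  by rewrite uv; exists 0, 1; rewrite mul1r mul0r add0r; split; [apply: OS0 | apply: OS1 |].
(* A unit among these elements would put a power of [v] into (u). Any other one can be divided by
   [v] modulo [u], with a quotient of the same kind. *)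
pose good z := [/\ OS p z, ~ (exists2 w, OS p w & z = u * w) &
  exists e w, OS p w /\ v ^+ e * z = u * w].
have step z : exists z' : K, good z -> good z' /\ exists2 a, OS p a & z = a * u + v * z'.
  have [[Oz nz [e [w [Ow ew]]]]|ng] := pselect (good z); last by exists 0.
  have [uz|] := OS_unit_or_max Oz.
    exfalso; apply: N0; exists e, (w / z); split.
      by apply: OSM => //; apply/OSunit_OS/OSunitV.
    by have z0 := OSunit_neq0 uz; apply: (mulIf z0); rewrite ew; field.
  rewrite uv => -[a [b [Oa Ob zE]]]; exists b => _; split; last first.
    by exists a => //; rewrite zE [b * v]mulrC.
  split=> // [[w' Ow' bE]|].
    by apply: nz; exists (a + w' * v); [apply: OSD => //; apply: OSM => //; exact: OSm_OS|];
      rewrite zE bE; ring.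
  exists e.+1, (w - v ^+ e * a); split.
    by apply: OSB => //; apply: OSM => //; apply: OSX; exact: OSm_OS.
  by rewrite mulrBr -ew zE exprS; ring.
have [h hP] := choice step.
pose c i := iter i h s.
have cg i : good (c i).
  elim: i => [|i IH]; last by have [] := hP _ IH.
  by split=> //; exists 1, t; rewrite expr1.
(* When the ideals generated by [u] and [c i] stabilize, [c i.+1] is a multiple of [v * c i.+1]
   modulo [u]; as 1 minus a multiple of [v] is a unit, it lies in (u). *)
have [||i iE] := @OS_acc _ _ _ S p (fun i => ideal2 p u (c i)) pS.
- by move=> i; apply: OS_ideal2 => //; [exact: OSm_OS | case: (cg i)].
- move=> i; have [_ [a Oa E]] := hP _ (cg i).
  apply: ideal2_sub => //; first by rewrite -[X in ideal2 _ _ _ X]mul1r; apply: ideal2l => //; apply: OS1.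
  exists a, v; split=> //; first by exact: OSm_OS.
have [_ [a Oa E]] := hP _ (cg i).
have [|a' [b' [Oa' Ob' E']]] := iE (c i.+1).
  by rewrite -[X in ideal2 _ _ _ X]mul1r; apply: ideal2r => //; apply: OS1.
have [Oc nc _] := cg i.+1; apply: nc.
have U : OSunit p (1 - b' * v).
  by apply: (OSunitD pS (OSunit1 p)); apply: OSmN; apply: OSmM.
exists ((a' + b' * a) / (1 - b' * v)).
  by apply: OSM; [apply: OSD => //; apply: OSM | apply/OSunit_OS/OSunitV].
have U0 := OSunit_neq0 U.
apply: (mulIf U0); rewrite -mulrA divfK //.
rewrite -/(c i.+1) in E.
have -> : c i.+1 * (1 - b' * v) = c i.+1 - b' * (v * c i.+1) by ring.
have -> : v * c i.+1 = c i - a * u by rewrite E addrC addKr.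
rewrite {1}E'; ring.
Qed.

(* If some power of v were in (u), then u would be the local equation of a divisor
   supported at the point p, of anticanonical degree 0. *)
Lemma parameter_not_in_radical p u v e w : onS p -> regular_params emb x p u v ->
  OS p w -> v ^+ e = u * w -> u != 0 -> False.
Proof.
move=> pS uv Ow vu u0.
have mu : OSm p u.
  by rewrite uv; exists 1, 0; rewrite mul1r mul0r addr0; split; [apply: OS1 | apply: OS0 |].
have mv : OSm p v.
  by rewrite uv; exists 0, 1; rewrite mul1r mul0r add0r; split; [apply: OS0 | apply: OS1 |].
(* All elements of the maximal ideal are nilpotent modulo [u], so [p] is an isolated zero of [u]. *)
have pow z : OSm p z -> exists k0, ideal2 p u u (z ^+ k0).
  rewrite uv => -[a [b [Oa Ob zE]]]; exists e.
  have [c Oc cE] : exists2 c, OS p c & z ^+ e = c * u + (b * v) ^+ e.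
    rewrite zE; elim: (e) => [|k0 [c Oc cE]]; first by exists 0; [apply: OS0 | rewrite mul0r add0r].
    exists (a * (c * u + (b * v) ^+ k0) + b * v * c).
      have OsX : OS p ((b * v) ^+ k0) by apply: OSX; apply: OSM => //; exact: OSm_OS.
      apply: OSD => //; first by apply: OSM => //; apply: OSD => //; apply: OSM => //; exact: OSm_OS.
      by apply: OSM => //; apply: OSM => //; exact: OSm_OS.
    by rewrite !exprS cE; ring.
  exists (c + b ^+ e * w), 0; split; last by rewrite cE exprMn vu; ring.
    by apply: OSD => //; apply: OSM => //; apply: OSX.
  exact: OS0.
have [eG [G [Ge Gp Gq]]] := isolated_zero pS pow.
(* This is Cartier because [u] is a unit at all other points of a neighbourhood of [p]. *)
pose Cu : Div := fun q => if q == p then u else 1.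
have Cup : Cu p = u by rewrite /Cu eqxx.
have Cuq q : q != p -> Cu q = 1 by rewrite /Cu => /negPf ->.
have CuC : cartier Cu.
  move=> q qS; have [->|qp] := eqVneq q p.
    rewrite Cup; split=> //.
    have [e1 [a [b [ae be b0 uE]]]] := OSm_OS mu.
    exists (eG + e1)%N, (G * b); split; first exact: homogeneousM.
      by rewrite rmorphM mulf_neq0.
    move=> q' q'S; rewrite rmorphM mulf_eq0 negb_or => /andP[G0 b0'].
    have [->|q'p] := eqVneq q' p; first by rewrite Cup divff //; apply: OSunit1.
    rewrite Cuq // divr1; have Ou : OS q' u by rewrite uE; apply: (OS_frac ae be).
    have [//|m'] := OS_unit_or_max Ou.
    by move/eqP: q'p; rewrite (Gq q' q'S G0 m' m').
  rewrite Cuq //; split; first exact: oner_neq0.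
  have [i [j ij]] : exists i j, q 0 i * p 0 j != q 0 j * p 0 i.
    apply: contrapT => N0; move/eqP: qp; apply; apply: (onS_point qS pS) => i j.
    by apply/eqP/negPn/negP => h; apply: N0; exists i, j.
  exists 1%N, (p 0 j *: mX i - p 0 i *: mX j); split.
  - by apply: homogeneousB; apply: homogeneousZ; apply: homogeneousX.
  - by rewrite rmorphB /= !ptZ !ptX subr_eq0 mulrC [X in _ != X]mulrC.
  - move=> q' q'S l0; have [E|q'p] := eqVneq q' p.
      by move: l0; rewrite E rmorphB /= !ptZ !ptX mulrC subrr eqxx.
    by rewrite Cuq // divr1; apply: OSunit1.
have CuE : effective Cu.
  move=> q qS; have [->|qp] := eqVneq q p; first by rewrite Cup; exact: OSm_OS.
  by rewrite Cuq //; apply: OS1.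
have [m [C CP]] := effective_prime_sum CuC CuE.
have [Cp CE] := CP.
have mprod : OSm p (\prod_i C i p).
  have := div_eq_sym CE pS => U; rewrite -(divfK (cartier_neq0 CuC pS) (\prod_i C i p)) Cup.
  by rewrite Cup in U; apply: OSmM => //; case: U.
have [i mi] := prod_OSm pS (fun i => prime_effective (Cp i) pS) mprod.
have Cunit q : onS q -> q != p -> OSunit q (C i q).
  by move=> qS qp; apply: (prime_sum_unit qS CP CuC); rewrite Cuq //; apply: OSunit1.
have := prime_degree_gt0 (Cp i).
have [l [l0 [H [HC phiH HVA]]]] := exists_sections phiP dP.
have [A [AC AE Aphi uA]] := avoiding_section phiP HC phiH HVA pS.
have [k0 [Aj AP]] := effective_prime_sum AC AE; have [Ajp _] := AP.
have : lf (phi A) (phi (C i)) = 0.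
  rewrite (phi_prime_sum phiP AC AP) lform_suml big1 // => j _.
  have uAj := prime_sum_unit pS AP AC uA j.
  have NAC : ~ div_eq (Aj j) (C i).
    by move=> h; apply: (OSm_not_unit mi); apply: (div_eq_unit h pS uAj (prime_cartier (Ajp j))).
  apply/eqP/negPn/negP => ne0.
  have [q [qS mA mC]] := prime_intersection_meet BP phiP (Ajp j) (Cp i) NAC ne0.
  have [E|qp] := eqVneq q p; first by rewrite E in mA; apply: (OSm_not_unit mA).
  by apply: (OSm_not_unit mC); apply: Cunit.
rewrite Aphi lf_section => /eqP; rewrite mulf_eq0 pnatr_eq0 gtn_eqF //= => /eqP ->.
by rewrite ltxx.
Qed.

(** A failure would put a power of [v] into (u), which is excluded for nonzero [u]; and with [u = 0]
    also [v] would be 0, leaving no maximal ideal. *)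
Lemma regular_sequence p u v s t : onS p -> regular_params emb x p u v ->
  OS p s -> OS p t -> v * s = u * t -> exists2 s', OS p s' & s = u * s'.
Proof.
move=> pS uv Os Ot vs; apply: contrapT => ns.
have [e [w [Ow vu]]] := power_of_second_parameter pS uv Os Ot vs ns.
have [u0|] := eqVneq u 0; last exact: (parameter_not_in_radical pS uv Ow vu).
have s0 : s != 0.
  by apply/eqP => s0; apply: ns; exists 0; [apply: OS0 | rewrite s0 mulr0].
have v0 : v = 0 by move/eqP: vs; rewrite u0 mul0r mulf_eq0 (negPf s0) orbF => /eqP.
have [z mz z0] := maximal_ideal_neq0 pS.
move: mz; rewrite uv u0 v0 => -[a [b [_ _ zE]]].
by move: z0; rewrite zE !mulr0 addr0 eqxx.
Qed.

Lemma regular_params_neq0 p u v : onS p -> regular_params emb x p u v -> u != 0.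
Proof.
move=> pS uv; apply/eqP => u0.
have vu : regular_params emb x p v u.
  rewrite /regular_params; have -> : local_ideal2 emb x p v u = local_ideal2 emb x p u v; last exact: uv.
  by apply/seteqP; split=> z [a [b [Oa Ob ->]]]; exists b, a; split=> //; rewrite addrC.
have mv : OSm p v.
  by rewrite uv; exists 0, 1; rewrite mul1r mul0r add0r; split; [apply: OS0 | apply: OS1 |].
have [s' Os' E] : exists2 s', OS p s' & 1 = v * s'.
  by apply: (regular_sequence pS vu (OS1 p) (OS0 p)); rewrite u0 mul0r mulr0.
apply: (OSm_not_unit _ (OSunit1 p)); rewrite E mulrC; exact: OSmM.
Qed.

(** The Cohen-Macaulay property. Modulo [h], the element [a] is killed by (g, h), hence by powers of
    [u] and [v]. So a multiple of [a] outside (h) is killed modulo [h] by both [u] and [v], and the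
    regular sequence formed by them puts it into (h) after all. *)
Lemma nonzerodivisor p g h m a b : onS p -> OS p g -> OS p h -> h != 0 -> lmult p g h m ->
  OS p a -> OS p b -> g * a = h * b -> exists2 a', OS p a' & a = h * a'.
Proof.
move=> pS Og Oh h0 gh Oa Ob gab; apply: contrapT => na.
have [u [v uv]] := geom_regular pS.
have u0 := regular_params_neq0 pS uv.
have mu : OSm p u.
  by rewrite uv; exists 1, 0; rewrite mul1r mul0r addr0; split; [apply: OS1 | apply: OS0 |].
have mv : OSm p v.
  by rewrite uv; exists 0, 1; rewrite mul1r mul0r add0r; split; [apply: OS0 | apply: OS1 |].
pose hO z := exists2 z', OS p z' & z = h * z'.
have hOM y z : OS p y -> hO z -> hO (y * z).
  by move=> Oy [z' Oz' ->]; exists (y * z'); [apply: OSM | ring].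
have ann y : ideal2 p g h y -> hO (y * a).
  move=> [c [c' [Oc Oc' ->]]]; exists (c * b + c' * a); first by apply: OSD => //; apply: OSM.
  by rewrite mulrDl -[c * g * a]mulrA gab; ring.
(* Takes the last multiple of [z] by a power of [y] that is outside (h); whatever kills [z] modulo
   [h] still kills it. *)
have pick_last z y : OS p z -> OS p y -> (exists e, hO (y ^+ e * z)) -> ~ hO z ->
    exists z', [/\ OS p z', ~ hO z', hO (y * z') & forall c, hO (c * z) -> OS p c -> hO (c * z')].
  move=> Oz Oy ey nz.
  have E : exists e, `[< hO (y ^+ e * z) >] by case: ey => e he; exists e; apply/asboolP.
  case: (ex_minnP E) => -[|e] /asboolP he emin; first by case: nz; rewrite expr0 mul1r in he.
  exists (y ^+ e * z); split.
  - by apply: OSM => //; apply: OSX.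
  - by move=> h'; have := emin e (introT (asboolP _) h'); rewrite ltnn.
  - by rewrite mulrA -exprS.
  - by move=> c hc Oc; rewrite mulrCA; apply: hOM => //; apply: OSX.
have [eu eu'] := local_mult_power pS gh mu; have [ev ev'] := local_mult_power pS gh mv.
have [a1 [Oa1 na1 ua1 a1P]] := pick_last a u Oa (OSm_OS mu) (ex_intro _ eu (ann _ eu')) na.
have va1 : hO (v ^+ ev * a1) by apply: a1P; [apply: ann | apply: OSX; exact: OSm_OS].
have [a2 [Oa2 na2 [t Ot va2] a2P]] := pick_last a1 v Oa1 (OSm_OS mv) (ex_intro _ ev va1) na1.
have [s Os ua2] := a2P u ua1 (OSm_OS mu).
have vs : v * s = u * t.
  by apply: (mulfI h0); rewrite mulrCA -ua2 [RHS]mulrCA -va2; ring.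
have [s' Os' sE] := regular_sequence pS uv Os Ot vs.
apply: na2; exists s' => //; apply: (mulfI u0); rewrite ua2 sE; ring.
Qed.

End RegularSequences.

(** * Additivity and comparison of local multiplicities *)

Section Additivity.
Variables (k : fieldType) (kb : closedFieldType) (iota : {rmorphism k -> kb}).
Variable S : smooth_projective_surface iota.

Local Notation K := (fun_field S).
Local Notation N := (dim_amb S).
Local Notation form := (mpol kb N.+1).
Local Notation pt := 'rV[kb]_N.+1.
Local Notation emb := (fun_emb S).
Local Notation x := (gen_pt S).
Local Notation gev := (gen_eval emb x).
Local Notation OSm p := (local_max emb x p).
Local Notation Div := (divisor S).
Variables (B : Div -> Div -> int) (d : nat) (phi : Div -> lattice d).
Hypothesis BP : intersection_form B.
Hypothesis phiP : marking B phi.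
Hypothesis dP : del_pezzo B d.
Hypothesis d_le7 : (d <= 7)%N.

Local Notation n := (9 - d)%N.
Local Notation lf := (@lform n int).
Local Notation antican := (anticanonical n int).
Local Notation ideal2 p f g := (local_ideal2 emb x p f g).
Local Notation lmult p f g m := (@local_mult _ _ _ S p f g m).
Implicit Types (p q : pt) (C D E A : Div).

Lemma local_mult_intro p f g m (e : 'I_m -> K) : onS p -> (forall i, OS p (e i)) ->
  (forall z, OS p z -> exists c : 'I_m -> kb, ideal2 p f g (z - \sum_i emb (c i) * e i)) ->
  (forall c : 'I_m -> kb, ideal2 p f g (\sum_i emb (c i) * e i) -> forall i, c i = 0) ->
  lmult p f g m.
Proof.
move=> pS Oe sp ind; exists e => // z /sp [c cz]; exists (\row_i c i); split.
  rewrite (_ : \sum_i _ = \sum_i emb (c i) * e i) //.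
  by apply: eq_bigr => i _; rewrite mxE.
move=> c' cz'; apply/rowP => i; rewrite mxE; apply/eqP; rewrite -subr_eq0; apply/eqP.
apply: (ind (fun i => c i - c' 0 i)); have := ideal2B pS cz' cz.
suff -> : \sum_j emb (c j - c' 0 j) * e j =
    z - \sum_j emb (c' 0 j) * e j - (z - \sum_j emb (c j) * e j) by [].
rewrite opprB addrC addrA subrK -sumrB; apply: eq_bigr => j _.
by rewrite rmorphB mulrBl.
Qed.

(** The exact sequence 0 -> O/(f, h) -> O/(f g, h) -> O/(g, h) -> 0, whose first map is
    multiplication by g; it is injective because g is a nonzerodivisor modulo h. *)
Lemma local_mult_mul p f g h m1 m2 : onS p -> OS p f -> OS p g -> OS p h -> h != 0 ->
  lmult p f h m1 -> lmult p g h m2 -> lmult p (f * g) h (m1 + m2).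
Proof.
move=> pS Of Og Oh h0 /local_mult_span [e1 [Oe1 sp1 ind1]] gh.
have [e2 [Oe2 sp2 ind2]] := local_mult_span gh.
pose e i := match fintype.split i with inl a => g * e1 a | inr b => e2 b end.
have eE (c : 'I_(m1 + m2) -> kb) : \sum_i emb (c i) * e i =
    g * (\sum_i emb (c (lshift m2 i)) * e1 i) + \sum_i emb (c (rshift m1 i)) * e2 i.
  rewrite big_split_ord /= mulr_sumr; congr (_ + _); apply: eq_bigr => i _; rewrite /e.
    by rewrite -[lshift _ _]/(unsplit (inl i)) unsplitK mulrCA.
  by rewrite -[rshift _ _]/(unsplit (inr i)) unsplitK.
apply: (local_mult_intro (e := e)) => //.
- by move=> i; rewrite /e; case: (fintype.split i) => // a; apply: OSM.
- move=> z /sp2 [c2 [a [b [Oa Ob zE]]]].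
  have [c1 [a' [b' [Oa' Ob' aE]]]] := sp1 _ Oa.
  exists (fun i => match fintype.split i with inl a => c1 a | inr b => c2 b end).
  rewrite eE; under eq_bigr => i _ do rewrite -[lshift _ _]/(unsplit (inl i)) unsplitK.
  rewrite [X in g * _ + X](eq_bigr (fun i => emb (c2 i) * e2 i)); last first.
    by move=> i _; rewrite -[rshift _ _]/(unsplit (inr i)) unsplitK.
  exists a', (b' * g + b); split=> //; first by apply: OSD => //; apply: OSM.
  rewrite opprD addrCA zE addrC.
  have -> : a = a' * f + b' * h + \sum_i emb (c1 i) * e1 i by rewrite -aE subrK.
  ring.
- move=> c; rewrite eE => -[a [b [Oa Ob cE]]].
  have c2 : forall i, c (rshift m1 i) = 0.
    apply: ind2; exists (a * f - \sum_i emb (c (lshift m2 i)) * e1 i), b; split=> //.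
      apply: OSB => //; first exact: OSM.
      by apply: OS_sum => // i _; apply: OSM => //; apply: OS_emb.
    by apply: (addrI (g * (\sum_i emb (c (lshift m2 i)) * e1 i))); rewrite cE; ring.
  have cE' : g * (\sum_i emb (c (lshift m2 i)) * e1 i - a * f) = h * b.
    rewrite [X in _ + X = _]big1 ?addr0 in cE; last by move=> i _; rewrite c2 rmorph0 mul0r.
    by rewrite mulrBr cE; ring.
  have [|a' Oa' aE] := nonzerodivisor BP phiP dP d_le7 pS Og Oh h0 gh _ Ob cE'.
    apply: OSB => //; last exact: OSM.
    by apply: OS_sum => // i _; apply: OSM => //; apply: OS_emb.
  have c1 : forall i, c (lshift m2 i) = 0.
    by apply: ind1; exists a, a'; split=> //; rewrite (mulrC a') -aE addrC subrK.
  by move=> i; rewrite -(splitK i); case: (fintype.split i) => j /=.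
Qed.

Lemma local_mult1 p h : onS p -> lmult p 1 h 0.
Proof.
move=> pS; apply: (local_mult_intro (e := fun i : 'I_0 => 0)) => // [[]|z Oz|c _ []] //.
by exists (fun=> 0); rewrite big_ord0 subr0 -(mulr1 z); apply: ideal2l.
Qed.

Lemma local_mult_prod p h r (f : 'I_r -> K) (m : 'I_r -> nat) : onS p ->
  (forall i, OS p (f i)) -> OS p h -> h != 0 -> (forall i, lmult p (f i) h (m i)) ->
  lmult p (\prod_i f i) h (\sum_i m i).
Proof.
move=> pS Of Oh h0; elim: r f m Of => [|r IH] f m Of fm; first by rewrite !big_ord0; apply: local_mult1.
rewrite !big_ord_recl; apply: local_mult_mul => //; first exact: OS_prod.
exact: IH.
Qed.

Lemma local_mult_le p f g f' g' m m' : onS p -> ideal2 p f g `<=` ideal2 p f' g' ->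
  lmult p f g m -> lmult p f' g' m' -> (m' <= m)%N.
Proof.
move=> pS sub /local_mult_span [e [Oe sp _]] /local_mult_span [e' [Oe' _ ind]].
by apply: (spanning_independent_le pS (e := e) (e' := e') _ sub ind) => j; apply: sp.
Qed.

(** Quantified over all decompositions, so that no uniqueness of prime factorization is involved. *)
Definition no_component E D : Prop := forall m (C : 'I_m -> Div), prime_sum D C ->
  forall i, ~ div_eq (C i) E.

(** Local multiplicities are attached to given equations; those of the product [D'] of the
    components differ from the ones of [D] by units. *)
Lemma effective_intersection D E : cartier D -> effective D -> prime_divisor E ->
  no_component E D -> exists (m : pt -> nat) (D' : Div), 
  [/\ div_eq D' D, forall p, onS p -> lmult p (D' p) (E p) (m p) &
    exists s0 : seq pt, forall s, uniq s -> (forall q, q \in s -> onS q) ->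
      {subset [seq q <- s0 | `[< onS q >]] <= s} ->
      lf (phi D) (phi E) = \sum_(q <- s) (m q)%:Z].
Proof.
move=> DC DE Ep nE; have [r [C CP]] := effective_prime_sum DC DE; have [Cp CD] := CP.
have [m mP] := choice (fun i => prime_intersection BP phiP (Cp i) Ep (nE r C CP i)).
have [s0 sP] := choice (fun i => (mP i).2).
exists (fun p => \sum_i m i p)%N, (fun p => \prod_i C i p); split.
- exact: div_eq_sym.
- move=> p pS; apply: local_mult_prod => //.
  + by move=> i; apply: prime_effective (Cp i) p pS.
  + exact: prime_effective Ep p pS.
  + by apply: cartier_neq0 => //; apply: prime_cartier.
  + by move=> i; apply: (mP i).1.
exists (flatten [seq s0 i | i <- enum 'I_r]) => s us sS ss.
rewrite (phi_prime_sum phiP DC CP) lform_suml.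
under [RHS]eq_bigr => q _ do rewrite -natz natr_sum.
rewrite exchange_big /=; apply: eq_bigr => i _.
rewrite (sP i s us sS).
  by apply: eq_bigr => q _; rewrite natz.
move=> q; rewrite mem_filter => /andP[qS qs]; apply: ss; rewrite mem_filter qS /=.
by apply/flattenP; exists (s0 i) => //; apply/mapP; exists i; rewrite ?mem_enum.
Qed.

(** At every point (Y, E) is contained in (Z, E), so the quotient by the second ideal has the
    smaller dimension. *)
Lemma intersection_compare Y Z E : cartier Y -> effective Y -> cartier Z -> effective Z ->
  prime_divisor E -> no_component E Y -> no_component E Z ->
  (forall p, onS p -> ideal2 p (Z p) (E p) (Y p)) ->
  lf (phi Z) (phi E) <= lf (phi Y) (phi E).
Proof.
move=> YC YE ZC ZE Ep nY nZ YZ.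
have [m [Y' [YY' mY [s0 sY]]]] := effective_intersection YC YE Ep nY.
have [m' [Z' [ZZ' mZ [s0' sZ]]]] := effective_intersection ZC ZE Ep nZ.
have [s [us sS ss]] := cover_seq (S := S) (s0 ++ s0').
rewrite (sY s us sS) ?(sZ s us sS); first last.
- by move=> q qs; apply: ss; move: qs; rewrite !mem_filter mem_cat => /andP[-> ->].
- by move=> q qs; apply: ss; move: qs; rewrite !mem_filter mem_cat orbC => /andP[-> ->].
rewrite big_seq [leRHS]big_seq; apply: ler_sum => q /sS qS; rewrite lez_nat.
have Eq : OS q (E q) by apply: prime_effective Ep q qS.
apply: (local_mult_le qS _ (mY q qS) (mZ q qS)); apply: ideal2_sub => //; last first.
  by have := ideal2r (Z' q) (E q) (OS1 q); rewrite mul1r.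
have uY := YY' q qS; rewrite -(divfK (cartier_neq0 YC qS) (Y' q)).
apply: ideal2M => //; first exact: OSunit_OS.
have [a [b [Oa Ob ->]]] := YZ q qS; apply: ideal2D => //; last exact: ideal2r.
have Z'0 : Z' q != 0.
  by apply/eqP => h; have [] := ZZ' q qS; rewrite h mul0r eqxx.
rewrite -(divfK Z'0 (Z q)) mulrA; apply: ideal2l => //; apply: OSM => //.
by apply: OSunit_OS; rewrite -invf_div; apply: OSunitV; apply: ZZ'.
Qed.

End Additivity.

(** * Fields of definition of divisors *)

Section FieldsOfDefinition.
Variables (k : fieldType) (kb : closedFieldType) (iota : {rmorphism k -> kb}).
Variable S : smooth_projective_surface iota.

Local Notation K := (fun_field S).
Local Notation N := (dim_amb S).
Local Notation form := (mpol kb N.+1).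
Local Notation pt := 'rV[kb]_N.+1.
Local Notation emb := (fun_emb S).
Local Notation x := (gen_pt S).
Local Notation gev := (gen_eval emb x).
Local Notation OSm p := (local_max emb x p).
Local Notation Div := (divisor S).
Implicit Types (p q : pt) (D E : Div) (Phi : set kb) (F G A : form).

Lemma subfield_range : subfield_set (range iota).
Proof.
split=> [|_ _ [a _ <-] [b _ <-]|_ _ [a _ <-] [b _ <-]|_ [a _ <-]].
- by exists 1; rewrite ?rmorph1.
- by exists (a - b); rewrite ?rmorphB.
- by exists (a * b); rewrite ?rmorphM.
- by exists a^-1; rewrite ?fmorphV.
Qed.

Lemma poly_in_sub Phi Phi' n (P : mpol kb n) : Phi `<=` Phi' -> poly_in Phi P -> poly_in Phi' P.
Proof. by move=> s h m; apply: s. Qed.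

Lemma coord_gen_neq0 q i : onS q -> q 0 i != 0 -> x i != 0.
Proof. by move=> qS qi; rewrite -gevX; apply: (onS_neq0 qS (homogeneousX i)); rewrite ptX. Qed.

Lemma homogeneous_Xn i e : homogeneous e (mX i ^+ e : form).
Proof. by rewrite -{1}[e]mul1n; apply: homogeneous_exp; apply: homogeneousX. Qed.

Lemma coord_unit q i i' e : onS q -> q 0 i != 0 -> q 0 i' != 0 -> OSunit q (x i ^+ e / x i' ^+ e).
Proof.
move=> qS qi qi'; rewrite -!gevX -!rmorphXn.
by apply: (OSunit_frac qS (homogeneous_Xn i e) (homogeneous_Xn i' e));
  rewrite rmorphXn /= ptX expf_neq0.
Qed.

Lemma dehom_IS i F : IS F -> x i != 0 -> dehom i F = 0 :> K.
Proof.
move=> FI xi; have [m ->] := piece_sum F; rewrite rmorph_sum big1 // => j _ /=.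
by rewrite (dehom_homogeneous (piece_homogeneous j F) xi) IS_piece // mul0r.
Qed.

(** The analogue of [divisor_over_k] for a subset [Phi] of [kb], meant to be an intermediate field;
    [divisor_over_kP] compares the two for k. *)
Definition defined_over Phi D : Prop := forall p, onS p -> exists d e (g a b : form),
  [/\ [/\ homogeneous d g, homogeneous e a & homogeneous e b],
      [/\ poly_in Phi g, poly_in Phi a & poly_in Phi b],
      [/\ pt_eval p g != 0, gev a != 0 & gev b != 0] &
      forall q, onS q -> pt_eval q g != 0 -> OSunit q (gev a / gev b / D q)].

Lemma defined_over_sub Phi Phi' D : Phi `<=` Phi' -> defined_over Phi D -> defined_over Phi' D.
Proof.
move=> s DD p /DD [d [e [g [a [b [h1 [h2 h3 h4] h5 h6]]]]]].
by exists d, e, g, a, b; split=> //; split; apply: poly_in_sub; eassumption.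
Qed.

Section Over.
Variable Phi : set kb.
Hypothesis PhiF : subfield_set Phi.
Hypothesis Phik : range iota `<=` Phi.

Lemma IS_spanned_over G : IS G -> exists2 s : seq (kb * form),
  forall y, y \in s -> poly_in Phi y.2 /\ IS y.2 & G = \sum_(y <- s) y.1 *: y.2.
Proof.
move=> /IS_spanned [s sP sE]; exists s => // y /sP [h h']; split=> //.
exact: poly_in_sub h.
Qed.

Lemma defined_over_mul D E : defined_over Phi D -> defined_over Phi E ->
  defined_over Phi (div_add D E).
Proof.
move=> DD DE p pS.
have [d [e [g [a [b [[gd ae be] [Pg Pa Pb] [gp a0 b0] H]]]]]] := DD p pS.
have [d' [e' [g' [a' [b' [[gd' ae' be'] [Pg' Pa' Pb'] [gp' a0' b0'] H']]]]]] := DE p pS.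
exists (d + d')%N, (e + e')%N, (g * g'), (a * a'), (b * b'); split.
- by split; apply: homogeneousM.
- by split; apply: poly_inM.
- by rewrite !rmorphM /=; split; apply: mulf_neq0.
move=> q qS; rewrite rmorphM mulf_eq0 negb_or => /andP[h h'].
have := OSunitM (H q qS h) (H' q qS h'); rewrite /div_add !rmorphM !invfM /=.
by rewrite !mulrA; congr (OSunit q); ring.
Qed.

Lemma defined_over_opp D : defined_over Phi D -> defined_over Phi (div_opp D).
Proof.
move=> DD p /DD [d [e [g [a [b [[gd ae be] [Pg Pa Pb] [gp a0 b0] H]]]]]].
exists d, e, g, b, a; split=> // q qS h; have := OSunitV (H q qS h).
by rewrite /div_opp invrK invf_div invf_div mulrC.
Qed.

Lemma defined_over_eq D E : cartier D -> div_eq D E -> defined_over Phi D -> defined_over Phi E.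
Proof.
move=> DC DE DD p /DD [d [e [g [a [b [h1 h2 h3 H]]]]]].
exists d, e, g, a, b; split=> // q qS h; have := OSunitM (H q qS h) (DE q qS).
by rewrite -mulrA [_ * (D q / _)]mulrA mulVf ?cartier_neq0 // mul1r.
Qed.

Lemma defined_over_scale e a b D : homogeneous e a -> homogeneous e b -> poly_in Phi a ->
  poly_in Phi b -> gev a != 0 -> gev b != 0 -> defined_over Phi D ->
  defined_over Phi (fun p => gev a / gev b * D p).
Proof.
move=> ae be Pa Pb a0 b0 DD; apply: (@defined_over_mul (fun=> gev a / gev b)) => // p pS.
exists 0%N, e, 1, a, b; split=> //.
- by split=> //; apply: homogeneous1.
- by split=> //; apply: poly_in1.
- by rewrite rmorph1 oner_eq0.
by move=> q qS _; rewrite divff ?mulf_neq0 ?invr_eq0 //; apply: OSunit1.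
Qed.

(** With D = a / b on a set g != 0, vanishing of F there means that b (g x_i)^M F = x_i^e a c on S
    for some form c. This is linear in F and c with coefficients over [Phi], and conversely a
    solution whose c has no new monomials gives a form vanishing there. *)
Lemma vanishing_local D e F p : cartier D -> defined_over Phi D -> onS p -> homogeneous e F ->
  vanishing D F -> exists w : form * form * (form * form),
    [/\ poly_in Phi w.1.1, poly_in Phi w.1.2, IS (w.1.1 * F + w.1.2 * w.2.1), pt_eval p w.2.2 != 0 &
      forall F' c, homogeneous e F' -> {subset msupp c <= msupp w.2.1} ->
        IS (w.1.1 * F' + w.1.2 * c) ->
        forall q i, onS q -> pt_eval q w.2.2 != 0 -> q 0 i = 1 -> OS q (dehom i F' / D q)].
Proof.
move=> DC DD pS Fe FV.
have [d [e' [g [a [b [[gd ae be] [Pg Pa Pb] [gp a0 b0] H]]]]]] := DD p pS.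
have [i pi xi] := onS_coord pS.
have G'h : homogeneous (d + 1) (g * mX i) by apply: homogeneousM => //; apply: homogeneousX.
have [||M [c [ch cE]]] := @regular_on_basic_open _ _ _ S (gev F / x i ^+ e * (gev b / gev a)) _ _ G'h.
- by rewrite addn1.
- move=> q qS; rewrite rmorphM mulf_eq0 negb_or /= ptX => /andP[gq qi].
  have [i' qi' xi'] := onS_coord qS.
  have q0 : q 0 i' != 0 by rewrite qi' oner_eq0.
  have D0 := cartier_neq0 DC qS.
  have := OSM (OSM (FV q i' qS qi') (OSunit_OS (OSunitV (H q qS gq)))) (OSunit_OS (coord_unit e qS q0 qi)).
  rewrite (dehom_homogeneous Fe xi'); congr (OS q); field.
  by rewrite D0 a0 b0 !expf_neq0.
exists ((b * (g * mX i) ^+ M, - (mX i ^+ e * a)), (c, g * mX i)) => /=; split.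
- apply: poly_inM => //; apply: poly_in_exp => //; apply: poly_inM => //.
  exact: poly_inX.
- apply: poly_inN => //; apply: poly_inM => //; apply: poly_in_exp => //.
  exact: poly_inX.
- have h : homogeneous (e' + (d + 1) * M + e) (b * (g * mX i) ^+ M * F + - (mX i ^+ e * a) * c).
    apply: homogeneousD; first by do 2?[apply: homogeneousM => //]; apply: homogeneous_exp.
    rewrite mulNr -mulrN -mulrA addnC [(e' + _)%N]addnC.
    rewrite [(_ * M + _)%N]addnC; apply: homogeneousM; first exact: homogeneous_Xn.
    by apply: homogeneousM => //; rewrite -scaleN1r; apply: homogeneousZ.
  apply/(IS_homogeneous h); rewrite rmorphD !rmorphM rmorphN !rmorphM /= -cE !rmorphXn /=.
  rewrite gevX; field.
  by rewrite a0 expf_neq0.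
- by rewrite rmorphM /= ptX pi mulr1.
move=> F' c' Fe' c's FI q i' qS; rewrite rmorphM mulf_eq0 negb_or /= ptX => /andP[gq qi] qi'.
have q0 : q 0 i' != 0 by rewrite qi' oner_eq0.
have xi' := coord_gen_neq0 qS q0.
have ch' := homogeneous_subset c's ch.
have h : homogeneous (e' + (d + 1) * M + e) (b * (g * mX i) ^+ M * F' + - (mX i ^+ e * a) * c').
  apply: homogeneousD; first by do 2?[apply: homogeneousM => //]; apply: homogeneous_exp.
  rewrite mulNr -mulrN -mulrA addnC [(e' + _)%N]addnC.
  rewrite [(_ * M + _)%N]addnC; apply: homogeneousM; first exact: homogeneous_Xn.
  by apply: homogeneousM => //; rewrite -scaleN1r; apply: homogeneousZ.
move/(IS_homogeneous h): FI.
have Ggq : pt_eval q ((g * mX i) ^+ M) != 0.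
  by rewrite rmorphXn rmorphM /= ptX expf_neq0 // mulf_neq0.
have Gg0 : gev ((g * mX i) ^+ M) != 0.
  by apply: (onS_neq0 qS (homogeneous_exp M G'h) Ggq).
have D0 := cartier_neq0 DC qS.
rewrite rmorphD !rmorphM rmorphN rmorphM /= => E.
have OSc : OS q (gev c' / gev ((g * mX i) ^+ M)).
  by apply: (OS_frac ch' _ Ggq); apply: homogeneous_exp.
have -> : dehom i' F' / D q = gev c' / gev ((g * mX i) ^+ M) * (gev a / gev b / D q) *
    (x i ^+ e / x i' ^+ e).
  rewrite (dehom_homogeneous Fe' xi').
  have -> : gev F' = gev (mX i ^+ e) * gev a * gev c' / (gev b * gev ((g * mX i) ^+ M)).
    apply: (canRL (mulfK _)); first by rewrite mulf_neq0.
    by apply/eqP; rewrite -subr_eq0 -E; apply/eqP; ring.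
  rewrite rmorphXn /= gevX; field.
  by rewrite D0 b0 Gg0 expf_neq0.
apply: OSM; last exact/OSunit_OS/coord_unit.
by apply: OSM => //; apply: OSunit_OS; apply: H.
Qed.

(** On a finite cover vanishing is a finite linear system over [Phi], to which [descend_equations]
    applies; preservation of supports keeps the degree. *)
Lemma vanishing_spanned D e F : cartier D -> defined_over Phi D -> homogeneous e F ->
  vanishing D F -> exists m (b : 'I_m -> kb) (R : 'I_m -> form),
    (forall l, [/\ homogeneous e (R l), poly_in Phi (R l) & vanishing D (R l)]) /\
    F = \sum_l b l *: R l.
Proof.
move=> DC DD Fe FV.
have /choice [w wP] : forall p, exists w : form * form * (form * form), onS p ->
    [/\ poly_in Phi w.1.1, poly_in Phi w.1.2, IS (w.1.1 * F + w.1.2 * w.2.1), pt_eval p w.2.2 != 0 &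
      forall F' c, homogeneous e F' -> {subset msupp c <= msupp w.2.1} ->
        IS (w.1.1 * F' + w.1.2 * c) ->
        forall q i, onS q -> pt_eval q w.2.2 != 0 -> q 0 i = 1 -> OS q (dehom i F' / D q)].
  move=> p; have [pS|nS] := pselect (onS p); last by exists (0, 0, (0, 0)).
  by have [w wP] := vanishing_local DC DD pS Fe FV; exists w.
have [s sS scov] := @finite_cover _ _ _ S (fun p => (w p).2.2)
  (fun p pS => let: And5 _ _ _ h _ := wP p pS in h).
pose pt t : 'rV[kb]_N.+1 := tnth (in_tuple s) t.
have ptS t : onS (pt t) by apply: sS; apply: mem_tnth.
(* The first unknown is F; the others are the auxiliary forms, one for each member of the cover. *)
pose P (t : 'I_(size s)) (j : 'I_(size s).+1) : form :=
  if unlift ord0 j is Some t' then if t' == t then (w (pt t)).1.2 else 0 else (w (pt t)).1.1.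
pose Q (j : 'I_(size s).+1) : form := if unlift ord0 j is Some t then (w (pt t)).2.1 else F.
have sumE t (X : 'I_(size s).+1 -> form) : \sum_j P t j * X j =
    (w (pt t)).1.1 * X ord0 + (w (pt t)).1.2 * X (lift ord0 t).
  rewrite big_ord_recl /P unlift_none; congr (_ + _).
  rewrite (bigD1 t) //= liftK eqxx big1 ?addr0 // => t' /negPf t't.
  by rewrite liftK t't mul0r.
have [||m [b [R [PR QE RI Rs]]]] := @descend_equations _ _ PhiF _ (@IS _ _ _ S) _ _ P Q
  (@IS_ideal _ _ _ S) IS_spanned_over.
- move=> t j; rewrite /P; have [P1 P2 _ _ _] := wP _ (ptS t).
  by case: unliftP => // t' _; case: eqP => // _; apply: poly_in0.
- by move=> t; rewrite sumE /Q unlift_none liftK; have [_ _ h _ _] := wP _ (ptS t).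
exists m, b, (fun l => R l ord0); split; last by have := QE ord0; rewrite {1}/Q unlift_none.
move=> l; have Rl : homogeneous e (R l ord0).
  by apply: homogeneous_subset (Rs l ord0) _; rewrite /Q unlift_none.
split=> // q i qS qi; have [p0 p0s gq] := scov q qS.
have [t p0E] : exists t, p0 = pt t.
  have lt : (index p0 s < size s)%N by rewrite index_mem.
  by exists (Ordinal lt); rewrite /pt (tnth_nth 0) /= nth_index.
rewrite p0E in gq; have [_ _ _ _ H] := wP _ (ptS t).
apply: (H (R l ord0) (R l (lift ord0 t))) => //; last by have := RI l t; rewrite sumE.
by move=> mu /Rs; rewrite /Q liftK.
Qed.

End Over.
End FieldsOfDefinition.

(** * Local generators of divisors over intermediate fields *)

Section Generators.
Variables (k : fieldType) (kb : closedFieldType) (iota : {rmorphism k -> kb}).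
Variable S : smooth_projective_surface iota.

Local Notation K := (fun_field S).
Local Notation N := (dim_amb S).
Local Notation form := (mpol kb N.+1).
Local Notation pt := 'rV[kb]_N.+1.
Local Notation emb := (fun_emb S).
Local Notation x := (gen_pt S).
Local Notation gev := (gen_eval emb x).
Local Notation OSm p := (local_max emb x p).
Local Notation Div := (divisor S).
Implicit Types (p q : pt) (D E : Div) (Phi : set kb) (F G A : form).

Definition coord p : 'I_N.+1 := odflt ord0 [pick i | p 0 i == 1].

Lemma coordP p : onS p -> p 0 (coord p) = 1.
Proof.
move=> pS; rewrite /coord; case: pickP => [i /eqP //|h].
by have [i pi _] := onS_coord pS; rewrite -pi; have := h i; rewrite pi eqxx.
Qed.

Lemma coordP0 p : onS p -> p 0 (coord p) != 0.
Proof. by move=> pS; rewrite coordP // oner_eq0. Qed.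

Definition form_divisor A : Div := fun p => dehom (coord p) A.

Lemma form_divisorE e A p : homogeneous e A -> onS p ->
  form_divisor A p = gev A / x (coord p) ^+ e.
Proof. by move=> Ae pS; apply: dehom_homogeneous => //; apply: (coord_gen_neq0 pS); apply: coordP0. Qed.

Lemma form_divisor_neq0 e A p : homogeneous e A -> gev A != 0 -> onS p -> form_divisor A p != 0.
Proof.
move=> Ae A0 pS; rewrite (form_divisorE Ae pS) mulf_neq0 // invr_eq0 expf_neq0 //.
by apply: (coord_gen_neq0 pS); apply: coordP0.
Qed.

Lemma form_divisor_local e A p i : homogeneous e A -> gev A != 0 -> onS p -> p 0 i != 0 ->
  OSunit p (gev A / gev (mX i ^+ e) / form_divisor A p).
Proof.
move=> Ae A0 pS pi; rewrite (form_divisorE Ae pS).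
have xi := coord_gen_neq0 pS pi; have xc := coord_gen_neq0 pS (coordP0 pS).
have := coord_unit e pS (coordP0 pS) pi; congr (OSunit p); rewrite rmorphXn /= gevX; field.
by rewrite A0 !expf_neq0.
Qed.

Lemma form_divisor_defined_over Phi e A : subfield_set Phi -> homogeneous e A -> poly_in Phi A ->
  gev A != 0 -> defined_over Phi (form_divisor A).
Proof.
move=> PhiF Ae PA A0 p pS; pose i := coord p.
exists 1%N, e, (mX i), A, (mX i ^+ e); split=> //.
- by split=> //; [apply: homogeneousX | apply: homogeneous_Xn].
- by split=> //; [apply: poly_inX | apply: poly_in_exp => //; apply: poly_inX].
- split=> //; first by rewrite /= ptX; apply: coordP0.
  by rewrite rmorphXn /= gevX expf_neq0 //; apply: (coord_gen_neq0 pS); apply: coordP0.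
by move=> q qS; rewrite /= ptX => qi; apply: form_divisor_local.
Qed.

Lemma form_divisor_cartier e A : homogeneous e A -> gev A != 0 -> cartier (form_divisor A).
Proof.
move=> Ae A0 p pS; split; first exact: form_divisor_neq0 Ae A0 pS.
exists 1%N, (mX (coord p)); split; first exact: homogeneousX.
  by rewrite ptX; apply: coordP0.
move=> q qS; rewrite ptX => qi; have := form_divisor_local Ae A0 qS qi.
by rewrite rmorphXn /= gevX -(form_divisorE Ae pS).
Qed.

Lemma form_divisor_effective A : effective (form_divisor A).
Proof. by move=> p pS; apply: dehom_OS => //; apply: coordP. Qed.

Lemma form_divisor_lin_equiv e A A' : homogeneous e A -> homogeneous e A' -> gev A != 0 ->
  gev A' != 0 -> lin_equiv (form_divisor A) (form_divisor A').
Proof.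
move=> Ae Ae' A0 A0'; exists (gev A / gev A'); first by rewrite mulf_neq0 ?invr_eq0.
move=> p pS; rewrite (form_divisorE Ae pS) (form_divisorE Ae' pS) mulrA divfK // divff.
  exact: OSunit1.
rewrite mulf_neq0 // invr_eq0 expf_neq0 //.
by apply: (coord_gen_neq0 pS); apply: coordP0.
Qed.

Lemma dehom_change e A p i i' : homogeneous e A -> onS p -> p 0 i != 0 -> p 0 i' != 0 ->
  dehom i A = dehom i' A * (x i' ^+ e / x i ^+ e).
Proof.
move=> Ae pS pi pi'; have xi := coord_gen_neq0 pS pi; have xi' := coord_gen_neq0 pS pi'.
rewrite !(dehom_homogeneous Ae) //; field.
by rewrite !expf_neq0.
Qed.

Lemma vanishingP e D A : homogeneous e A -> cartier D ->
  vanishing D A <-> forall q, onS q -> OS q (form_divisor A q / D q).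
Proof.
move=> Ae DC; split=> H q => [qS|i qS qi]; first by apply: (H q (coord q) qS); apply: coordP.
have q0 : q 0 i != 0 by rewrite qi oner_eq0.
rewrite (dehom_change Ae qS q0 (coordP0 qS)) mulrAC; apply: OSM; first exact: H.
by apply: OSunit_OS; apply: coord_unit => //; apply: coordP0.
Qed.

Lemma generatesP e D A q : homogeneous e A -> onS q ->
  generates D q A <-> OSunit q (form_divisor A q / D q).
Proof.
move=> Ae qS; split=> [h|H i qi]; first by apply: h; apply: coordP.
have q0 : q 0 i != 0 by rewrite qi oner_eq0.
rewrite (dehom_change Ae qS q0 (coordP0 qS)) mulrAC; apply: OSunitM => //.
by apply: coord_unit => //; apply: coordP0.
Qed.

Lemma OSunit_open q z : onS q -> OSunit q z -> exists e F G, [/\ homogeneous e F, homogeneous e G,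
  pt_eval q F != 0, pt_eval q G != 0 & z = gev F / gev G].
Proof.
move=> qS uz; have [e [F [G [Fe Ge G0 zE]]]] := OSunit_OS uz.
exists e, F, G; split=> //; apply/eqP => F0; have := OSm_frac qS Fe Ge G0.
by rewrite -zE => -[_ /(_ F0) /OSm_not_unit].
Qed.

Section Over.
Variable Phi : set kb.
Hypothesis PhiF : subfield_set Phi.
Hypothesis Phik : range iota `<=` Phi.

(** The point [p] need not be rational over [Phi]. The given solution of A s = B c is a combination
    of solutions over [Phi], and one of these must have its s nonzero at [p]. *)
Lemma quotient_over e A B p : homogeneous e A -> homogeneous e B -> poly_in Phi A ->
  poly_in Phi B -> gev B != 0 -> onS p -> OS p (gev A / gev B) ->
  exists d s c, [/\ homogeneous d s, homogeneous d c & [/\ poly_in Phi s, poly_in Phi c,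
    pt_eval p s != 0 & IS (A * s - B * c)]].
Proof.
move=> Ae Be PA PB B0 pS [d [c [s [cd sd s0 E]]]].
have gs := onS_neq0 pS sd s0.
pose P (t : 'I_1) (j : 'I_2) := if j == ord0 then A else - B.
pose Q (j : 'I_2) := if j == ord0 then s else c.
have sumE t (X : 'I_2 -> form) : \sum_j P t j * X j = A * X ord0 - B * X (lift ord0 ord0).
  by rewrite big_ord_recl big_ord1 /P /= mulNr.
have [||m [b [R [PR QE RI Rs]]]] := @descend_equations _ _ PhiF _ (@IS _ _ _ S) _ _ P Q
  (@IS_ideal _ _ _ S) (IS_spanned_over Phik).
- by move=> t j; rewrite /P; case: eqP => // _; apply: poly_inN.
- move=> t; rewrite sumE /Q /=; have h : homogeneous (e + d) (A * s - B * c).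
    by apply: homogeneousB; apply: homogeneousM.
  apply/(IS_homogeneous h); rewrite rmorphB !rmorphM /=.
  by apply/eqP; rewrite subr_eq0; move/eqP: E; rewrite eqr_div // mulrC [_ * gev B]mulrC => /eqP ->.
have [l sl] : exists l, pt_eval p (R l ord0) != 0.
  apply: contrapT => N0; move/eqP: s0; apply; have := QE ord0; rewrite {1}/Q /= => ->.
  rewrite rmorph_sum big1 // => l _ /=; rewrite ptZ.
  by have [->|h] := eqVneq (pt_eval p (R l ord0)) 0; [rewrite mulr0 | case: N0; exists l].
exists d, (R l ord0), (R l (lift ord0 ord0)); split.
- exact: (homogeneous_subset (Rs l ord0) sd).
- exact: (homogeneous_subset (Rs l (lift ord0 ord0)) cd).
by split=> //; have := RI l ord0; rewrite sumE.
Qed.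

(** A generator is a combination of forms over [Phi] that vanish along [D]; if none of them were a
    generator, neither would be their combination. *)
Lemma generator_over D p : cartier D -> effective D -> defined_over Phi D -> onS p ->
  exists e A, [/\ homogeneous e A, poly_in Phi A, vanishing D A & generates D p A].
Proof.
move=> DC DE DD pS; have [e [A [Ae AV Ag]]] := exists_generator DC DE pS.
have [m [b [R [RP AE]]]] := vanishing_spanned PhiF Phik DC DD Ae AV.
apply: contrapT => N0; have := (generatesP D Ae pS).1 Ag.
suff : OSm p (form_divisor A p / D p) by move/OSm_not_unit.
rewrite AE /form_divisor rmorph_sum mulr_suml; apply: (OSm_sum pS) => l _ /=.
have [Rl PR RV] := RP l.
rewrite -mul_mpolyC rmorphM /= /dehom mmapC -mulrA; apply: OSmM; first exact: OS_emb.
have [u|//] := OS_unit_or_max (RV p (coord p) pS (coordP pS)).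
by case: N0; exists e, (R l); split=> //; apply/(generatesP _ Rl pS).
Qed.

(** The neighbourhood on which [B] generates [D] has to be described over [Phi]. Finitely many local
    generators suffice, and the denominators over [Phi] of their quotients by [B] cut out an open
    set on which [B] divides all of them. *)
Lemma generators_defined_over D : cartier D -> effective D ->
  (forall p, onS p -> exists e A, [/\ homogeneous e A, poly_in Phi A, vanishing D A & generates D p A]) ->
  defined_over Phi D.
Proof.
move=> DC DE H p pS.
have /choice [w wP] : forall q, exists w : nat * form * form, onS q ->
    [/\ homogeneous w.1.1 w.1.2, poly_in Phi w.1.2, vanishing D w.1.2, pt_eval q w.2 != 0 &
     forall q', onS q' -> pt_eval q' w.2 != 0 -> generates D q' w.1.2].
  move=> q; have [qS|nS] := pselect (onS q); last by exists (0%N, 0, 0).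
  have [e [A [Ae PA AV Ag]]] := H q qS.
  have uA := (generatesP D Ae qS).1 Ag.
  have [e' [F [G [Fe Ge F0 G0 FGE]]]] := OSunit_open qS uA.
  have [d [g [gd _ g0 gP]]] := cartier_local DC qS.
  exists (e, A, g * F * G * mX (coord q)); split=> //=.
    by rewrite !rmorphM /= ptX !mulf_neq0 ?coordP0.
  move=> q' q'S; rewrite !rmorphM /= ptX !mulf_eq0 !negb_or.
  move=> /andP[/andP[/andP[g0' F0'] G0'] qi].
  apply/(generatesP _ Ae q'S).
  have D0 := cartier_neq0 DC qS; have D0' := cartier_neq0 DC q'S.
  have := OSunitM (OSunitM (OSunit_frac q'S Fe Ge F0' G0') (gP q' q'S g0'))
    (coord_unit e q'S qi (coordP0 q'S)).
  rewrite -FGE (form_divisorE Ae qS) (form_divisorE Ae q'S); congr (OSunit q'); field.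
  by rewrite D0 D0' !expf_neq0 // ?(coord_gen_neq0 q'S qi) ?(coord_gen_neq0 q'S (coordP0 q'S)).
have [s sS scov] := @finite_cover _ _ _ S (fun q => (w q).2)
  (fun q qS => let: And5 _ _ _ h _ := wP q qS in h).
have [e [B [Be PB BV Bg]]] := H p pS; pose i := coord p.
have uB := (generatesP D Be pS).1 Bg.
have B0 : gev B != 0.
  apply: contraTneq isT => B0; case: (OSunit_neq0 uB).
  by rewrite (form_divisorE Be pS) B0 !mul0r eqxx.
have xi : x i != 0 by apply: (coord_gen_neq0 pS); apply: coordP0.
have /choice [v vP] : forall q, exists v : nat * form * form, q \in s ->
    [/\ homogeneous v.1.1 v.1.2, homogeneous v.1.1 v.2, poly_in Phi v.1.2, pt_eval p v.1.2 != 0 &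
     IS (mX i ^+ e * (w q).1.2 * v.1.2 - mX i ^+ (w q).1.1 * B * v.2)].
  move=> q; have [qs|_] := boolP (q \in s); last by exists (0%N, 0, 0).
  have [Ah PA AV _ _] := wP q (sS q qs).
  have [||||||d [sq [c [sd cd [Ps Pc s0 scI]]]]] := @quotient_over ((w q).1.1 + e)
    (mX i ^+ e * (w q).1.2) (mX i ^+ (w q).1.1 * B) p _ _ _ _ _ pS.
  - by rewrite addnC; apply: homogeneousM => //; apply: homogeneous_Xn.
  - by apply: homogeneousM => //; apply: homogeneous_Xn.
  - by apply: poly_inM => //; apply: poly_in_exp => //; apply: poly_inX.
  - by apply: poly_inM => //; apply: poly_in_exp => //; apply: poly_inX.
  - by rewrite rmorphM rmorphXn /= gevX mulf_neq0 ?expf_neq0.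
  - have D0 := cartier_neq0 DC pS.
    have := OSM ((vanishingP Ah DC).1 AV p pS) (OSunit_OS (OSunitV uB)).
    rewrite (form_divisorE Ah pS) (form_divisorE Be pS) !rmorphM !rmorphXn /= !gevX.
    by congr (OS p); field; rewrite D0 B0 !expf_neq0.
  by exists (d, sq, c).
exists ((\sum_(q <- s) (v q).1.1) + 1)%N, e, ((\prod_(q <- s) (v q).1.2) * mX i), B, (mX i ^+ e).
split.
- split=> //; last exact: homogeneous_Xn.
  apply: homogeneousM; last exact: homogeneousX.
  rewrite !big_seq; apply: (big_ind2 (fun d P => homogeneous d P)) => [|d1 P1 d2 P2|q qs].
  + exact: homogeneous1.
  + exact: homogeneousM.
  + by have [] := vP q qs.
- split=> //; last by apply: poly_in_exp => //; apply: poly_inX.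
  apply: poly_inM => //; last exact: poly_inX.
  by rewrite big_seq; apply: poly_in_prod => // q qs; have [] := vP q qs.
- split=> //; last by rewrite rmorphXn /= gevX expf_neq0.
  rewrite rmorphM /= ptX mulf_neq0 ?coordP0 // rmorph_prod.
  rewrite prodf_seq_neq0; apply/allP => q qs /=.
  by have [] := vP q qs.
move=> q qS; rewrite rmorphM /= ptX mulf_eq0 negb_or rmorph_prod prodf_seq_neq0.
move=> /andP[/allP sq qi].
have [q0 q0s gq] := scov q qS; have [Ah PA AV _ Agen] := wP q0 (sS q0 q0s).
have [sd cd Ps _ scI] := vP q0 q0s.
have s0 : pt_eval q (v q0).1.2 != 0 := sq q0 q0s.
have uA := (generatesP D Ah qS).1 (Agen q qS gq).
have OB := (vanishingP Be DC).1 BV q qS.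
have D0 := cartier_neq0 DC qS.
have xq : x (coord q) != 0 := coord_gen_neq0 qS (coordP0 qS).
have gs : gev (v q0).1.2 != 0 := onS_neq0 qS sd s0.
have scE : gev (w q0).1.2 = x i ^+ (w q0).1.1 * gev B * gev (v q0).2 / (x i ^+ e * gev (v q0).1.2).
  have h : homogeneous (e + (w q0).1.1 + (v q0).1.1)
     (mX i ^+ e * (w q0).1.2 * (v q0).1.2 - mX i ^+ (w q0).1.1 * B * (v q0).2).
    apply: homogeneousB; apply: homogeneousM => //; [|rewrite addnC];
      by apply: homogeneousM => //; apply: homogeneous_Xn.
  move/(IS_homogeneous h): scI; rewrite rmorphB !rmorphM !rmorphXn /= !gevX => /eqP.
  rewrite subr_eq0 => /eqP E; apply: (canRL (mulfK _)); first by rewrite mulf_neq0 ?expf_neq0.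
  by rewrite mulrA [gev (w q0).1.2 * _]mulrC.
have OBi : OS q (gev B / gev (mX i ^+ e) / D q).
  have := OSM OB (OSunit_OS (coord_unit e qS (coordP0 qS) qi)).
  rewrite (form_divisorE Be qS) rmorphXn /= gevX; congr (OS q); field.
  by rewrite D0 !expf_neq0.
split=> //.
  by rewrite !mulf_neq0 ?invr_eq0 // rmorphXn /= gevX expf_neq0.
have := OSM (OSM (OS_frac cd sd s0) (OSunit_OS (OSunitV uA)))
   (OSunit_OS (coord_unit (w q0).1.1 qS qi (coordP0 qS))).
have A0 : gev (w q0).1.2 != 0.
  apply: contraTneq isT => A0; case: (OSunit_neq0 uA).
  by rewrite (form_divisorE Ah qS) A0 !mul0r eqxx.
have c0 : gev (v q0).2 != 0.
  by apply: contraTneq A0 => c0; rewrite scE c0 mulr0 mul0r eqxx.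
rewrite (form_divisorE Ah qS) rmorphXn /= gevX scE; congr (OS q); field.
by rewrite D0 B0 gs c0 !expf_neq0.
Qed.

(* The numerators F of f for a fixed denominator G over Phi form, up to elements
   vanishing on S, a line that is defined over Phi. *)
Lemma section_ratio D f p : onS p -> cartier D -> defined_over Phi D -> f != 0 -> div_eq D (fun=> f) ->
  exists c e F G, [/\ homogeneous e F, homogeneous e G, poly_in Phi F & poly_in Phi G] /\
   [/\ gev F != 0, gev G != 0, c != 0 & f = emb c * (gev F / gev G)].
Proof.
move=> pS DC DD f0 Df.
have [d [e [g [a [b [[gd ae be] [Pg Pa Pb] [gp a0 b0] H]]]]]] := DD p pS.
pose i := coord p; have xi : x i != 0 by apply: (coord_gen_neq0 pS); apply: coordP0.
have gh : homogeneous (d + 1) (g * mX i) by apply: homogeneousM => //; apply: homogeneousX.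
have [||M [c [ch cE]]] := @regular_on_basic_open _ _ _ S (f * (gev b / gev a)) _ _ gh.
- by rewrite addn1.
- move=> q qS; rewrite rmorphM mulf_eq0 negb_or => /andP[gq _].
  have D0 := cartier_neq0 DC qS.
  have := OSM (OSunit_OS (OSunitV (Df q qS))) (OSunit_OS (OSunitV (H q qS gq))).
  by congr (OS q); field; rewrite D0 f0 a0 b0.
pose G := b * (g * mX i) ^+ M; pose F := a * c.
have gg0 : gev (g * mX i) != 0.
  by rewrite rmorphM /= gevX mulf_neq0 //; apply: (onS_neq0 pS gd gp).
have G0 : gev G != 0 by rewrite rmorphM rmorphXn mulf_neq0 ?expf_neq0.
have Gh : homogeneous (e + (d + 1) * M) G by apply: homogeneousM => //; apply: homogeneous_exp.
have Fh : homogeneous (e + (d + 1) * M) F by apply: homogeneousM.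
have PG : poly_in Phi G.
  by apply: poly_inM => //; apply: poly_in_exp => //; apply: poly_inM => //; apply: poly_inX.
have FE : gev F = f * gev G.
  by rewrite /F /G !rmorphM !rmorphXn /= -cE; field.
pose D' := div_add (form_divisor G) D.
have GC := form_divisor_cartier Gh G0.
have D'C : cartier D' by apply: cartier_mul.
have D'D : defined_over Phi D' by apply: defined_over_mul => //; apply: form_divisor_defined_over Gh _ _.
have F0 : gev F != 0 by rewrite FE mulf_neq0.
have FV : div_eq (form_divisor F) D'.
  move=> q qS; have := OSunitV (Df q qS); have D0 := cartier_neq0 DC qS.
  rewrite /D' /div_add (form_divisorE Fh qS) (form_divisorE Gh qS) FE; congr (OSunit q); field.
  by rewrite f0 D0 G0 expf_neq0 // (coord_gen_neq0 qS) // coordP0.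
have [|m [bb [R [RP FRE]]]] := vanishing_spanned PhiF Phik D'C D'D Fh.
  by apply/(vanishingP Fh D'C) => q qS; apply/OSunit_OS/FV.
have [l Rl0] : exists l, gev (R l) != 0.
  apply: contrapT => N0; move/eqP: F0; apply; rewrite FRE rmorph_sum big1 // => l _ /=.
  by rewrite gevZ; have [->|h] := eqVneq (gev (R l)) 0; [rewrite mulr0 | case: N0; exists l].
have [Rl PR RV] := RP l.
have [q qS|c' c'E] := @global_function_const _ _ _ S (gev (R l) / gev F).
  have := OSM ((vanishingP Rl D'C).1 RV q qS) (OSunit_OS (OSunitV (FV q qS))).
  have D0 := cartier_neq0 D'C qS.
  rewrite (form_divisorE Rl qS) (form_divisorE Fh qS); congr (OS q); field.
  by rewrite D0 F0 expf_neq0 // (coord_gen_neq0 qS) // coordP0.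
have c'0 : c' != 0.
  by apply: contraTneq Rl0 => h; move/eqP: c'E; rewrite h rmorph0 mulf_eq0 invr_eq0 (negPf F0) orbF negbK.
exists c'^-1, (e + (d + 1) * M)%N, (R l), G; split=> //; split=> //.
  by rewrite invr_eq0.
rewrite fmorphV -c'E FE; field.
by rewrite G0 f0 Rl0.
Qed.

End Over.

(** A finite cover involves finitely many forms, hence finitely many coefficients. *)
Lemma coefs_of_finite_definition D : cartier D -> exists s : seq kb, forall Phi, subfield_set Phi ->
  (forall z, z \in s -> Phi z) -> defined_over Phi D.
Proof.
move=> DC.
have /choice [w wP] : forall p, exists w : nat * nat * (form * form * form), onS p ->
    [/\ homogeneous w.1.1 w.2.1.1, homogeneous w.1.2 w.2.1.2, homogeneous w.1.2 w.2.2,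
     pt_eval p w.2.1.1 != 0 & [/\ gev w.2.1.2 != 0, gev w.2.2 != 0 &
     forall q, onS q -> pt_eval q w.2.1.1 != 0 -> OSunit q (gev w.2.1.2 / gev w.2.2 / D q)]].
  move=> p; have [pS|nS] := pselect (onS p); last by exists (0%N, 0%N, (0, 0, 0)).
  have [d [g [gd _ g0 gP]]] := cartier_local DC pS.
  have [e [a [b [ae be b0 DE]]]] := fun_field_gen (D p).
  exists (d, e, (g, a, b)); split=> //=; split=> //.
    by have := cartier_neq0 DC pS; rewrite DE mulf_eq0 negb_or => /andP[].
  by move=> q qS gq; have := gP q qS gq; rewrite DE.
have [s sS scov] := @finite_cover _ _ _ S (fun q => (w q).2.1.1)
  (fun q qS => let: And5 _ _ _ h _ := wP q qS in h).
exists [seq mcoeff m P | P <- flatten [seq [:: (w q).2.1.1; (w q).2.1.2; (w q).2.2] | q <- s],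
   m <- msupp P] => Phi PhiF sPhi p pS.
have [q qs gq] := scov p pS; have [h1 h2 h3 _ [h4 h5 h6]] := wP q (sS q qs).
have pin P : P \in [:: (w q).2.1.1; (w q).2.1.2; (w q).2.2] -> poly_in Phi P.
  move=> PP m; have [mP|/memN_msupp_eq0 ->] := boolP (m \in msupp P); last exact: sf0.
  apply: sPhi; apply/allpairsPdep; exists P, m; split=> //.
  by apply/flattenP; exists [:: (w q).2.1.1; (w q).2.1.2; (w q).2.2] => //; apply/mapP; exists q.
exists (w q).1.1, (w q).1.2, (w q).2.1.1, (w q).2.1.2, (w q).2.2; split=> //.
by split; apply: pin; rewrite !inE eqxx ?orbT.
Qed.

End Generators.

(** * Separable descent of scalars *)

Section SeparableSubfield.
Variables (k : fieldType) (kb : closedFieldType) (iota : {rmorphism k -> kb}).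
Hypothesis alg : forall z : kb, algebraicOver iota z.

Local Notation pk P := (map_poly iota P).

Lemma exists_minimal_poly (F : fieldType) (j : {rmorphism F -> kb}) z P : P != 0 ->
  root (map_poly j P) z -> exists p, [/\ p != 0, root (map_poly j p) z &
    forall q, root (map_poly j q) z -> q != 0 -> (size p <= size q)%N].
Proof.
move=> P0 Pz.
have E : exists n, `[< exists p, [/\ p != 0, root (map_poly j p) z & size p = n] >].
  by exists (size P); apply/asboolP; exists P.
case: (ex_minnP E) => n /asboolP[p [p0 pz pn]] nmin; exists p; split=> // q qz q0.
by rewrite pn; apply: nmin; apply/asboolP; exists q.
Qed.

Lemma tower_step (L : fieldExtType k) (j : {rmorphism L -> kb}) (z : kb) :
  (forall c, j c%:A = iota c) -> exists (L' : fieldExtType k) (j' : {rmorphism L' -> kb})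
    (i : L -> L'), [/\ forall c, j' c%:A = iota c, forall y, j' (i y) = j y & exists y, j' y = z].
Proof.
move=> jP; have [P P0 Pz] := alg z.
have [||p [p0 pz pmin]] := @exists_minimal_poly _ j z (map_poly (in_alg L) P).
- by rewrite map_poly_eq0.
- rewrite -map_poly_comp; suff -> : map_poly (j \o in_alg L) P = pk P by [].
  by apply: eq_map_poly => c /=.
have irr : irreducible_poly p by apply/(subfx_irreducibleP pz p0).
pose L1 : fieldExtType L := SubFieldExtType pz irr.
pose L' : fieldExtType k := baseFieldType L1.
pose f : L' -> kb := fun y => subfx_inj (y : L1).
have [||| j' j'E] := @mk_rmorphism L' kb f.
- by move=> a b; apply: (rmorphB (@subfx_inj _ _ j z p)).
- by move=> a b; apply: (rmorphM (@subfx_inj _ _ j z p)).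
- exact: (rmorph1 (@subfx_inj _ _ j z p)).
exists L', j', (fun y => (y%:A : L1)); split=> [c|y|].
- rewrite j'E /f baseField_scaleE -jP; exact: subfx_inj_base.
- by rewrite j'E; apply: subfx_inj_base.
- by exists (subfx_root j z p); rewrite j'E; apply: subfx_inj_root.
Qed.

(** Realizes finitely many elements of [kb] inside a finite extension with an embedding [j], the
    setting in which separability and derivations are formulated. *)
Lemma tower (s : seq kb) : exists (L : fieldExtType k) (j : {rmorphism L -> kb}) (s1 : seq L),
  (forall c, j c%:A = iota c) /\ map j s1 = s.
Proof.
elim: s => [|z s [L [j [s1 [jP js1]]]]].
  have [||| j jE] := @mk_rmorphism (k^o : fieldExtType k) kb iota.
  - by move=> a b; apply: rmorphB.
  - by move=> a b; apply: rmorphM.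
  - exact: rmorph1.
  by exists (k^o : fieldExtType k), j, [::]; split=> // c; rewrite jE; congr (iota _); apply: mulr1.
have [L' [j' [i [jP' ij [y yz]]]]] := tower_step z jP.
exists L', j', (y :: map i s1); split=> //=.
by rewrite yz -js1 -map_comp; congr (_ :: _); apply: eq_map => u; apply: ij.
Qed.

Section InTower.
Variables (L : fieldExtType k) (j : {rmorphism L -> kb}).
Hypothesis jP : forall c, j c%:A = iota c.

Lemma image_subfield (E : {subfield L}) : subfield_set [set z | exists2 y, y \in E & z = j y].
Proof.
split=> [|_ _ [a aE ->] [b bE ->]|_ _ [a aE ->] [b bE ->]|_ [a aE ->]].
- by exists 1; rewrite ?mem1v ?rmorph1.
- by exists (a - b); rewrite ?rpredB ?rmorphB.
- by exists (a * b); rewrite ?rpredM ?rmorphM.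
- by exists a^-1; rewrite ?rpredV ?fmorphV.
Qed.

Lemma image_base (E : {subfield L}) : range iota `<=` [set z | exists2 y, y \in E & z = j y].
Proof. by move=> _ [c _ <-]; exists c%:A; rewrite ?jP // rpredZ ?mem1v. Qed.

Lemma map_in_alg (P : {poly k}) : map_poly j (map_poly (in_alg L) P) = pk P.
Proof. by rewrite -map_poly_comp; apply: eq_map_poly => c /=. Qed.

Lemma Fadjoin_seq_image (Psi : set kb) (K : {subfield L}) (rs : seq L) : subfield_set Psi ->
  (forall y, y \in K -> Psi (j y)) -> (forall a, a \in rs -> Psi (j a)) ->
  forall y, y \in <<K & rs>>%VS -> Psi (j y).
Proof.
move=> PsiF; elim: rs K => [|a rs IH] K KP rsP y; first by rewrite Fadjoin_nil; apply: KP.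
rewrite adjoin_cons; apply: IH => [u|b brs]; last by apply: rsP; rewrite inE brs orbT.
move=> /Fadjoin_polyP[p /polyOverP pK ->]; rewrite -horner_map horner_coef; apply: sf_sum => // i _.
rewrite coef_map; apply: (sfM PsiF); first exact: KP.
elim: (i : nat) => [|m IHm]; first by rewrite expr0; apply: sf1.
by rewrite exprS; apply: (sfM PsiF) => //; apply: rsP; rewrite inE eqxx.
Qed.

Lemma conjugate_root (y : L) z : root (map_poly j (minPoly 1 y)) z ->
  exists s s' : {rmorphism kb -> kb}, [/\ cancel s s', cancel s' s,
    forall c, s (iota c) = iota c & s (j y) = z].
Proof.
move=> zr; apply: (extend_automorphism alg) => P; rewrite -map_in_alg => Py.
have : minPoly 1 y %| map_poly (in_alg L) P.
  apply: minPoly_dvdp; first by apply/polyOver1P; exists P.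
  by move: Py; rewrite /root horner_map fmorph_eq0.
move=> /dvdpP[Q ->]; rewrite rmorphM rootM zr orbT //.
Qed.

(** All conjugates of [j y] coincide with it, while a separable minimal polynomial has distinct
    roots; so the degree is 1. *)
Lemma separable_fixed y : separable_element 1 y ->
  (forall s s' : {rmorphism kb -> kb}, cancel s s' -> cancel s' s ->
    (forall c, s (iota c) = iota c) -> s (j y) = j y) -> range iota (j y).
Proof.
move=> ysep yfix; have [rs rsE] := closed_field_poly_normal (map_poly j (minPoly 1 y)).
have lc : lead_coef (map_poly j (minPoly 1 y)) = 1.
  by rewrite lead_coef_map (monicP (monic_minPoly 1 y)) rmorph1.
rewrite lc scale1r in rsE.
have urs : uniq rs by rewrite -separable_prod_XsubC -rsE separable_map.
have rsy r : r \in rs -> r = j y.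
  move=> rr; have [s [s' [c1 c2 c3 <-]]] : exists s s' : {rmorphism kb -> kb},
     [/\ cancel s s', cancel s' s, forall c, s (iota c) = iota c & s (j y) = r].
    by apply: conjugate_root; rewrite rsE root_prod_XsubC.
  exact: yfix c1 c2 c3.
have srs : (size rs <= 1)%N.
  apply: (@uniq_leq_size _ rs [:: j y]) => // r /rsy ->; exact: mem_head.
have : (size (minPoly 1 y) <= 2)%N.
  by rewrite -(size_map_poly j) rsE size_prod_XsubC ltnS.
rewrite size_minPoly ltnS => d1.
have : y \in 1%VS by rewrite -adjoin_deg_eq1 eqn_leq d1.
by move=> /vlineP[c ->]; exists c.
Qed.

End InTower.

(** Closing [s] under conjugation makes [E] stable under automorphisms. Conjugates of separable
    elements are separable, so the separable part [<<1; th>>] of [E] is stable too. *)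
Lemma separable_tower (s : seq kb) : exists (L : fieldExtType k) (j : {rmorphism L -> kb})
    (E : {subfield L}) (th : L),
  [/\ forall c, j c%:A = iota c, forall z, z \in s -> exists2 y, y \in E & z = j y,
    separable_element 1 th, th \in E /\ purely_inseparable <<1; th>> E &
    forall t : {rmorphism kb -> kb}, (forall c, t (iota c) = iota c) ->
      forall y, y \in <<1; th>>%VS -> exists2 y', y' \in <<1; th>>%VS & t (j y) = j y'].
Proof.
have /choice [P PP] : forall z, exists P : {poly k}, P != 0 /\ root (pk P) z.
  by move=> z; have [P P0 Pz] := alg z; exists P.
have /choice [rs rsP] : forall z, exists rs : seq kb, pk (P z) = lead_coef (pk (P z)) *: \prod_(r <- rs) ('X - r%:P).
  by move=> z; have [rs E] := closed_field_poly_normal (pk (P z)); exists rs.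
have rsE z r : (r \in rs z) = root (pk (P z)) r.
  rewrite rsP rootZ ?root_prod_XsubC // lead_coef_eq0 map_poly_eq0.
  by have [] := PP z.
have [L [j [s1 [jP js1]]]] := tower (flatten [seq rs z | z <- s]).
pose E : {subfield L} := <<1 & s1>>%AS.
have [th [thE thsep] thins] := separable_inseparable_decomposition E 1%AS.
have thE' : (<<1; th>> <= E)%VS.
  by apply/FadjoinP; split=> //; apply: sub1v.
exists L, j, E, th; split=> // [z zs|t tc].
  have : z \in map j s1.
    by rewrite js1; apply/flattenP; exists (rs z); [apply: map_f | rewrite rsE; case: (PP z)].
  by case/mapP => y ys1 ->; exists y => //; apply: seqv_sub_adjoin.
have tE y : y \in E -> exists2 y', y' \in E & t (j y) = j y'.
  apply: (@Fadjoin_seq_image L j [set z | exists2 y', y' \in E & t z = j y'] 1%AS s1).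
  - split=> [|a b [a' aE aE'] [b' bE bE']|a b [a' aE aE'] [b' bE bE']|a [a' aE aE']].
    + by exists 1; rewrite ?mem1v ?rmorph1.
    + by exists (a' - b'); rewrite ?rpredB // !rmorphB /= aE' bE'.
    + by exists (a' * b'); rewrite ?rpredM // !rmorphM /= aE' bE'.
    + by exists a'^-1; rewrite ?rpredV // !fmorphV /= aE'.
  - move=> _ /vlineP[c ->]; exists c%:A; first by rewrite rpredZ ?mem1v.
    by rewrite jP tc.
  - move=> a as1; have : j a \in map j s1 by apply: map_f.
    rewrite js1 => /flattenP[_ /mapP[z zs ->]]; rewrite rsE => ra.
    have : t (j a) \in map j s1.
      rewrite js1; apply/flattenP; exists (rs z); first exact: map_f.
      rewrite rsE; have {1}-> : pk (P z) = map_poly t (pk (P z)).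
        by rewrite -map_poly_comp; apply: eq_map_poly => c /=; rewrite tc.
      by move/rootP: ra => ra; apply/rootP; rewrite horner_map ra rmorph0.
    by case/mapP => b bs1 tb; exists b => //; apply: seqv_sub_adjoin.
move=> y yth; have yE : y \in E := subvP thE' _ yth.
have [y' y'E ty] := tE y yE; exists y' => //.
have ysep : separable_element 1 y by apply: (adjoin_separableP thsep).
have y'sep : separable_element 1 y'.
  apply/separable_elementP; exists (minPoly 1 y); split=> //; first exact: minPolyOver.
  have /polyOver1P[m mE] := minPolyOver 1 y.
  have : root (map_poly j (minPoly 1 y)) (j y).
    by rewrite /root horner_map fmorph_eq0 -/(root _ _) root_minPoly.
  rewrite mE map_in_alg // => /rootP r.
  have : (pk m).[t (j y)] = 0.
    have -> : pk m = map_poly t (pk m).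
      by rewrite -map_poly_comp; apply: eq_map_poly => c /=; rewrite tc.
    by rewrite horner_map r rmorph0.
  rewrite ty -(map_in_alg jP) horner_map => /eqP; rewrite fmorph_eq0 //.
rewrite -separable_inseparable_element (separable_elementS (sub1v _) y'sep) /=.
by apply: (purely_inseparableP thins).
Qed.

End SeparableSubfield.

(** * Derivations and purely inseparable descent *)

Section DerivationStable.
Variables (k : fieldType) (kb : closedFieldType) (iota : {rmorphism k -> kb}).
Variable S : smooth_projective_surface iota.

Local Notation K := (fun_field S).
Local Notation N := (dim_amb S).
Local Notation form := (mpol kb N.+1).
Local Notation pt := 'rV[kb]_N.+1.
Local Notation emb := (fun_emb S).
Local Notation x := (gen_pt S).
Local Notation gev := (gen_eval emb x).
Local Notation OSm p := (local_max emb x p).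
Local Notation Div := (divisor S).
Variables (B : Div -> Div -> int) (d : nat) (phi : Div -> lattice d).
Hypothesis BP : intersection_form B.
Hypothesis phiP : marking B phi.
Hypothesis dP : del_pezzo B d.
Hypothesis d_le7 : (d <= 7)%N.

Local Notation n := (9 - d)%N.
Local Notation lf := (@lform n int).
Local Notation ideal2 p f g := (local_ideal2 emb x p f g).
Implicit Types (p q : pt) (C D E : Div) (A F G P Q R : form).

Lemma component_divides D E m (C : 'I_m -> Div) i : cartier D -> prime_sum D C -> cartier E ->
  div_eq (C i) E -> forall p, onS p -> OS p (D p / E p).
Proof.
move=> DC [Cp DE] EC CE p pS; have Ci0 := cartier_neq0 (prime_cartier (Cp i)) pS.
have := OSM (OSunit_OS (DE p pS)) (OSunit_OS (CE p pS)).
rewrite (bigD1 i) //=; set X := \prod_(j | j != i) _.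
have OX : OS p X by apply: OS_prod => j _; apply: prime_effective (Cp j) p pS.
have X0 : X != 0.
  by apply/prodf_neq0 => j _; apply: cartier_neq0 pS; apply: prime_cartier.
have E0 := cartier_neq0 EC pS.
move=> h; have := OSM h OX; congr (OS p); field.
by rewrite E0 Ci0 X0.
Qed.

Lemma generates_summand D e p (s : seq (kb * form)) : cartier D -> onS p ->
  (forall y, y \in s -> homogeneous e y.2 /\ vanishing D y.2) ->
  generates D p (\sum_(y <- s) y.1 *: y.2) -> exists2 y, y \in s & generates D p y.2.
Proof.
move=> DC pS sP Dg; apply: contrapT => N0.
have : homogeneous e (\sum_(y <- s) y.1 *: y.2).
  by rewrite big_seq; apply: homogeneous_sum => y /sP [h _]; apply: homogeneousZ.
move=> Ae; have := (generatesP D Ae pS).1 Dg.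
suff : OSm p (form_divisor (\sum_(y <- s) y.1 *: y.2) p / D p) by move/OSm_not_unit.
rewrite /form_divisor rmorph_sum mulr_suml big_seq; apply: (OSm_sum pS) => y ys /=.
have [Rl RV] := sP y ys.
rewrite -mul_mpolyC rmorphM /= /dehom mmapC -mulrA; apply: OSmM; first exact: OS_emb.
have [u|//] := OS_unit_or_max (RV p (coord p) pS (coordP pS)).
by case: N0; exists y => //; apply/(generatesP _ Rl pS).
Qed.

Section Derivation.
Variables (Phi : set kb) (delta : kb -> kb).
Hypothesis PhiF : subfield_set Phi.
Hypothesis Phik : range iota `<=` Phi.
Hypothesis dD : forall a b, Phi a -> Phi b -> delta (a + b) = delta a + delta b.
Hypothesis dM : forall a b, Phi a -> Phi b -> delta (a * b) = delta a * b + a * delta b.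
Hypothesis dk : forall c, delta (iota c) = 0.

Lemma delta0 : delta 0 = 0. Proof. by have := dk 0; rewrite rmorph0. Qed.

Lemma delta_sum I (r : seq I) (P : pred I) (f : I -> kb) : (forall i, P i -> Phi (f i)) ->
  delta (\sum_(i <- r | P i) f i) = \sum_(i <- r | P i) delta (f i).
Proof.
move=> fP; elim: r => [|i r IH]; first by rewrite !big_nil delta0.
rewrite !big_cons; case: ifP => // Pi; rewrite dD ?IH //; first exact: fP.
exact: sf_sum.
Qed.

Lemma mapc_deltaM P Q : poly_in Phi P -> poly_in Phi Q ->
  mapc delta (P * Q) = mapc delta P * Q + P * mapc delta Q.
Proof.
move=> PP PQ; apply/mpolyP => m; rewrite mcoeff_mapc ?delta0 // mcoeffD !mcoeffM delta_sum.
  rewrite -big_split; apply: eq_bigr => i _ /=.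
  by rewrite dM ?mcoeff_mapc ?delta0.
by move=> i _; apply: (sfM PhiF).
Qed.

Lemma mapc_deltaB P Q : poly_in Phi P -> poly_in Phi Q ->
  mapc delta (P - Q) = mapc delta P - mapc delta Q.
Proof.
move=> PP PQ; apply/mpolyP => m; rewrite !(mcoeff_mapc, mcoeffB) ?delta0 //.
have PN : Phi (- mcoeff m Q) by apply: (sfN PhiF (PQ m)).
rewrite dD //; congr (_ + _); apply/eqP; rewrite -addr_eq0 -dD //.
by rewrite addNr delta0.
Qed.

Lemma mapc_delta_k P : poly_in (range iota) P -> mapc delta P = 0.
Proof.
move=> PP; apply/mpolyP => m; rewrite mcoeff_mapc ?delta0 // mcoeff0.
by have [c _ <-] := PP m; apply: dk.
Qed.

(** The ideal is spanned by polynomials over k, and on their combinations [delta] acts through the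
    scalars only. *)
Lemma IS_mapc_delta G : IS G -> poly_in Phi G -> IS (mapc delta G).
Proof.
move=> GI PG; have [s sP ->] := spanned_in (subfield_range iota) PhiF Phik (@IS_ideal _ _ _ S)
  (@IS_spanned _ _ _ S) GI PG.
have -> : mapc delta (\sum_(y <- s) y.1 *: y.2) = \sum_(y <- s) delta y.1 *: y.2.
  apply/mpolyP => m; rewrite mcoeff_mapc ?delta0 // !raddf_sum /= !big_seq delta_sum.
    apply: eq_bigr => y /sP [P1 P2 _]; rewrite !mcoeffZ dM //; last by apply: Phik; apply: P2.
    by have [c _ <-] := P2 m; rewrite dk mulr0 addr0.
  by move=> y /sP [P1 P2 _]; rewrite mcoeffZ; apply: (sfM PhiF P1); apply: Phik; apply: P2.
have [I0 ID IM] := @IS_ideal _ _ _ S.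
rewrite big_seq; apply: (big_ind (@IS _ _ _ S)) => // y /sP [_ _ h].
by rewrite -mul_mpolyC; apply: IM.
Qed.

Variable E : Div.
Hypothesis Ep : prime_divisor E.
Hypothesis E_neg : lf (phi E) (phi E) < 0.
Hypothesis EPhi : defined_over Phi E.

(** With a local generator B1 of E, write A s = B1 c on S and differentiate. As s is a unit, delta A
    is a combination of c, which is a unit times A / E, and of A and B1, which are multiples of
    E. *)
Lemma delta_local e A p : homogeneous e A -> poly_in Phi A -> vanishing E A -> onS p ->
  ideal2 p (form_divisor A p / E p) (E p) (form_divisor (mapc delta A) p).
Proof.
move=> Ae PA AV pS; have EC := prime_cartier Ep; have E0 := cartier_neq0 EC pS.
have [e' [B1 [Be PB BV Bg]]] := generator_over PhiF Phik EC (prime_effective Ep) EPhi pS.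
have uB := (generatesP E Be pS).1 Bg; have OA := (vanishingP Ae EC).1 AV p pS.
pose i := coord p; have xi : x i != 0 := coord_gen_neq0 pS (coordP0 pS).
have B0 : gev B1 != 0.
  apply: contraTneq isT => B0; case: (OSunit_neq0 uB).
  by rewrite (form_divisorE Be pS) B0 !mul0r eqxx.
have PX m : poly_in Phi (mX i ^+ m : form) by apply: poly_in_exp => //; apply: poly_inX.
have dX m : mapc delta (mX i ^+ m : form) = 0.
  apply: mapc_delta_k; apply: poly_in_exp; first exact: subfield_range.
  by apply: poly_inX; apply: subfield_range.
have [||||||h [s [c [sd cd [Ps Pc s0 scI]]]]] := @quotient_over _ _ _ S Phi PhiF Phik (e' + e)
    (mX i ^+ e' * A) (mX i ^+ e * B1) p _ _ _ _ _ pS.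
- by apply: homogeneousM => //; apply: homogeneous_Xn.
- by rewrite addnC; apply: homogeneousM => //; apply: homogeneous_Xn.
- exact: poly_inM.
- exact: poly_inM.
- by rewrite rmorphM rmorphXn /= gevX mulf_neq0 ?expf_neq0.
- have := OSM OA (OSunit_OS (OSunitV uB)).
  rewrite (form_divisorE Ae pS) (form_divisorE Be pS) !rmorphM !rmorphXn /= !gevX.
  by congr (OS p); field; rewrite E0 B0 !expf_neq0.
have PXA : poly_in Phi (mX i ^+ e' * A) by apply: poly_inM.
have PXB : poly_in Phi (mX i ^+ e * B1) by apply: poly_inM.
have PXAs : poly_in Phi (mX i ^+ e' * A * s) by apply: poly_inM.
have PXBc : poly_in Phi (mX i ^+ e * B1 * c) by apply: poly_inM.
have := IS_mapc_delta scI (poly_inB PhiF PXAs PXBc).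
rewrite mapc_deltaB // !mapc_deltaM // !dX !mul0r !add0r => dI.
have dXi m : dehom i (mX i ^+ m : form) = 1 :> K.
  by rewrite (dehom_homogeneous (homogeneous_Xn i m) xi) rmorphXn /= gevX divff // expf_neq0.
have := dehom_IS scI xi; have := dehom_IS dI xi.
rewrite !(rmorphB, rmorphD, rmorphM) /= !dXi !mul1r => E1 E2.
have us : OSunit p (dehom i s).
  rewrite (dehom_homogeneous sd xi) -gevX -rmorphXn.
  by apply: (OSunit_frac pS sd (homogeneous_Xn i h) s0); rewrite rmorphXn /= ptX coordP // expr1n oner_eq0.
have u0 := OSunit_neq0 us.
have Od F : OS p (dehom i F) by apply: dehom_OS => //; apply: coordP.
set u := form_divisor B1 p / E p in uB.
have uu0 := OSunit_neq0 uB.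
exists (dehom i (mapc delta B1) / u), ((u * dehom i (mapc delta c) - form_divisor A p / E p * dehom i (mapc delta s)) / dehom i s).
split.
- by apply: OSM => //; apply/OSunit_OS/OSunitV.
- apply: OSM; last exact/OSunit_OS/OSunitV.
  apply: OSB => //; first by apply: OSM => //; exact: OSunit_OS.
  exact: OSM.
have bE : dehom i B1 = u * E p by rewrite /u divfK.
have aE : dehom i A = form_divisor A p / E p * E p by rewrite divfK.
rewrite -/i in aE *; set Z := form_divisor A p / E p in aE *.
have cE : dehom i c = Z * dehom i s / u.
  apply: (mulfI (mulf_neq0 uu0 E0)); rewrite -bE; move/eqP: E2; rewrite subr_eq0 => /eqP <-.
  by rewrite aE bE; field.
rewrite /form_divisor -/i; move: E1; rewrite cE bE aE => E1.
apply: (mulIf u0); rewrite mulrDl; apply/eqP; rewrite -subr_eq0 -E1; apply/eqP.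
by field; rewrite uu0 u0.
Qed.

(* Put div A = E + Z and Y = div (delta A). If delta A does not vanish on E, then
   neither Y nor Z contains E, and Y lies locally in the ideal (Z, E) by
   [delta_local]; hence Z.E <= Y.E, whereas Y ~ E + Z gives Y.E < Z.E. *)
Lemma derivation_stable e A : homogeneous e A -> poly_in Phi A -> vanishing E A ->
  vanishing E (mapc delta A).
Proof.
move=> Ae PA AV; apply: contrapT => NV.
have EC := prime_cartier Ep.
have dAe : homogeneous e (mapc delta A) by apply: homogeneous_mapc => //; apply: delta0.
have van0 F : IS F -> vanishing E F.
  move=> FI q i qS qi; rewrite dehom_IS // ?mul0r; first exact: OS0.
  by apply: (coord_gen_neq0 qS); rewrite qi oner_eq0.
have A0 : gev A != 0.
  apply/eqP => A0; apply: NV; apply: van0; apply: IS_mapc_delta => //.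
  by apply/(IS_homogeneous Ae).
have dA0 : gev (mapc delta A) != 0.
  by apply/eqP => A1; apply: NV; apply: van0; apply/(IS_homogeneous dAe).
pose Z : Div := fun p => form_divisor A p / E p.
pose Y := form_divisor (mapc delta A).
have AC := form_divisor_cartier Ae A0; have YC := form_divisor_cartier dAe dA0.
have ZC : cartier Z by apply: (cartier_mul AC (cartier_inv EC)).
have ZE : effective Z := (vanishingP Ae EC).1 AV.
have YE : effective Y by apply: form_divisor_effective.
have YZ p : onS p -> ideal2 p (Z p) (E p) (Y p) by move=> pS; apply: delta_local Ae PA AV pS.
have nY : ~ forall p, onS p -> OS p (Y p / E p) by move=> h; apply/NV/(vanishingP dAe EC).
have : lf (phi Z) (phi E) <= lf (phi Y) (phi E).
  apply: (intersection_compare BP phiP dP d_le7 YC YE ZC ZE Ep _ _ YZ).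
    by move=> m C CP i CE; apply: nY => p pS; apply: (component_divides YC CP EC CE pS).
  move=> m C CP i CE; apply: nY => p pS; have E0 := cartier_neq0 EC pS.
  have OZ := component_divides ZC CP EC CE pS.
  have [a [b [Oa Ob ->]]] := YZ p pS.
  by rewrite mulrDl mulfK // -mulrA; apply: (OSD pS) => //; apply: OSM.
have -> : phi Y = phi E + phi Z.
  rewrite -(phi_add phiP EC ZC).
  transitivity (phi (form_divisor A)).
    by apply/(phi_lin_equiv phiP YC AC); apply: form_divisor_lin_equiv dAe Ae dA0 A0.
  apply: (phi_div_eq phiP AC (cartier_mul EC ZC)) => p pS.
  rewrite /div_add /Z mulrCA divff ?mulr1 ?(cartier_neq0 EC pS) // divff; first exact: OSunit1.
  exact: cartier_neq0 AC pS.
by rewrite lformDl lerDr leNgt E_neg.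
Qed.

End Derivation.

Section InseparableDescent.
Variables (L : fieldExtType k) (j : {rmorphism L -> kb}).
Hypothesis jP : forall c, j c%:A = iota c.
Variable E : Div.
Hypothesis Ep : prime_divisor E.
Hypothesis E_neg : lf (phi E) (phi E) < 0.

Local Notation im H := [set z | exists2 y, y \in H & z = j y].

(** A maximal proper intermediate field: [H] is generated over it by any element outside, which
    makes the kernel of a nonzero derivation over [H'] exactly [H']. *)
Lemma maximal_subfield (H0 H : {subfield L}) : (H0 <= H)%VS -> H0 != H :> {vspace L} ->
  exists H' : {subfield L}, [/\ (H0 <= H')%VS, (H' <= H)%VS, ~~ (H <= H')%VS &
    forall u, u \in H -> u \notin H' -> <<H'; u>>%VS = H].
Proof.
move=> H0H H0neq.
pose good (H' : {subfield L}) := [/\ (H0 <= H')%VS, (H' <= H)%VS & ~~ (H <= H')%VS].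
have Ex : exists m, `[< exists H', good H' /\ \dim H' = m >].
  exists (\dim H0); apply/asboolP; exists H0; split=> //; split=> //.
  by apply: contraNN H0neq => h; apply/eqP/subv_anti; rewrite H0H h.
have bound m : `[< exists H', good H' /\ \dim H' = m >] -> (m <= \dim H)%N.
  by move=> /asboolP[H' [[_ h _] <-]]; apply: dimvS.
case: (ex_maxnP Ex bound) => m /asboolP[H' [[h1 h2 h3] dE]] mmax.
exists H'; split=> // u uH uH'; apply/eqP/negPn/negP => neq.
have sub : (<<H'; u>> <= H)%VS by apply/FadjoinP.
have := mmax (\dim <<H'; u>>%VS) => /(_ _) lem.
have : (\dim <<H'; u>>%VS <= m)%N.
  apply: lem; apply/asboolP; exists <<H'; u>>%AS; split=> //; split=> //.
    by apply: subv_trans h1 _; apply: subv_adjoin.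
  by apply: contraNN neq => h; apply/eqP/subv_anti; rewrite sub h.
rewrite -dE => le; have : H' == <<H'; u>>%VS :> {vspace L}.
  by rewrite eqEdim subv_adjoin le.
by move/eqP => EH; move/negP: uH'; apply; rewrite EH; apply: memv_adjoin.
Qed.

(** As [u] is inseparable over [H'], there is a nonzero derivation of [H] over [H']. It preserves
    the forms over [H] that vanish along [E], so these are spanned by forms over its field of
    constants, which is [H']. *)
Lemma inseparable_step (H0 H : {subfield L}) : (H0 <= H)%VS -> H0 != H :> {vspace L} ->
  purely_inseparable H0 H -> defined_over (im H) E ->
  exists H' : {subfield L}, [/\ (H0 <= H')%VS, (H' <= H)%VS, (\dim H' < \dim H)%N & defined_over (im H') E].
Proof.
move=> H0H neq ins EH; have [H' [h1 h2 h3 h4]] := maximal_subfield H0H neq.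
have [u uH uH'] := subvPn h3.
have nsep : ~ separable_element H' u.
  move=> su; move/negP: uH'; apply; rewrite -separable_inseparable_element su /=.
  by apply: (sub_inseparable h1); apply: (purely_inseparableP ins).
have [D [DD DH' DH]] : exists D : 'End(L), [/\ Derivation H D, (H' <= lker D)%VS & ~ (H <= lker D)%VS].
  apply: contrapT => N0; apply: nsep; apply/Derivation_separableP; rewrite (h4 u uH uH') => D DD DH'.
  by apply: contrapT => DH; apply: N0; exists D.
have kerD y : y \in H -> D y = 0 -> y \in H'.
  move=> yH Dy; apply/negPn/negP => yH'; apply: DH; rewrite -(h4 y yH yH').
  apply/subvP => _ /Fadjoin_polyP[p pH' ->]; rewrite memv_ker (Derivation_horner DD) //; last first.
    by apply: polyOverS pH' => z /(subvP h2).
  rewrite Dy mulr0 addr0; have -> : map_poly D p = 0; last by rewrite horner0.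
  apply/polyP => i; rewrite coef0 coef_map_id0 ?linear0 //; apply/eqP; rewrite -memv_ker.
  by apply: (subvP DH'); move/polyOverP: pH'.
(* [h] inverts [j] on the image of [H]; outside it has the default value 0, and nothing is claimed
   there. *)
pose h z := xget 0 [set y | y \in H /\ z = j y].
have hj y : y \in H -> h (j y) = y.
  move=> yH; have [_ /fmorph_inj //] : h (j y) \in H /\ j y = j (h (j y)).
    exact: (@xgetPex _ 0 [set y' | y' \in H /\ j y = j y'] (ex_intro _ y (conj yH erefl))).
have Du : D u != 0 by apply: contraNneq uH' => /(kerD u uH).
have DuH y : y \in H -> D y / D u \in H.
  rewrite -(h4 u uH uH') => /Fadjoin_polyP[p pH' ->]; rewrite (Derivation_horner DD) //; last first.
    by apply: polyOverS pH' => z /(subvP h2).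
  have -> : map_poly D p = 0.
    apply/polyP => i; rewrite coef0 coef_map_id0 ?linear0 //; apply/eqP; rewrite -memv_ker.
    by apply: (subvP DH'); move/polyOverP: pH'.
  rewrite horner0 add0r mulfK //; apply/Fadjoin_polyP; exists p^`() => //.
  exact: polyOver_deriv.
(* The division makes [delta] map [im H] to itself. *)
pose delta z := j (D (h z) / D u).
have deltaE y : y \in H -> delta (j y) = j (D y / D u) by move=> yH; rewrite /delta hj.
have PhiF := image_subfield j H; have Phik := image_base jP H.
have dD a b : (im H) a -> (im H) b -> delta (a + b) = delta a + delta b.
  move=> [a' aH ->] [b' bH ->]; rewrite -rmorphD !deltaE ?rpredD //.
  by rewrite linearD mulrDl rmorphD.
have dM a b : (im H) a -> (im H) b -> delta (a * b) = delta a * b + a * delta b.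
  move=> [a' aH ->] [b' bH ->]; rewrite -rmorphM !deltaE ?rpredM //.
  rewrite (Derivation_mul DD) // -!rmorphM -rmorphD; congr (j _); ring.
have dk c : delta (iota c) = 0.
  rewrite -jP deltaE ?rpredZ ?mem1v // linearZ /= (Derivation1 DD) scaler0 mul0r rmorph0 //.
have dPhi a : (im H) a -> (im H) (delta a).
  by move=> [a' aH ->]; rewrite deltaE //; exists (D a' / D u) => //; apply: DuH.
have EC := prime_cartier Ep; have EE := prime_effective Ep.
exists H'; split=> //.
  by rewrite ltn_neqAle dimvS // andbT; apply: contraNneq h3 => dE; rewrite -(geq_leqif (dimv_leqif_sup h2)) dE.
apply: (generators_defined_over (image_subfield j H') (image_base jP H')) => // p pS.
have [e [A [Ae PA AV Ag]]] := generator_over PhiF Phik EC EE EH pS.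
pose W := [set F : form | homogeneous e F /\ vanishing E F].
have [V0 VD VM] := vanishing_ideal E.
have [||||||s sP sE] := @operator_descent kb (im H) [set delta] N.+1 PhiF _ _ _ W _ _ _ A (conj Ae AV) PA.
- by move=> _ ->; apply: (delta0 dk).
- by move=> _ ->; have := dk 1; rewrite rmorph1.
- by move=> _ z ->; apply: dPhi.
- by move=> a b [ae aV] [be bV]; split; [apply: homogeneousD | apply: VD].
- by move=> c a _ [ae aV]; split; [apply: homogeneousZ | rewrite -mul_mpolyC; apply: VM].
- move=> _ a -> Pa [ae aV]; split; first by apply: homogeneous_mapc => //; apply: (delta0 dk).
  exact: (derivation_stable PhiF Phik dD dM dk Ep E_neg EH ae Pa aV).
rewrite sE in Ag; have [y ys yg] := generates_summand EC pS (fun y ys => let: And4 _ h _ _ := sP y ys in h) Ag.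
have [_ [ye yV] yK _] := sP y ys; exists e, y.2; split=> // m.
have [[z zH zE] zd] := yK m; exists z => //; apply: kerD => //.
have := zd delta erefl; rewrite zE deltaE // => /eqP; rewrite fmorph_eq0 mulf_eq0 invr_eq0 (negPf Du) orbF.
by move/eqP.
Qed.

Lemma inseparable_descent (H0 H : {subfield L}) : (H0 <= H)%VS -> purely_inseparable H0 H ->
  defined_over (im H) E -> defined_over (im H0) E.
Proof.
have [m] := ubnP (\dim H); elim: m H => // m IH H Hm H0H ins EH.
have [HE|neq] := eqVneq (H0 : {vspace L}) H; first by move: EH; rewrite -HE.
have [H' [h1 h2 h3 h4]] := inseparable_step H0H neq ins EH.
apply: (IH H') => //; first by apply: leq_trans h3 _.
apply/purely_inseparableP => y /(subvP h2); exact: (purely_inseparableP ins).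
Qed.

End InseparableDescent.
End DerivationStable.

(** * The Galois action on divisors *)

Section GaloisAction.
Variables (k : fieldType) (kb : closedFieldType) (iota : {rmorphism k -> kb}).
Variable S : smooth_projective_surface iota.

Local Notation K := (fun_field S).
Local Notation N := (dim_amb S).
Local Notation form := (mpol kb N.+1).
Local Notation pt := 'rV[kb]_N.+1.
Local Notation emb := (fun_emb S).
Local Notation x := (gen_pt S).
Local Notation gev := (gen_eval emb x).
Local Notation OSm p := (local_max emb x p).
Local Notation Div := (divisor S).
Implicit Types (p q : pt) (C D E : Div) (A F G P Q R : form).

Lemma map_mpoly_homogeneous (s : {rmorphism kb -> kb}) e F : homogeneous e F ->
  homogeneous e (map_mpoly s F).
Proof.
move=> /homogeneousP Fe; apply: homogeneous_coeff => m.
by rewrite mcoeff_map_mpoly fmorph_eq0; apply: Fe.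
Qed.

Lemma map_mpoly_fixed (s : {rmorphism kb -> kb}) F (Phi : set kb) : (forall z, Phi z -> s z = z) ->
  poly_in Phi F -> map_mpoly s F = F.
Proof. by move=> sP PF; apply/mpolyP => m; rewrite mcoeff_map_mpoly; apply: sP. Qed.

Lemma map_mpoly_cancel (s s' : {rmorphism kb -> kb}) : cancel s s' ->
  cancel (@map_mpoly N.+1 _ _ s) (@map_mpoly N.+1 _ _ s').
Proof. by move=> sK F; apply/mpolyP => m; rewrite !mcoeff_map_mpoly; apply: sK. Qed.

Lemma IS_map_mpoly (s : {rmorphism kb -> kb}) F : (forall c, s (iota c) = iota c) -> IS F ->
  IS (map_mpoly s F).
Proof.
move=> sc FI; have [t tP ->] := IS_spanned FI; have [I0 ID IM] := @IS_ideal _ _ _ S.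
rewrite rmorph_sum big_seq; apply: (big_ind (@IS _ _ _ S)) => // y /tP [yk yI] /=.
rewrite map_mpolyZ -mul_mpolyC (map_mpoly_fixed _ yk); first exact: IM.
by move=> _ [c _ <-].
Qed.

Lemma map_mpoly_gev_neq0 (s s' : {rmorphism kb -> kb}) e G : cancel s s' -> cancel s' s ->
  (forall c, s (iota c) = iota c) -> homogeneous e G -> gev G != 0 -> gev (map_mpoly s G) != 0.
Proof.
move=> sK s'K sc Ge; apply: contraNneq => G0.
have s'c c : s' (iota c) = iota c by rewrite -[LHS](congr1 s' (sc c)) sK.
apply/eqP/(IS_homogeneous Ge); rewrite -(map_mpoly_cancel sK G); apply: IS_map_mpoly => //.
by apply/(IS_homogeneous (map_mpoly_homogeneous s Ge)).
Qed.

(** Acting on the coefficients of numerators and denominators is well defined because the ideal of S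
    is spanned over k. *)
Lemma exists_tau (s s' : {rmorphism kb -> kb}) : cancel s s' -> cancel s' s ->
  (forall c, s (iota c) = iota c) -> exists tau : {rmorphism K -> K}, galois_element s s' tau.
Proof.
move=> sK s'K sc; have ne0 := map_mpoly_gev_neq0 sK s'K sc.
pose graph (z w : K) := exists e F G, [/\ homogeneous e F, homogeneous e G, gev G != 0,
  z = gev F / gev G & w = gev (map_mpoly s F) / gev (map_mpoly s G)].
have fract z : exists w, graph z w.
  have [e [F [G [Fe Ge G0 zE]]]] := fun_field_gen z.
  by exists (gev (map_mpoly s F) / gev (map_mpoly s G)), e, F, G.
have funct z w w' : graph z w -> graph z w' -> w = w'.
  move=> [e [F [G [Fe Ge G0 -> ->]]]] [e' [F' [G' [Fe' Ge' G0' E ->]]]].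
  have h : homogeneous (e + e') (F * G' - F' * G).
    by apply: homogeneousB; [|rewrite addnC]; apply: homogeneousM.
  have /(IS_homogeneous h) /(IS_map_mpoly sc) : gev (F * G' - F' * G) = 0.
    by move/eqP: E; rewrite eqr_div // -!rmorphM -subr_eq0 -rmorphB => /eqP.
  move=> /(IS_homogeneous (map_mpoly_homogeneous s h)); rewrite !(rmorphB, rmorphM) /= => /eqP.
  rewrite subr_eq0 => /eqP E'; have h1 := ne0 e G Ge G0; have h2 := ne0 e' G' Ge' G0'.
  by apply/eqP; rewrite eqr_div //; apply/eqP.
have [t0 t0P] := choice fract.
have [|||tau tauE] := @mk_rmorphism K K t0.
- move=> z w; apply: (funct _ _ _ (t0P _)).
  have [e [F [G [Fe Ge G0 -> ->]]]] := t0P z; have [e' [F' [G' [Fe' Ge' G0' -> ->]]]] := t0P w.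
  exists (e + e')%N, (F * G' - F' * G), (G * G'); split.
  + by apply: homogeneousB; [|rewrite addnC]; apply: homogeneousM.
  + exact: homogeneousM.
  + by rewrite rmorphM mulf_neq0.
  + by rewrite rmorphB !rmorphM /= -[- (gev F' / _)]mulNr addf_div // mulNr.
  + have h := ne0 e G Ge G0; have h' := ne0 e' G' Ge' G0'.
    by rewrite !(rmorphB, rmorphM) /= -[- (gev (map_mpoly s F') / _)]mulNr addf_div // mulNr.
- move=> z w; apply: (funct _ _ _ (t0P _)).
  have [e [F [G [Fe Ge G0 -> ->]]]] := t0P z; have [e' [F' [G' [Fe' Ge' G0' -> ->]]]] := t0P w.
  exists (e + e')%N, (F * F'), (G * G'); split.
  + exact: homogeneousM.
  + exact: homogeneousM.
  + by rewrite rmorphM mulf_neq0.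
  + by rewrite !rmorphM /= mulf_div.
  + by rewrite !rmorphM /= mulf_div.
- apply: (funct _ _ _ (t0P _)); exists 0%N, 1, 1; rewrite !rmorph1 divr1 oner_eq0.
  by split=> //; apply: homogeneous1.
exists tau; split=> // [c|z [e [F [G [Fe Ge G0 zE]]]]]; rewrite tauE; apply: (funct _ _ _ (t0P _)).
  exists 0%N, (mpolyC _ c), 1; rewrite !rmorph1 !divr1 oner_eq0 map_mpolyC !gevC.
  by split=> //; [apply: homogeneousC | apply: homogeneous1].
have kE H : gev (map_mpoly iota H) = gen_eval_k iota emb x H.
  apply: (@mpoly_morphP _ _ _ (mmap emb x \o map_mpoly iota) (mmap (emb \o iota) x)) => [c|j] /=.
    by rewrite map_mpolyC !mmapC.
  by rewrite map_mpolyX !mmapX !mmap1U.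
have kh H : homogeneous e H -> homogeneous e (map_mpoly iota H : form).
  move=> /homogeneousP He; apply: homogeneous_coeff => m.
  by rewrite mcoeff_map_mpoly fmorph_eq0; apply: He.
have ks H : map_mpoly s (map_mpoly iota H) = map_mpoly iota H.
  by apply/mpolyP => m; rewrite !mcoeff_map_mpoly; apply: sc.
exists e, (map_mpoly iota F), (map_mpoly iota G); rewrite !ks !kE zE.
by split=> //; apply: kh.
Qed.

Section Element.
Variables (sigma sigma' : {rmorphism kb -> kb}) (tau : {rmorphism K -> K}).
Hypothesis gal : galois_element sigma sigma' tau.

Local Notation sg := (map_mpoly sigma).
Local Notation pb p := (map_mx sigma' p).
Local Notation act := (galois_act sigma' tau).

Lemma gal_fix' c : sigma' (iota c) = iota c.
Proof. by case: gal => sK _ sc _ _; rewrite -[LHS](congr1 sigma' (sc c)) sK. Qed.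

Lemma tau_dehom i F : x i != 0 -> tau (dehom i F) = dehom i (sg F).
Proof.
move=> xi; case: gal => _ _ _ te tk.
apply: (@mpoly_morphP _ _ _ (tau \o dehom i) (dehom i \o sg)) => [c|j] /=.
  by rewrite map_mpolyC /dehom !mmapC te.
rewrite map_mpolyX /dehom !mmapX !mmap1U; apply: tk.
exists 1%N, (mX j), (mX i); rewrite /gen_eval_k !mmapX !mmap1U.
by split=> //; apply: homogeneousX.
Qed.

Lemma tau_frac e F G : homogeneous e F -> homogeneous e G ->
  tau (gev F / gev G) = gev (sg F) / gev (sg G).
Proof.
move=> Fe Ge; have [i xi] := gen_pt_neq0 S.
have E H : gev H / x i ^+ e / (gev G / x i ^+ e) = gev H / gev G.
  by rewrite invf_div mulrA divfK // expf_neq0.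
have xe : x i ^+ e != 0 by rewrite expf_neq0.
rewrite -(mulfK xe (gev F)) -mulrA mulrC -mulrA [X in tau (_ * X)]mulrC.
have -> : (x i ^+ e)^-1 * (gev F * x i ^+ e / gev G) = (gev F / x i ^+ e) / (gev G / x i ^+ e).
  by rewrite invf_div; ring.
rewrite fmorph_div -!(dehom_homogeneous _ xi) // !tau_dehom //.
rewrite !(@dehom_homogeneous _ _ _ _ _ e) //; try exact: map_mpoly_homogeneous.
by rewrite invf_div mulrA divfK.
Qed.

Lemma pt_eval_galois p F : pt_eval p (sg F) = sigma (pt_eval (pb p) F).
Proof.
case: gal => sK s'K _ _ _.
apply: (@mpoly_morphP _ _ _ (meval (fun i => p 0 i) \o sg) (sigma \o meval (fun i => pb p 0 i))) => [c|j] /=.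
  by rewrite map_mpolyC !mevalC.
by rewrite map_mpolyX !mevalXU mxE s'K.
Qed.

Lemma onS_galois p : onS p -> onS (pb p).
Proof.
case: gal => sK s'K sc _ _ [[i pi pz] pI]; split.
  by exists i => [|i' lt]; rewrite mxE ?pi ?rmorph1 // pz // rmorph0.
move=> e F Fe F0; apply: (fmorph_inj sigma); rewrite rmorph0 -pt_eval_galois.
apply: (pI e); first exact: map_mpoly_homogeneous.
apply/(IS_homogeneous (map_mpoly_homogeneous sigma Fe)); apply: IS_map_mpoly => //.
exact/(IS_homogeneous Fe).
Qed.

Lemma OS_galois p z : OS (pb p) z -> OS p (tau z).
Proof.
move=> [e [F [G [Fe Ge G0 ->]]]]; rewrite (tau_frac Fe Ge).
exists e, (sg F), (sg G); split=> //; try exact: map_mpoly_homogeneous.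
by rewrite pt_eval_galois fmorph_eq0.
Qed.

Lemma OSunit_galois p z : OSunit (pb p) z -> OSunit p (tau z).
Proof.
move=> [z0 Oz Oz']; split; first by rewrite fmorph_eq0.
  exact: OS_galois.
by rewrite -fmorphV; apply: OS_galois.
Qed.

Lemma galois_act_cartier D : cartier D -> cartier (act D).
Proof.
move=> DC p pS; have qS := onS_galois pS.
split; first by rewrite /galois_act fmorph_eq0; apply: cartier_neq0.
have [e [g [ge _ gq gP]]] := cartier_local DC qS.
exists e, (sg g); split; first exact: map_mpoly_homogeneous.
  by rewrite pt_eval_galois fmorph_eq0.
move=> p' p'S; rewrite pt_eval_galois fmorph_eq0 => gq'.
rewrite /galois_act -fmorph_div; apply: OSunit_galois.
by apply: gP => //; apply: onS_galois.
Qed.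

Lemma galois_act_effective D : effective D -> effective (act D).
Proof. by move=> DE p pS; apply: OS_galois; apply: DE; apply: onS_galois. Qed.

Lemma galois_act_div_eq D E : div_eq D E -> div_eq (act D) (act E).
Proof.
by move=> DE p pS; rewrite /galois_act -fmorph_div; apply/OSunit_galois/DE/onS_galois.
Qed.

Lemma galois_act_add D E : act (div_add D E) = div_add (act D) (act E).
Proof. by apply/funext => p; rewrite /galois_act /div_add rmorphM. Qed.

Lemma galois_act_scale f D : act (fun p => f * D p) = fun p => tau f * act D p.
Proof. by apply/funext => p; rewrite /galois_act rmorphM. Qed.

Lemma galois_act_lin_equiv D E : lin_equiv D E -> lin_equiv (act D) (act E).
Proof.
move=> [f f0 DE]; exists (tau f); first by rewrite fmorph_eq0.
by rewrite -galois_act_scale; apply: galois_act_div_eq.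
Qed.

Lemma galois_act_defined_over (Phi : set kb) D : (forall z, Phi z -> Phi (sigma z)) ->
  defined_over Phi D -> defined_over Phi (act D).
Proof.
move=> sP DD p pS; have qS := onS_galois pS; case: gal => sK s'K sc _ _.
have [d [e [g [a [b [[gd ae be] [Pg Pa Pb] [gp a0 b0] H]]]]]] := DD _ qS.
have PM F : poly_in Phi F -> poly_in Phi (sg F) by move=> PF m; rewrite mcoeff_map_mpoly; apply: sP.
exists d, e, (sg g), (sg a), (sg b); split.
- by split; apply: map_mpoly_homogeneous.
- by split; apply: PM.
- by split; [rewrite pt_eval_galois fmorph_eq0 | apply: map_mpoly_gev_neq0 ae a0 | apply: map_mpoly_gev_neq0 be b0].
move=> p' p'S; rewrite pt_eval_galois fmorph_eq0 => gq'.
rewrite -(tau_frac ae be) /galois_act -fmorph_div; apply: OSunit_galois.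
by apply: H => //; apply: onS_galois.
Qed.

(** A local equation with fixed coefficients is its own conjugate, and the set where it is valid is
    mapped to itself. *)
Lemma galois_act_fixed (Phi : set kb) D : cartier D -> (forall z, Phi z -> sigma z = z) ->
  defined_over Phi D -> div_eq (act D) D.
Proof.
move=> DC sP DD p pS; have qS := onS_galois pS.
have [d [e [g [a [b [[gd ae be] [Pg Pa Pb] [gp a0 b0] H]]]]]] := DD _ qS.
have := OSunitV (OSunit_galois (H _ qS gp)).
have gp' : pt_eval p g != 0.
  by rewrite -(map_mpoly_fixed sP Pg) pt_eval_galois fmorph_eq0.
move=> U; have := OSunitM U (H _ pS gp').
rewrite fmorph_div (tau_frac ae be) !(map_mpoly_fixed sP) // -/(galois_act sigma' tau D p).
have D0 := cartier_neq0 DC pS; have aD0 := cartier_neq0 (galois_act_cartier DC) pS.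
by congr (OSunit p); field; rewrite D0 aD0 a0 b0.
Qed.

End Element.

Lemma galois_inverse sigma sigma' tau : @galois_element _ _ _ S sigma sigma' tau ->
  exists tau', [/\ galois_element sigma' sigma tau', cancel tau tau' & cancel tau' tau].
Proof.
move=> gal; have [sK s'K sc te tk] := gal.
have [tau' gal'] := exists_tau s'K sK (gal_fix' gal).
exists tau'; split=> // z; have [e [F [G [Fe Ge G0 ->]]]] := fun_field_gen z.
  rewrite (tau_frac gal Fe Ge) (tau_frac gal' (map_mpoly_homogeneous sigma Fe) (map_mpoly_homogeneous sigma Ge)).
  by rewrite !(map_mpoly_cancel sK).
rewrite (tau_frac gal' Fe Ge) (tau_frac gal (map_mpoly_homogeneous sigma' Fe) (map_mpoly_homogeneous sigma' Ge)).
by rewrite !(map_mpoly_cancel s'K).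
Qed.

Lemma galois_actK s s' (t t' : {rmorphism K -> K}) : @galois_element _ _ _ S s s' t -> cancel t t' ->
  forall D, galois_act s t' (galois_act s' t D) = D.
Proof.
move=> [sK s'K _ _ _] tK D; apply/funext => p; rewrite /galois_act tK; congr D.
by apply/rowP => i; rewrite !mxE sK.
Qed.

End GaloisAction.

(** * Galois invariance of the intersection form *)

Section GaloisForm.
Variables (k : fieldType) (kb : closedFieldType) (iota : {rmorphism k -> kb}).
Variable S : smooth_projective_surface iota.

Local Notation K := (fun_field S).
Local Notation N := (dim_amb S).
Local Notation form := (mpol kb N.+1).
Local Notation pt := 'rV[kb]_N.+1.
Local Notation emb := (fun_emb S).
Local Notation x := (gen_pt S).
Local Notation gev := (gen_eval emb x).
Local Notation OSm p := (local_max emb x p).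
Local Notation Div := (divisor S).
Variables (B : Div -> Div -> int) (d : nat) (phi : Div -> lattice d).
Hypothesis BP : intersection_form B.
Hypothesis phiP : marking B phi.
Hypothesis dP : del_pezzo B d.
Hypothesis d_le7 : (d <= 7)%N.

Local Notation n := (9 - d)%N.
Local Notation lf := (@lform n int).
Local Notation ideal2 p f g := (local_ideal2 emb x p f g).
Local Notation lmult p f g m := (@local_mult _ _ _ S p f g m).
Implicit Types (p q : pt) (C D E : Div) (A F G P Q R : form).

Lemma additive_int_sum (V W : zmodType) (w : V -> W) : (forall a b, w (a + b) = w a + w b) ->
  forall m (c : 'I_m -> int) (e : 'I_m -> V), w (\sum_i e i *~ c i) = \sum_i w (e i) *~ c i.
Proof.
move=> wD m c e; have w0 : w 0 = 0.
  by apply/eqP; have /eqP := wD 0 0; rewrite addr0 -subr_eq0 opprD addrA addrN sub0r oppr_eq0.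
have wN a : w (- a) = - w a by apply/eqP; rewrite -addr_eq0 -wD addNr w0.
have wMn a i : w (a *+ i) = w a *+ i by elim: i => [|i IH]; rewrite ?mulr0n // !mulrS wD IH.
rewrite (big_morph w wD w0); apply: eq_bigr => i _.
by case: (c i) => j; rewrite ?NegzE ?mulrNz ?wN -!pmulrn wMn.
Qed.

(** For a form A generating C at p, the residual divisor Z of A avoids p, and so does the divisor Y
    of a power of a coordinate of the same degree. Thus C is equivalent to Y - Z, and its
    self-intersection becomes a difference of proper intersections. *)
Lemma exists_moving C : prime_divisor C -> exists Y Z,
  [/\ cartier Y, effective Y, cartier Z, effective Z & [/\ lin_equiv (div_add C Z) Y,
   no_component C Y & no_component C Z]].
Proof.
move=> Cp; have CC := prime_cartier Cp; have [p [pS mp]] := prime_nonunit Cp.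
have [e [A [Ae AV Ag]]] := exists_generator CC (prime_effective Cp) pS.
have uA := (generatesP C Ae pS).1 Ag; pose i := coord p.
have xi : x i != 0 := coord_gen_neq0 pS (coordP0 pS).
have A0 : gev A != 0.
  apply: contraTneq isT => A0; case: (OSunit_neq0 uA).
  by rewrite (form_divisorE Ae pS) A0 !mul0r eqxx.
have Xe := @homogeneous_Xn _ _ _ S i e.
have X0 : gev (mX i ^+ e) != 0 by rewrite rmorphXn /= gevX expf_neq0.
have AC := form_divisor_cartier Ae A0; have XC := form_divisor_cartier Xe X0.
pose Z : Div := fun q => form_divisor A q / C q.
have ZC : cartier Z by apply: (cartier_mul AC (cartier_inv CC)).
have nc D : cartier D -> OSunit p (D p) -> no_component C D.
  move=> DC uD m C' C'P l C'C; have := component_divides DC C'P CC C'C pS.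
  move=> h; apply: (OSm_not_unit mp); split=> //; first exact: cartier_neq0 CC pS.
    exact: prime_effective Cp p pS.
  have := OSM (OSunit_OS (OSunitV uD)) h; have D0 := OSunit_neq0 uD.
  by rewrite mulrA mulVf // mul1r.
exists (form_divisor (mX i ^+ e)), Z; split=> //.
- exact: form_divisor_effective.
- by move=> q qS; apply: ((vanishingP Ae CC).1 AV).
split; last exact: nc.
- have [f f0 fP] := form_divisor_lin_equiv Ae Xe A0 X0; exists f => // q qS.
  by have := fP q qS; rewrite /div_add /Z mulrCA divff ?mulr1 // cartier_neq0.
apply: nc => //; rewrite (form_divisorE Xe pS) rmorphXn /= gevX divff; first exact: OSunit1.
by rewrite expf_neq0.
Qed.

Section Element.
Variables (sigma sigma' : {rmorphism kb -> kb}) (tau tau' : {rmorphism K -> K}).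
Hypothesis gal : galois_element sigma sigma' tau.
Hypothesis gal' : galois_element sigma' sigma tau'.
Hypothesis tauK : cancel tau tau'.
Hypothesis tauK' : cancel tau' tau.

Local Notation pb p := (map_mx sigma' p).
Local Notation act := (galois_act sigma' tau).
Local Notation act' := (galois_act sigma tau').

Lemma pb_cancel p : map_mx sigma (pb p) = p.
Proof. by apply/rowP => i; rewrite !mxE; case: gal => _ ->. Qed.

Lemma ideal2_galois p f g z : ideal2 (pb p) f g z -> ideal2 p (tau f) (tau g) (tau z).
Proof.
move=> [a [b [Oa Ob ->]]]; exists (tau a), (tau b); rewrite rmorphD !rmorphM.
by split=> //; apply: (OS_galois gal).
Qed.

Lemma ideal2_galois' p f g z : ideal2 p f g z -> ideal2 (pb p) (tau' f) (tau' g) (tau' z).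
Proof.
move=> [a [b [Oa Ob ->]]]; exists (tau' a), (tau' b); rewrite rmorphD !rmorphM.
by split=> //; apply: (OS_galois gal'); rewrite pb_cancel.
Qed.

Lemma local_mult_galois p f g m : onS p -> lmult (pb p) f g m -> lmult p (tau f) (tau g) m.
Proof.
move=> pS /local_mult_span [e [Oe sp ind]].
have [sK s'K _ te _] := gal; have [_ _ _ te' _] := gal'.
apply: (local_mult_intro pS (e := fun i => tau (e i))) => [i|z Oz|c cI i].
- exact: (OS_galois gal).
- have [|c cP] := sp (tau' z); first by apply: (OS_galois gal'); rewrite pb_cancel.
  exists (fun i => sigma (c i)); have := ideal2_galois cP; rewrite rmorphB tauK' rmorph_sum.
  by under eq_bigr => i _ do rewrite rmorphM /= te.
- apply: (fmorph_inj sigma'); rewrite rmorph0; apply: (ind (fun i => sigma' (c i))).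
  have := ideal2_galois' cI; rewrite rmorph_sum !tauK.
  by under eq_bigr => j _ do rewrite rmorphM /= te' tauK.
Qed.

Lemma act_cancel D : act' (act D) = D. Proof. exact: galois_actK gal tauK D. Qed.
Lemma act'_cancel D : act (act' D) = D. Proof. exact: galois_actK gal' tauK' D. Qed.

Lemma galois_prime C : prime_divisor C -> prime_divisor (act C).
Proof.
move=> [CC CE C0 Cirr]; split.
- exact: galois_act_cartier gal _ CC.
- exact: galois_act_effective gal _ CE.
- move=> h; apply: C0 => p pS; rewrite -[C]act_cancel.
  by apply: (OSunit_galois gal'); apply: h; apply: onS_galois gal' _ pS.
move=> D E DC DE EC EE CDE.
have zero D' : div_zero (act' D') -> div_zero D'.
  move=> h p pS; rewrite -[D']act'_cancel; apply: (OSunit_galois gal).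
  by apply: h; apply: onS_galois gal _ pS.
case: (Cirr (act' D) (act' E)).
- exact: galois_act_cartier gal' _ DC.
- exact: galois_act_effective gal' _ DE.
- exact: galois_act_cartier gal' _ EC.
- exact: galois_act_effective gal' _ EE.
- by rewrite -galois_act_add -[X in div_eq X _]act_cancel; apply: (galois_act_div_eq gal').
- by left; apply: zero.
- by right; apply: zero.
Qed.

Lemma galois_distinct C C' : ~ div_eq C C' -> ~ div_eq (act C) (act C').
Proof. by move=> h /(galois_act_div_eq gal'); rewrite !act_cancel. Qed.

Lemma galois_prime_intersection C C' : prime_divisor C -> prime_divisor C' -> ~ div_eq C C' ->
  lf (phi (act C)) (phi (act C')) = lf (phi C) (phi C').
Proof.
move=> Cp C'p CC'.
have [m [mP [s0 sP]]] := prime_intersection BP phiP Cp C'p CC'.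
have [m' [mP' [s0' sP']]] := prime_intersection BP phiP (galois_prime Cp) (galois_prime C'p) (galois_distinct CC').
(* Two values for the multiplicity of one and the same ideal bound each other. *)
have mE p : onS p -> m' p = m (pb p).
  move=> pS; have h := local_mult_galois pS (mP _ (onS_galois gal pS)).
  by apply/eqP; rewrite eqn_leq; apply/andP; split; apply: (local_mult_le pS _ _ (mP' p pS)) || apply: (local_mult_le pS _ (mP' p pS)); try exact: h.
pose cv := [seq map_mx sigma q | q <- s0] ++ s0'.
have [s [us sS ss]] := cover_seq (S := S) cv.
have [sK s'K _ _ _] := gal.
rewrite (sP' s us sS); last first.
  by move=> q; rewrite mem_filter => /andP[h h']; apply: ss; rewrite mem_filter h mem_cat h' orbT.
rewrite (sP [seq pb q | q <- s]).
- by rewrite big_map big_seq [RHS]big_seq; apply: eq_bigr => q /sS /mE ->.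
- rewrite map_inj_uniq // => p q /(congr1 (map_mx sigma)); by rewrite !pb_cancel.
- by move=> _ /mapP[q /sS qS ->]; apply: onS_galois gal _ qS.
move=> q; rewrite mem_filter => /andP[/asboolP qS qs].
have E : pb (map_mx sigma q) = q by apply/rowP => i; rewrite !mxE sK.
rewrite -E; apply: map_f; apply: ss; rewrite mem_filter mem_cat map_f // andbT.
by apply/asboolP; apply: onS_galois gal' _ qS.
Qed.

Lemma galois_prime_sum D m (C : 'I_m -> Div) : prime_sum D C -> prime_sum (act D) (fun i => act (C i)).
Proof.
move=> [Cp DE]; split=> [i|]; first exact: galois_prime.
have := galois_act_div_eq gal DE.
suff -> : act (fun p => \prod_i C i p) = fun p => \prod_i act (C i) p by [].
by apply/funext => p; rewrite /galois_act rmorph_prod.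
Qed.

Lemma galois_effective_intersection D C : cartier D -> effective D -> prime_divisor C ->
  no_component C D -> lf (phi (act D)) (phi (act C)) = lf (phi D) (phi C).
Proof.
move=> DC DE Cp nC; have [m [C' C'P]] := effective_prime_sum DC DE; have [C'p _] := C'P.
rewrite (phi_prime_sum phiP DC C'P).
rewrite (phi_prime_sum phiP (galois_act_cartier gal DC) (galois_prime_sum C'P)).
rewrite !lform_suml; apply: eq_bigr => i _.
by apply: galois_prime_intersection => //; apply: (nC _ _ C'P).
Qed.

Lemma phi_galois_eq D E : cartier D -> cartier E -> phi D = phi E -> phi (act D) = phi (act E).
Proof.
move=> DC EC /(phi_lin_equiv phiP DC EC) DE.
apply/(phi_lin_equiv phiP); [exact: galois_act_cartier gal _ DC | exact: galois_act_cartier gal _ EC |].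
exact: galois_act_lin_equiv gal _ _ DE.
Qed.

(** For distinct curves the local multiplicities are transported; a self-intersection is made proper
    by [exists_moving]. *)
Lemma galois_prime_form C C' : prime_divisor C -> prime_divisor C' ->
  lf (phi (act C)) (phi (act C')) = lf (phi C) (phi C').
Proof.
move=> Cp C'p; have CC := prime_cartier Cp; have CC' := prime_cartier C'p.
have [E|] := pselect (div_eq C C'); last exact: galois_prime_intersection.
rewrite -(phi_div_eq phiP CC CC' E).
rewrite -(phi_galois_eq CC CC' (phi_div_eq phiP CC CC' E)).
have [Y [Z [YC YE ZC ZE [CZY nY nZ]]]] := exists_moving Cp.
have CZC := cartier_mul CC ZC.
have E1 : phi C = phi Y - phi Z.
  by apply/eqP; rewrite eq_sym subr_eq -(phi_add phiP) //; apply/eqP/esym/(phi_lin_equiv phiP).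
have E2 : phi (act C) = phi (act Y) - phi (act Z).
  have aC D := @galois_act_cartier _ _ _ S _ _ _ gal D.
  apply/eqP; rewrite eq_sym subr_eq -(phi_add phiP (aC _ CC) (aC _ ZC)) -galois_act_add; apply/eqP/esym.
  by apply: phi_galois_eq => //; apply/(phi_lin_equiv phiP).
rewrite {1}E2 {1}E1 !lformDl !lformNl.
by rewrite !galois_effective_intersection.
Qed.

(** Isometry only has to be checked on the classes of (-1)-curves, which span the lattice and are
    represented by prime divisors. *)
Lemma galois_map_exists : exists w, [/\ galois_image phi w,
  forall D, cartier D -> phi (act D) = w (phi D), forall u v, w (u + v) = w u + w v &
  forall u v, lf (w u) (w v) = lf u v].
Proof.
have [D0 D0P] := choice (fun v => let: ex_intro2 D a b := phi_onto phiP v in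
  ex_intro (fun D => cartier D /\ phi D = v) D (conj a b)).
pose w v := phi (act (D0 v)).
have wE D : cartier D -> phi (act D) = w (phi D).
  by move=> DC; have [h1 h2] := D0P (phi D); apply: phi_galois_eq.
have wD u v : w (u + v) = w u + w v.
  have [h1 <-] := D0P u; have [h3 <-] := D0P v.
  rewrite -(phi_add phiP) // -!wE //; last exact: cartier_mul.
  by rewrite galois_act_add (phi_add phiP) //; apply: galois_act_cartier gal _ _.
exists w; split=> // [|u v]; first by exists sigma, sigma', tau.
have exc_form e e' : exceptional e -> exceptional e' -> lf (w e) (w e') = lf e e'.
  move=> /(phi_exceptional phiP) [C Cm <-] /(phi_exceptional phiP) [C' Cm' <-].
  have Cp := minus_one_prime Cm; have Cp' := minus_one_prime Cm'.
  by rewrite -!wE; [apply: galois_prime_form | apply: prime_cartier | apply: prime_cartier].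
have [m [c [e [eE ->]]]] := exceptional_span (n_ge2 d_le7) u.
have [m' [c' [e' [eE' ->]]]] := exceptional_span (n_ge2 d_le7) v.
have zE (z : int) (y : lattice d) : z *: y = y *~ z by rewrite -[X in X *: y]intz scaler_int.
under eq_bigr do rewrite zE; under [\sum_(i < m') _]eq_bigr do rewrite zE.
rewrite !(additive_int_sum wD) !lform_suml; apply: eq_bigr => i _.
rewrite !lform_sumr; apply: eq_bigr => j _.
by rewrite -!zE !lformZl !lformZr exc_form.
Qed.

End Element.
End GaloisForm.

(** * Descent of divisors to the base field *)

Section DescentToBase.
Variables (k : fieldType) (kb : closedFieldType) (iota : {rmorphism k -> kb}).
Variable S : smooth_projective_surface iota.

Local Notation K := (fun_field S).
Local Notation N := (dim_amb S).
Local Notation form := (mpol kb N.+1).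
Local Notation pt := 'rV[kb]_N.+1.
Local Notation emb := (fun_emb S).
Local Notation x := (gen_pt S).
Local Notation gev := (gen_eval emb x).
Local Notation OSm p := (local_max emb x p).
Local Notation Div := (divisor S).
Hypothesis alg : forall z : kb, algebraicOver iota z.
Implicit Types (p q : pt) (C D E : Div) (A F G P Q R : form) (Phi : set kb).

Lemma galois_act_agree Phi s1 s1' t1 s2 s2' t2 D : @galois_element _ _ _ S s1 s1' t1 ->
  galois_element s2 s2' t2 -> (forall z, Phi z -> s1 z = s2 z) -> cartier D ->
  defined_over Phi D -> div_eq (galois_act s1' t1 D) (galois_act s2' t2 D).
Proof.
move=> g1 g2 ag DC DD p pS; have qS1 := onS_galois g1 pS; have qS2 := onS_galois g2 pS.
have [d [e [g [a [b [[gd ae be] [Pg Pa Pb] [gp a0 b0] H]]]]]] := DD _ qS1.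
have agP F : poly_in Phi F -> map_mpoly s1 F = map_mpoly s2 F.
  by move=> PF; apply/mpolyP => m; rewrite !mcoeff_map_mpoly; apply: ag.
have gq2 : pt_eval (map_mx s2' p) g != 0.
  rewrite -(fmorph_eq0 s2) -(pt_eval_galois g2) -agP // (pt_eval_galois g1) fmorph_eq0 //.
have := OSunit_div (OSunit_galois g2 (H _ qS2 gq2)) (OSunit_galois g1 (H _ qS1 gp)).
rewrite (fmorph_div t2) (fmorph_div t1) (tau_frac g1 ae be) (tau_frac g2 ae be) !agP //.
rewrite -/(galois_act s1' t1 D p) -/(galois_act s2' t2 D p).
have D1 := cartier_neq0 (galois_act_cartier g1 DC) pS.
have D2 := cartier_neq0 (galois_act_cartier g2 DC) pS.
have sK2 : cancel s2 s2' by case: g2.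
have s2K : cancel s2' s2 by case: g2.
have sc2 : forall c, s2 (iota c) = iota c by case: g2.
have a1 := map_mpoly_gev_neq0 sK2 s2K sc2 ae a0; have b1 := map_mpoly_gev_neq0 sK2 s2K sc2 be b0.
move: (gev (map_mpoly s2 a)) (gev (map_mpoly s2 b)) a1 b1 => a' b' a1 b1.
by congr (OSunit p); field; rewrite D1 D2 a1 b1.
Qed.

Lemma galois_comp s1 s1' t1 s2 s2' t2 : @galois_element _ _ _ S s1 s1' t1 ->
  galois_element s2 s2' t2 -> galois_element (s1 \o s2) (s2' \o s1') (t1 \o t2 : {rmorphism K -> K}).
Proof.
move=> [a1 a2 a3 a4 a5] [b1 b2 b3 b4 b5]; split=> [z|z|c|c|z kz] /=.
- by rewrite a1 b1.
- by rewrite b2 a2.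
- by rewrite b3 a3.
- by rewrite b4 a4.
- by rewrite b5 // a5.
Qed.

Lemma galois_act_comp (s1' s2' : {rmorphism kb -> kb}) (t1 t2 : {rmorphism K -> K}) D :
  galois_act (s2' \o s1') (t1 \o t2 : {rmorphism K -> K}) D = galois_act s1' t1 (galois_act s2' t2 D).
Proof.
apply/funext => p; rewrite /galois_act /=; congr (t1 (t2 (D _))).
by apply/rowP => i; rewrite !mxE.
Qed.

Definition fraction_over Phi (z : K) : Prop := exists e F G,
  [/\ homogeneous e F, homogeneous e G, poly_in Phi F, poly_in Phi G & gev G != 0 /\ z = gev F / gev G].

Lemma fraction_overD Phi z w : subfield_set Phi -> fraction_over Phi z -> fraction_over Phi w ->
  fraction_over Phi (z + w).
Proof.
move=> PhiF [e [F [G [Fe Ge PF PG [G0 ->]]]]] [e' [F' [G' [Fe' Ge' PF' PG' [G0' ->]]]]].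
exists (e + e')%N, (F * G' + F' * G), (G * G'); split.
- by apply: homogeneousD; [|rewrite addnC]; apply: homogeneousM.
- exact: homogeneousM.
- by apply: poly_inD => //; apply: poly_inM.
- exact: poly_inM.
- by rewrite rmorphD !rmorphM /= mulf_neq0 // addf_div.
Qed.

Lemma fraction_over_emb Phi c z : subfield_set Phi -> Phi c -> fraction_over Phi z ->
  fraction_over Phi (emb c * z).
Proof.
move=> PhiF Pc [e [F [G [Fe Ge PF PG [G0 ->]]]]]; exists e, (c *: F), G; split=> //.
- exact: homogeneousZ.
- exact: poly_inZ.
- by rewrite gevZ mulrA.
Qed.

Lemma fraction_over_sum Phi (I : finType) (f : I -> K) : subfield_set Phi ->
  (forall i, fraction_over Phi (f i)) -> fraction_over Phi (\sum_i f i).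
Proof.
move=> PhiF fP; apply: (big_ind (fraction_over Phi)) => //.
  exists 0%N, 0, 1; split; [exact: homogeneous0 | exact: homogeneous1 | exact: poly_in0 | exact: poly_in1 |].
  by rewrite !rmorph0 rmorph1 oner_eq0 mul0r.
by move=> z w; apply: fraction_overD.
Qed.

Lemma cartier_comb r (b : 'I_r -> Div) (a : 'rV[int]_r) : (forall i, cartier (b i)) ->
  cartier (div_comb b a).
Proof.
move=> bC; apply: cartier_prod => i; case: (a 0 i) => m; first exact: cartier_muln.
by apply: cartier_inv; apply: (cartier_muln m.+1).
Qed.

Lemma defined_over_comb Phi r (b : 'I_r -> Div) (a : 'rV[int]_r) : subfield_set Phi ->
  (forall i, defined_over Phi (b i)) -> defined_over Phi (div_comb b a).
Proof.
move=> PhiF bD.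
have one : defined_over Phi (fun=> 1 : K).
  move=> p pS; exists 0%N, 0%N, 1, 1, 1; rewrite !rmorph1 !oner_eq0.
  split=> //; [split; exact: homogeneous1 | split; exact: poly_in1 |].
  by move=> q qS _; rewrite !divr1; apply: OSunit1.
have pow m D : defined_over Phi D -> defined_over Phi (fun p => D p ^+ m).
  move=> DD; elim: m => [|m IH]; first exact: one.
  suff -> : (fun p => D p ^+ m.+1) = div_add D (fun p => D p ^+ m) by apply: defined_over_mul.
  by apply/funext => p; rewrite exprS.
have int i : defined_over Phi (fun p => b i p ^ a 0 i).
  case: (a 0 i) => m; first exact: (pow m).
  by apply: (@defined_over_opp _ _ _ S Phi (fun p => b i p ^+ m.+1)); apply: (pow m.+1).
suff gen (s : seq 'I_r) : defined_over Phi (fun p => \prod_(i <- s) b i p ^ a 0 i) by apply: gen.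
elim: s => [|i s IH].
  suff -> : (fun p => \prod_(i <- [::]) b i p ^ a 0 i) = (fun=> 1 : K) by [].
  by apply/funext => p; rewrite big_nil.
suff -> : (fun p => \prod_(i <- i :: s) b i p ^ a 0 i) =
    div_add (fun p => b i p ^ a 0 i) (fun p => \prod_(i <- s) b i p ^ a 0 i) by apply: defined_over_mul.
by apply/funext => p; rewrite big_cons.
Qed.

Lemma form_over_base e F : poly_in (range iota) F -> homogeneous e F ->
  exists F0 : mpol k N.+1, map_mpoly iota F0 = F /\ homogeneous e F0.
Proof.
move=> PF Fe; have /choice[c cP] : forall m, exists c, iota c = mcoeff m F.
  by move=> m; have [c _ h] := PF m; exists c.
pose F0 : mpol k N.+1 := \sum_(m <- msupp F) c m *: mpolyX k m.
have E : map_mpoly iota F0 = F.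
  rewrite rmorph_sum {2}(mpolyE F); apply: eq_bigr => m _.
  by rewrite /= map_mpolyZ map_mpolyX cP.
exists F0; split=> //; apply: homogeneous_coeff => m; rewrite -(fmorph_eq0 iota) -mcoeff_map_mpoly E.
exact: (homogeneousP Fe).
Qed.

Lemma kS_fraction f : kS f <-> fraction_over (range iota) f.
Proof.
have kE (H : mpol k N.+1) : gev (map_mpoly iota H) = gen_eval_k iota emb x H.
  apply: (@mpoly_morphP _ _ _ (mmap emb x \o map_mpoly iota) (mmap (emb \o iota) x)) => [c|j] /=.
    by rewrite map_mpolyC !mmapC.
  by rewrite map_mpolyX !mmapX !mmap1U.
split=> [[e [F [G [/homogeneousP Fe /homogeneousP Ge G0 ->]]]]|].
  exists e, (map_mpoly iota F), (map_mpoly iota G); rewrite !kE; split=> //.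
  - by apply: homogeneous_coeff => m; rewrite mcoeff_map_mpoly fmorph_eq0; apply: Fe.
  - by apply: homogeneous_coeff => m; rewrite mcoeff_map_mpoly fmorph_eq0; apply: Ge.
  - by move=> m; rewrite mcoeff_map_mpoly; exists (mcoeff m F).
  - by move=> m; rewrite mcoeff_map_mpoly; exists (mcoeff m G).
move=> [e [F [G [Fe Ge PF PG [G0 ->]]]]].
have [F0 [FE F0e]] := form_over_base PF Fe; have [G0' [GE G0e]] := form_over_base PG Ge.
by exists e, F0, G0'; rewrite -!kE FE GE.
Qed.

Lemma divisor_over_kP D : divisor_over_k D <-> cartier D /\ defined_over (range iota) D.
Proof.
split=> [[DC H]|[DC DD]]; split=> // p pS.
  have [f [d [g [[fk f0] gd gp gP]]]] := H p pS.
  have [e [a [b [ae be Pa Pb [b0 fE]]]]] := (kS_fraction f).1 fk.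
  have a0 : gev a != 0 by move: f0; rewrite fE mulf_eq0 negb_or => /andP[].
  exists d, e, (map_mpoly iota g), a, b; rewrite -fE; split=> //; split=> //.
    apply: homogeneous_coeff => m; rewrite mcoeff_map_mpoly fmorph_eq0; exact: (homogeneousP gd).
  by move=> m; rewrite mcoeff_map_mpoly; exists (mcoeff m g).
have [d [e [g [a [b [[gd ae be] [Pg Pa Pb] [gp a0 b0] H]]]]]] := DD p pS.
have [g0 [gE g0d]] := form_over_base Pg gd.
exists (gev a / gev b), d, g0; rewrite gE; split=> //.
split; last by rewrite mulf_neq0 // invr_eq0.
by apply/kS_fraction; exists e, a, b.
Qed.

Section Effective.
Variables (L : fieldExtType k) (j : {rmorphism L -> kb}) (th : L).
Hypothesis jP : forall c, j c%:A = iota c.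
Hypothesis th_sep : separable_element 1 th.
Hypothesis th_stable : forall t : {rmorphism kb -> kb}, (forall c, t (iota c) = iota c) ->
  forall y, y \in <<1; th>>%VS -> exists2 y', y' \in <<1; th>>%VS & t (j y) = j y'.

Let Phi := [set z | exists2 y, y \in <<1; th>>%VS & z = j y].

Lemma Phi_fixed z : Phi z -> (forall s s' : {rmorphism kb -> kb}, cancel s s' -> cancel s' s ->
    (forall c, s (iota c) = iota c) -> s z = z) -> range iota z.
Proof.
move=> [y yth ->] h; apply: (separable_fixed alg jP) => //.
exact: (adjoin_separableP th_sep).
Qed.

Lemma Phi_stable (t : {rmorphism kb -> kb}) z : (forall c, t (iota c) = iota c) -> Phi z -> Phi (t z).
Proof. by move=> tc [y yth ->]; apply: th_stable. Qed.

Lemma Phi_agree (s t : {rmorphism kb -> kb}) z : (forall c, s (iota c) = iota c) ->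
  (forall c, t (iota c) = iota c) -> s (j th) = t (j th) -> Phi z -> s z = t z.
Proof.
move=> sc tc st [_ /Fadjoin_polyP[p /polyOver1P[P ->] ->] ->].
rewrite -horner_map (map_in_alg jP).
have E (u : {rmorphism kb -> kb}) : (forall c, u (iota c) = iota c) ->
    u (map_poly iota P).[j th] = (map_poly iota P).[u (j th)].
  move=> uc; rewrite -horner_map -map_poly_comp; congr (_.[_]).
  by apply: eq_map_poly => c /=; rewrite uc.
by rewrite !E // st.
Qed.

(** [Phi] is a finite separable extension stable under all automorphisms. The forms over it that
    vanish along an invariant [D] are stable too, so they are spanned by such forms over the fixed
    field, which is k. *)
Lemma effective_descent D : cartier D -> effective D -> defined_over Phi D ->
  (forall s s' t, galois_element s s' t -> div_eq (galois_act s' t D) D) ->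
  defined_over (range iota) D.
Proof.
move=> DC DE DD inv; have PhiF : subfield_set Phi := image_subfield j <<1; th>>%AS.
have Phik : range iota `<=` Phi := image_base jP <<1; th>>%AS.
apply: (generators_defined_over (subfield_range iota) (fun z h => h)) => // p pS.
have [e [A [Ae PA AV Ag]]] := generator_over PhiF Phik DC DE DD pS.
pose W := [set F : form | homogeneous e F /\ vanishing D F].
pose aut (s : {rmorphism kb -> kb}) := exists2 s' : {rmorphism kb -> kb}, cancel s s' /\ cancel s' s &
  forall c, s (iota c) = iota c.
(* [s - 1] replaces [s] because the operators of [operator_descent] have to kill 1. *)
pose TT := [set t : kb -> kb | exists2 s, aut s & t = fun z => s z - z].
have [V0 VD VM] := vanishing_ideal D.
have [||||||w wP wE] := @operator_descent kb Phi TT N.+1 PhiF _ _ _ W _ _ _ A (conj Ae AV) PA.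
- by move=> _ [s _ ->]; rewrite rmorph0 subrr.
- by move=> _ [s _ ->]; rewrite rmorph1 subrr.
- move=> _ z [s [s' _ sc] ->] Pz; apply: (sfB PhiF) => //; exact: Phi_stable.
- by move=> a b [ae aV] [be bV]; split; [apply: homogeneousD | apply: VD].
- by move=> c a _ [ae aV]; split; [apply: homogeneousZ | rewrite -mul_mpolyC; apply: VM].
- move=> _ a [s [s' [sK s'K] sc] ->] Pa [ae aV].
  have -> : mapc (fun z => s z - z) a = map_mpoly s a - a.
    by apply/mpolyP => m; rewrite mcoeff_mapc ?rmorph0 ?subrr // mcoeffB mcoeff_map_mpoly.
  have se := map_mpoly_homogeneous s ae.
  split; first exact: homogeneousB.
  suff sV : vanishing D (map_mpoly s a) by rewrite -mulN1r; apply: VD => //; apply: VM.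
  have [t gal] := @exists_tau _ _ _ S _ _ sK s'K sc.
  move=> q i qS qi; have xi : x i != 0 by apply: (coord_gen_neq0 qS); rewrite qi oner_eq0.
  have := OS_galois gal (aV _ i (onS_galois gal qS) _); rewrite mxE qi rmorph1 => /(_ erefl) h.
  have := OSM h (OSunit_OS (inv _ _ _ gal q qS)).
  rewrite fmorph_div (tau_dehom gal) // -/(galois_act s' t D q).
  by rewrite mulrA divfK // cartier_neq0 //; apply: galois_act_cartier gal _ _.
rewrite wE in Ag; have [y ys yg] := generates_summand DC pS (fun y ys => let: And4 _ h _ _ := wP y ys in h) Ag.
have [_ [ye yV] yK _] := wP y ys; exists e, y.2; split=> // m.
have [yPhi yfix] := yK m; apply: (Phi_fixed yPhi) => s s' sK s'K sc; apply/eqP.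
by rewrite -subr_eq0; apply/eqP; apply: (yfix (fun z => s z - z)); exists s => //; exists s'.
Qed.

End Effective.
End DescentToBase.

(** * Galois-invariant classes *)

Section Conjugates.
Variables (k : fieldType) (kb : closedFieldType) (iota : {rmorphism k -> kb}).
Variable S : smooth_projective_surface iota.

Local Notation K := (fun_field S).
Local Notation N := (dim_amb S).
Local Notation form := (mpol kb N.+1).
Local Notation pt := 'rV[kb]_N.+1.
Local Notation emb := (fun_emb S).
Local Notation x := (gen_pt S).
Local Notation gev := (gen_eval emb x).
Local Notation OSm p := (local_max emb x p).
Local Notation Div := (divisor S).
Hypothesis alg : forall z : kb, algebraicOver iota z.
Variables (L : fieldExtType k) (j : {rmorphism L -> kb}) (th : L).
Hypothesis jP : forall c, j c%:A = iota c.
Hypothesis th_sep : separable_element 1 th.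
Hypothesis th_stable : forall t : {rmorphism kb -> kb}, (forall c, t (iota c) = iota c) ->
  forall y, y \in <<1; th>>%VS -> exists2 y', y' \in <<1; th>>%VS & t (j y) = j y'.
Implicit Types (p q : pt) (C D E : Div) (A F G P Q R : form).

Let Phi := [set z | exists2 y, y \in <<1; th>>%VS & z = j y].

Lemma conjugate_family : exists m (r : 'I_m -> kb), [/\ injective r, exists i0, r i0 = j th,
  forall i, exists s s' : {rmorphism kb -> kb}, [/\ cancel s s', cancel s' s,
    forall c, s (iota c) = iota c & s (j th) = r i] &
  forall s : {rmorphism kb -> kb}, (forall c, s (iota c) = iota c) -> forall i, exists i', s (r i) = r i'].
Proof.
have [rs rsE] := closed_field_poly_normal (map_poly j (minPoly 1 th)).
have lc : lead_coef (map_poly j (minPoly 1 th)) = 1.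
  by rewrite lead_coef_map (monicP (monic_minPoly 1 th)) rmorph1.
rewrite lc scale1r in rsE.
have urs : uniq rs by rewrite -separable_prod_XsubC -rsE separable_map.
have rootE z : (z \in rs) = root (map_poly j (minPoly 1 th)) z by rewrite rsE root_prod_XsubC.
pose r (i : 'I_(size rs)) := rs`_i.
have rP z : z \in rs -> exists i, r i = z.
  move=> zrs; have lt : (index z rs < size rs)%N by rewrite index_mem.
  by exists (Ordinal lt); rewrite /r nth_index.
have rrs i : r i \in rs by apply: mem_nth.
exists (size rs), r; split.
- by move=> i i' /eqP; rewrite /r nth_uniq // => /eqP /val_inj.
- by apply: rP; rewrite rootE /root horner_map fmorph_eq0; apply: root_minPoly.
- by move=> i; apply: (conjugate_root alg jP); rewrite -rootE.
move=> s sc i; have [|i' E] := rP (s (r i)); last by exists i'.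
have /polyOver1P[P PE] := minPolyOver 1 th; have := rrs i.
rewrite !rootE PE (map_in_alg jP) => /rootP h; apply/rootP.
have -> : map_poly iota P = map_poly s (map_poly iota P).
  by rewrite -map_poly_comp; apply: eq_map_poly => c /=; rewrite sc.
by rewrite horner_map h rmorph0.
Qed.

(** Otherwise the sum of Q(r_i) f_i would vanish for every polynomial Q; a Q vanishing at every r_i
    except r_i0 isolates f_i0. *)
Lemma power_sum_neq0 m (r : 'I_m -> kb) (f : 'I_m -> K) i0 : injective r -> f i0 != 0 ->
  exists l, \sum_i emb (r i ^+ l) * f i != 0.
Proof.
move=> rinj f0; apply: contrapT => N0; move/eqP: f0; apply.
have poly0 (Q : {poly kb}) : \sum_i emb Q.[r i] * f i = 0.
  under eq_bigr do rewrite horner_coef rmorph_sum mulr_suml.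
  rewrite exchange_big /= big1 // => l _.
  under eq_bigr do rewrite rmorphM -mulrA.
  rewrite -mulr_sumr; apply/eqP; rewrite mulf_eq0; apply/orP; right.
  by apply/negPn/negP => h; apply: N0; exists l.
pose Q := \prod_(i | i != i0) ('X - (r i)%:P); have := poly0 Q.
have Q0 i : i != i0 -> Q.[r i] = 0.
  by move=> ii0; rewrite /Q horner_prod (bigD1 i) //= hornerXsubC subrr mul0r.
rewrite (bigD1 i0) //= [X in _ + X]big1 => [|i /Q0 ->]; last by rewrite rmorph0 mul0r.
rewrite addr0 => /eqP; rewrite mulf_eq0 fmorph_eq0 => /orP[|/eqP //].
rewrite /Q horner_prod prodf_seq_eq0 => /hasP[i _ /andP[ii0]].
by rewrite hornerXsubC subr_eq0 => /eqP /rinj E; rewrite E eqxx in ii0.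
Qed.

(** The product of all conjugates of [F] is a norm, its factors being permuted by automorphisms;
    [F'] collects the conjugates other than [F]. *)
Lemma form_norm e F : homogeneous e F -> poly_in Phi F -> gev F != 0 -> exists e' F',
  [/\ homogeneous e' F', homogeneous (e + e') (F * F'), poly_in (range iota) (F * F') & gev (F * F') != 0].
Proof.
move=> Fe PF F0; have PhiF : subfield_set Phi := image_subfield j <<1; th>>%AS.
have [m [r [rinj [i0 ri0] rconj rperm]]] := conjugate_family.
have [s sP] := choice rconj.
pose F' := \prod_(i | i != i0) map_mpoly (s i) F.
have sc i : forall c, s i (iota c) = iota c by have [s' []] := sP i.
have sth i : s i (j th) = r i by have [s' []] := sP i.
have si0 : map_mpoly (s i0) F = F.
  apply/mpolyP => mu; rewrite mcoeff_map_mpoly.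
  have ids c : (idfun : {rmorphism kb -> kb}) (iota c) = iota c by [].
  by apply: (Phi_agree jP (sc i0) ids _ (PF mu)); rewrite sth ri0.
have NE : F * F' = \prod_i map_mpoly (s i) F by rewrite (bigD1 i0) //= si0.
have sne i : gev (map_mpoly (s i) F) != 0.
  by have [s' [sK s'K c _]] := sP i; apply: map_mpoly_gev_neq0 sK s'K c Fe F0.
have he I (t : seq I) (Q : pred I) (g : I -> form) : (forall i, homogeneous e (g i)) ->
    homogeneous (\sum_(i <- t | Q i) e) (\prod_(i <- t | Q i) g i).
  move=> gh; apply: (big_ind2 (fun a P => homogeneous a P)) => //; first exact: homogeneous1.
  by move=> ????; apply: homogeneousM.
have F'h : homogeneous (\sum_(i | i != i0) e)%N F' by apply: he => i; apply: map_mpoly_homogeneous.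
exists (\sum_(i | i != i0) e)%N, F'; split=> //; first exact: homogeneousM; last first.
  rewrite NE rmorph_prod; apply/prodf_neq0 => i _; exact: sne.
have PN : poly_in Phi (F * F').
  rewrite NE; apply: poly_in_prod => // i _ mu; rewrite mcoeff_map_mpoly.
  exact: (Phi_stable th_stable (sc i) (PF mu)).
move=> mu; apply: (Phi_fixed alg jP th_sep (PN mu)) => t t' tK t'K tc.
have [pi piP] := choice (rperm t tc).
rewrite -mcoeff_map_mpoly NE rmorph_prod /=; congr mcoeff.
rewrite [RHS](reindex_inj (h := pi)); last first.
  by move=> i i' E; apply: rinj; apply: (fmorph_inj t); rewrite !piP E.
apply: eq_bigr => i _; apply/mpolyP => nu; rewrite !mcoeff_map_mpoly.
have tsc c : (t \o s i : {rmorphism kb -> kb}) (iota c) = iota c by rewrite /= sc tc.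
by apply: (Phi_agree jP tsc (sc (pi i)) _ (PF nu)); rewrite /= !sth.
Qed.

End Conjugates.

(** * Normalization at a rational point *)

Section RationalPoint.
Variables (k : fieldType) (kb : closedFieldType) (iota : {rmorphism k -> kb}).
Variable S : smooth_projective_surface iota.

Local Notation K := (fun_field S).
Local Notation N := (dim_amb S).
Local Notation form := (mpol kb N.+1).
Local Notation pt := 'rV[kb]_N.+1.
Local Notation emb := (fun_emb S).
Local Notation x := (gen_pt S).
Local Notation gev := (gen_eval emb x).
Local Notation OSm p := (local_max emb x p).
Local Notation Div := (divisor S).
Variables (B : Div -> Div -> int) (d : nat) (phi : Div -> lattice d).
Hypothesis BP : intersection_form B.
Hypothesis phiP : marking B phi.
Hypothesis dP : del_pezzo B d.
Hypothesis d_le7 : (d <= 7)%N.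
Hypothesis alg : forall z : kb, algebraicOver iota z.
Variable r0 : 'rV[k]_N.+1.
Hypothesis r0S : onS (map_mx iota r0).

Local Notation n := (9 - d)%N.
Local Notation lf := (@lform n int).
Local Notation rp := (map_mx iota r0).
Implicit Types (p q : pt) (C D E : Div) (A F G P Q R : form).

Lemma phi_comb r (b : 'I_r -> Div) (a : 'rV[int]_r) : (forall i, cartier (b i)) ->
  phi (div_comb b a) = \sum_i a 0 i *: phi (b i).
Proof.
move=> bC; rewrite /div_comb (phi_prod phiP (C := fun i p => b i p ^ a 0 i)).
  apply: eq_bigr => i _; case: (a 0 i) => m.
    by rewrite -[X in X *: _]intz scaler_int -pmulrn -(phi_muln phiP).
  rewrite -[X in X *: _]intz scaler_int NegzE mulrNz -pmulrn -(phi_muln phiP) // -(phi_opp phiP) //.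
  exact: cartier_muln.
move=> i; case: (a 0 i) => m; first exact: cartier_muln.
by apply: cartier_inv; apply: (cartier_muln m.+1).
Qed.

Lemma meval_in (Phi : set kb) F (y : 'I_N.+1 -> kb) : subfield_set Phi -> poly_in Phi F ->
  (forall i, Phi (y i)) -> Phi (meval y F).
Proof.
move=> PhiF PF yP; rewrite mevalE; apply: (sf_sum PhiF) => m _; apply: (sfM PhiF); first exact: PF.
apply: (big_ind Phi) => [||i _]; [exact: sf1 | exact: sfM |].
by elim: (m i) => [|l IH]; [exact: sf1 | rewrite exprS; apply: (sfM PhiF)].
Qed.

Lemma rational_fixed (s : {rmorphism kb -> kb}) : (forall c, s (iota c) = iota c) -> map_mx s rp = rp.
Proof. by move=> sc; apply/rowP => i; rewrite !mxE sc. Qed.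

Lemma OSm_galois_rational s s' t z : @galois_element _ _ _ S s s' t -> OSm rp z -> OSm rp (t z).
Proof.
move=> gal [Oz nz]; have [t' [gal' tK _]] := galois_inverse gal.
have [_ _ sc _ _] := gal; have sc' := gal_fix' gal.
split; first by apply: (OS_galois gal); rewrite rational_fixed.
move=> u; apply: nz; rewrite -(tK z); apply: (OSunit_galois gal').
by rewrite rational_fixed.
Qed.

(** The quotient of the two functions is regular everywhere, hence constant, and its value at the
    rational point is 1. *)
Lemma normalized_unique D f f' : cartier D -> f != 0 -> f' != 0 ->
  div_eq (fun p => f * D p) (fun p => f' * D p) -> OSm rp (f - 1) -> OSm rp (f' - 1) -> f = f'.
Proof.
move=> DC f0 f'0 E mf mf'; have [q qS|c cE] := @global_function_const _ _ _ S (f / f').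
  have := OSunit_OS (E q qS); congr (OS q); field.
  by rewrite f'0 (cartier_neq0 DC qS).
have fE : f = emb c * f' by rewrite -cE divfK.
have : OSm rp (emb (c - 1)).
  have -> : emb (c - 1) = f - 1 - emb c * (f' - 1) by rewrite fE rmorphB rmorph1; ring.
  by apply: (OSmB r0S) => //; apply: OSmM => //; apply: OS_emb.
by move/OSm_emb/eqP; rewrite subr_eq0 fE => /eqP ->; rewrite rmorph1 mul1r.
Qed.

Lemma normalized_ratio D D' : cartier D -> cartier D' -> lin_equiv D' D -> OSunit rp (D rp) ->
  OSunit rp (D' rp) -> exists f, [/\ f != 0, div_eq D' (fun p => f * D p) & OSm rp (f - 1)].
Proof.
move=> DC DC' [f f0 fP] uD uD'.
have uf : OSunit rp f.
  have := OSunit_div (OSunit_div uD' uD) (fP rp r0S); congr (OSunit rp); field.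
  by rewrite (OSunit_neq0 uD) (OSunit_neq0 uD') f0.
have [c cf] := OS_value r0S (OSunit_OS uf).
have c0 : c != 0.
  by apply/eqP => h; move: cf; rewrite h rmorph0 subr0 => /OSm_not_unit.
have ec0 : emb c != 0 by rewrite fmorph_eq0.
exists (f / emb c); split; first by rewrite mulf_neq0 // invr_eq0.
  move=> p pS; have := OSunitM (fP p pS) (OSunit_emb p c0); congr (OSunit p); field.
  by rewrite ec0 f0 (cartier_neq0 DC pS).
have -> : f / emb c - 1 = emb c^-1 * (f - emb c) by rewrite fmorphV; field.
by apply: OSmM => //; apply: OS_emb.
Qed.

(** By [section_ratio], [f] is a constant times a fraction over [Phi]. As the rational point has
    coordinates in k, the value 1 there forces the constant into [Phi]. *)
Lemma normalized_fraction (Phi : set kb) D f : subfield_set Phi -> range iota `<=` Phi ->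
  cartier D -> defined_over Phi D -> f != 0 -> div_eq D (fun=> f) -> OSm rp (f - 1) ->
  fraction_over Phi f.
Proof.
move=> PhiF Phik DC DD f0 Df mf.
have [c [e [F [G [[Fe Ge PF PG] [F0 G0 c0 fE]]]]]] := section_ratio PhiF Phik r0S DC DD f0 Df.
have uf : OSunit rp f by have := OSunitD r0S (OSunit1 rp) mf; rewrite addrC subrK.
have OFG : OS rp (gev F / gev G).
  have := OSM (OSunit_OS uf) (OS_emb rp c^-1); rewrite fE fmorphV; congr (OS rp); field.
  by rewrite G0 fmorph_eq0.
have [h [s [t [sd td [Ps Pt s0 stI]]]]] := quotient_over PhiF Phik Fe Ge PF PG G0 r0S OFG.
have gs := onS_neq0 r0S sd s0.
have E : gev F / gev G = gev t / gev s.
  apply/eqP; rewrite eqr_div // -!rmorphM -subr_eq0 -rmorphB [t * G]mulrC.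
  have hh : homogeneous (e + h) (F * s - G * t) by apply: homogeneousB; apply: homogeneousM.
  by apply/eqP/(IS_homogeneous hh).
have Prp Q : poly_in Phi Q -> Phi (pt_eval rp Q).
  by move=> PQ; apply: meval_in => // i; rewrite mxE; apply: Phik; exists (r0 0 i).
have ctE : c * pt_eval rp t = pt_eval rp s.
  have hh : homogeneous h (c *: t - s) by apply: homogeneousB => //; apply: homogeneousZ.
  have /(OSm_frac r0S hh sd s0) : OSm rp (gev (c *: t - s) / gev s).
    suff -> : gev (c *: t - s) / gev s = f - 1 by [].
    by rewrite rmorphB /= gevZ fE E mulrBl divff // mulrA.
  by rewrite rmorphB /= ptZ => /eqP; rewrite subr_eq0 => /eqP.
have t0 : pt_eval rp t != 0 by apply: contraNneq s0 => h0; rewrite -ctE h0 mulr0.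
rewrite fE; apply: fraction_over_emb => //; last by exists e, F, G.
have -> : c = pt_eval rp s / pt_eval rp t by rewrite -ctE mulfK.
by apply: (sfM PhiF); [apply: Prp | apply: (sfV PhiF); apply: Prp].
Qed.

End RationalPoint.

(** * Divisors over the base field in invariant classes *)

Section InvariantClasses.
Variables (k : fieldType) (kb : closedFieldType) (iota : {rmorphism k -> kb}).
Variable S : smooth_projective_surface iota.

Local Notation K := (fun_field S).
Local Notation N := (dim_amb S).
Local Notation form := (mpol kb N.+1).
Local Notation pt := 'rV[kb]_N.+1.
Local Notation emb := (fun_emb S).
Local Notation x := (gen_pt S).
Local Notation gev := (gen_eval emb x).
Local Notation OSm p := (local_max emb x p).
Local Notation Div := (divisor S).
Variables (B : Div -> Div -> int) (d : nat) (phi : Div -> lattice d).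
Hypothesis BP : intersection_form B.
Hypothesis phiP : marking B phi.
Hypothesis dP : del_pezzo B d.
Hypothesis d_le7 : (d <= 7)%N.
Hypothesis alg : forall z : kb, algebraicOver iota z.
Variable r0 : 'rV[k]_N.+1.
Hypothesis r0S : onS (map_mx iota r0).

Local Notation n := (9 - d)%N.
Local Notation lf := (@lform n int).
Local Notation rp := (map_mx iota r0).
Implicit Types (p q : pt) (C D E : Div) (A F G P Q R : form).

(** Finitely many coefficients define the curves over a finite extension. Since their squares are
    negative, [inseparable_descent] brings the field of definition down to its separable part. *)
Lemma separable_definition m (E : 'I_m -> Div) : (forall i, minus_one_curve B (E i)) ->
  exists (L : fieldExtType k) (j : {rmorphism L -> kb}) (th : L),
    [/\ forall c, j c%:A = iota c, separable_element 1 th,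
      forall t : {rmorphism kb -> kb}, (forall c, t (iota c) = iota c) ->
        forall y, y \in <<1; th>>%VS -> exists2 y', y' \in <<1; th>>%VS & t (j y) = j y' &
      forall i, defined_over [set z | exists2 y, y \in <<1; th>>%VS & z = j y] (E i)].
Proof.
move=> Em; have Ep i := minus_one_prime (Em i).
have [s sP] := choice (fun i => coefs_of_finite_definition (prime_cartier (Ep i))).
have [L [j [H [th [jP Hs th_sep [thH ins] st]]]]] := separable_tower alg (flatten [seq s i | i <- enum 'I_m]).
exists L, j, th; split=> // i.
apply: (inseparable_descent BP phiP dP d_le7 jP (Ep i) _ (H0 := <<1; th>>%AS) (H := H)) => //.
- by have [_ ->] := minus_one_exceptional phiP (Em i).
- by apply/FadjoinP; split=> //; apply: sub1v.
apply: sP; first exact: image_subfield.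
by move=> z zs; apply: Hs; apply/flattenP; exists (s i) => //; apply: map_f; rewrite mem_enum.
Qed.

Lemma effective_multiple_factor D A c p : effective D -> cartier D -> vanishing D A -> onS p ->
  OS p (form_divisor A p ^+ `|c|%N * D p ^ c).
Proof.
move=> DE DC AV pS; have OA : OS p (form_divisor A p) by apply: form_divisor_effective.
case: c => m; first by apply: OSM; apply: OSX => //; apply: DE.
rewrite /= -expr_div_n; apply: OSX; exact: AV (coordP pS).
Qed.

(* Hilbert's Theorem 90: a representative D1 of v over a Galois extension k(theta)
   is multiplied by h = sum_i r_i^l f_i, where the f_i with conjugate_i(D1) = f_i D1,
   normalized to take the value 1 at the rational point, form a cocycle. *)
Lemma fixed_class_over_k v : (forall w, galois_image phi w -> w v = v) ->
  exists2 D, divisor_over_k D & phi D = v.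
Proof.
move=> vfix; have [m [c [e [eE vE]]]] := exceptional_span (n_ge2 d_le7) v.
have /choice [E EP] : forall i, exists C, minus_one_curve B C /\ phi C = e i.
  by move=> i; have [C Cm CE] := (phi_exceptional phiP _).1 (eE i); exists C.
have EC i := prime_cartier (minus_one_prime (EP i).1).
have EE i := prime_effective (minus_one_prime (EP i).1).
have [L [j [th [jP th_sep th_stable ED]]]] := separable_definition (fun i => (EP i).1).
pose Phi := [set z | exists2 y, y \in <<1; th>>%VS & z = j y].
have PhiF : subfield_set Phi := image_subfield j <<1; th>>%AS.
have Phik : range iota `<=` Phi := image_base jP <<1; th>>%AS.
have stable (t : {rmorphism kb -> kb}) : (forall c, t (iota c) = iota c) -> forall z, Phi z -> Phi (t z).
  by move=> tc z; apply: (Phi_stable th_stable tc).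
pose D0 := div_comb E (\row_i c i).
have D0C : cartier D0 by apply: cartier_comb.
have D0D : defined_over Phi D0 by apply: defined_over_comb.
have D0v : phi D0 = v.
  by rewrite (phi_comb phiP) // vE; apply: eq_bigr => i _; rewrite mxE (EP i).2.
have [d' [e' [g [a [b [[gd ae be] [Pg Pa Pb] [gp a0 b0] gP]]]]]] := D0D _ r0S.
have ba0 : gev b / gev a != 0 by rewrite mulf_neq0 // invr_eq0.
(* Division by the equation of [D0] at the rational point makes [D1] a unit there, so the functions
   relating its conjugates can be normalized. *)
pose D1 : Div := fun p => gev b / gev a * D0 p.
have D1C : cartier D1 by apply: cartier_scale.
have D1D : defined_over Phi D1 by apply: defined_over_scale be ae _ _ _ _ _.
have D1v : phi D1 = v by rewrite (phi_scale phiP).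
have uD1 : OSunit rp (D1 rp).
  have := OSunitV (gP _ r0S gp); rewrite /D1; congr (OSunit rp); field.
  by rewrite a0 b0 (cartier_neq0 D0C r0S).
have actC s s' t (gl : galois_element s s' t) : cartier (galois_act s' t D1).
  exact: galois_act_cartier gl _ D1C.
have norm s s' t (gl : galois_element s s' t) : exists f, [/\ f != 0,
    div_eq (galois_act s' t D1) (fun p => f * D1 p) & OSm rp (f - 1)].
  apply: (normalized_ratio r0S D1C (actC _ _ _ gl) _ uD1).
    have [t' [gl' tK t'K]] := galois_inverse gl.
    have [w [wI wE _ _]] := galois_map_exists BP phiP d_le7 gl gl' tK t'K.
    by apply/(phi_lin_equiv phiP (actC _ _ _ gl) D1C); rewrite wE // D1v vfix.
  by apply: (OSunit_galois gl); rewrite rational_fixed //; apply: gal_fix' gl.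
have [m' [r [rinj [i0 ri0] rconj rperm]]] := conjugate_family alg jP th_sep.
have /choice [u uP] : forall i, exists u : {rmorphism kb -> kb} * {rmorphism kb -> kb} * {rmorphism K -> K},
    galois_element u.1.1 u.1.2 u.2 /\ u.1.1 (j th) = r i.
  move=> i; have [s [s' [sK s'K sc sth]]] := rconj i.
  by have [t gl] := @exists_tau _ _ _ S _ _ sK s'K sc; exists (s, s', t).
have [f fP] := choice (fun i => norm _ _ _ (uP i).1).
have uc i : forall c, (u i).1.1 (iota c) = iota c by case: (uP i) => -[].
have ffrac i : fraction_over Phi (f i).
  have [f0 fD mf] := fP i; have DC := cartier_mul (actC _ _ _ (uP i).1) (cartier_inv D1C).
  apply: (normalized_fraction r0S PhiF Phik DC _ f0 _ mf).
    apply: (defined_over_mul PhiF); last exact: defined_over_opp.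
    by apply: (galois_act_defined_over (uP i).1) => // z; apply: stable; apply: uc.
  move=> p pS; have := fD p pS; rewrite /div_add /div_opp invfM; congr (OSunit p); ring.
have rPhi i : Phi (r i).
  by rewrite -(uP i).2; apply: stable; [exact: uc | exists th; rewrite ?memv_adjoin].
have [l hl] := power_sum_neq0 rinj (let: And3 h _ _ := fP i0 in h).
set h := \sum_i _ in hl.
have hfrac : fraction_over Phi h.
  apply: fraction_over_sum => // i; apply: fraction_over_emb => //.
  by elim: (l) => [|l' IH]; [exact: sf1 | rewrite exprS; apply: (sfM PhiF)].
(* The cocycle relation: both sides carry [D1] to the same conjugate and have the value 1 at the
   rational point. *)
have twist s s' t (gl : galois_element s s' t) fs i i' : fs != 0 ->
    div_eq (galois_act s' t D1) (fun p => fs * D1 p) -> OSm rp (fs - 1) ->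
    s (r i) = r i' -> t (f i) * fs = f i'.
  move=> fs0 fsD mfs sri; have [f0 fD mf] := fP i; have [f0' fD' mf'] := fP i'.
  have tf0 : t (f i) != 0 by rewrite fmorph_eq0.
  apply: (normalized_unique r0S D1C _ f0' _ _ mf') => [|p pS|]; first by rewrite mulf_neq0.
    have gc := galois_comp gl (uP i).1.
    have sc : forall c, s (iota c) = iota c by case: gl.
    have U2 : OSunit p (galois_act s' t (galois_act (u i).1.2 (u i).2 D1) p /
        galois_act (u i').1.2 (u i').2 D1 p).
      rewrite -galois_act_comp; apply: (galois_act_agree gc (uP i').1 _ D1C D1D pS) => z Pz.
      apply: (Phi_agree jP _ (uc i') _ Pz) => [c'|] /=; first by rewrite uc sc.
      by rewrite (uP i).2 (uP i').2.
    have U3 := galois_act_div_eq gl fD pS; rewrite galois_act_scale in U3.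
    have U4 := fsD p pS; have U1 := fD' p pS.
    have := OSunit_div (OSunit_div (OSunitM U1 U2) U3) U4; congr (OSunit p); field.
    have n1 := cartier_neq0 (galois_act_cartier gl (actC _ _ _ (uP i).1)) pS.
    have n2 := cartier_neq0 (actC _ _ _ (uP i').1) pS; have n3 := cartier_neq0 (actC _ _ _ gl) pS.
    have n4 := cartier_neq0 D1C pS.
    by do !(apply/andP; split).
  have -> : t (f i) * fs - 1 = t (f i) * (fs - 1) + t (f i - 1) by rewrite rmorphB rmorph1; ring.
  apply: (OSmD r0S); last exact: OSm_galois_rational gl mf.
  apply: OSmM => //; have := OS_galois gl (p := rp) (z := f i); apply.
  rewrite rational_fixed; last exact: gal_fix' gl.
  by have := OSunitD r0S (OSunit1 rp) mf; rewrite addrC subrK => /OSunit_OS.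
(* The automorphism permutes the [r i], and by the cocycle relation it rescales [h] by the inverse
   of the factor [fs] by which it rescales [D1]. *)
have hinv s s' t (gl : galois_element s s' t) fs : fs != 0 ->
    div_eq (galois_act s' t D1) (fun p => fs * D1 p) -> OSm rp (fs - 1) -> t h * fs = h.
  move=> fs0 fsD mfs; have sc : forall c, s (iota c) = iota c by case: gl.
  have te : forall c, t (emb c) = emb (s c) by case: gl.
  have [pi piP] := choice (rperm s sc).
  have pinj : injective pi by move=> i i' E'; apply: rinj; apply: (fmorph_inj s); rewrite !piP E'.
  rewrite /h rmorph_sum mulr_suml [RHS](reindex_inj pinj); apply: eq_bigr => i _.
  by rewrite rmorphM te rmorphXn /= piP -mulrA (twist s s' t gl fs i (pi i)).
have [eh [F [G [Fe Ge PF PG [G0 hE]]]]] := hfrac.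
have F0 : gev F != 0 by move: hl; rewrite hE mulf_eq0 negb_or => /andP[].
pose D2 : Div := fun p => h * D1 p.
have D2C : cartier D2 by apply: cartier_scale.
have D2D : defined_over Phi D2 by rewrite /D2 hE; apply: defined_over_scale Fe Ge _ _ _ _ _.
have D2inv s s' t : galois_element s s' t -> div_eq (galois_act s' t D2) D2.
  move=> gl p pS; have [fs [fs0 fsD mfs]] := norm s s' t gl.
  have := fsD p pS; rewrite /D2 galois_act_scale -{2}(hinv s s' t gl fs fs0 fsD mfs).
  have th0 : t h != 0 by rewrite fmorph_eq0.
  by congr (OSunit p); field; rewrite fs0 th0 (cartier_neq0 D1C pS).
(* [effective_descent] applies to effective divisors. The poles of [D2] are cleared by [a], [G] and
   forms [A i] vanishing along the curves; replacing their product by its norm [Nf] makes the added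
   divisor one over k. *)
have /choice [A AP] : forall i, exists A : nat * form, [/\ homogeneous A.1 A.2, poly_in Phi A.2,
    vanishing (E i) A.2 & gev A.2 != 0].
  move=> i; have [eA [A [Ae PA AV Ag]]] := generator_over PhiF Phik (EC i) (EE i) (ED i) r0S.
  exists (eA, A); split=> //; apply: contraTneq isT => A0.
  by case: (OSunit_neq0 ((generatesP (E i) Ae r0S).1 Ag)); rewrite (form_divisorE Ae r0S) A0 !mul0r eqxx.
pose X := \prod_i (A i).2 ^+ `|c i|%N.
have Xh : homogeneous (\sum_i (A i).1 * `|c i|)%N X.
  apply: (big_ind2 (fun a P => homogeneous a P)) => [||i _]; first exact: homogeneous1.
    by move=> *; apply: homogeneousM.
  by apply: homogeneous_exp; have [] := AP i.
have PX : poly_in Phi X by apply: poly_in_prod => // i _; apply: poly_in_exp => //; have [] := AP i.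
have X0 : gev X != 0.
  by rewrite rmorph_prod; apply/prodf_neq0 => i _; rewrite rmorphXn expf_neq0 //; have [] := AP i.
have Hh : homogeneous (e' + eh + \sum_i (A i).1 * `|c i|)%N (a * G * X).
  by apply: homogeneousM => //; apply: homogeneousM.
have [||e2 [H' [H'h Nh PN N0]]] := form_norm alg jP th_sep th_stable Hh.
- by apply: poly_inM => //; apply: poly_inM.
- by rewrite !rmorphM !mulf_neq0.
set Nf := a * G * X * H' in Nh PN N0.
have NC := form_divisor_cartier Nh N0.
have ND := form_divisor_defined_over (subfield_range iota) Nh PN N0.
pose D3 := div_add (form_divisor Nf) D2.
have D3C : cartier D3 by apply: cartier_mul.
have D3E : effective D3.
  move=> p pS; pose i := coord p; have xi : x i != 0 := coord_gen_neq0 pS (coordP0 pS).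
  have Od Q : OS p (dehom i Q) by apply: dehom_OS => //; apply: coordP.
  have -> : D3 p = dehom i (b * F) * (\prod_l (form_divisor (A l).2 p ^+ `|c l|%N * E l p ^ c l)) * dehom i H'.
    rewrite /D3 /div_add /D2 /D1 hE /Nf /form_divisor -/i !rmorphM /= big_split /=.
    have -> : dehom i X = \prod_l dehom i (A l).2 ^+ `|c l|%N.
      by rewrite rmorph_prod; apply: eq_bigr => l' _; rewrite rmorphXn.
    have -> : D0 p = \prod_l E l p ^ c l by apply: eq_bigr => l' _; rewrite mxE.
    rewrite (dehom_homogeneous ae xi) (dehom_homogeneous Ge xi) (dehom_homogeneous be xi) (dehom_homogeneous Fe xi).
    by field; rewrite a0 G0 !expf_neq0.
  apply: OSM => //; apply: OSM => //; apply: OS_prod => l' _.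
  by apply: effective_multiple_factor => //; have [] := AP l'.
have D3D : defined_over (range iota) D3.
  apply: (effective_descent alg jP th_sep th_stable D3C D3E).
    by apply: defined_over_mul => //; apply: defined_over_sub ND.
  move=> s s' t gl p pS; rewrite /D3 galois_act_add.
  have sc : forall c, s (iota c) = iota c by case: gl.
  have kfix : forall z, range iota z -> s z = z by move=> _ [c' _ <-].
  have := OSunitM (galois_act_fixed gl NC kfix ND pS) (D2inv s s' t gl p pS).
  rewrite /div_add; congr (OSunit p); field.
  by rewrite (cartier_neq0 NC pS) (cartier_neq0 D2C pS).
exists D2; last by rewrite (phi_scale phiP).
apply/divisor_over_kP; split=> //.
(* The divisor of [Nf], being over k, can be subtracted again. *)
apply: (@defined_over_eq _ _ _ S (range iota) (div_add D3 (div_opp (form_divisor Nf)))).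
- by apply: cartier_mul => //; apply: cartier_inv.
- move=> p pS; have n1 := cartier_neq0 NC pS; have n2 := cartier_neq0 D2C pS.
  have n3 : form_divisor Nf p * D2 p != 0 by rewrite mulf_neq0.
  by rewrite /D3 /div_add /div_opp -mulrA -invfM divff //; apply: OSunit1.
apply: defined_over_mul => //; first exact: subfield_range.
exact: defined_over_opp.
Qed.

End InvariantClasses.

(** * The constant alpha *)

Section OrbitSum.
Variables (k : fieldType) (kb : closedFieldType) (iota : {rmorphism k -> kb}).
Variable S : smooth_projective_surface iota.

Local Notation K := (fun_field S).
Local Notation N := (dim_amb S).
Local Notation form := (mpol kb N.+1).
Local Notation pt := 'rV[kb]_N.+1.
Local Notation emb := (fun_emb S).
Local Notation x := (gen_pt S).
Local Notation gev := (gen_eval emb x).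
Local Notation OSm p := (local_max emb x p).
Local Notation Div := (divisor S).
Variables (B : Div -> Div -> int) (d : nat) (phi : Div -> lattice d).
Hypothesis BP : intersection_form B.
Hypothesis phiP : marking B phi.
Hypothesis dP : del_pezzo B d.
Hypothesis d_le7 : (d <= 7)%N.
Hypothesis alg : forall z : kb, algebraicOver iota z.

Local Notation n := (9 - d)%N.
Local Notation lf := (@lform n int).
Implicit Types (p q : pt) (C D E : Div).

Lemma galois_image_additive w : galois_image phi w -> forall u v, w (u + v) = w u + w v.
Proof.
move=> [s [s' [t [gl wE]]]] u v.
have [D DC <-] := phi_onto phiP u; have [E EC <-] := phi_onto phiP v.
rewrite -(phi_add phiP DC EC) -!wE //; last exact: cartier_mul.
by rewrite galois_act_add (phi_add phiP) //; apply: galois_act_cartier gl _ _.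
Qed.

Lemma over_k_fixed D w : divisor_over_k D -> galois_image phi w -> w (phi D) = phi D.
Proof.
move=> /divisor_over_kP [DC DD] [s [s' [t [gl wE]]]]; rewrite -wE //.
have kfix : forall z, range iota z -> s z = z by case: gl => _ _ sc _ _ _ [c _ <-].
apply: (phi_div_eq phiP) => //; first exact: galois_act_cartier gl _ DC.
by apply: (galois_act_fixed gl DC kfix DD).
Qed.

(** The sum is indexed by the conjugates of [th], so a conjugate curve may occur several times,
    which only scales the sum. Classes over k are fixed by the Galois isometries and pair equally
    with all conjugates of [E]. *)
Lemma orbit_sum E : minus_one_curve B E -> exists D m,
  [/\ divisor_over_k D, effective D, phi D != 0, (0 < m)%N &
    forall D', divisor_over_k D' -> lf (phi D') (phi D) = m%:R * lf (phi D') (phi E)].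
Proof.
move=> Em; have Ep := minus_one_prime Em; have EC := prime_cartier Ep.
have [L [j [th [jP th_sep th_stable ED]]]] := separable_definition BP phiP dP d_le7 alg (fun _ : 'I_1 => Em).
pose Phi := [set z | exists2 y, y \in <<1; th>>%VS & z = j y].
have PhiF : subfield_set Phi := image_subfield j <<1; th>>%AS.
have [m [r [rinj [i0 ri0] rconj rperm]]] := conjugate_family alg jP th_sep.
have /choice [u uP] : forall i, exists u : {rmorphism kb -> kb} * {rmorphism kb -> kb} * {rmorphism K -> K},
    galois_element u.1.1 u.1.2 u.2 /\ u.1.1 (j th) = r i.
  move=> i; have [s [s' [sK s'K sc sth]]] := rconj i.
  by have [t gl] := @exists_tau _ _ _ S _ _ sK s'K sc; exists (s, s', t).
pose Eu i := galois_act (u i).1.2 (u i).2 E.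
have uc i : forall c, (u i).1.1 (iota c) = iota c by case: (uP i) => -[].
have EuC i : cartier (Eu i) := galois_act_cartier (uP i).1 EC.
pose D : Div := fun p => \prod_i Eu i p.
have DC : cartier D by apply: cartier_prod.
have DE : effective D.
  move=> p pS; apply: OS_prod => i _; exact: (galois_act_effective (uP i).1 (prime_effective Ep)).
have DD : defined_over Phi D.
  have -> : D = div_comb Eu (\row_i 1).
    by apply/funext => p; apply: eq_bigr => i _; rewrite mxE expr1z.
  apply: defined_over_comb => // i; apply: (galois_act_defined_over (uP i).1) (ED ord0).
  by move=> z; apply: (Phi_stable th_stable (uc i)).
have Dinv s s' t : galois_element s s' t -> div_eq (galois_act s' t D) D.
  move=> gl p pS; have sc : forall c, s (iota c) = iota c by case: gl.
  have [pi piP] := choice (rperm s sc).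
  have pinj : injective pi by move=> i i' E'; apply: rinj; apply: (fmorph_inj s); rewrite !piP E'.
  rewrite /D {1}/galois_act rmorph_prod [X in _ / X](reindex_inj pinj) -prodf_div.
  apply: (big_ind (OSunit p)) => [||i _]; [exact: OSunit1 | exact: OSunitM |].
  rewrite -[t _]/(galois_act s' t (Eu i) p) /Eu -galois_act_comp.
  have gc := galois_comp gl (uP i).1.
  apply: (galois_act_agree gc (uP (pi i)).1 _ EC (ED ord0) pS) => z Pz.
  apply: (Phi_agree jP _ (uc (pi i)) _ Pz) => [c'|] /=; first by rewrite uc sc.
  by rewrite (uP i).2 (uP (pi i)).2.
have Dk : divisor_over_k D.
  apply/divisor_over_kP; split=> //; exact: (effective_descent alg jP th_sep th_stable DC DE DD Dinv).
have phiD : phi D = \sum_i phi (Eu i) by rewrite -(phi_prod phiP).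
exists D, m; split=> //; [|by apply: leq_ltn_trans (ltn_ord i0)|].
  have Eup i : prime_divisor (Eu i).
    have [t' [gl' tK t'K]] := galois_inverse (uP i).1.
    exact: galois_prime (uP i).1 gl' tK t'K _ Ep.
  have : 0 < lf (anticanonical n int) (phi D).
    rewrite phiD lform_sumr (bigD1 i0) //=; apply: ltr_wpDr.
      by apply: sumr_ge0 => i _; apply/ltW/(prime_degree_gt0 BP phiP dP d_le7).
    exact: (prime_degree_gt0 BP phiP dP d_le7).
  by apply: contraTneq => ->; rewrite lform0r ltxx.
move=> D' D'k; have [D'C D'D] := (divisor_over_kP D').1 D'k.
rewrite phiD lform_sumr (eq_bigr (fun=> lf (phi D') (phi E))).
  by rewrite sumr_const card_ord mulr_natl.
move=> i _; have [t' [gl' tK t'K]] := galois_inverse (uP i).1.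
have [w [wI wE _ worth]] := galois_map_exists BP phiP d_le7 (uP i).1 gl' tK t'K.
by rewrite /Eu wE // -{1}(over_k_fixed D'k wI) worth.
Qed.

End OrbitSum.

(** * The constant alpha computed from a family of lattice classes *)

Section FamilyAlpha.
Variables (R : realType) (d : nat).
Hypothesis d_le7 : (d <= 7)%N.
Local Notation n := (9 - d)%N.

Definition family_sum r (b : 'I_r -> lattice d) (y : 'rV[R]_r) : 'rV[R]_n.+1 :=
  \sum_i y 0 i *: toR R (b i).

(** Mirrors [alpha_in_basis], with duality to the effective cone replaced by the condition [nef],
    which is purely lattice-theoretic. *)
Definition family_alpha r (b : 'I_r -> lattice d) : \bar R :=
  ((r%:R)%:E * ((`|\det (\matrix_(i, j) (lform (b i) (b j))%:~R : 'M[R]_r)|)%:E *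
    volume [set y : 'rV[R]_r | nef (family_sum b y) /\
      lform (family_sum b y) (toR R (anticanonical n int)) <= 1]%R))%E.

Definition lattice_basis (P : set (lattice d)) r (b : 'I_r -> lattice d) : Prop :=
  (forall i, P (b i)) /\ forall v, P v -> exists! a : 'rV[int]_r, v = \sum_i a 0 i *: b i.

Lemma lform_family r (b : 'I_r -> lattice d) y v :
  lform (family_sum b y) (toR R v) = \sum_i y 0 i * (lform (b i) v)%:~R.
Proof. by rewrite lform_suml; apply: eq_bigr => i _; rewrite lformZl lform_toR. Qed.

Lemma family_sum_int r (b : 'I_r -> lattice d) (a : 'rV[int]_r) :
  family_sum b (map_mx intr a) = toR R (\sum_i a 0 i *: b i).
Proof.
apply/rowP => l; rewrite !mxE !summxE rmorph_sum; apply: eq_bigr => i _.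
by rewrite !mxE rmorphM.
Qed.

Lemma family_alpha_isometry r (b : 'I_r -> lattice d) (g g' : lattice d -> lattice d) :
  (forall u v, lform (g u) (g v) = lform u v) -> cancel g g' -> cancel g' g ->
  g (anticanonical n int) = anticanonical n int -> family_alpha (g \o b) = family_alpha b.
Proof.
move=> go gK g'K gK0.
have exc_g e : exceptional e -> exceptional (g e) by move=> [h1 h2]; split; [rewrite -{1}gK0 go | rewrite go].
have exc_g' e : exceptional e -> exceptional (g' e).
  by move=> [h1 h2]; split; [rewrite -{1}(gK (anticanonical n int)) gK0 -go !g'K | rewrite -go g'K].
rewrite /family_alpha; congr (_ * (_ * _))%E.
  by congr (`| \det _ |%:E); apply/matrixP => i j; rewrite !mxE /= go.
have E y v : lform (family_sum (g \o b) y) (toR R (g v)) = lform (family_sum b y) (toR R v).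
  by rewrite !lform_family; apply: eq_bigr => i _; rewrite /= go.
congr volume; apply/seteqP; split=> y /= [N K1]; split.
- by move=> e /exc_g h; rewrite -E; apply: N.
- by rewrite -E gK0.
- by move=> e /exc_g' h; rewrite -(g'K e) E; apply: N.
- by rewrite -gK0 E.
Qed.

Lemma weyl_isometry g : @weyl_group d g -> exists g', [/\ cancel g g', cancel g' g,
  forall u v, g (u + v) = g u + g v, forall u v, @lform n int (g u) (g v) = lform u v &
  g (anticanonical n int) = anticanonical n int].
Proof.
elim=> {g} [|a w [Ka aa] _ [w' [wK w'K wD wo wK0]]]; first by exists id.
have aa' : @lform n int a a = - 2%:R := aa.
have Ka' : @lform n int (anticanonical n int) a = 0 := Ka.
have rE v : lat_reflection a v = @reflect_in n int a v by [].
exists (w' \o lat_reflection a); split=> [v|v|u v|u v|] /=; rewrite ?rE.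
- by rewrite (reflect_inK aa').
- by rewrite w'K (reflect_inK aa').
- by rewrite wD /reflect_in lformDl scalerDl addrACA.
- by rewrite lform_reflect.
- by rewrite wK0 /reflect_in Ka' scale0r addr0.
Qed.

Lemma zsum_mul r s (a : 'rV[int]_r) (A : 'M[int]_(r, s)) (b : 'I_s -> lattice d) :
  \sum_i a 0 i *: (\sum_j A i j *: b j) = \sum_j (a *m A) 0 j *: b j.
Proof.
under eq_bigr do rewrite scaler_sumr.
rewrite exchange_big; apply: eq_bigr => j _ /=; rewrite mxE scaler_suml.
by apply: eq_bigr => i _; rewrite scalerA.
Qed.

(** The coordinates of the family [c] have nonzero determinant, and the adjugate matrix expresses
    that multiple of [v]. *)
Lemma full_rank_multiple (P : set (lattice d)) r (b c : 'I_r -> lattice d) : lattice_basis P b ->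
  (forall i, P (c i)) -> (forall a : 'rV[int]_r, \sum_i a 0 i *: c i = 0 -> a = 0) ->
  forall v, P v -> exists m (a : 'rV[int]_r), m != 0 /\ m *: v = \sum_i a 0 i *: c i.
Proof.
move=> [bP bB] cP cI v vP.
have [A0 A0P] := choice (fun i => let: ex_intro a h := bB _ (cP i) in
  ex_intro (fun a : 'rV[int]_r => c i = \sum_j a 0 j *: b j) a h.1).
pose A : 'M[int]_r := \matrix_(i, j) A0 i 0 j.
have cE i : c i = \sum_j A i j *: b j by rewrite {1}A0P; apply: eq_bigr => j _; rewrite mxE.
have csum (a : 'rV[int]_r) : \sum_i a 0 i *: c i = \sum_j (a *m A) 0 j *: b j.
  by rewrite -zsum_mul; apply: eq_bigr => i _; rewrite cE.
have [a [vE _]] := bB v vP.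
exists (\det A), (a *m \adj A); split.
  apply/det0P => -[u u0 uA]; move/eqP: u0; apply; apply: cI; rewrite csum uA.
  by rewrite big1 // => j _; rewrite mxE scale0r.
rewrite csum -mulmxA mul_adj_mx mul_mx_scalar vE scaler_sumr.
by apply: eq_bigr => j _; rewrite mxE scalerA.
Qed.

End FamilyAlpha.

Lemma additive_int_comb (V W : lmodType int) (w : V -> W) : (forall a b, w (a + b) = w a + w b) ->
  forall m (c : 'rV[int]_m) (e : 'I_m -> V), w (\sum_i c 0 i *: e i) = \sum_i c 0 i *: w (e i).
Proof.
move=> wD m c e; have zE (U : lmodType int) (z : int) (u : U) : z *: u = u *~ z.
  by rewrite -[X in X *: _]intz scaler_int.
under eq_bigr do rewrite zE; rewrite (additive_int_sum wD (fun i => c 0 i)).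
by apply: eq_bigr => i _; rewrite zE.
Qed.

Lemma additive_intZ (V W : lmodType int) (w : V -> W) : (forall a b, w (a + b) = w a + w b) ->
  forall m v, w (m *: v) = m *: w v.
Proof.
move=> wD m v; have := additive_int_comb wD (m%:M : 'rV_1) (fun=> v).
by rewrite !big_ord1 !mxE eqxx mulr1n.
Qed.

(** * Pic(S) as the lattice of fixed classes *)

Section AlphaLattice.
Variables (k : fieldType) (kb : closedFieldType) (iota : {rmorphism k -> kb}).
Variable S : smooth_projective_surface iota.

Local Notation K := (fun_field S).
Local Notation N := (dim_amb S).
Local Notation form := (mpol kb N.+1).
Local Notation pt := 'rV[kb]_N.+1.
Local Notation emb := (fun_emb S).
Local Notation x := (gen_pt S).
Local Notation gev := (gen_eval emb x).
Local Notation OSm p := (local_max emb x p).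
Local Notation Div := (divisor S).
Variables (R : realType) (B : Div -> Div -> int) (d : nat) (phi : Div -> lattice d).
Hypothesis BP : intersection_form B.
Hypothesis phiP : marking B phi.
Hypothesis dP : del_pezzo B d.
Hypothesis d_le7 : (d <= 7)%N.
Hypothesis alg : forall z : kb, algebraicOver iota z.
Hypothesis rat_pt : has_rational_point S.

Local Notation n := (9 - d)%N.
Local Notation lf := (@lform n int).
Implicit Types (p q : pt) (C D E : Div).

Let M : set (lattice d) := [set v | forall w, galois_image phi w -> w v = v].

Lemma fixed_classP v : M v <-> exists2 D, divisor_over_k D & phi D = v.
Proof.
have [r0 r0S] := rat_pt; split; first exact: (fixed_class_over_k BP phiP dP d_le7 alg r0S).
by move=> [D Dk <-] w wI; apply: (over_k_fixed phiP Dk).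
Qed.

(** By [section_ratio], a function relating two divisors over k is a constant times a fraction over
    k, and the constant may be dropped. *)
Lemma lin_equiv_kP D E : divisor_over_k D -> divisor_over_k E ->
  lin_equiv_k D E <-> phi D = phi E.
Proof.
move=> Dk Ek; have [DC DD] := (divisor_over_kP D).1 Dk; have [EC ED] := (divisor_over_kP E).1 Ek.
split=> [[f [_ f0 DE]]|]; first by apply/(phi_lin_equiv phiP) => //; exists f.
move=> /(phi_lin_equiv phiP DC EC) [f f0 DE]; have [r0 r0S] := rat_pt.
have kF := subfield_range iota.
have [||||c [e [F [G [[Fe Ge PF PG] [F0 G0 c0 fE]]]]]] := section_ratio kF (fun z h => h) r0S
  (D := div_add D (div_opp E)) (f := f).
- by apply: cartier_mul => //; apply: cartier_inv.
- by apply: defined_over_mul => //; apply: defined_over_opp.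
- exact: f0.
- move=> p pS; have := DE p pS; rewrite /div_add /div_opp invfM; congr (OSunit p); ring.
exists (gev F / gev G); split; last 2 first.
- by rewrite mulf_neq0 // invr_eq0.
- move=> p pS; have := OSunitM (DE p pS) (OSunit_emb p c0); rewrite fE; congr (OSunit p); field.
  by rewrite G0 F0 (cartier_neq0 EC pS) fmorph_eq0.
by apply/kS_fraction; exists e, F, G.
Qed.

Lemma div_comb_over_k r (b : 'I_r -> Div) (a : 'rV[int]_r) : (forall i, divisor_over_k (b i)) ->
  divisor_over_k (div_comb b a).
Proof.
move=> bk; apply/divisor_over_kP; split.
  by apply: cartier_comb => i; have /divisor_over_kP [] := bk i.
apply: defined_over_comb; first exact: subfield_range.
by move=> i; have /divisor_over_kP [] := bk i.
Qed.

Lemma phi_comb_over_k r (b : 'I_r -> Div) (a : 'rV[int]_r) : (forall i, divisor_over_k (b i)) ->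
  phi (div_comb b a) = \sum_i a 0 i *: phi (b i).
Proof. by move=> bk; apply: (phi_comb phiP) => i; have /divisor_over_kP [] := bk i. Qed.

Lemma pic_basisP r (b : 'I_r -> Div) : (forall i, divisor_over_k (b i)) ->
  pic_basis b <-> lattice_basis M (phi \o b).
Proof.
move=> bk; have E D a : divisor_over_k D -> lin_equiv_k D (div_comb b a) <-> phi D = \sum_i a 0 i *: phi (b i).
  by move=> Dk; rewrite -(phi_comb_over_k a bk); apply: lin_equiv_kP => //; apply: div_comb_over_k.
split=> [[_ bB]|[_ bB]]; split=> //.
- by move=> i; apply/fixed_classP; exists (b i).
- move=> v /fixed_classP [D Dk <-]; have [a [aE aU]] := bB D Dk.
  by exists a; split; [apply/(E D a Dk) | move=> a' /(E D a' Dk) /aU].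
- move=> D Dk; have [|a [aE aU]] := bB (phi D); first by apply/fixed_classP; exists D.
  by exists a; split; [apply/(E D a Dk) | move=> a' /(E D a' Dk) /aU].
Qed.

Lemma pairing_family r (b : 'I_r -> Div) (y z : 'rV[R]_r) : (forall i, cartier (b i)) ->
  pairing B b y z = lform (family_sum (phi \o b) y) (family_sum (phi \o b) z).
Proof.
move=> bC; rewrite /pairing mxE lform_sumr; apply: eq_bigr => j _.
rewrite lformZr lform_family !mxE mulrC; congr (_ * _); apply: eq_bigr => i _.
by rewrite mxE -(phi_form phiP).
Qed.

Lemma dual_effective_nef r (b : 'I_r -> Div) (y : 'rV[R]_r) : pic_basis b ->
  dual_effective_cone B b y <-> nef (family_sum (phi \o b) y).
Proof.
move=> bP; have [bk bB] := bP; have bC i : cartier (b i) by have /divisor_over_kP [] := bk i.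
have eff_phi a D : divisor_over_k D -> lin_equiv_k D (div_comb b a) ->
    family_sum (phi \o b) (map_mx intr a) = toR R (phi D).
  move=> Dk Da; rewrite family_sum_int -(phi_comb_over_k a bk); congr toR.
  by apply/esym/lin_equiv_kP => //; apply: div_comb_over_k.
split=> [dual e /(phi_exceptional phiP) [E Em <-]|Nef z [m [c [a [c0 aE ->]]]]].
  (* A class over k pairs with the orbit sum as [m] times with [E], so the sign can be tested on an
     effective divisor over k. *)
  have [D [m [Dk DE _ m0 DP]]] := orbit_sum BP phiP dP d_le7 alg Em.
  have [a [aE _]] := bB D Dk.
  have : 0 <= pairing B b y (map_mx intr a).
    apply: dual; exists 1%N, (fun=> 1), (fun=> a); split=> [i|i|]; first exact: ler01.
      by exists D.
    by rewrite big_ord1 scale1r.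
  rewrite pairing_family // (eff_phi a D) // lform_family.
  have -> : \sum_i y 0 i * (lform ((phi \o b) i) (phi D))%:~R =
      m%:R * lform (family_sum (phi \o b) y) (toR R (phi E)).
    rewrite lform_family mulr_sumr; apply: eq_bigr => i _ /=.
    by rewrite (DP (b i) (bk i)) rmorphM /= rmorph_nat mulrCA.
  by rewrite pmulr_rge0 // ltr0n.
rewrite pairing_family //.
have -> : family_sum (phi \o b) (\sum_i c i *: map_mx intr (a i)) =
    \sum_i c i *: family_sum (phi \o b) (map_mx intr (a i)).
  rewrite /family_sum; under [RHS]eq_bigr do rewrite scaler_sumr.
  rewrite exchange_big; apply: eq_bigr => j _ /=; rewrite summxE scaler_suml.
  by apply: eq_bigr => i _; rewrite !mxE scalerA.
rewrite lform_sumr; apply: sumr_ge0 => i _; rewrite lformZr; apply: mulr_ge0 => //.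
have [D [Dk DE Da]] := aE i; rewrite (eff_phi (a i) D Dk Da).
have [DC _] := (divisor_over_kP D).1 Dk.
have [l [C CP]] := effective_prime_sum DC DE; have [Cp _] := CP.
rewrite (phi_prime_sum phiP DC CP).
have -> : toR R (\sum_i phi (C i)) = \sum_i toR R (phi (C i)).
  by apply/rowP => i'; rewrite mxE !summxE rmorph_sum; apply: eq_bigr => i'' _; rewrite mxE.
rewrite lform_sumr; apply: sumr_ge0 => i' _.
have [[E Em CE]|Cnef] := prime_nef BP phiP (Cp i').
  rewrite (phi_div_eq phiP (prime_cartier (Cp i')) (prime_cartier (minus_one_prime Em)) CE).
  by apply: Nef; apply: (minus_one_exceptional phiP).
exact: (nef_pairing (n_ge2 d_le7) (n_le8 BP phiP dP d_le7) Nef Cnef).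
Qed.

Lemma alpha_in_basisE r (b : 'I_r -> Div) : pic_basis b ->
  alpha_in_basis R B b = family_alpha R (phi \o b).
Proof.
move=> bP; have [bk bB] := bP; have bC i : cartier (b i) by have /divisor_over_kP [] := bk i.
rewrite /alpha_in_basis /family_alpha; congr (_ * (_ * _))%E.
  by congr (`| \det _ |%:E); apply/matrixP => i j; rewrite !mxE -(phi_form phiP).
have sumE (y : 'rV[R]_r) Kc : canonical_divisor Kc -> \sum_i y 0 i * (B (b i) (div_opp Kc))%:~R =
    lform (family_sum (phi \o b) y) (toR R (anticanonical n int)).
  move=> KcP; have [KcC _] := KcP; rewrite lform_family; apply: eq_bigr => i _.
  by rewrite -(phi_canonical phiP KcP) -(phi_form phiP) //; apply: cartier_inv.
congr volume; apply/seteqP; split=> y /= [h1 h2]; split.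
- exact/(dual_effective_nef y bP).
- by have [Kc [KcP _ _]] := dP; rewrite -(sumE y Kc KcP); apply: h2.
- exact/(dual_effective_nef y bP).
- by move=> Kc KcP; rewrite (sumE y Kc KcP).
Qed.

Lemma lattice_basis_lift r (c : 'I_r -> lattice d) : lattice_basis M c ->
  exists2 b : 'I_r -> Div, pic_basis b & phi \o b = c.
Proof.
move=> cB; have /choice [b bP] : forall i, exists D, divisor_over_k D /\ phi D = c i.
  by move=> i; have /fixed_classP [D h1 h2] := cB.1 i; exists D.
have bc : phi \o b = c by apply/funext => i; apply: (bP i).2.
by exists b => //; apply/pic_basisP; [move=> i; apply: (bP i).1 | rewrite bc].
Qed.

Lemma alphaE : alpha R B = xget 0%E [set a | exists r (c : 'I_r -> lattice d),
  lattice_basis M c /\ a = family_alpha R c].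
Proof.
rewrite /alpha; congr xget; apply/seteqP; split=> a [r [b [bB ->]]].
  by exists r, (phi \o b); split; [apply/(pic_basisP bB.1) | apply: alpha_in_basisE].
by have [b' b'B <-] := lattice_basis_lift bB; exists r, b'; split=> //; rewrite alpha_in_basisE.
Qed.

Lemma picard_rankE : picard_rank S =
  xget 0%N [set r | exists c : 'I_r -> lattice d, lattice_basis M c].
Proof.
rewrite /picard_rank; congr xget; apply/seteqP; split=> r [b bB].
  by exists (phi \o b); apply/(pic_basisP bB.1).
by have [b' b'B _] := lattice_basis_lift bB; exists b'.
Qed.

(** Rank 0 can then only be the default value of [picard_rank]. *)
Lemma fixed_class_neq0 : exists2 v, M v & v != 0.
Proof.
have [E Em _] := (phi_exceptional phiP _).1 (exceptional_point (Ordinal (leq_trans (isT : 0 < 2)%N (n_ge2 d_le7)))).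
have [D [m [Dk _ D0 _ _]]] := orbit_sum BP phiP dP d_le7 alg Em.
by exists (phi D) => //; apply/fixed_classP; exists D.
Qed.

(** Galois maps are additive and the lattice is torsion-free, so the fixed classes are saturated. *)
Lemma fixed_class_divisible m v : m != 0 -> M (m *: v) -> M v.
Proof.
move=> m0 Mv w wI; have wD := galois_image_additive phiP wI.
have : m *: (w v - v) = 0 by rewrite scalerBr -(additive_intZ wD) (Mv w wI) subrr.
move=> /rowP h; apply/eqP; rewrite -subr_eq0; apply/eqP/rowP => i.
by have := h i; rewrite !mxE => /eqP; rewrite mulf_eq0 (negPf m0) => /eqP.
Qed.

End AlphaLattice.

Lemma lattice_basis_image d (M1 M2 : set (lattice d)) (g g' : lattice d -> lattice d) r
    (b : 'I_r -> lattice d) : cancel g g' -> (forall u v, g (u + v) = g u + g v) ->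
  (forall v, M1 v <-> exists2 u, M2 u & v = g u) -> lattice_basis M2 b -> lattice_basis M1 (g \o b).
Proof.
move=> gK gD M12 [bM bB].
split=> [i|v /M12 [u uM ->]]; first by apply/M12; exists (b i).
have [a [aE aU]] := bB u uM; exists a; split; first by rewrite {1}aE (additive_int_comb gD).
by move=> a' a'E; apply: aU; apply: (can_inj gK); rewrite a'E (additive_int_comb gD).
Qed.

Theorem theorem2p2 (R : realType) (k : fieldType) (kbar : closedFieldType)
    (iota : {rmorphism k -> kbar})
    (kbar_algebraic : forall z : kbar, algebraicOver iota z)
    (d : nat) (d_le7 : (d <= 7)%N)
    (S1 S2 : smooth_projective_surface iota)
    (B1 : divisor S1 -> divisor S1 -> int) (B1P : intersection_form B1)
    (B2 : divisor S2 -> divisor S2 -> int) (B2P : intersection_form B2)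
    (dP1 : del_pezzo B1 d) (dP2 : del_pezzo B2 d)
    (pt1 : has_rational_point S1) (pt2 : has_rational_point S2)
    (phi1 : divisor S1 -> lattice d) (phi1P : marking B1 phi1)
    (phi2 : divisor S2 -> lattice d) (phi2P : marking B2 phi2)
    (W12 : exists2 g, weyl_group g &
       galois_image phi1 `<=` conjugate g (galois_image phi2))
    (rk12 : picard_rank S1 = picard_rank S2) :
  alpha R B1 = alpha R B2.
Proof.
have [g gW g12] := W12; have [g' [gK g'K gD go gK0]] := weyl_isometry gW.
pose M1 : set (lattice d) := [set v | forall w, galois_image phi1 w -> w v = v].
pose M2 : set (lattice d) := [set v | forall w, galois_image phi2 w -> w v = v].
have gM u : M2 u -> M1 (g u) by move=> Mu w /g12 [w' w'I ->]; rewrite Mu.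
rewrite (alphaE R B1P phi1P dP1 d_le7 kbar_algebraic pt1).
rewrite (alphaE R B2P phi2P dP2 d_le7 kbar_algebraic pt2) -/M1 -/M2.
move: rk12; rewrite (picard_rankE B1P phi1P dP1 d_le7 kbar_algebraic pt1).
rewrite (picard_rankE B2P phi2P dP2 d_le7 kbar_algebraic pt2) -/M1 -/M2 => rk.
(* [picard_rank] and [alpha] have default values when there is no basis. *)
have rank0 (M : set (lattice d)) : (exists2 v, M v & v != 0) ->
    xget 0%N [set r | exists c : 'I_r -> lattice d, lattice_basis M c] = 0%N ->
    ~ exists r (c : 'I_r -> lattice d), lattice_basis M c.
  move=> [v Mv v0] x0 [r [c cB]].
  have [c' [_ c'B]] : exists c : 'I_0 -> lattice d, lattice_basis M c.
    rewrite -x0; exact: (@xgetPex _ 0%N [set r | exists c : 'I_r -> lattice d, lattice_basis M c]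
      (ex_intro _ r (ex_intro _ c cB))).
  by have [a [vE _]] := c'B v Mv; move: v0; rewrite vE big_ord0 eqxx.
have none (M : set (lattice d)) : ~ (exists r (c : 'I_r -> lattice d), lattice_basis M c) ->
    xget 0%N [set r | exists c : 'I_r -> lattice d, lattice_basis M c] = 0%N.
  by move=> h; apply: xgetPN => r [c cB]; apply: h; exists r, c.
have none_alpha (M : set (lattice d)) : ~ (exists r (c : 'I_r -> lattice d), lattice_basis M c) ->
    xget 0%E [set a | exists r (c : 'I_r -> lattice d), lattice_basis M c /\ a = family_alpha R c] = 0%E.
  by move=> h; apply: xgetPN => a [r [c [cB _]]]; apply: h; exists r, c.
have ne1 := fixed_class_neq0 B1P phi1P dP1 d_le7 kbar_algebraic pt1.
have ne2 := fixed_class_neq0 B2P phi2P dP2 d_le7 kbar_algebraic pt2.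
(* If one side has no basis, the equality of ranks and [rank0] show that the other has none either,
   and both constants take the default value 0. *)
have [[r1 [c1 c1B]]|N1] := pselect (exists r (c : 'I_r -> lattice d), lattice_basis M1 c); last first.
  rewrite (none_alpha _ N1) none_alpha //; apply: rank0 => //.
  by rewrite -rk none.
have [[r2 [c2 c2B]]|N2] := pselect (exists r (c : 'I_r -> lattice d), lattice_basis M2 c); last first.
  by case: (rank0 M1 ne1 _); [rewrite rk none | exists r1, c1].
have [b1 b1B] : exists c : 'I_(xget 0%N [set r | exists c : 'I_r -> lattice d, lattice_basis M1 c]) -> lattice d,
    lattice_basis M1 c.
  exact: (@xgetPex _ 0%N [set r | exists c : 'I_r -> lattice d, lattice_basis M1 c] (ex_intro _ r1 (ex_intro _ c1 c1B))).
have [b2 b2B] : exists c : 'I_(xget 0%N [set r | exists c : 'I_r -> lattice d, lattice_basis M1 c]) -> lattice d,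
    lattice_basis M2 c.
  rewrite rk; exact: (@xgetPex _ 0%N [set r | exists c : 'I_r -> lattice d, lattice_basis M2 c] (ex_intro _ r2 (ex_intro _ c2 c2B))).
set r := xget _ _ in b1 b1B b2 b2B.
have g0 : g 0 = 0 by have := additive_intZ gD 0 0; rewrite !scale0r.
have M2sum (a : 'rV[int]_r) : M2 (\sum_i a 0 i *: b2 i).
  move=> w wI; rewrite (additive_int_comb (galois_image_additive phi2P wI)).
  by apply: eq_bigr => i _; rewrite (b2B.1 i w wI).
(* By equality of ranks, a nonzero multiple of [v] is an integral combination of images of a basis
   of [M2]; saturation of [M2] removes the factor. *)
have M12 v : M1 v <-> exists2 u, M2 u & v = g u.
  split=> [Mv|[u Mu ->]]; last exact: gM.
  have [||m [a [m0 mv]]] := full_rank_multiple b1B (c := g \o b2) _ _ Mv.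
  - by move=> i; apply: gM; apply: b2B.1.
  - move=> a; rewrite /= -(additive_int_comb gD) -[RHS]g0 => /(can_inj gK) a0.
    have [|a' [_ a'U]] := b2B.2 0; first by rewrite -a0.
    rewrite -(a'U a) //; apply: a'U.
    by rewrite big1 // => i _; rewrite mxE scale0r.
  exists (g' v); last by rewrite g'K.
  apply: (fixed_class_divisible phi2P m0); have -> : m *: g' v = \sum_i a 0 i *: b2 i; last exact: M2sum.
  by apply: (can_inj gK); rewrite (additive_intZ gD) g'K mv (additive_int_comb gD).
have g'D u v : g' (u + v) = g' u + g' v by apply: (can_inj gK); rewrite gD !g'K.
have M21 v : M2 v <-> exists2 u, M1 u & v = g' u.
  split=> [Mv|[u /M12 [u' Mu' ->] ->]]; last by rewrite gK.
  by exists (g v); [apply: gM | rewrite gK].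
have g'K0 : g' (anticanonical (9 - d) int) = anticanonical (9 - d) int by rewrite -[X in g' X]gK0 gK.
have g'o u v : lform (g' u) (g' v) = lform u v by rewrite -go !g'K.
(* [alpha] is a chosen member of a set of values, so the two sets are matched by carrying bases
   along [g] and [g']. *)
congr xget; apply/seteqP; split=> a [r' [c [cB ->]]].
  exists r', (g' \o c); split; first exact: lattice_basis_image g'K g'D M21 cB.
  by rewrite (family_alpha_isometry R c g'o g'K gK g'K0).
exists r', (g \o c); split; first exact: lattice_basis_image gK gD M12 cB.
by rewrite (family_alpha_isometry R c go gK g'K gK0).
Qed.
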